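(* Let $D\ge4$ and consider the system, for unknowns $P_I(t,\theta)$, $Q_I(t,\theta)$, $I=3,\dots,D-1$, $$\mathcal D^2P_I-t^2\partial_\theta^2P_I=-\tfrac12e^{-2(P+P_I)}\big[(\mathcal DQ_I)^2-(t\partial_\theta Q_I)^2\big],\qquad \mathcal D^2Q_I-t^2\partial_\theta^2Q_I=2\big[\mathcal D(P+P_I)\mathcal DQ_I-t^2\partial_\theta(P+P_I)\partial_\theta Q_I\big],$$ where $\mathcal D=t\partial_t$ and $P=\sum_{J=3}^{D-1}P_J$. Let $p_{I0},p_{I1},q_{I0},q_{I1}$ be real analytic functions of $\theta$ in a neighbourhood of $\theta_0$, set $p_0=\sum_Jp_{J0}$ and $k_I=p_0+p_{I0}$, and suppose $0<k_I<1$ for all $\theta$ and all $I$. Let $\epsilon_I$ satisfy $0<\epsilon_I<\min\{2k_I,2(1-k_I)\}$. Then there exists a unique solution of this system in a neighbourhood of $\theta=\theta_0$ (and for small $t>0$) of the form $$P_I=p_{I0}(\theta)\ln t+p_{I1}(\theta)+t^{\epsilon_I}\pi_I(t,\theta),\qquad Q_I=q_{I0}(\theta)+t^{2k_I}q_{I1}(\theta)+t^{2k_I}\kappa_I(t,\theta),$$ where $\pi_I,\kappa_I$ (together with $\mathcal D\pi_I, t\partial_\theta\pi_I,\mathcal D\kappa_I,t\partial_\theta\kappa_I$) are analytic in $\theta$, continuous in $t$, and tend to zero as $t\to0$.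
   Context: This system is the reduction of the vacuum Einstein equations in dimension $D$ for $T^{D-2}$-symmetric metrics on $T^{D-1}\times\mathbb R$ in areal time, with diagonal orbit metric $f_{IJ}=e^{2P_I}\delta_{IJ}$ and twist potentials $Q_I$. *)

(* Defs.v *)
From Stdlib Require Import Reals Lra.
From Coquelicot Require Import Coquelicot.
Open Scope R_scope.

(* Partial derivatives of a function f(t, theta) (Coquelicot's total Derive;
   existence is always required separately via ex_derive). *)
Definition dt (f : R -> R -> R) (t x : R) : R := Derive (fun s => f s x) t.
Definition dth (f : R -> R -> R) (t x : R) : R := Derive (fun y => f t y) x.

Definition Dt (f : R -> R -> R) (t x : R) : R := t * dt f t x.
Definition tdth (f : R -> R -> R) (t x : R) : R := t * dth f t x.

Definition analytic_on (g : R -> R) (a b : R) : Prop :=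
  forall x, a < x < b ->
    exists r, 0 < r /\ exists c : nat -> R,
      forall y, Rabs (y - x) < r -> is_series (fun n => c n * (y - x) ^ n) (g y).

Definition small_analytic (g : R -> R -> R) (T a b : R) : Prop :=
  (forall t, 0 < t < T -> analytic_on (g t) a b) /\
  (forall t x, 0 < t < T -> a < x < b -> continuous (fun s => g s x) t) /\
  (forall e, 0 < e -> exists d, 0 < d /\
     forall t x, 0 < t < d -> t < T -> a < x < b -> Rabs (g t x) < e).

Definition remainder_class (f : R -> R -> R) (T a b : R) : Prop :=
  (forall t x, 0 < t < T -> a < x < b ->
     ex_derive (fun s => f s x) t /\ ex_derive (fun y => f t y) x) /\
  small_analytic f T a b /\
  small_analytic (Dt f) T a b /\
  small_analytic (tdth f) T a b.

Definition in_range (D I : nat) : Prop := (3 <= I)%nat /\ (I <= D - 1)%nat.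

Definition Psum (D : nat) (P : nat -> R -> R -> R) (t x : R) : R :=
  sum_f_R0 (fun j => P (j + 3)%nat t x) (D - 4).

Definition psum (D : nat) (p : nat -> R -> R) (x : R) : R :=
  sum_f_R0 (fun j => p (j + 3)%nat x) (D - 4).

Definition is_solution (D : nat) (P Q : nat -> R -> R -> R) (T a b : R) : Prop :=
  forall I, in_range D I -> forall t x, 0 < t < T -> a < x < b ->
    ex_derive (fun s => P I s x) t /\ ex_derive (fun y => P I t y) x /\
    ex_derive (fun s => Dt (P I) s x) t /\ ex_derive (fun y => dth (P I) t y) x /\
    ex_derive (fun s => Q I s x) t /\ ex_derive (fun y => Q I t y) x /\
    ex_derive (fun s => Dt (Q I) s x) t /\ ex_derive (fun y => dth (Q I) t y) x /\
    Dt (Dt (P I)) t x - t ^ 2 * dth (dth (P I)) t x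
      = - (1/2) * exp (-2 * (Psum D P t x + P I t x))
          * ((Dt (Q I) t x) ^ 2 - (tdth (Q I) t x) ^ 2) /\
    Dt (Dt (Q I)) t x - t ^ 2 * dth (dth (Q I)) t x
      = 2 * (Dt (fun s y => Psum D P s y + P I s y) t x * Dt (Q I) t x
             - t ^ 2 * dth (fun s y => Psum D P s y + P I s y) t x * dth (Q I) t x).

Definition kI (D : nat) (p0 : nat -> R -> R) (I : nat) (x : R) : R :=
  psum D p0 x + p0 I x.

Definition has_form (D : nat) (p0 p1 q0 q1 : nat -> R -> R) (eps : nat -> R)
    (P Q : nat -> R -> R -> R) (T a b : R) : Prop :=
  exists pi kappa : nat -> R -> R -> R,
    forall I, in_range D I ->
      remainder_class (pi I) T a b /\ remainder_class (kappa I) T a b /\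
      forall t x, 0 < t < T -> a < x < b ->
        P I t x = p0 I x * ln t + p1 I x + Rpower t (eps I) * pi I t x /\
        Q I t x = q0 I x + Rpower t (2 * kI D p0 I x) * q1 I x
                  + Rpower t (2 * kI D p0 I x) * kappa I t x.

Definition form_solution D p0 p1 q0 q1 eps P Q T (th0 r : R) : Prop :=
  0 < T /\ 0 < r /\
  is_solution D P Q T (th0 - r) (th0 + r) /\
  has_form D p0 p1 q0 q1 eps P Q T (th0 - r) (th0 + r).

(* Main.v *)
Require Import Defs.
From Stdlib Require Import Reals Lra Lia Psatz Factorial Classical ClassicalEpsilon.
From Coquelicot Require Import Coquelicot.
Open Scope R_scope.

(* Existence. Put [psi = P + P_I], [k = k_I], and write [exp (-2 psi) = t^(-2k) y1(x) (1 + E)]. Then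
   [(D + eps)^2 pi], [(D + 2 k(theta_0)) D kappa] and [D E] solve a fixed-point problem whose unknowns enter through
   the operators [(D + a)^-1 f = t^-a int_0^t s^a f ds/s]. The Taylor coefficients in [x - theta_0] are measured
   against the majorant [t^p Z(t)^n / (n+1)^2] with [Z(t) = R exp (t^dl)]: its radius shrinks with [t], so that
   [d/dx (D + a)^-1] is bounded up to a factor [t^-dl] in one fixed norm and the map is a contraction.

   Uniqueness. The radius of analyticity of a competitor in [x] may degenerate with [t], and joint continuity is not
   assumed, so it is treated as a C^1 solution of a wave equation with little regularity. A Baire-category argument
   gives, near some times, Lipschitz bounds in [x] uniform in [t]; differences of [x]-averages are transported along
   characteristics and carry these bounds to all times. The difference of two solutions satisfies first-order systems
   [D A = t d_x B + f0] with [A = y (D v + 2 k v + a)], [B = y (t d_x v + b)]. If [S] is the potential with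
   [S_t = B], [S_x = A - F], [D F = f0], then [W = v + e S / (t y)] for [e = 1, -1] obeys transport equations damped because
   [k > 0], so [v] is bounded by the sources [O(t^lam)]. Feeding [P] into [Q] and back raises [lam] by a fixed amount until it exceeds
   [1], after which the same estimates are a contraction and the difference vanishes. *)

(** Two obstacles shape the existence part. [exp (-2 psi)] is not polynomial in the unknowns; giving
    [E] its own linear equation makes every functional a finite combination of products, so one
    convolution estimate suffices. And [(D + a)^-1] acts coefficientwise only for constant [a], so
    [k] is frozen at [theta_0]; the term left over gains no power of [t] and is small only because
    [k - k(theta_0)] has no constant term and [R] is large. The bounds on [eps] say that the
    exponents [2 k - eps] and [2 - 2 k - eps] met in the equation of [P] are positive. In the
    uniqueness part the obstacle is [2 k > 1]. Estimating [Q] from [P] involves [t / t^(2 k)], which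
    is then unbounded, so a rate [lam] for [P] yields only [lam + 1 - 2 k] for [Q], possibly
    negative. But [Q] acts back on [P] with the weights [t^(2 k)] and [t], and when no rate for [Q]
    is available these weights alone are already better than [t^lam]. Hence every round gains,
    whatever the value of [k] in [(0,1)]. *)

Lemma Rpower_pos x y : 0 < Rpower x y.
Proof. apply exp_pos. Qed.

Lemma Rabs_mult_le u w c d : Rabs u <= c -> Rabs w <= d -> Rabs (u * w) <= c * d.
Proof. rewrite Rabs_mult. apply Rmult_le_compat; apply Rabs_pos. Qed.

Lemma Rabs_plus_le u w c d : Rabs u <= c -> Rabs w <= d -> Rabs (u + w) <= c + d.
Proof. intros. eapply Rle_trans; [apply Rabs_triang | lra]. Qed.

Create HintDb pos.
#[export] Hint Resolve Rabs_pos Rlt_le Rpower_pos exp_pos pow_le pow_lt cond_pos pos_INR Rinv_0_lt_compat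
  Rdiv_lt_0_compat Rmult_lt_0_compat Rmult_le_pos Rplus_le_le_0_compat Rmin_glb_lt
  Rmult_le_compat_l Rmult_le_compat_r Rplus_le_compat Rmult_le_compat Rabs_mult_le Rabs_plus_le : pos.
#[export] Hint Extern 1 (_ < _) => lra : pos.
#[export] Hint Extern 1 (_ <= _) => lra : pos.
#[export] Hint Extern 1 (_ /\ _) => split : pos.
Ltac postmin a b := lazymatch goal with
  | _ : Rmin a b <= a |- _ => fail
  | _ => assert (Rmin a b <= a) by apply Rmin_l; assert (Rmin a b <= b) by apply Rmin_r end.
Ltac pos := solve [auto 8 with pos].
Ltac splits := repeat match goal with |- _ /\ _ => split end.

Ltac mins := repeat match goal with
  | d := Rmin ?a ?b |- _ => lazymatch goal with
      _ : d <= a |- _ => fail | _ => assert (d <= a) by apply Rmin_l; assert (d <= b) by apply Rmin_r end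
  | _ := context [Rmin ?a ?b] |- _ => postmin a b
  | _ : context [Rmin ?a ?b] |- _ => postmin a b
  | |- context [Rmin ?a ?b] => postmin a b end.

(** * Choice, epsilon formulations and integrals of continuous functions *)

Lemma choice_fun {A B : Type} (Q : A -> B -> Prop) :
  (forall a, exists b, Q a b) -> exists f : A -> B, forall a, Q a (f a).
Proof.
  intros H.
  exists (fun a => proj1_sig (constructive_indefinite_description _ (H a))).
  intros. apply proj2_sig.
Qed.

Lemma continuous_eps f x : continuous f x <->
  forall e, 0 < e -> exists d, 0 < d /\ forall y, Rabs (y - x) < d -> Rabs (f y - f x) < e.
Proof.
  split.
  - intros H e He.
    destruct (proj1 (filterlim_locally f (f x)) H (mkposreal e He)) as [d Hd].
    exists d. pos.
  - intros H. apply filterlim_locally. intros [e He].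
    destruct (H e He) as [d [Hd H1]]. exists (mkposreal d Hd). auto.
Qed.

Lemma lim_seq_eps u (l : R) : is_lim_seq u l <->
  forall e, 0 < e -> exists N, forall n, (N <= n)%nat -> Rabs (u n - l) < e.
Proof.
  split.
  - intros H e He. apply is_lim_seq_spec in H. apply (H (mkposreal e He)).
  - intros H. apply is_lim_seq_spec. intros [e He]. apply H; auto.
Qed.

Lemma Rcont_plus f g (x : R) : continuous f x -> continuous g x -> continuous (fun y => f y + g y) x.
Proof. apply (@continuous_plus R_UniformSpace R_AbsRing R_NormedModule). Qed.

Lemma Rcont_minus f g (x : R) : continuous f x -> continuous g x -> continuous (fun y => f y - g y) x.
Proof. apply (@continuous_minus R_UniformSpace R_AbsRing R_NormedModule). Qed.

Lemma Rcont_mult f g (x : R) : continuous f x -> continuous g x -> continuous (fun y => f y * g y) x.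
Proof. apply (@continuous_mult R_UniformSpace R_AbsRing). Qed.

Lemma Rcont_opp f (x : R) : continuous f x -> continuous (fun y => - f y) x.
Proof. apply (@continuous_opp R_UniformSpace R_AbsRing R_NormedModule). Qed.

Lemma Rcont_const (c x : R) : continuous (fun _ : R => c) x.
Proof. apply continuous_const. Qed.

Lemma Rcont_abs f (x : R) : continuous f x -> continuous (fun y => Rabs (f y)) x.
Proof. intros. apply continuous_comp; [auto | apply continuous_Rabs]. Qed.

Lemma continuous_Rmax (f g : R -> R) x :
  continuous f x -> continuous g x -> continuous (fun y => Rmax (f y) (g y)) x.
Proof.
  intros.
  apply continuous_ext with (fun y => (f y + g y + Rabs (f y - g y)) / 2).
  { intros. unfold Rmax, Rabs. destruct Rcase_abs; destruct Rle_dec; lra. }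
  apply Rcont_mult; [|apply Rcont_const].
  apply Rcont_plus; [apply Rcont_plus | apply Rcont_abs, Rcont_minus]; assumption.
Qed.

Lemma continuous_Rmin (f g : R -> R) x :
  continuous f x -> continuous g x -> continuous (fun y => Rmin (f y) (g y)) x.
Proof.
  intros.
  apply continuous_ext with (fun y => - Rmax (- f y) (- g y)).
  { intros. unfold Rmax, Rmin. destruct Rle_dec; destruct Rle_dec; lra. }
  apply Rcont_opp, continuous_Rmax; apply Rcont_opp; assumption.
Qed.

Lemma ex_RInt_cont (f : R -> R) a b :
  a <= b -> (forall x, a <= x <= b -> continuous f x) -> ex_RInt f a b.
Proof.
  intros. apply (ex_RInt_continuous (V:=R_CompleteNormedModule)).
  rewrite Rmin_left, Rmax_right by lra. auto.
Qed.

Lemma RInt_le_cont f g a b : a <= b -> (forall x, a <= x <= b -> continuous f x) ->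
  (forall x, a <= x <= b -> continuous g x) ->
  (forall x, a <= x <= b -> f x <= g x) -> RInt f a b <= RInt g a b.
Proof.
  intros. apply RInt_le; auto using ex_RInt_cont.
  pos.
Qed.

Lemma RInt_plus_cont f g a b : a <= b -> (forall x, a <= x <= b -> continuous f x) ->
  (forall x, a <= x <= b -> continuous g x) ->
  RInt (fun x => f x + g x) a b = RInt f a b + RInt g a b.
Proof.
  intros. apply (RInt_plus (V := R_CompleteNormedModule)); auto using ex_RInt_cont.
Qed.

Lemma RInt_minus_cont f g a b : a <= b -> (forall x, a <= x <= b -> continuous f x) ->
  (forall x, a <= x <= b -> continuous g x) ->
  RInt (fun x => f x - g x) a b = RInt f a b - RInt g a b.
Proof.
  intros. apply (RInt_minus (V := R_CompleteNormedModule)); auto using ex_RInt_cont.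
Qed.

Lemma RInt_cst c a b : RInt (fun _ => c) a b = c * (b - a).
Proof. rewrite RInt_const. unfold scal; simpl; unfold mult; simpl. ring. Qed.

Lemma RInt_abs_bound f a b M : a <= b -> (forall x, a <= x <= b -> continuous f x) ->
  (forall x, a <= x <= b -> Rabs (f x) <= M) -> Rabs (RInt f a b) <= M * (b - a).
Proof.
  intros. rewrite Rmult_comm. apply abs_RInt_le_const; auto using ex_RInt_cont.
Qed.

(** * Bounded convergence for continuous functions, and Baire category *)

(** Points [u n] where [p n] is still at least [e] would cluster at some [l]. Some [p N] is below
    [e] near [l], and monotonicity in [n] carries this to all later indices, a contradiction. *)
Lemma dini p a b : a <= b ->
  (forall n x, a <= x <= b -> continuous (p n) x) ->
  (forall n x, p (S n) x <= p n x) ->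
  (forall x, a <= x <= b -> is_lim_seq (fun n => p n x) 0) ->
  forall e, 0 < e -> exists N, forall x, a <= x <= b -> p N x < e.
Proof.
  intros Hab Hc Hd Hl e. apply NNPP. intros HN.
  assert (H1 : forall n, exists x, a <= x <= b /\ e <= p n x).
  { intros n. apply NNPP. intros H. apply HN. exists n. intros x Hx.
    apply Rnot_le_lt. eauto. }
  destruct (choice_fun _ H1) as [u Hu].
  destruct (Bolzano_Weierstrass u (fun x => a <= x <= b)) as [l Hl2].
  { apply compact_P3. }
  { apply Hu. }
  assert (Hlab : a <= l <= b).
  { apply NNPP. intros Hn.
    assert (Hd0 : exists d, 0 < d /\ forall y, Rabs (y - l) < d -> ~ (a <= y <= b)).
    { destruct (Rlt_le_dec l a).
      - exists (a - l). split; [lra|]. intros y Hy. apply Rabs_def2 in Hy. lra.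
      - exists (l - b). split; [lra|]. intros y Hy. apply Rabs_def2 in Hy. lra. }
    destruct Hd0 as [d [Hd0 Hd1]].
    destruct (Hl2 (disc l (mkposreal d Hd0)) 0%nat) as [q [_ Hq]].
    { exists (mkposreal d Hd0). intros y Hy. auto. }
    apply (Hd1 (u q)); [auto | apply Hu]. }
  destruct (proj1 (lim_seq_eps _ _) (Hl l Hlab) (e / 2)) as [N HN1]; [lra|].
  specialize (HN1 N (le_n N)). apply Rabs_def2 in HN1.
  destruct (proj1 (continuous_eps _ _) (Hc N l Hlab) (e / 2)) as [d [Hd0 Hd1]]; [lra|].
  destruct (Hl2 (disc l (mkposreal d Hd0)) N) as [q [HqN Hq]].
  { exists (mkposreal d Hd0). intros y. auto. }
  specialize (Hd1 (u q) Hq). apply Rabs_def2 in Hd1.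
  assert (Hm : forall k x, p (N + k)%nat x <= p N x).
  { induction k; intros x. rewrite Nat.add_0_r; lra.
    rewrite Nat.add_succ_r. eapply Rle_trans; auto. }
  specialize (Hm (q - N)%nat (u q)). replace (N + (q - N))%nat with q in Hm by lia.
  destruct (Hu q). lra.
Qed.

Fixpoint runmax (f : nat -> R -> R) (n m : nat) (x : R) : R :=
  match m with
  | O => Rabs (f n x)
  | S m' => Rmax (runmax f n m' x) (Rabs (f (n + m)%nat x))
  end.

Lemma runmax_cont f n m x :
  (forall k, continuous (f k) x) -> continuous (runmax f n m) x.
Proof.
  intros. induction m.
  - apply (continuous_comp (f n)); [auto | apply continuous_Rabs].
  - apply continuous_Rmax; auto.
    apply continuous_comp; [auto | apply continuous_Rabs].
Qed.

Lemma runmax_ge f n m k x : (n <= k <= n + m)%nat -> Rabs (f k x) <= runmax f n m x.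
Proof.
  induction m; simpl; intros H.
  - replace k with n by lia. lra.
  - destruct (Nat.eq_dec k (n + S m)) as [->|].
    + apply Rmax_r.
    + eapply Rle_trans; [apply IHm; lia | apply Rmax_l].
Qed.

Lemma runmax_le f n m x c :
  (forall k, (n <= k <= n + m)%nat -> Rabs (f k x) <= c) -> runmax f n m x <= c.
Proof.
  induction m; intros H.
  - apply H; lia.
  - apply Rmax_lub; [apply IHm; intros; apply H; lia | apply H; lia].
Qed.

(* Arzela's theorem. The running maxima [runmax f n m] increase in [m]; stopping each where
   its integral is almost exhausted and taking minima over [n] yields a decreasing sequence,
   to which Dini's theorem applies. *)
Lemma bounded_convergence0 f a b M : a <= b ->
  (forall n x, a <= x <= b -> continuous (f n) x) ->
  (forall n x, a <= x <= b -> Rabs (f n x) <= M) ->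
  (forall x, a <= x <= b -> is_lim_seq (fun n => f n x) 0) ->
  is_lim_seq (fun n => RInt (f n) a b) 0.
Proof.
  intros Hab Hc HM Hl.
  assert (Hcm : forall n m x, a <= x <= b -> continuous (runmax f n m) x).
  { intros n m x Hx. apply runmax_cont. auto. }
  apply lim_seq_eps. intros e He.
  assert (Hex : forall n, exists m, forall m',
    RInt (runmax f n m') a b <= RInt (runmax f n m) a b + e / 4 * / 2 ^ n).
  { intros n. apply NNPP. intros Hn.
    set (c := e / 4 * / 2 ^ n) in *.
    assert (Hcpos : 0 < c).
    { apply Rmult_lt_0_compat; [lra|]. pos. }
    assert (H1 : forall m, exists m', RInt (runmax f n m) a b + c < RInt (runmax f n m') a b).
    { intros m. apply NNPP. intros H. apply Hn. exists m. intros m'.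
      apply Rnot_lt_le. eauto. }
    assert (H2 : forall j : nat, exists m, INR j * c <= RInt (runmax f n m) a b).
    { induction j.
      - exists O. simpl. apply Rle_trans with (RInt (fun _ => 0) a b).
        rewrite RInt_cst; lra. apply RInt_le_cont; auto. intros; apply Rcont_const.
        apply (Hcm n O). pos.
      - destruct IHj as [m Hm]. destruct (H1 m) as [m' Hm']. exists m'. rewrite S_INR. lra. }
    destruct (nfloor_ex (Rmax 0 (M * (b - a) / c))) as [j Hj]; [apply Rmax_l|].
    destruct (H2 (S j)) as [m Hm].
    assert (H3 : RInt (runmax f n m) a b <= M * (b - a)).
    { replace (M * (b - a)) with (RInt (fun _ => M) a b).
      2: apply RInt_cst.
      apply RInt_le_cont; auto. intros; apply continuous_const.
      intros x Hx. apply runmax_le. auto. }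
    rewrite S_INR in Hm.
    assert (H4 := Rmax_r 0 (M * (b - a) / c)).
    assert (H5 : M * (b - a) / c < INR j + 1) by lra.
    apply Rlt_div_l in H5; auto. lra. }
  destruct (choice_fun _ Hex) as [mm Hmm].
  set (ph := fun n => runmax f n (mm n)).
  set (ps := fix ps n : R -> R :=
    match n with O => ph O | S n' => fun x => Rmin (ps n' x) (ph (S n') x) end).
  assert (Hphc : forall n x, a <= x <= b -> continuous (ph n) x) by eauto.
  assert (Hpsc : forall n x, a <= x <= b -> continuous (ps n) x).
  { induction n; intros x Hx. apply Hphc, Hx. apply continuous_Rmin; auto.  }
  assert (Hpsph : forall n x, ps n x <= ph n x).
  { destruct n; intros x; simpl. lra. mins; lra. }
  assert (Hps0 : forall n x, 0 <= ps n x).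
  { assert (Hph0 : forall n x, 0 <= ph n x).
    { intros n x. eapply Rle_trans; [apply Rabs_pos|]. apply (runmax_ge f n (mm n) n). lia. }
    induction n; intros x. apply Hph0. apply Rmin_glb; auto. }
  assert (Hlin : forall u v w z : R -> R, (forall x, a <= x <= b -> continuous u x) -> (forall x, a <= x <= b -> continuous v x) ->
    (forall x, a <= x <= b -> continuous w x) -> (forall x, a <= x <= b -> continuous z x) ->
    (forall x, a <= x <= b -> continuous (fun x => u x + (v x - w x) + (z x - v x)) x) /\
    RInt (fun x => u x + (v x - w x) + (z x - v x)) a b = RInt u a b + (RInt v a b - RInt w a b) + (RInt z a b - RInt v a b)).
  { intros u v w z Hu Hv Hw Hz.
    assert (H1 : forall x, a <= x <= b -> continuous (fun x => u x + (v x - w x)) x) by (intros; apply Rcont_plus, Rcont_minus; auto).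
    assert (H2 : forall x, a <= x <= b -> continuous (fun x => z x - v x) x) by (intros; apply Rcont_minus; auto).
    split; [intros; apply Rcont_plus; auto|].
    rewrite !RInt_plus_cont, !RInt_minus_cont; auto. intros; apply Rcont_minus; auto. }
  (* Replacing [ph] by the running minimum [ps] costs at stage [n] only what [runmax f n] can still
     gain after its stopping index, at most [e / 4 / 2^n] in integral. The losses sum to less than
     [e / 2]. *)
  assert (Hint : forall n, RInt (ph n) a b <= RInt (ps n) a b + e / 4 * (2 - 2 * / 2 ^ n)).
  { induction n.
    - simpl. lra.
    - set (big := (mm n + mm (S n) + 1)%nat).
      assert (Hpt : forall x, ph (S n) x <= ps (S n) x + (ph n x - ps n x) + (runmax f n big x - ph n x)).
      { intros x. simpl.
        assert (H1 : ph (S n) x <= runmax f n big x).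
        { apply runmax_le. intros k Hk. apply runmax_ge. lia. }
        assert (H2 : ph n x <= runmax f n big x).
        { apply runmax_le. intros k Hk. apply runmax_ge. lia. }
        assert (H3 := Hpsph n x).
        unfold Rmin. destruct Rle_dec; lra. }
      assert (Hi : RInt (ph (S n)) a b <=
        RInt (fun x => ps (S n) x + (ph n x - ps n x) + (runmax f n big x - ph n x)) a b).
      { apply RInt_le_cont; auto. apply Hlin; auto. }
      rewrite (proj2 (Hlin (ps (S n)) (ph n) (ps n) (runmax f n big) (Hpsc (S n)) (Hphc n) (Hpsc n) (Hcm n big))) in Hi.
      specialize (Hmm n big).
      assert (H2n : / 2 ^ n = 2 * / 2 ^ S n).
      { simpl. field. apply pow_nonzero. lra. }
      change (RInt (runmax f n (mm n)) a b) with (RInt (ph n) a b) in Hmm.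
      nra. }
  assert (Hdini : exists N, forall x, a <= x <= b -> ps N x < e / 4 / (b - a + 1)).
  { apply dini; auto.
    - intros n x. apply Rmin_l.
    - intros x Hx. apply lim_seq_eps. intros e' He'.
      destruct (proj1 (lim_seq_eps _ _) (Hl x Hx) (e' / 2)) as [N HN]; [lra|].
      exists N. intros n Hn. rewrite Rminus_0_r, Rabs_pos_eq by pos.
      apply Rle_lt_trans with (e' / 2); [|lra].
      eapply Rle_trans; auto. apply runmax_le. intros k Hk.
      specialize (HN k ltac:(lia)). rewrite Rminus_0_r in HN. lra.
    - pos. }
  destruct Hdini as [N HN].
  assert (Hmono : forall k x, ps (N + k)%nat x <= ps N x).
  { induction k; intros x. rewrite Nat.add_0_r; lra.
    rewrite Nat.add_succ_r. eapply Rle_trans; [apply Rmin_l | auto]. }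
  exists N. intros n Hn. rewrite Rminus_0_r.
  assert (H1 : Rabs (RInt (f n) a b) <= RInt (ph n) a b).
  { eapply Rle_trans; [apply abs_RInt_le; auto; apply ex_RInt_cont; auto|].
    apply RInt_le_cont; auto.
    - intros x Hx. apply Rcont_abs; auto.
    - intros x Hx. apply runmax_ge. lia. }
  assert (H2 : RInt (ps n) a b <= e / 4).
  { apply Rle_trans with (RInt (fun _ => e / 4 / (b - a + 1)) a b).
    - apply RInt_le_cont; auto. intros; apply continuous_const.
      intros x Hx. replace n with (N + (n - N))%nat by lia.
      apply Rle_trans with (ps N x); pos.
    - rewrite RInt_cst.
      replace (e / 4 / (b - a + 1) * (b - a)) with (e / 4 * ((b - a) / (b - a + 1))) by lra.
      rewrite <- (Rmult_1_r (e / 4)) at 2. apply Rmult_le_compat_l; [lra|].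
      apply Rle_div_l; lra. }
  specialize (Hint n).
  assert (H3 : 0 < / 2 ^ n) by pos.
  nra.
Qed.

Lemma bounded_convergence f (g : R -> R) a b M : a <= b ->
  (forall n x, a <= x <= b -> continuous (f n) x) ->
  (forall x, a <= x <= b -> continuous g x) ->
  (forall n x, a <= x <= b -> Rabs (f n x) <= M) ->
  (forall x, a <= x <= b -> is_lim_seq (fun n => f n x) (g x)) ->
  is_lim_seq (fun n => RInt (f n) a b) (RInt g a b).
Proof.
  intros Hab Hc Hg HM Hl.
  assert (HMg : forall x, a <= x <= b -> Rabs (g x) <= M).
  { intros x Hx. apply (is_lim_seq_le (fun n => Rabs (f n x)) (fun _ => M) (Rabs (g x)) M).
    - auto.
    - apply (is_lim_seq_abs _ (g x)). auto.
    - apply is_lim_seq_const. }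
  assert (H0 : is_lim_seq (fun n => RInt (fun x => f n x - g x) a b) 0).
  { apply bounded_convergence0 with (M := 2 * M); auto.
    - intros n x Hx. apply Rcont_minus; auto.
    - intros n x Hx. eapply Rle_trans; [apply Rabs_triang|]. rewrite Rabs_Ropp.
      specialize (HM n x). specialize (HMg x). lra.
    - intros x Hx. replace (Finite 0) with (Finite (g x - g x)) by (f_equal; ring).
      apply is_lim_seq_minus'; auto. apply is_lim_seq_const. }
  replace (Finite (RInt g a b)) with (Finite (0 + RInt g a b)) by (f_equal; ring).
  apply is_lim_seq_ext with (fun n => RInt (fun x => f n x - g x) a b + RInt g a b).
  - intros. rewrite RInt_minus_cont; auto. ring.
  - apply is_lim_seq_plus'; [auto | apply is_lim_seq_const].
Qed.

(** If no [E n] had interior relative to the closed set [Z], one could choose nested balls centred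
    in [Z], the next ball avoiding [E n] on [Z]; their common point would lie in [Z] and outside
    every [E n]. *)
Lemma baire_closed Z (E : nat -> R -> Prop) : (forall x, (forall d, 0 < d -> exists z, Z z /\ Rabs (z - x) < d) -> Z x) ->
  (forall n x, Z x -> (forall d, 0 < d -> exists z, Z z /\ E n z /\ Rabs (z - x) < d) -> E n x) ->
  (forall z, Z z -> exists n, E n z) ->
  (exists z, Z z) ->
  exists n z d, Z z /\ 0 < d /\ forall y, Z y -> Rabs (y - z) < d -> E n y.
Proof.
  intros HZ HE Hcov [z0 Hz0]. apply NNPP. intros HN.
  set (good := fun q : R * R => Z (fst q) /\ 0 < snd q).
  assert (Hstep : forall nq : nat * {q | good q}, exists q' : {q | good q},
    let q := proj1_sig (snd nq) in let r := proj1_sig q' in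
    Rabs (fst r - fst q) + snd r <= snd q /\ snd r <= snd q / 2 /\
    forall w, Z w -> Rabs (w - fst r) <= snd r -> ~ E (fst nq) w).
  { intros [n [[z d] [Hz Hd]]]; simpl in *.
    assert (H1 : exists y, Z y /\ Rabs (y - z) < d /\ ~ E n y).
    { apply NNPP. intros H. apply HN. exists n, z, d. repeat split; auto.
      intros y Hy Hyz. apply NNPP. intros HnE. eauto. }
    destruct H1 as [y [Hy [Hyz HnE]]].
    assert (H2 : exists d', 0 < d' /\ forall w, Z w -> Rabs (w - y) < d' -> ~ E n w).
    { apply NNPP. intros H. apply HnE. apply HE; auto. intros d' Hd'.
      apply NNPP. intros H3. apply H. exists d'. split; auto.
      intros w Hw Hwy HEw. eauto. }
    destruct H2 as [d' [Hd' Hw]].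
    (* [d' / 2] makes even the closed ball miss [E n], [d / 2] forces the radii to tend to zero, and
       [d - Rabs (y - z)] keeps the balls nested. *)
    set (r := Rmin (Rmin (d' / 2) (d / 2)) (d - Rabs (y - z))).
    assert (Hr : 0 < r) by (repeat apply Rmin_glb_lt; lra).
    exists (exist good (y, r) (conj Hy Hr)). simpl.
    assert (r <= d' / 2) by (eapply Rle_trans; [apply Rmin_l | apply Rmin_l]).
    assert (r <= d / 2) by (eapply Rle_trans; [apply Rmin_l | apply Rmin_r]).
    assert (r <= d - Rabs (y - z)) by apply Rmin_r.
    pos. }
  destruct (choice_fun _ Hstep) as [st Hst].
  set (s := fix s n : {q | good q} :=
    match n with
    | O => exist good (z0, 1) (conj Hz0 Rlt_0_1)
    | S n' => st (n', s n')
    end).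
  set (zz := fun n => fst (proj1_sig (s n))). set (dd := fun n => snd (proj1_sig (s n))).
  assert (Hs : forall n, Rabs (zz (S n) - zz n) + dd (S n) <= dd n).
  { intros n. apply Hst. }
  assert (Hs3 : forall n, dd (S n) <= dd n / 2).
  { intros n. apply Hst. }
  assert (Hs2 : forall n w, Z w -> Rabs (w - zz (S n)) <= dd (S n) -> ~ E n w).
  { intros n. apply Hst. }
  assert (Hgz : forall n, Z (zz n)) by (intros n; apply (proj2_sig (s n))).
  assert (Hgd : forall n, 0 < dd n) by (intros n; apply (proj2_sig (s n))).
  assert (Hnest : forall k n, Rabs (zz (n + k)%nat - zz n) + dd (n + k)%nat <= dd n).
  { induction k; intros n.
    - rewrite Nat.add_0_r, Rminus_diag, Rabs_R0. lra.
    - rewrite Nat.add_succ_r. specialize (IHk n). specialize (Hs (n + k)%nat).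
      replace (zz (S (n + k)) - zz n) with ((zz (S (n + k)) - zz (n + k)%nat) + (zz (n + k)%nat - zz n)) by lra.
      assert (H := Rabs_triang (zz (S (n + k)) - zz (n + k)%nat) (zz (n + k)%nat - zz n)). lra. }
  assert (Hall : forall n m, zz n - dd n <= zz m + dd m).
  { intros n m. destruct (Nat.le_ge_cases n m).
    - assert (H1 := Hnest (m - n)%nat n). replace (n + (m - n))%nat with m in H1 by lia.
      assert (H2 := Hgd m). assert (H3 := Rle_abs (- (zz m - zz n))). rewrite Rabs_Ropp in H3. lra.
    - assert (H1 := Hnest (n - m)%nat m). replace (m + (n - m))%nat with n in H1 by lia.
      assert (H2 := Hgd n). assert (H3 := Rle_abs ((zz n - zz m))). lra. }
  destruct (completeness (fun x => exists n, x = zz n - dd n)) as [l [Hl1 Hl2]].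
  { exists (zz O + dd O). intros x [n ->]. auto. }
  { exists (zz O - dd O). eauto. }
  assert (Hl : forall n, Rabs (l - zz n) <= dd n).
  { intros n. apply Rabs_le. split.
    - assert (H := Hl1 _ (ex_intro _ n eq_refl)). lra.
    - assert (H : l <= zz n + dd n). { apply Hl2. intros x [m ->]. auto. } lra. }
  assert (HlZ : Z l).
  { apply HZ. intros d Hd.
    assert (Hpow : forall n, dd n <= (/ 2) ^ n).
    { induction n. unfold dd; simpl; lra. specialize (Hs3 n). simpl. lra. }
    destruct (pow_lt_1_zero (/ 2)) with (y := d) as [N HN1]; auto.
    { rewrite Rabs_pos_eq; lra. }
    specialize (HN1 N (le_n N)). rewrite Rabs_pos_eq in HN1 by pos.
    exists (zz N). split; auto. rewrite Rabs_minus_sym.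
    specialize (Hl N). specialize (Hpow N). lra. }
  destruct (Hcov l HlZ) as [n Hn]. eapply Hs2; eauto.
Qed.

(** * Mean values, derivatives along lines, joint continuity *)

Lemma MVT_le f df a b : a <= b -> (forall x, a <= x <= b -> is_derive f x (df x)) ->
  exists c, a <= c <= b /\ f b - f a = df c * (b - a).
Proof.
  intros Hab H. destruct (MVT_gen f a b df) as [c [Hc He]].
  - rewrite Rmin_left, Rmax_right by lra. pos.
  - rewrite Rmin_left, Rmax_right by lra. intros x Hx.
    apply derivable_continuous_pt. exists (df x). apply is_derive_Reals, H; lra.
  - rewrite Rmin_left, Rmax_right in Hc by lra. eauto.
Qed.

Lemma MVT_between f df a b : (forall x, Rmin a b <= x <= Rmax a b -> is_derive f x (df x)) ->
  exists c, Rmin a b <= c <= Rmax a b /\ f b - f a = df c * (b - a).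
Proof.
  intros H. apply MVT_gen.
  - pos.
  - intros x Hx. apply derivable_continuous_pt. exists (df x). apply is_derive_Reals, H; lra.
Qed.

Lemma between_dist a b x : Rmin a b <= x <= Rmax a b -> Rabs (x - a) <= Rabs (b - a).
Proof.
  unfold Rmin, Rmax. destruct Rle_dec; intros H.
  - rewrite !Rabs_pos_eq; lra.
  - rewrite !Rabs_left1; lra.
Qed.

Lemma incr_of_derive f df a b : a <= b -> (forall x, a <= x <= b -> is_derive f x (df x)) ->
  (forall x, a <= x <= b -> 0 <= df x) -> f a <= f b.
Proof.
  intros Hab H Hp. destruct (MVT_le f df a b Hab H) as [c [Hc He]].
  specialize (Hp c). nra.
Qed.

Lemma derive_bound_lip f df a b M : (forall x, Rmin a b <= x <= Rmax a b -> is_derive f x (df x)) ->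
  (forall x, Rmin a b <= x <= Rmax a b -> Rabs (df x) <= M) ->
  Rabs (f b - f a) <= M * Rabs (b - a).
Proof.
  intros H. destruct (MVT_between f df a b H) as [c [Hc He]].
  rewrite He. pos.
Qed.

Lemma is_derive_cont (f : R -> R) x l : is_derive f x l -> continuous f x.
Proof. intros. apply (@ex_derive_continuous R_AbsRing R_NormedModule). exists l. auto. Qed.

Lemma is_derive_eps f x l : is_derive f x l <->
  forall e, 0 < e -> exists d, 0 < d /\ forall h, Rabs h < d ->
    Rabs (f (x + h) - f x - l * h) <= e * Rabs h.
Proof.
  split.
  - intros H e He. apply is_derive_Reals in H. destruct (H e He) as [d Hd].
    exists d. split; [pos |]. intros h Hh.
    destruct (Req_dec h 0) as [->|Hn].
    + rewrite Rplus_0_r. replace (f x - f x - l * 0) with 0 by lra. rewrite Rabs_R0. lra.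
    + replace (f (x + h) - f x - l * h) with (((f (x + h) - f x) / h - l) * h) by (field; auto).
      pos.
  - intros H. apply is_derive_Reals. intros e He. destruct (H (e / 2)) as [d [Hd H1]]; [lra|].
    exists (mkposreal d Hd). intros h Hn Hh.
    replace ((f (x + h) - f x) / h - l) with ((f (x + h) - f x - l * h) / h) by (field; auto).
    unfold Rdiv. rewrite Rabs_mult, Rabs_inv.
    assert (0 < Rabs h) by (apply Rabs_pos_lt; auto).
    eapply Rle_lt_trans.
    + pos.
    + rewrite Rmult_assoc, Rinv_r; lra.
Qed.

Lemma cont2_eps f t x : continuity_2d_pt f t x <->
  forall e, 0 < e -> exists d, 0 < d /\
    forall s y, Rabs (s - t) < d -> Rabs (y - x) < d -> Rabs (f s y - f t x) < e.
Proof.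
  split.
  - intros H e He. destruct (H (mkposreal e He)) as [d Hd]. exists d. pos.
  - intros H [e He]. destruct (H e He) as [d [Hd H1]]. exists (mkposreal d Hd). auto.
Qed.

(** Differentiability along a slanted line needs one partial derivative nearby, continuous at the
    point, and the other one at the point only: the increment is split into a vertical piece,
    treated by the mean value theorem, and a horizontal one. Competing solutions offer no more than
    this. *)
Lemma chain_line f ft fx t x c d0 : 0 < d0 ->
  (forall s y, Rabs (s - t) < d0 -> Rabs (y - x) < d0 -> is_derive (fun s => f s y) s (ft s y)) ->
  continuity_2d_pt ft t x ->
  is_derive (fun y => f t y) x fx ->
  is_derive (fun s => f s (x + c * (s - t))) t (ft t x + c * fx).
Proof.
  intros Hd0 Hft Hc Hx. apply is_derive_eps. intros e He.
  set (c1 := Rabs c + 1).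
  assert (Hc1 : 1 <= c1) by (unfold c1; assert (H := Rabs_pos c); lra).
  destruct (proj1 (cont2_eps _ _ _) Hc (e / 2)) as [d1 [Hd1 H1]]; [lra|].
  destruct (proj1 (is_derive_eps _ _ _) Hx (e / (2 * c1))) as [d2 [Hd2 H2]].
  { pos. }
  set (d := Rmin d0 (Rmin d1 d2) / c1).
  assert (Hmin : 0 < Rmin d0 (Rmin d1 d2)) by pos.
  assert (Hd : 0 < d) by (apply Rdiv_lt_0_compat; lra).
  exists d. split; auto. intros h Hh.
  assert (Hh1 : Rabs h * c1 < Rmin d0 (Rmin d1 d2)) by (apply Rlt_div_r in Hh; lra).
  assert (Hp := Rabs_pos h).
  mins.
  assert (Hch : Rabs (c * h) <= Rabs h * c1 - Rabs h).
  { rewrite Rabs_mult. unfold c1. lra. }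
  replace (t + h - t) with h by lra. replace (t - t) with 0 by lra.
  rewrite Rmult_0_r, Rplus_0_r.
  assert (Hh2 : Rabs h < d0 /\ Rabs h < d1) by nra.
  destruct (MVT_between (fun s => f s (x + c * h)) (fun s => ft s (x + c * h)) t (t + h)) as [xi [Hxi He1]].
  { intros s Hs. apply Hft.
    - apply Rle_lt_trans with (Rabs h); [|lra]. apply between_dist in Hs.
      eapply Rle_trans; eauto. right; f_equal; ring.
    - replace (x + c * h - x) with (c * h) by lra. lra. }
  assert (Hxi2 : Rabs (xi - t) <= Rabs h).
  { apply between_dist in Hxi. eapply Rle_trans; eauto. right; f_equal; ring. }
  replace (f (t + h) (x + c * h) - f t x - (ft t x + c * fx) * h) with
    ((f (t + h) (x + c * h) - f t (x + c * h) - ft t x * h) + (f t (x + c * h) - f t x - fx * (c * h))) by lra.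
  rewrite He1. replace (t + h - t) with h by lra.
  eapply Rle_trans; [apply Rabs_triang|].
  specialize (H1 xi (x + c * h)).
  replace (x + c * h - x) with (c * h) in H1 by lra.
  assert (H1' : Rabs (ft xi (x + c * h) * h - ft t x * h) <= e / 2 * Rabs h).
  { rewrite <- Rmult_minus_distr_r. pos. }
  assert (H2' : Rabs (f t (x + c * h) - f t x - fx * (c * h)) <= e / 2 * Rabs h).
  { eapply Rle_trans; [pos |].
    apply Rle_trans with (e / (2 * c1) * (Rabs h * c1)).
    - pos.
    - right. field. lra. }
  lra.
Qed.

Lemma cont2_fst f t x : continuity_2d_pt f t x -> continuous (fun s => f s x) t.
Proof.
  intros H. apply continuous_eps. intros e He.
  destruct (proj1 (cont2_eps _ _ _) H e He) as [d [Hd H1]]. exists d. split; auto.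
  intros. apply H1; auto. rewrite Rminus_diag, Rabs_R0. auto.
Qed.

Lemma cont2_snd f t x : continuity_2d_pt f t x -> continuous (fun y => f t y) x.
Proof.
  intros H. apply continuous_eps. intros e He.
  destruct (proj1 (cont2_eps _ _ _) H e He) as [d [Hd H1]]. exists d. split; auto.
  intros. apply H1; auto. rewrite Rminus_diag, Rabs_R0. auto.
Qed.

Lemma cont2_line f t x c : continuity_2d_pt f t x -> continuous (fun s => f s (x + c * (s - t))) t.
Proof.
  intros H. apply continuous_eps. intros e He.
  destruct (proj1 (cont2_eps _ _ _) H e He) as [d [Hd H1]].
  assert (Hp := Rabs_pos c).
  exists (d / (Rabs c + 1)). split. apply Rdiv_lt_0_compat; lra.
  intros y Hy. replace (x + c * (t - t)) with x by lra.
  apply Rlt_div_r in Hy; [|lra].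
  apply H1; [nra|]. replace (x + c * (y - t) - x) with (c * (y - t)) by lra.
  rewrite Rabs_mult. nra.
Qed.

(** This is how joint continuity is recovered without being assumed: a Lipschitz constant in the
    second variable that is uniform in the first, and continuity along a single vertical line. *)
Lemma cont2_of_lip f t x d0 L : 0 < d0 ->
  (forall s y z, Rabs (s - t) < d0 -> Rabs (y - x) < d0 -> Rabs (z - x) < d0 ->
     Rabs (f s y - f s z) <= L * Rabs (y - z)) ->
  continuous (fun s => f s x) t -> continuity_2d_pt f t x.
Proof.
  intros Hd0 HL Hc. apply cont2_eps. intros e He.
  destruct (proj1 (continuous_eps _ _) Hc (e / 2)) as [d1 [Hd1 H1]]; [lra|].
  set (L1 := Rabs L + 1). assert (HL1 : 1 <= L1) by (unfold L1; assert (H := Rabs_pos L); lra).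
  set (d := Rmin (Rmin d0 d1) (e / 2 / L1)).
  assert (Hd : 0 < d). { repeat apply Rmin_glb_lt; auto. pos. }
  assert (d <= d0) by (eapply Rle_trans; [apply Rmin_l | apply Rmin_l]).
  assert (d <= d1) by (eapply Rle_trans; [apply Rmin_l | apply Rmin_r]).
  assert (Hd3 : d <= e / 2 / L1) by apply Rmin_r.
  exists d. split; auto. intros s y Hs Hy.
  specialize (HL s y x).
  rewrite Rminus_diag, Rabs_R0 in HL.
  replace (f s y - f t x) with ((f s y - f s x) + (f s x - f t x)) by lra.
  eapply Rle_lt_trans; [apply Rabs_triang|].
  assert (Rabs (f s y - f s x) <= e / 2).
  { eapply Rle_trans; [pos |]. apply Rle_trans with (L1 * (e / 2 / L1)).
    - apply Rle_trans with (L1 * Rabs (y - x)).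
      + apply Rmult_le_compat_r; [pos |]. unfold L1. assert (H3 := Rle_abs L). lra.
      + pos.
    - right. field. lra. }
  assert (Rabs (f s x - f t x) < e / 2) by pos. lra.
Qed.

(** * Power series and analytic functions *)

Lemma CV_radius_gt c K s r : 0 < r -> 0 <= s < r -> (forall n, Rabs (c n) * r ^ n <= K) -> Rbar_lt s (CV_radius c).
Proof.
  intros. apply Rbar_lt_le_trans with r; [simpl; lra|].
  apply (proj1 (CV_radius_bounded c)). exists K. intros n.
  rewrite Rabs_mult, (Rabs_pos_eq (r ^ n)) by pos. auto.
Qed.

Lemma CV_radius_coef c r : 0 < r -> Rbar_lt r (CV_radius c) -> exists K, 0 < K /\ forall n, Rabs (c n) * r ^ n <= K.
Proof.
  intros.
  assert (He : ex_series (fun n => Rabs (c n * r ^ n))).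
  { apply CV_disk_inside. rewrite Rabs_pos_eq; auto; lra. }
  apply ex_series_lim_0 in He.
  destruct (proj1 (lim_seq_eps _ _) He 1) as [N HN]; [lra|].
  assert (HB : exists B, 0 < B /\ forall n, (n < N)%nat -> Rabs (c n) * r ^ n <= B).
  { clear HN. induction N.
    - exists 1. split; [lra|]. lia.
    - destruct IHN as [B [HB1 HB2]]. exists (B + Rabs (c N) * r ^ N).
      assert (0 <= Rabs (c N) * r ^ N) by pos.
      split; [lra|]. intros n Hn. destruct (Nat.eq_dec n N) as [->|]; [lra|].
      specialize (HB2 n ltac:(lia)). lra. }
  destruct HB as [B [HB1 HB2]]. exists (B + 1). split; [lra|]. intros n.
  destruct (Nat.lt_ge_cases n N) as [Hn|Hn].
  - specialize (HB2 n Hn). lra.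
  - specialize (HN n Hn). rewrite Rminus_0_r, Rabs_Rabsolu, Rabs_mult, (Rabs_pos_eq (r ^ n)) in HN.
    lra. pos.
Qed.

Lemma analytic_local g a b x : analytic_on g a b -> a < x < b ->
  exists r c, 0 < r /\ Rbar_lt r (CV_radius c) /\
    forall y, Rabs (y - x) < r -> g y = PSeries c (y - x).
Proof.
  intros H Hx. destruct (H x Hx) as [r [Hr [c Hc]]].
  (* Convergence at [3 r / 4] puts [r / 2] strictly inside the disc of convergence. *)
  exists (r / 2), c. split; [lra|]. split.
  - assert (He : ex_series (fun n => c n * (3 * r / 4) ^ n)).
    { eexists. specialize (Hc (x + 3 * r / 4)). replace (x + 3 * r / 4 - x) with (3 * r / 4) in Hc by lra.
      apply Hc. rewrite Rabs_pos_eq; lra. }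
    apply Rbar_lt_le_trans with (3 * r / 4); [simpl; lra|].
    destruct (Rbar_le_lt_dec (3 * r / 4) (CV_radius c)) as [Hl|Hl]; auto.
    exfalso. apply (CV_disk_outside c (3 * r / 4)).
    + rewrite Rabs_pos_eq; pos.
    + apply ex_series_lim_0, He.
  - symmetry. apply is_pseries_unique, is_pseries_R. pos.
Qed.

Lemma PSeries_CV_lt c (r y : R) : Rbar_lt r (CV_radius c) -> Rabs y < r -> Rbar_lt (Rabs y) (CV_radius c).
Proof. intros. apply Rbar_lt_trans with r; auto. Qed.

Lemma analytic_is_derive_local g a b x : analytic_on g a b -> a < x < b ->
  exists r c, 0 < r /\ Rbar_lt r (CV_radius c) /\
    (forall y, Rabs (y - x) < r -> g y = PSeries c (y - x)) /\
    (forall y, Rabs (y - x) < r -> is_derive g y (PSeries (PS_derive c) (y - x))).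
Proof.
  intros H Hx. destruct (analytic_local g a b x H Hx) as [r [c [Hr [Hc Hg]]]].
  exists r, c. splits; auto. intros y Hy.
  eapply is_derive_ext_loc.
  { assert (Hd : 0 < r - Rabs (y - x)) by lra.
    exists (mkposreal _ Hd). intros z Hz. symmetry. apply Hg.
    change (Rabs (z - y) < r - Rabs (y - x)) in Hz.
    replace (z - x) with ((z - y) + (y - x)) by lra.
    eapply Rle_lt_trans; [apply Rabs_triang|]. lra. }
  evar_last.
  - apply is_derive_comp.
    + apply is_derive_PSeries, (PSeries_CV_lt c r); auto.
    + auto_derive; reflexivity.
  - unfold scal; simpl; unfold mult; simpl. ring.
Qed.

Lemma analytic_ex_derive g a b x : analytic_on g a b -> a < x < b -> ex_derive g x.
Proof.
  intros H Hx. destruct (analytic_is_derive_local g a b x H Hx) as [r [c [Hr [_ [_ Hd]]]]].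
  eexists. apply Hd. rewrite Rminus_diag, Rabs_R0. auto.
Qed.

Lemma analytic_Derive g a b : analytic_on g a b -> analytic_on (Derive g) a b.
Proof.
  intros H x Hx. destruct (analytic_is_derive_local g a b x H Hx) as [r [c [Hr [Hc [_ Hd]]]]].
  exists r. split; auto. exists (PS_derive c). intros y Hy.
  rewrite (is_derive_unique _ _ _ (Hd y Hy)).
  refine (proj1 (is_pseries_R _ _ _) (PSeries_correct _ _ (CV_radius_inside _ _ _))).
  rewrite CV_radius_derive. apply (PSeries_CV_lt c r); auto.
Qed.

Lemma analytic_ext f g a b : (forall x, a < x < b -> f x = g x) -> analytic_on f a b -> analytic_on g a b.
Proof.
  intros He H x Hx. destruct (H x Hx) as [r [Hr [c Hc]]].
  exists (Rmin r (Rmin (x - a) (b - x))). split. repeat apply Rmin_glb_lt; lra.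
  exists c. intros y Hy.
  mins.
  rewrite <- He. apply Hc; lra. apply Rabs_def2 in Hy. lra.
Qed.

Lemma analytic_sub g a b a' b' : analytic_on g a b -> a <= a' -> b' <= b -> analytic_on g a' b'.
Proof. intros H H1 H2 x. pos. Qed.

(** * Continuously differentiable functions on an open interval *)

Definition C1 (f : R -> R) (a b : R) : Prop :=
  forall x, a < x < b -> ex_derive f x /\ continuous (Derive f) x.

Lemma analytic_C1 g a b : analytic_on g a b -> C1 g a b.
Proof.
  split. eapply analytic_ex_derive; eauto.
  apply (@ex_derive_continuous R_AbsRing R_NormedModule).
  eapply analytic_ex_derive; eauto using analytic_Derive.
Qed.

Lemma locally_itv a b x : a < x < b -> locally x (fun y => a < y < b).
Proof.
  intros. assert (Hd : 0 < Rmin (x - a) (b - x)) by pos.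
  exists (mkposreal _ Hd). intros y Hy. change (Rabs (y - x) < Rmin (x - a) (b - x)) in Hy.
  mins.
  apply Rabs_def2 in Hy. lra.
Qed.

Lemma C1_of_derive f df a b : (forall x, a < x < b -> is_derive f x (df x)) ->
  (forall x, a < x < b -> continuous df x) -> C1 f a b.
Proof.
  intros H Hc x Hx. split. exists (df x). auto.
  eapply continuous_ext_loc; auto.
  apply filter_imp with (2 := locally_itv a b x Hx).
  symmetry. apply is_derive_unique. auto.
Qed.

Lemma C1_is_derive f a b x : C1 f a b -> a < x < b -> is_derive f x (Derive f x).
Proof. intros H Hx. apply Derive_correct, H, Hx. Qed.

Lemma C1_cont f a b x : C1 f a b -> a < x < b -> continuous f x.
Proof. intros. eapply is_derive_cont. eapply C1_is_derive; eauto. Qed.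

Lemma C1_ext f g a b : (forall x, a < x < b -> f x = g x) -> C1 f a b -> C1 g a b.
Proof.
  intros He H. eapply C1_of_derive.
  - intros x Hx. eapply is_derive_ext_loc.
    + apply filter_imp with (2 := locally_itv a b x Hx). auto.
    + eapply C1_is_derive; eauto.
  - intros x Hx. apply H, Hx.
Qed.

Lemma C1_const c a b : C1 (fun _ => c) a b.
Proof.
  eapply C1_of_derive.
  - intros; apply (@is_derive_const R_AbsRing R_NormedModule).
  - intros; apply Rcont_const.
Qed.

Lemma C1_plus f g a b : C1 f a b -> C1 g a b -> C1 (fun x => f x + g x) a b.
Proof.
  intros Hf Hg. eapply C1_of_derive.
  - intros; apply (@is_derive_plus R_AbsRing R_NormedModule); eapply C1_is_derive; eauto.
  - intros. apply Rcont_plus; [apply Hf | apply Hg]; auto.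
Qed.

Lemma is_derive_Rmult f g x df dg : is_derive f x df -> is_derive g x dg -> is_derive (fun y => f y * g y) x (df * g x + f x * dg).
Proof.
  intros. apply (is_derive_mult f); auto. apply Rmult_comm.
Qed.

Lemma C1_mult f g a b : C1 f a b -> C1 g a b -> C1 (fun x => f x * g x) a b.
Proof.
  intros Hf Hg. eapply C1_of_derive.
  - intros; apply is_derive_Rmult; eapply C1_is_derive; eauto.
  - intros x Hx. assert (Cf := C1_cont f a b x Hf Hx). assert (Cg := C1_cont g a b x Hg Hx).
    destruct (Hf x Hx) as [_ Df]. destruct (Hg x Hx) as [_ Dg].
    apply Rcont_plus; apply Rcont_mult; assumption.
Qed.

Lemma C1_exp f a b : C1 f a b -> C1 (fun x => exp (f x)) a b.
Proof.
  intros Hf. eapply C1_of_derive.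
  - intros x Hx. apply is_derive_comp; [|eapply C1_is_derive; eauto].
    apply is_derive_Reals, derivable_pt_lim_exp.
  - intros x Hx. apply Rcont_mult; [apply Hf, Hx|].
    apply continuous_comp; [eapply C1_cont; eauto|].
    apply (is_derive_cont _ _ (exp (f x))), is_derive_Reals, derivable_pt_lim_exp.
Qed.

(** * Re-expansion of a power series inside its disc *)

Lemma Derive_n_geom n x : x < 1 -> is_derive_n (fun y => / (1 - y)) n x (INR (fact n) / (1 - x) ^ (S n)).
Proof.
  revert x. induction n; intros x Hx.
  - simpl. field. lra.
  - simpl is_derive_n.
    eapply is_derive_ext_loc.
    { assert (Hd : 0 < 1 - x) by lra. exists (mkposreal _ Hd). intros y Hy.
      change (Rabs (y - x) < 1 - x) in Hy. apply Rabs_def2 in Hy.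
      symmetry. apply is_derive_n_unique, IHn. lra. }
    assert (Hp : (1 - x) ^ n <> 0) by (apply pow_nonzero; lra).
    assert (Hp2 : (1 - x) ^ S n <> 0) by (apply pow_nonzero; lra).
    eapply is_derive_ext. reflexivity.
    evar_last.
    { apply is_derive_Rmult. apply (@is_derive_const R_AbsRing R_NormedModule).
      apply is_derive_inv; auto.
      apply is_derive_pow.
      auto_derive; auto. }
    change (@zero R_NormedModule) with 0. rewrite plus_INR, mult_INR, S_INR. simpl pow. field.
    lra.
Qed.

(** The [k]-th derivative of the geometric series, computed termwise and from [1 / (1 - q)]. *)
Lemma PSeries_geom_shift k q : 0 <= q < 1 ->
  is_series (fun n => INR (fact (n + k)) / INR (fact n) * q ^ n) (INR (fact k) / (1 - q) ^ (S k)).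
Proof.
  intros.
  assert (HCV : Rbar_lt (Rabs q) (CV_radius (fun _ => 1))).
  { rewrite Rabs_pos_eq by lra. apply CV_radius_gt with 1 1; try lra.
    intros n. rewrite pow1, Rabs_R1. lra. }
  assert (H1 := is_derive_n_PSeries k (fun _ => 1) q HCV).
  assert (H2 : is_derive_n (PSeries (fun _ => 1)) k q (INR (fact k) / (1 - q) ^ (S k))).
  { eapply is_derive_n_ext_loc.
    - assert (Hd : 0 < 1 - q) by lra. exists (mkposreal _ Hd). intros y Hy.
      change (Rabs (y - q) < 1 - q) in Hy. apply Rabs_def2 in Hy.
      symmetry. apply is_pseries_unique, is_pseries_R.
      apply is_series_ext with (fun n => y ^ n). intros; simpl; ring.
      apply is_series_geom. apply Rabs_def1; lra.
    - apply Derive_n_geom. lra. }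
  apply is_derive_n_unique in H1. apply is_derive_n_unique in H2. rewrite H2 in H1. rewrite H1.
  apply is_series_ext with (fun n => PS_derive_n k (fun _ => 1) n * q ^ n).
  { intros. unfold PS_derive_n. lra. }
  refine (proj1 (is_pseries_R _ _ _) (PSeries_correct _ _ (CV_radius_inside _ _ _))).
  rewrite CV_radius_derive_n. auto.
Qed.

(** A real-variable Cauchy estimate: the differentiated series is dominated term by term by the
    [k]-th derivative of a geometric series of ratio [Rabs x / s]. *)
Lemma Derive_n_PSeries_bound c K s x k : 0 < s -> (forall n, Rabs (c n) * s ^ n <= K) -> Rabs x < s ->
  Rabs (Derive_n (PSeries c) k x) <= K / (1 - Rabs x / s) * INR (fact k) * (/ (s - Rabs x)) ^ k.
Proof.
  intros Hs HK Hx.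
  assert (Hxp := Rabs_pos x).
  assert (HCV : Rbar_lt (Rabs x) (CV_radius c)) by (apply CV_radius_gt with K s; auto).
  rewrite Derive_n_PSeries by pos.
  set (q := Rabs x / s).
  assert (Hq : 0 <= q < 1).
  { split. apply Rdiv_le_0_compat; lra. apply Rlt_div_l; lra. }
  assert (HG := PSeries_geom_shift k q Hq).
  assert (Hb : forall n, Rabs (PS_derive_n k c n * x ^ n) <= K * / s ^ k * (INR (fact (n + k)) / INR (fact n) * q ^ n)).
  { intros n. unfold PS_derive_n. rewrite !Rabs_mult.
    assert (Hf : 0 < INR (fact (n + k)) / INR (fact n)).
    { apply Rdiv_lt_0_compat; apply INR_fact_lt_0. }
    rewrite (Rabs_pos_eq _ (Rlt_le _ _ Hf)).
    unfold q. rewrite <- RPow_abs. unfold Rdiv at 3. rewrite Rpow_mult_distr, pow_inv.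
    assert (Hsn : 0 < s ^ n) by pos.
    assert (Hsk : 0 < s ^ k) by pos.
    specialize (HK (n + k)%nat). rewrite pow_add in HK.
    assert (Hc : Rabs (c (n + k)%nat) <= K * / s ^ k * / s ^ n).
    { apply Rmult_le_reg_r with (s ^ n * s ^ k); [nra|].
      replace (K * / s ^ k * / s ^ n * (s ^ n * s ^ k)) with K by (field; lra). auto. }
    apply Rle_trans with (INR (fact (n + k)) / INR (fact n) * (K * / s ^ k * / s ^ n) * Rabs x ^ n).
    2: right; try lra.
    pos. }
  assert (HG2 : is_series (fun n => K * / s ^ k * (INR (fact (n + k)) / INR (fact n) * q ^ n))
     (K * / s ^ k * (INR (fact k) / (1 - q) ^ (S k)))) by apply (is_series_scal (K * / s ^ k) _ _ HG).
  assert (He : ex_series (fun n => Rabs (PS_derive_n k c n * x ^ n))).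
  { eapply (@ex_series_le R_AbsRing R_CompleteNormedModule).
    - intros n. rewrite Rabs_Rabsolu. apply Hb.
    - eexists; exact HG2. }
  eapply Rle_trans; [apply Series_Rabs; exact He|].
  apply Rle_trans with (K * / s ^ k * (INR (fact k) / (1 - q) ^ (S k))).
  - rewrite <- (is_series_unique _ _ HG2). apply Series_le.
    + pos.
    + eexists; exact HG2.
  - right. unfold q. rewrite pow_inv.
    replace (s - Rabs x) with (s * (1 - Rabs x / s)) by (field; lra).
    rewrite Rpow_mult_distr. simpl pow.
    assert (s ^ k <> 0) by (apply pow_nonzero; lra).
    assert ((1 - Rabs x / s) <> 0) by (unfold q in Hq; lra).
    assert ((1 - Rabs x / s) ^ k <> 0) by (apply pow_nonzero; lra).
    field. lra.
Qed.

Lemma Taylor_pos f n x h : 0 < h -> (forall t, Rabs (t - x) <= h -> forall k, (k <= S n)%nat -> ex_derive_n f k t) ->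
  exists z, Rabs (z - x) <= h /\
    f (x + h) = sum_f_R0 (fun m => h ^ m / INR (fact m) * Derive_n f m x) n
      + h ^ S n / INR (fact (S n)) * Derive_n f (S n) z.
Proof.
  intros Hh H. destruct (Taylor_Lagrange f n x (x + h)) as [z [Hz He]]; try lra.
  { intros. apply H; auto. rewrite Rabs_pos_eq; lra. }
  exists z. split. rewrite Rabs_pos_eq; lra.
  replace (x + h - x) with h in He by lra. auto.
Qed.

Lemma locally_absball x0 d0 x : Rabs (x - x0) < d0 -> locally x (fun y => Rabs (y - x0) < d0).
Proof.
  intros. assert (Hd : 0 < d0 - Rabs (x - x0)) by lra.
  exists (mkposreal _ Hd). intros y Hy. change (Rabs (y - x) < d0 - Rabs (x - x0)) in Hy.
  replace (y - x0) with ((y - x) + (x - x0)) by lra.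
  eapply Rle_lt_trans; [apply Rabs_triang|]. lra.
Qed.

(** For negative [h] the expansion of [y -> f (- y)] at [- x] is used; the signs [(-1)^m] of the
    reflected derivatives cancel those of [(- h)^m]. *)
Lemma Taylor_both f n x h d0 : Rabs h < d0 -> h <> 0 -> (forall t, Rabs (t - x) < d0 -> forall k, ex_derive_n f k t) ->
  exists z, Rabs (z - x) <= Rabs h /\
    f (x + h) = sum_f_R0 (fun m => h ^ m / INR (fact m) * Derive_n f m x) n
      + h ^ S n / INR (fact (S n)) * Derive_n f (S n) z.
Proof.
  intros Hd Hh H. destruct (Rlt_le_dec 0 h) as [Hp|Hp].
  - rewrite Rabs_pos_eq in * by lra. apply Taylor_pos; auto. pos.
  - rewrite Rabs_left1 in * by lra.
    assert (Hloc : forall t, Rabs (t - - x) < d0 -> forall k, locally (- t) (fun y => forall j, (j <= k)%nat -> ex_derive_n f j y)).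
    { intros t Ht k. eapply filter_imp.
      - intros y Hy j _. apply H, Hy.
      - apply locally_absball. replace (- t - x) with (- (t - - x)) by lra. rewrite Rabs_Ropp. auto. }
    destruct (Taylor_pos (fun y => f (- y)) n (- x) (- h)) as [z [Hz He]]; try lra.
    { intros. apply ex_derive_n_comp_opp, Hloc. lra. }
    assert (Hpar : forall m y, Rabs (y - - x) < d0 ->
      (- h) ^ m * Derive_n (fun y => f (- y)) m y = h ^ m * Derive_n f m (- y)).
    { intros m y Hy. rewrite Derive_n_comp_opp by pos.
      replace ((- h) ^ m) with ((-1) ^ m * h ^ m) by (rewrite <- Rpow_mult_distr; f_equal; ring).
      replace ((-1) ^ m * h ^ m * ((-1) ^ m * Derive_n f m (- y)))
        with (((-1) ^ m * (-1) ^ m) * (h ^ m * Derive_n f m (- y))) by lra.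
      rewrite <- Rpow_mult_distr. replace (-1 * -1) with 1 by lra. rewrite pow1. ring. }
    exists (- z). split.
    { replace (- z - x) with (- (z - - x)) by lra. rewrite Rabs_Ropp. auto. }
    replace (- (- x + - h)) with (x + h) in He by lra. rewrite He. f_equal.
    + apply sum_eq. intros m _. unfold Rdiv.
      replace ((- h) ^ m * / INR (fact m) * Derive_n (fun y => f (- y)) m (- x))
        with ((- h) ^ m * Derive_n (fun y => f (- y)) m (- x) * / INR (fact m)) by lra.
      rewrite Hpar by (rewrite Rminus_diag, Rabs_R0; lra). rewrite Ropp_involutive. ring.
    + unfold Rdiv.
      replace ((- h) ^ S n * / INR (fact (S n)) * Derive_n (fun y => f (- y)) (S n) z)
        with ((- h) ^ S n * Derive_n (fun y => f (- y)) (S n) z * / INR (fact (S n))) by lra.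
      rewrite Hpar by lra. ring.
Qed.

Lemma is_series_lim a l : is_series a l <-> is_lim_seq (sum_f_R0 a) l.
Proof.
  split; intros H.
  - eapply is_lim_seq_ext. apply sum_n_Reals. auto.
  - apply is_lim_seq_ext with (v := sum_n a) in H. exact H. symmetry; apply sum_n_Reals.
Qed.

(** Taylor's formula at the new centre with Lagrange remainder. On the ball of radius [d] the
    derivatives obey a Cauchy estimate with radius [R0 - m], and [d] is at most half of that radius,
    so the remainder of order [n] is at most [K1 / 2^(n+1)]. *)
Lemma PSeries_analytic c K R0 x0 : 0 < R0 -> (forall n, Rabs (c n) * R0 ^ n <= K) ->
  analytic_on (fun x => PSeries c (x - x0)) (x0 - R0) (x0 + R0).
Proof.
  intros HR HK x Hx. set (X := x - x0).
  assert (HX : Rabs X < R0) by (apply Rabs_def1; unfold X; lra).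
  set (m := (Rabs X + R0) / 2).
  assert (Hm : Rabs X < m < R0) by (unfold m; lra).
  set (d := Rmin (m - Rabs X) ((R0 - m) / 2)).
  assert (Hd : 0 < d) by (apply Rmin_glb_lt; lra).
  assert (Hd1 : d <= m - Rabs X) by apply Rmin_l.
  assert (Hd2 : d <= (R0 - m) / 2) by apply Rmin_r.
  assert (HK0 : 0 <= K).
  { specialize (HK O). assert (H := Rabs_pos (c O)). lra. }
  set (K1 := K / (1 - m / R0)).
  assert (Hq : m / R0 < 1) by (apply Rlt_div_l; lra).
  assert (HK1 : 0 <= K1) by (apply Rdiv_le_0_compat; lra).
  assert (Hball : forall t, Rabs (t - X) < d -> Rabs t < m).
  { intros t Ht. replace t with ((t - X) + X) by lra.
    eapply Rle_lt_trans; [apply Rabs_triang|]. lra. }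
  assert (Hder : forall t k, Rabs t < m -> Rabs (Derive_n (PSeries c) k t) <= K1 * INR (fact k) * (/ (R0 - m)) ^ k).
  { intros t k Ht. eapply Rle_trans; [apply Derive_n_PSeries_bound with (1 := HR) (2 := HK); lra|].
    assert (Hq2 : Rabs t / R0 <= m / R0) by (apply Rmult_le_compat_r; pos).
    apply Rmult_le_compat.
    - apply Rmult_le_pos; [| pos]. apply Rdiv_le_0_compat; lra.
    - pos.
    - apply Rmult_le_compat_r; [pos |]. apply Rmult_le_compat_l; auto.
      apply Rinv_le_contravar; lra.
    - apply pow_incr. split; [pos |]. apply Rinv_le_contravar; lra. }
  exists d. split; auto. exists (fun k => / INR (fact k) * Derive_n (PSeries c) k X).
  intros y Hy. set (h := y - x) in *. replace (y - x0) with (X + h) by (unfold X, h; ring).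
  destruct (Req_dec h 0) as [Hh|Hh].
  { rewrite Hh, Rplus_0_r. apply is_series_lim. apply lim_seq_eps. exists O. intros n _.
    replace (sum_f_R0 (fun n => / INR (fact n) * Derive_n (PSeries c) n X * 0 ^ n) n) with (PSeries c X).
    rewrite Rminus_diag, Rabs_R0; auto.
    induction n; simpl. field. lra. }
  apply is_series_lim, lim_seq_eps. intros e He.
  destruct (pow_lt_1_zero (/ 2)) with (y := e / (K1 + 1)) as [N HN].
  { rewrite Rabs_pos_eq; lra. }
  { pos. }
  exists N. intros n Hn.
  destruct (Taylor_both (PSeries c) n X h d Hy Hh) as [z [Hz Hez]].
  { intros t Ht k. apply ex_derive_n_PSeries. apply CV_radius_gt with K R0; auto.
    split; [pos |]. specialize (Hball t). lra. }
  rewrite Hez. rewrite (sum_eq _ (fun m => h ^ m / INR (fact m) * Derive_n (PSeries c) m X)).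
  2:{ intros; lra. }
  match goal with |- Rabs (?a - (?a + ?b)) < e => replace (a - (a + b)) with (- b) by ring end.
  rewrite Rabs_Ropp, Rabs_mult. unfold Rdiv. rewrite Rabs_mult, <- RPow_abs.
  rewrite (Rabs_pos_eq (/ INR (fact (S n)))) by (apply Rlt_le, Rinv_0_lt_compat, INR_fact_lt_0).
  assert (Hzm : Rabs z < m) by pos.
  specialize (HN (S n) ltac:(lia)).
  rewrite Rabs_pos_eq in HN by pos.
  apply Rle_lt_trans with (K1 * (/ 2) ^ S n).
  - eapply Rle_trans.
    + apply Rmult_le_compat_l; auto. apply Rmult_le_pos; [pos |].
      apply Rlt_le, Rinv_0_lt_compat, INR_fact_lt_0.
    + replace (Rabs h ^ S n * / INR (fact (S n)) * (K1 * INR (fact (S n)) * (/ (R0 - m)) ^ S n))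
        with (K1 * (Rabs h * / (R0 - m)) ^ S n).
      2:{ rewrite Rpow_mult_distr. assert (HF := INR_fact_neq_0).
          field. auto. }
      apply Rmult_le_compat_l; auto. apply pow_incr. split.
      * pos.
      * apply Rle_div_l; lra.
  - apply Rle_lt_trans with ((K1 + 1) * (/ 2) ^ S n).
    + pos.
    + apply Rlt_div_r in HN; [|lra]. lra.
Qed.

(** * Limits at [0+] and primitives of [f t / t] *)

Definition lim0 (f : R -> R) : Prop :=
  forall e, 0 < e -> exists d, 0 < d /\ forall t, 0 < t < d -> Rabs (f t) < e.

Lemma lim0_le f g T : 0 < T -> (forall t, 0 < t < T -> Rabs (f t) <= g t) -> lim0 g -> lim0 f.
Proof.
  intros HT H Hg e He. destruct (Hg e He) as [d [Hd H1]].
  exists (Rmin T d). split. apply Rmin_glb_lt; auto. intros.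
  mins.
  eapply Rle_lt_trans; [pos |]. eapply Rle_lt_trans; [apply Rle_abs|]. pos.
Qed.

Lemma Rpower_1_l y : Rpower 1 y = 1.
Proof. unfold Rpower. rewrite ln_1, Rmult_0_r. apply exp_0. Qed.

Lemma Rpower_le_base x y p : 0 < x <= y -> 0 <= p -> Rpower x p <= Rpower y p.
Proof.
  intros. destruct (Req_dec p 0) as [->|]. rewrite !Rpower_O; lra.
  apply Rle_Rpower_l; lra.
Qed.

Lemma Rpower_le1 x p : 0 < x <= 1 -> 0 <= p -> Rpower x p <= 1.
Proof. intros. rewrite <- (Rpower_1_l p). apply Rpower_le_base; lra. Qed.

Lemma Rpower_anti x p q : 0 < x <= 1 -> q <= p -> Rpower x p <= Rpower x q.
Proof.
  replace p with (q + (p - q)) by lra. rewrite Rpower_plus.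
  assert (H1 := Rpower_le1 x (p - q)). assert (H2 := Rpower_pos x q). nra.
Qed.

Lemma lim0_Rpower K p : 0 < p -> lim0 (fun t => K * Rpower t p).
Proof.
  intros Hp e He. set (K1 := Rabs K + 1).
  assert (HK1 : 0 < K1) by (unfold K1; assert (H := Rabs_pos K); lra).
  assert (Hq : 0 < e / K1) by pos.
  exists (Rpower (e / K1) (/ p)). split; [pos |]. intros t Ht.
  rewrite Rabs_mult, (Rabs_pos_eq (Rpower t p)) by pos.
  assert (H : Rpower t p < e / K1).
  { apply Rlt_le_trans with (Rpower (Rpower (e / K1) (/ p)) p).
    - apply exp_increasing. apply Rmult_lt_compat_l; auto. apply ln_increasing; lra.
    - rewrite Rpower_mult, Rinv_l, Rpower_1; lra. }
  apply Rlt_div_r in H; auto.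
  assert (Hpp := Rpower_pos t p). unfold K1 in H. nra.
Qed.

Lemma is_derive_Rpower_t p t : 0 < t -> is_derive (fun s => Rpower s p) t (p * Rpower t p / t).
Proof.
  intros. unfold Rpower. auto_derive; auto. lra.
Qed.

(** [G - F] is nondecreasing and tends to zero at [0+], hence nonnegative. This replaces integration
    from the singular endpoint. *)
Lemma compare0 F f G g T : (forall t, 0 < t < T -> is_derive F t (f t)) ->
  (forall t, 0 < t < T -> is_derive G t (g t)) ->
  (forall t, 0 < t < T -> f t <= g t) -> lim0 F -> lim0 G ->
  forall t, 0 < t < T -> F t <= G t.
Proof.
  intros HF HG Hle HF0 HG0 t Ht. apply Rnot_lt_le. intros Hlt.
  set (e := (F t - G t) / 2).
  destruct (HF0 e) as [d1 [Hd1 H1]]; [unfold e; lra|].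
  destruct (HG0 e) as [d2 [Hd2 H2]]; [unfold e; lra|].
  set (s := Rmin t (Rmin d1 d2) / 2).
  assert (Hm : 0 < Rmin t (Rmin d1 d2)) by pos.
  assert (Hb1 := Rmin_l t (Rmin d1 d2)). assert (Hb2 := Rmin_r t (Rmin d1 d2)).
  mins.
  specialize (H1 s ltac:(unfold s; lra)). specialize (H2 s ltac:(unfold s; lra)).
  apply Rabs_def2 in H1. apply Rabs_def2 in H2.
  assert (H3 : G s - F s <= G t - F t).
  { apply (incr_of_derive (fun t => G t - F t) (fun t => g t - f t)).
    - unfold s; lra.
    - intros x Hx. apply (@is_derive_minus R_AbsRing R_NormedModule); [apply HG | apply HF]; unfold s in Hx; lra.
    - intros x Hx. assert (f x <= g x) by (apply Hle; unfold s in Hx; lra). lra. }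
  unfold e in *. lra.
Qed.

Lemma lim0_opp f : lim0 f -> lim0 (fun t => - f t).
Proof.
  intros H e He. destruct (H e He) as [d [Hd H1]]. exists d. split; auto.
  intros. rewrite Rabs_Ropp. auto.
Qed.

Lemma compare0_abs F f G g T : (forall t, 0 < t < T -> is_derive F t (f t)) ->
  (forall t, 0 < t < T -> is_derive G t (g t)) ->
  (forall t, 0 < t < T -> Rabs (f t) <= g t) -> lim0 F -> lim0 G ->
  forall t, 0 < t < T -> Rabs (F t) <= G t.
Proof.
  intros HF HG Hle HF0 HG0 t Ht. apply Rabs_le. split.
  - assert (H : - F t <= G t); [|lra].
    apply (compare0 (fun t => - F t) (fun t => - f t) G g T); auto using lim0_opp.
    + intros; apply (@is_derive_opp R_AbsRing R_NormedModule); auto.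
    + intros s Hs. specialize (Hle s). assert (H := Rle_abs (- f s)). rewrite Rabs_Ropp in H. lra.
  - apply (compare0 F f G g T); auto.
    intros s. specialize (Hle s). assert (H := Rle_abs (f s)). lra.
Qed.

(* The primitive is [t |-> int_0^(t^q) f(r^(1/q))/(q r) dr] with [q = p/2]: in the variable
   [r = t^q] the integrand extends continuously by [0]. *)
Lemma prim_exists f p K T : 0 < p -> 0 <= K -> (forall t, 0 < t < T -> continuous f t) ->
  (forall t, 0 < t < T -> Rabs (f t) <= K * Rpower t p) ->
  exists F, (forall t, 0 < t < T -> is_derive F t (f t / t)) /\ lim0 F.
Proof.
  intros Hp HK Hc Hb.
  set (q := p / 2). assert (Hq : 0 < q) by (unfold q; lra).
  set (g := fun r => if Rlt_dec 0 r then f (Rpower r (/ q)) / (q * r) else 0).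
  assert (Hrq : forall r, 0 < r -> Rpower (Rpower r (/ q)) q = r).
  { intros r Hr. rewrite Rpower_mult, Rinv_l, Rpower_1; lra. }
  assert (Hlt : forall r, 0 < r < Rpower T q -> 0 < Rpower r (/ q) < T \/ T <= 0).
  { destruct (Rlt_le_dec 0 T) as [HT|HT]; [left| auto]. split; [pos |].
    replace T with (Rpower (Rpower T q) (/ q)). 2: rewrite Rpower_mult, Rinv_r, Rpower_1; lra.
    apply exp_increasing, Rmult_lt_compat_l.
    apply Rinv_0_lt_compat; auto. apply ln_increasing; lra. }
  destruct (Rlt_le_dec 0 T) as [HT|HT].
  2:{ exists (fun _ => 0). split. intros; lra. exists 1. split; [lra|]. rewrite Rabs_R0; auto. }
  assert (Hgb : forall r, r < Rpower T q -> Rabs (g r) <= K / q * Rmax 0 r).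
  { intros r Hr. unfold g. destruct Rlt_dec as [H0|H0].
    - destruct (Hlt r (conj H0 Hr)) as [H1|]; [|lra].
      unfold Rdiv. rewrite Rabs_mult, Rabs_inv, (Rabs_pos_eq (q * r)) by nra.
      specialize (Hb _ H1). replace (Rpower (Rpower r (/ q)) p) with (r * r) in Hb.
      2:{ replace p with (q + q) by (unfold q; field). rewrite Rpower_plus, !Hrq; auto. }
      rewrite Rmax_right by lra.
      apply Rmult_le_reg_r with (q * r); [nra|]. rewrite Rmult_assoc, Rinv_l by nra.
      replace (K * / q * r * (q * r)) with (K * (r * r)) by (field; lra). lra.
    - rewrite Rabs_R0. apply Rmult_le_pos; [|apply Rmax_l]. apply Rdiv_le_0_compat; lra. }
  assert (Hgc : forall r, r < Rpower T q -> continuous g r).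
  { intros r Hr. destruct (Rlt_le_dec 0 r) as [H0|H0].
    - destruct (Hlt r (conj H0 Hr)) as [H1|]; [|lra].
      eapply continuous_ext_loc.
      { exists (mkposreal r H0). intros y Hy. change (Rabs (y - r) < r) in Hy. apply Rabs_def2 in Hy.
        unfold g. destruct Rlt_dec; [reflexivity | lra]. }
      apply Rcont_mult.
      + apply continuous_comp; auto.
        eapply is_derive_cont. apply is_derive_Rpower_t; auto.
      + apply continuous_comp.
        * apply Rcont_mult; [apply Rcont_const | apply continuous_id].
        * apply continuous_Rinv. nra.
    - apply continuous_eps. intros e He.
      set (d := Rmin (Rpower T q - r) (e / (K / q + 1))).
      assert (HKq : 0 <= K / q) by (apply Rdiv_le_0_compat; lra).
      assert (Hd : 0 < d). { apply Rmin_glb_lt; [lra|]. pos. }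
      exists d. split; auto. intros y Hy.
      mins.
      apply Rabs_def2 in Hy.
      replace (g r) with 0 by (unfold g; destruct Rlt_dec; lra). rewrite Rminus_0_r.
      eapply Rle_lt_trans; [pos |].
      assert (Hm : Rmax 0 y < e / (K / q + 1)). { apply Rmax_lub_lt; lra. }
      apply Rlt_div_r in Hm; [|lra]. nra. }
  exists (fun t => RInt g 0 (Rpower t q)). split.
  - intros t Ht. assert (Htq : 0 < Rpower t q < Rpower T q).
    { split; [pos |]. apply exp_increasing, Rmult_lt_compat_l; auto. apply ln_increasing; lra. }
    evar_last.
    + apply is_derive_comp.
      * eapply is_derive_RInt.
        -- apply filter_imp with (2 := locally_itv 0 (Rpower T q) _ Htq). intros.
           apply (RInt_correct (V := R_CompleteNormedModule)). apply ex_RInt_cont; [lra|]. pos.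
        -- pos.
      * apply is_derive_Rpower_t; lra.
    + unfold scal; simpl; unfold mult; simpl. unfold g. destruct Rlt_dec; [|lra].
      replace (Rpower (Rpower t q) (/ q)) with t. 2: rewrite Rpower_mult, Rinv_r, Rpower_1; lra.
      field. lra.
  - apply (lim0_le _ (fun t => (K / q * Rpower T q) * Rpower t q) T); auto.
    2: apply lim0_Rpower; auto.
    intros t Ht. assert (Htq : 0 < Rpower t q < Rpower T q).
    { split; [pos |]. apply exp_increasing, Rmult_lt_compat_l; auto. apply ln_increasing; lra. }
    eapply Rle_trans; [apply RInt_abs_bound with (M := K / q * Rpower T q)|].
    + lra.
    + pos.
    + intros. eapply Rle_trans; [pos |]. apply Rmult_le_compat_l. apply Rdiv_le_0_compat; lra.
      apply Rmax_lub; lra.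
    + lra.
Qed.

(** * Weights stable under convolution *)

Definition wgt (n : nat) : R := / 8 / (INR n + 1) ^ 2.

Lemma wgt_pos n : 0 < wgt n.
Proof.
  assert (H := pos_INR n). apply Rdiv_lt_0_compat; [lra|]. pos.
Qed.

Lemma wgt_S n : wgt (S n) <= wgt n.
Proof.
  unfold wgt. assert (H := pos_INR n). rewrite S_INR. apply Rmult_le_compat_l; [lra|].
  apply Rinv_le_contravar; [pos |]. lra.
Qed.

Lemma sum_inv_sq n : sum_f_R0 (fun k => / (INR k + 1) ^ 2) n <= 2 - / (INR n + 1).
Proof.
  induction n.
  - simpl. lra.
  - rewrite tech5, S_INR. assert (H := pos_INR n).
    assert (H1 : / (INR n + 1 + 1) ^ 2 <= / (INR n + 1) - / (INR n + 1 + 1)).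
    { replace (/ (INR n + 1) - / (INR n + 1 + 1)) with (/ ((INR n + 1) * (INR n + 1 + 1))) by (field; lra).
      apply Rinv_le_contravar; nra. }
    lra.
Qed.

Lemma sum_f_R0_rev f n : sum_f_R0 (fun k => f (n - k)%nat) n = sum_f_R0 f n.
Proof.
  revert f. induction n; intros f; simpl; auto.
  rewrite Nat.sub_diag. rewrite <- (IHn f).
  change (sum_f_R0 (fun k => f (S n - k)%nat) n + f O = sum_f_R0 (fun k => f (n - k)%nat) n + f (S n)).
  destruct n.
  - simpl. ring.
  - rewrite decomp_sum by lia. rewrite tech5.
    rewrite Nat.sub_0_r, Nat.sub_diag.
    simpl Nat.pred.
    rewrite (sum_eq (fun i => f (S (S n) - S i)%nat) (fun k => f (S n - k)%nat)).
    ring. auto.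
Qed.

(** With [a = k + 1] and [b = n - k + 1], the inequality [(a + b)^2 <= 2 (a^2 + b^2)] bounds
    [1 / (a b)^2] by [2 (1 / a^2 + 1 / b^2) / (n + 2)^2], and each sum of inverse squares is at most
    2. The factor [1/8] in [wgt] is what makes the constant here equal to one, so that bounds on
    products are products of bounds. *)
Lemma wgt_conv n : sum_f_R0 (fun k => wgt k * wgt (n - k)) n <= wgt n.
Proof.
  assert (Hn := pos_INR n).
  apply Rle_trans with (sum_f_R0 (fun k => (/ (INR k + 1) ^ 2 + / (INR (n - k) + 1) ^ 2) * (/ 32 / (INR n + 2) ^ 2)) n).
  - apply sum_Rle. intros k Hk. unfold wgt.
    assert (Hk0 := pos_INR k). assert (Hnk := pos_INR (n - k)).
    assert (Hs : INR n + 2 = (INR k + 1) + (INR (n - k) + 1)) by (rewrite minus_INR by lia; ring).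
    rewrite Hs. set (a := INR k + 1) in *. set (b := INR (n - k) + 1) in *.
    assert (Ha : 0 < a) by (unfold a; lra). assert (Hb : 0 < b) by (unfold b; lra).
    replace (/ 8 / a ^ 2 * (/ 8 / b ^ 2)) with (/ 64 * / (a ^ 2 * b ^ 2)) by (field; split; lra).
    replace ((/ a ^ 2 + / b ^ 2) * (/ 32 / (a + b) ^ 2)) with
      (/ 64 * / (a ^ 2 * b ^ 2) * (2 * (a ^ 2 + b ^ 2) / (a + b) ^ 2)) by (field; lra).
    rewrite <- Rmult_1_r at 1.
    apply Rmult_le_compat_l.
    + pos.
    + apply Rle_div_r. apply Rlt_gt, pow_lt; lra. assert (H := pow2_ge_0 (a - b)). nra.
  - rewrite <- scal_sum, sum_plus, (sum_f_R0_rev (fun k => / (INR k + 1) ^ 2)).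
    assert (H := sum_inv_sq n).
    assert (H1 : 0 < / (INR n + 1)) by pos.
    assert (H2 : 0 < / 32 / (INR n + 2) ^ 2) by pos.
    apply Rle_trans with (/ 32 / (INR n + 2) ^ 2 * 4); [nra|].
    replace (/ 32 / (INR n + 2) ^ 2 * 4) with (/ 8 / (INR n + 2) ^ 2) by lra.
    apply Rmult_le_compat_l; [lra|]. apply Rinv_le_contravar; pos.
Qed.

Ltac nonneg := first [lra | apply Rlt_le, Rinv_0_lt_compat; nra | apply Rmult_le_pos; nonneg].

(** * Coefficient sequences *)

(* [u n t] is the coefficient of [(x - x0)^n] at time [t]. *)
Definition coef := nat -> R -> R.

Definition cadd (u v : coef) : coef := fun n t => u n t + v n t.
Definition csub (u v : coef) : coef := fun n t => u n t - v n t.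
Definition cmul (u v : coef) : coef :=
  fun n t => sum_f_R0 (fun k => u k t * v (n - k)%nat t) n.
Definition cdx (u : coef) : coef := fun n t => INR (S n) * u (S n) t.

Section Weighted.
Context (R0 dl : R) (HR0 : 0 < R0) (Hdl : 0 < dl).

(* The radius [1/ZZ t] of the majorant shrinks as [t] grows; integrating [dt/t] therefore
   gains one [x]-derivative at the cost of [t^dl] (see [Bd_cdx_J]). *)
Definition ZZ (t : R) : R := R0 * exp (Rpower t dl).

Definition Bd (T K p : R) (u : coef) : Prop :=
  forall n t, 0 < t < T -> Rabs (u n t) <= K * Rpower t p * (wgt n * ZZ t ^ n).

Definition Ct (T : R) (u : coef) : Prop := forall n t, 0 < t < T -> continuous (u n) t.

Lemma ZZ_pos t : 0 < ZZ t.
Proof. apply Rmult_lt_0_compat; pos. Qed.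

Lemma ZZ_le t : 0 < t <= 1 -> ZZ t <= 3 * R0.
Proof.
  intros Ht. unfold ZZ. rewrite Rmult_comm. apply Rmult_le_compat_r; [lra|].
  eapply Rle_trans; [|apply exp_le_3].
  assert (H := Rpower_le1 t dl). destruct (Req_dec (Rpower t dl) 1) as [->|]. lra.
  apply Rlt_le, exp_increasing; lra.
Qed.

Lemma ZZ_ge t : R0 <= ZZ t.
Proof.
  rewrite <- Rmult_1_r at 1. apply Rmult_le_compat_l; [lra|].
  rewrite <- exp_0. apply Rlt_le, exp_increasing, Rpower_pos.
Qed.

Definition wz (n : nat) (t : R) : R := wgt n * ZZ t ^ n.

Lemma wz_pos n t : 0 < wz n t.
Proof. apply Rmult_lt_0_compat; [apply wgt_pos | apply pow_lt, ZZ_pos]. Qed.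
Hint Resolve wgt_pos ZZ_pos wz_pos : pos.

Lemma Bd_ext T K p u v :
  (forall n t, 0 < t < T -> u n t = v n t) -> Bd T K p u -> Bd T K p v.
Proof. intros H Hu n t Ht. rewrite <- H; auto. Qed.

Lemma Bd_add T K1 K2 p u v :
  Bd T K1 p u -> Bd T K2 p v -> Bd T (K1 + K2) p (cadd u v).
Proof.
  intros Hu Hv n t Ht. eapply Rle_trans; [apply Rabs_triang|].
  specialize (Hu n t). specialize (Hv n t). lra.
Qed.

Lemma Bd_mul T K1 K2 p1 p2 u v :
  0 <= K1 -> 0 <= K2 ->
  Bd T K1 p1 u -> Bd T K2 p2 v -> Bd T (K1 * K2) (p1 + p2) (cmul u v).
Proof.
  intros HK1 HK2 Hu Hv n t Ht.
  eapply Rle_trans; [apply sum_f_R0_triangle|].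
  apply Rle_trans with (sum_f_R0 (fun k => wgt k * wgt (n - k) * (K1 * K2 * Rpower t (p1 + p2) * ZZ t ^ n)) n).
  - apply sum_Rle. intros k Hk. rewrite Rabs_mult.
    eapply Rle_trans.
    + apply Rmult_le_compat; auto using Rabs_pos.
    + right. rewrite Rpower_plus. replace (ZZ t ^ n) with (ZZ t ^ k * ZZ t ^ (n - k)). ring.
      rewrite <- pow_add. f_equal. lia.
  - rewrite <- scal_sum.
    eapply Rle_trans.
    + apply Rmult_le_compat_l; [|apply wgt_conv].
      pos.
    + lra.
Qed.

Lemma Bd_weaken T K p q u : 0 < T <= 1 -> 0 <= K -> q <= p -> Bd T K p u -> Bd T (K * Rpower T (p - q)) q u.
Proof.
  intros HT HK Hq H n t Ht. eapply Rle_trans; auto.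
  apply Rmult_le_compat_r; [pos |]. rewrite Rmult_assoc.
  apply Rmult_le_compat_l; auto. replace p with ((p - q) + q) at 1 by lra. rewrite Rpower_plus.
  apply Rmult_le_compat_r; [pos |]. apply Rpower_le_base; lra.
Qed.

Lemma Bd_le T K K' p u : K <= K' -> Bd T K p u -> Bd T K' p u.
Proof.
  intros HK H n t Ht. eapply Rle_trans; auto.
  pos.
Qed.

Lemma Bd_weaken1 T K p q u : 0 < T <= 1 -> 0 <= K -> q <= p -> Bd T K p u -> Bd T K q u.
Proof.
  intros. apply Bd_le with (K * Rpower T (p - q)); [|apply Bd_weaken; auto].
  rewrite <- (Rmult_1_r K) at 2. apply Rmult_le_compat_l; auto. apply Rpower_le1; lra.
Qed.

Lemma Bd_sub_T T T' K p u : T' <= T -> Bd T K p u -> Bd T' K p u.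
Proof. intros H Hu n. pos. Qed.

Lemma Ct_add T u v : Ct T u -> Ct T v -> Ct T (cadd u v).
Proof. intros Hu Hv n t Ht. apply Rcont_plus; auto. Qed.

Lemma cont_sum_f (f : nat -> R -> R) N t :
  (forall k, (k <= N)%nat -> continuous (f k) t) -> continuous (fun s => sum_f_R0 (fun k => f k s) N) t.
Proof.
  induction N; intros H.
  - eauto.
  - apply Rcont_plus; auto.
Qed.

Lemma Ct_mul T u v : Ct T u -> Ct T v -> Ct T (cmul u v).
Proof. intros Hu Hv n t Ht. apply cont_sum_f. intros; apply Rcont_mult; auto. Qed.

Lemma Ct_dx T u : Ct T u -> Ct T (cdx u).
Proof. intros Hu n t Ht. apply Rcont_mult; [apply Rcont_const | auto]. Qed.

(** * The inverse of [D + a] *)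

(** The primitive of [f t / t] that vanishes at [0+], chosen by [epsilon] so that it is a total
    function of [f]. Its value is meaningful only on [(0, T)] and for [f] satisfying [okf]. *)
Definition prim (T : R) (f : R -> R) : R -> R :=
  epsilon (inhabits (fun _ => 0))
    (fun F => (forall t, 0 < t < T -> is_derive F t (f t / t)) /\ lim0 F).

Definition Jf (T a : R) (f : R -> R) (t : R) : R :=
  Rpower t (- a) * prim T (fun s => Rpower s a * f s) t.

Definition Jc (T a : R) (u : coef) : coef := fun n => Jf T a (u n).

Definition okf (T : R) (f : R -> R) : Prop :=
  (forall t, 0 < t < T -> continuous f t) /\
  exists K p, 0 <= K /\ 0 < p /\ forall t, 0 < t < T -> Rabs (f t) <= K * Rpower t p.

Lemma cont_Rpower_t p t : 0 < t -> continuous (fun s => Rpower s p) t.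
Proof. intros H. eapply is_derive_cont, is_derive_Rpower_t, H. Qed.

Lemma okf_Rpower T a f : 0 < T <= 1 -> 0 <= a -> okf T f -> okf T (fun s => Rpower s a * f s).
Proof.
  intros HT Ha [Hc [K [p [HK [Hp Hb]]]]]. split.
  - intros t Ht. apply Rcont_mult; auto. apply cont_Rpower_t; lra.
  - exists K, p. split; auto. split; auto. intros t. rewrite Rabs_mult, Rabs_pos_eq by pos.
    specialize (Hb t). assert (H := Rpower_le1 t a).
    assert (H2 := Rabs_pos (f t)). nra.
Qed.

Lemma prim_spec T f : okf T f ->
  (forall t, 0 < t < T -> is_derive (prim T f) t (f t / t)) /\ lim0 (prim T f).
Proof.
  intros [Hc [K [p [HK [Hp Hb]]]]]. unfold prim. apply epsilon_spec.
  apply (prim_exists f p K); auto.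
Qed.

Lemma Rpower_inv t a : 0 < t -> Rpower t (- a) * Rpower t a = 1.
Proof. rewrite <- Rpower_plus. replace (- a + a) with 0 by lra. apply Rpower_O. Qed.

Lemma Jf_derive T a f t : 0 < T <= 1 -> 0 <= a -> okf T f -> 0 < t < T ->
  is_derive (Jf T a f) t ((f t - a * Jf T a f t) / t).
Proof.
  intros HT Ha Hf Ht. destruct (prim_spec T _ (okf_Rpower T a f HT Ha Hf)) as [H1 _].
  unfold Jf. evar_last.
  - apply is_derive_Rmult. apply is_derive_Rpower_t; lra. auto.
  - assert (H := Rpower_inv t a ltac:(lra)).
    transitivity ((Rpower t (- a) * Rpower t a * f t - a * (Rpower t (- a) * prim T (fun s => Rpower s a * f s) t)) / t).
    lra. rewrite H. lra.
Qed.

(** [t^a G] grows at least as fast as the primitive, since the extra term [a t^(a-1) G] of its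
    derivative is nonnegative. Thus any nonnegative [G] vanishing at [0+] with
    [Rabs (f t) <= t G'(t)] bounds [(D + a)^-1 f], uniformly in [a >= 0]; the next two bounds are
    two choices of [G]. *)
Lemma Jf_bound T a f G g t : 0 < T <= 1 -> 0 <= a -> okf T f ->
  (forall s, 0 < s < T -> is_derive G s (g s)) -> (forall s, 0 < s < T -> 0 <= G s) -> lim0 G ->
  (forall s, 0 < s < T -> Rabs (f s) <= s * g s) -> 0 < t < T -> Rabs (Jf T a f t) <= G t.
Proof.
  intros HT Ha Hf HG HG0 HGl Hle Ht.
  destruct (prim_spec T _ (okf_Rpower T a f HT Ha Hf)) as [H1 H2].
  unfold Jf. rewrite Rabs_mult, Rabs_pos_eq by pos.
  assert (H : Rabs (prim T (fun s => Rpower s a * f s) t) <= Rpower t a * G t).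
  { apply (compare0_abs _ (fun s => Rpower s a * f s / s) (fun s => Rpower s a * G s)
      (fun s => a * Rpower s a / s * G s + Rpower s a * g s) T); auto.
    - intros s Hs. apply (is_derive_Rmult (fun s => Rpower s a)); [apply is_derive_Rpower_t; lra | auto].
    - intros s Hs. unfold Rdiv. rewrite !Rabs_mult, Rabs_inv, (Rabs_pos_eq s), Rabs_pos_eq by pos.
      assert (H3 : Rpower s a * Rabs (f s) * / s <= Rpower s a * g s).
      { eapply Rle_trans.
        - pos.
        - right. field. lra. }
      assert (H4 : 0 <= a * Rpower s a * / s * G s) by pos.
      lra.
    - apply (lim0_le _ (fun s => Rabs (G s)) T); try lra.
      + intros s Hs. rewrite Rabs_mult, Rabs_pos_eq by pos.
        assert (H3 := Rpower_le1 s a). assert (H4 := Rabs_pos (G s)). nra.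
      + intros e He. destruct (HGl e He) as [d [Hd Hd2]]. exists d. split; auto. intros. rewrite Rabs_Rabsolu. auto. }
  apply Rle_trans with (Rpower t (- a) * (Rpower t a * G t)).
  - pos.
  - rewrite <- Rmult_assoc, Rpower_inv by lra. lra.
Qed.

Lemma okf_Bd T K p u n : 0 < T <= 1 -> 0 <= K -> 0 < p -> Ct T u -> Bd T K p u -> okf T (u n).
Proof.
  split; auto.
  exists (K * (wgt n * (3 * R0) ^ n)), p. split; [|split; auto].
  - pos.
  - intros t Ht. eapply Rle_trans; auto.
    replace (K * (wgt n * (3 * R0) ^ n) * Rpower t p) with (K * Rpower t p * (wgt n * (3 * R0) ^ n)) by lra.
    apply Rmult_le_compat_l. apply Rmult_le_pos; auto; apply Rlt_le, Rpower_pos.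
    apply Rmult_le_compat_l. apply Rlt_le, wgt_pos. apply pow_incr. split; [pos | apply ZZ_le; lra].
Qed.

Lemma Ct_J T a K p u : 0 < T <= 1 -> 0 <= a -> 0 <= K -> 0 < p -> Ct T u -> Bd T K p u -> Ct T (Jc T a u).
Proof.
  intros HT Ha HK Hp Hc Hb n t Ht. eapply is_derive_cont, Jf_derive; eauto using okf_Bd.
Qed.

Lemma is_derive_ZZ n t : 0 < t -> is_derive (fun s => ZZ s ^ n) t (INR n * dl * Rpower t dl / t * ZZ t ^ n).
Proof.
  intros.
  assert (H1 : is_derive ZZ t (dl * Rpower t dl / t * ZZ t)).
  { unfold ZZ, Rpower. auto_derive; auto. lra. }
  evar_last; [apply (is_derive_pow ZZ n t _ H1)|].
  destruct n; [simpl; field; lra|]. simpl pow. lra.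
Qed.

Lemma is_derive_majorant A w p n t : 0 < t ->
  is_derive (fun t => A * Rpower t p * (w * ZZ t ^ n)) t
    (A * (p * Rpower t p / t) * (w * ZZ t ^ n) + A * Rpower t p * (w * (INR n * dl * Rpower t dl / t * ZZ t ^ n))).
Proof.
  intros. apply (is_derive_Rmult (fun t => A * Rpower t p) (fun t => w * ZZ t ^ n)).
  - apply is_derive_scal. apply is_derive_Rpower_t; auto.
  - apply is_derive_scal. apply is_derive_ZZ; auto.
Qed.

Lemma lim0_Bd T K p n : 0 < T <= 1 -> 0 <= K -> 0 < p -> lim0 (fun t => K * Rpower t p * (wgt n * ZZ t ^ n)).
Proof.
  intros HT HK Hp. apply (lim0_le _ (fun t => (K * (wgt n * (3 * R0) ^ n)) * Rpower t p) T); [lra| |apply lim0_Rpower; auto].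
  intros t Ht. assert (H := wz_pos). assert (H1 := Rpower_pos t p).
  rewrite Rabs_pos_eq. 2: apply Rmult_le_pos; pos.
  replace (K * (wgt n * (3 * R0) ^ n) * Rpower t p) with (K * Rpower t p * (wgt n * (3 * R0) ^ n)) by lra.
  apply Rmult_le_compat_l. apply Rmult_le_pos; lra.
  apply Rmult_le_compat_l. apply Rlt_le, wgt_pos. apply pow_incr. split; [pos | apply ZZ_le; lra].
Qed.

Lemma Bd_J T a K p u : 0 < T <= 1 -> 0 <= a -> 0 <= K -> 0 < p -> Ct T u -> Bd T K p u ->
  Bd T (K / p) p (Jc T a u).
Proof.
  intros HT Ha HK Hp Hc Hb n t.
  assert (HKp : 0 <= K / p) by (apply Rdiv_le_0_compat; auto).
  apply (Jf_bound T a (u n) (fun t => K / p * Rpower t p * (wgt n * ZZ t ^ n))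
    (fun t => K / p * (p * Rpower t p / t) * (wgt n * ZZ t ^ n)
       + K / p * Rpower t p * (wgt n * (INR n * dl * Rpower t dl / t * ZZ t ^ n)))); auto.
  - apply (okf_Bd T K p); auto.
  - intros s Hs. apply is_derive_majorant; lra.
  - pos.
  - apply lim0_Bd with T; auto.
  - intros s Hs. eapply Rle_trans; auto. rewrite Rmult_plus_distr_l.
    replace (s * (K / p * (p * Rpower s p / s) * (wgt n * ZZ s ^ n))) with (K * Rpower s p * (wgt n * ZZ s ^ n)) by (field; lra).
    assert (0 <= s * (K / p * Rpower s p * (wgt n * (INR n * dl * Rpower s dl / s * ZZ s ^ n)))); [|lra].
    assert (H1 := Rpower_pos s p). assert (H2 := Rpower_pos s dl).
    assert (H4 := pow_lt _ n (ZZ_pos s)). assert (H5 := pos_INR n).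
    nonneg.
Qed.

(** [Bd_J] keeps the derivative of [t^p] in the majorant. Here the derivative of [ZZ t ^ (n+1)] is
    kept instead: it carries the factor [(n+1) dl t^dl], which pays for the factor [n+1] of the
    [x]-derivative, at the price of [t^(-dl)]. *)
Lemma Bd_cdx_J T a K p u : 0 < T <= 1 -> 0 <= a -> 0 <= K -> dl < p -> Ct T u -> Bd T K p u ->
  Bd T (K * (3 * R0 / dl)) (p - dl) (cdx (Jc T a u)).
Proof.
  intros HT Ha HK Hp Hc Hb n t Ht. unfold cdx.
  set (N := INR (S n)). assert (HN : 0 < N) by (apply lt_0_INR; lia).
  assert (HKd : 0 <= K / (dl * N)) by (apply Rdiv_le_0_compat; auto; nra).
  assert (H : Rabs (Jf T a (u (S n)) t) <= K / (dl * N) * Rpower t (p - dl) * (wgt (S n) * ZZ t ^ S n)).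
  { apply (Jf_bound T a (u (S n)) (fun t => K / (dl * N) * Rpower t (p - dl) * (wgt (S n) * ZZ t ^ S n))
    (fun t => K / (dl * N) * ((p - dl) * Rpower t (p - dl) / t) * (wgt (S n) * ZZ t ^ S n)
       + K / (dl * N) * Rpower t (p - dl) * (wgt (S n) * (INR (S n) * dl * Rpower t dl / t * ZZ t ^ S n)))); auto.
  - apply (okf_Bd T K p); auto; lra.
  - intros s Hs. apply is_derive_majorant; lra.
  - pos.
  - apply lim0_Bd with T; auto. lra.
  - intros s Hs. eapply Rle_trans; auto. rewrite Rmult_plus_distr_l.
    fold N.
    replace (Rpower s p) with (Rpower s (p - dl) * Rpower s dl) by (rewrite <- Rpower_plus; f_equal; ring).
    assert (0 <= s * (K / (dl * N) * ((p - dl) * Rpower s (p - dl) / s) * (wgt (S n) * ZZ s ^ S n))) by pos.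
    replace (s * (K / (dl * N) * Rpower s (p - dl) * (wgt (S n) * (N * dl * Rpower s dl / s * ZZ s ^ S n))))
      with (K * (Rpower s (p - dl) * Rpower s dl) * (wgt (S n) * ZZ s ^ S n)) by (field; repeat split; lra).
    lra. }
  rewrite Rabs_mult, Rabs_pos_eq by lra.
  apply Rle_trans with (N * (K / (dl * N) * Rpower t (p - dl) * (wgt (S n) * ZZ t ^ S n))).
  { pos. }
  assert (H1 := Rpower_pos t (p - dl)). assert (H3 := wgt_pos (S n)). assert (H4 := pow_lt _ n (ZZ_pos t)).
  replace (N * (K / (dl * N) * Rpower t (p - dl) * (wgt (S n) * ZZ t ^ S n)))
    with (K / dl * Rpower t (p - dl) * ((wgt (S n) * ZZ t) * ZZ t ^ n)) by (simpl; field; split; lra).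
  eapply Rle_trans.
  - apply Rmult_le_compat_l. apply Rmult_le_pos; [apply Rdiv_le_0_compat; auto | lra].
    apply Rmult_le_compat_r; [lra|]. apply Rmult_le_compat; try lra. apply Rlt_le, ZZ_pos. apply wgt_S. apply ZZ_le; lra.
  - lra.
Qed.

Lemma prim_unique T F1 F2 f : (forall t, 0 < t < T -> is_derive F1 t (f t)) ->
  (forall t, 0 < t < T -> is_derive F2 t (f t)) -> lim0 F1 -> lim0 F2 ->
  forall t, 0 < t < T -> F1 t = F2 t.
Proof.
  intros. apply Rle_antisym.
  - apply (compare0 F1 f F2 f T); auto; intros; lra.
  - apply (compare0 F2 f F1 f T); auto; intros; lra.
Qed.

Lemma lim0_minus f g : lim0 f -> lim0 g -> lim0 (fun t => f t - g t).
Proof.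
  intros Hf Hg e He. destruct (Hf (e / 2)) as [d1 [Hd1 H1]]; [lra|].
  destruct (Hg (e / 2)) as [d2 [Hd2 H2]]; [lra|].
  exists (Rmin d1 d2). split. apply Rmin_glb_lt; auto. intros t Ht.
  mins.
  specialize (H1 t). specialize (H2 t).
  eapply Rle_lt_trans; [apply Rabs_triang|]. rewrite Rabs_Ropp. lra.
Qed.

Lemma okf_minus T f g : 0 < T <= 1 -> okf T f -> okf T g -> okf T (fun t => f t - g t).
Proof.
  intros HT [Hc [K [p [HK [Hp Hb]]]]] [Hc' [K' [p' [HK' [Hp' Hb']]]]]. split.
  - intros; apply Rcont_minus; auto.
  - exists (K + K'), (Rmin p p'). split; [lra|]. split; [pos |].
    intros t Ht. specialize (Hb t). specialize (Hb' t).
    assert (H1 := Rpower_anti t p (Rmin p p') ltac:(lra) (Rmin_l p p')).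
    assert (H2 := Rpower_anti t p' (Rmin p p') ltac:(lra) (Rmin_r p p')).
    eapply Rle_trans; [apply Rabs_triang|]. rewrite Rabs_Ropp. nra.
Qed.

Lemma Jf_minus T a f g t : 0 < T <= 1 -> 0 <= a -> okf T f -> okf T g -> 0 < t < T ->
  Jf T a (fun s => f s - g s) t = Jf T a f t - Jf T a g t.
Proof.
  intros HT Ha Hf Hg Ht. unfold Jf. rewrite <- Rmult_minus_distr_l. f_equal.
  destruct (prim_spec T _ (okf_Rpower T a _ HT Ha (okf_minus T f g HT Hf Hg))) as [H1 H2].
  destruct (prim_spec T _ (okf_Rpower T a f HT Ha Hf)) as [H3 H4].
  destruct (prim_spec T _ (okf_Rpower T a g HT Ha Hg)) as [H5 H6].
  apply (prim_unique T _ (fun t => prim T (fun s => Rpower s a * f s) t - prim T (fun s => Rpower s a * g s) t)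
    (fun s => Rpower s a * (f s - g s) / s)); auto.
  - intros. evar_last. apply (@is_derive_minus R_AbsRing R_NormedModule); auto.
    unfold minus, plus, opp; simpl. lra.
  - apply lim0_minus; auto.
Qed.

(** * Lipschitz functionals and their fixed point *)

Definition idx := (nat * nat)%type.
Definition unk := idx -> coef.
(** The time [T] is an argument because [prim], and with it the inverse of [D + a], is chosen
    separately for each interval [(0, T)]. *)
Definition fnl := R -> unk -> coef.

Context (mu : R) (Hmu : 0 < mu).

Definition Ball (T : R) (U : unk) : Prop := forall c, Ct T (U c) /\ Bd T 1 mu (U c).
Definition Near (T d : R) (U V : unk) : Prop := forall c, Bd T d mu (csub (U c) (V c)).

Definition LipB (T B L p : R) (F : fnl) : Prop :=
  forall U V d, 0 <= d -> Ball T U -> Ball T V -> Near T d U V ->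
    Ct T (F T U) /\ Bd T B p (F T U) /\ Bd T (L * d) p (csub (F T U) (F T V)).

Definition Tame (p : R) (F : fnl) : Prop :=
  exists B, 0 <= B /\ forall T, 0 < T <= 1 -> LipB T B B p F.

Definition Contr (th : R) (F : fnl) : Prop :=
  exists T0, 0 < T0 <= 1 /\ forall T, 0 < T <= T0 -> LipB T th th mu F.

Lemma Near_sym T d U V : Near T d U V -> Near T d V U.
Proof.
  intros H c n t Ht. unfold csub. rewrite Rabs_minus_sym. apply H, Ht.
Qed.

Lemma Tame_const p B u : 0 <= B -> Ct 1 u -> Bd 1 B p u -> Tame p (fun _ _ => u).
Proof.
  exists B. split; auto. split; [|split].
  - intros n t Ht. pos.
  - apply Bd_sub_T with 1; pos.
  - intros n t. unfold csub. rewrite Rminus_diag, Rabs_R0.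
    pos.
Qed.

Lemma Tame_var c : Tame mu (fun _ U => U c).
Proof.
  exists 1. split; [lra|]. intros T HT U V d Hd HU. split; [|split]; try apply HU.
  rewrite Rmult_1_l. auto.
Qed.

Lemma Tame_plus p F G : Tame p F -> Tame p G -> Tame p (fun T U => cadd (F T U) (G T U)).
Proof.
  intros [B1 [HB1 H1]] [B2 [HB2 H2]]. exists (B1 + B2). split; [lra|].
  intros T HT U V d Hd HU HV HUV.
  destruct (H1 T HT U V d Hd HU HV HUV) as [C1' [D1 E1]].
  destruct (H2 T HT U V d Hd HU HV HUV) as [C2' [D2 E2]].
  splits.
  - apply Ct_add; auto.
  - apply Bd_add; auto.
  - rewrite Rmult_plus_distr_r.
    apply Bd_ext with (cadd (csub (F T U) (F T V)) (csub (G T U) (G T V))).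
    + intros; unfold cadd, csub; ring.
    + apply Bd_add; auto.
Qed.

Lemma Near_refl T d U : 0 <= d -> Near T d U U.
Proof.
  intros Hd c n t. unfold csub. rewrite Rminus_diag, Rabs_R0.
  pos.
Qed.

Lemma Tame_mult p q F G : Tame p F -> Tame q G -> Tame (p + q) (fun T U => cmul (F T U) (G T U)).
Proof.
  intros [B1 [HB1 H1]] [B2 [HB2 H2]]. exists (2 * B1 * B2). split; [nra|].
  intros T HT U V d Hd HU HV HUV.
  destruct (H1 T HT U V d Hd HU HV HUV) as [C1' [D1 E1]].
  destruct (H2 T HT U V d Hd HU HV HUV) as [C2' [D2 E2]].
  destruct (H1 T HT V V d Hd HV HV (Near_refl _ _ _ Hd)) as [C3 [D3 _]].
  splits.
  - apply Ct_mul; auto.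
  - apply Bd_le with (B1 * B2); [nra|]. apply Bd_mul; auto.
  - replace (2 * B1 * B2 * d) with ((B1 * d) * B2 + B1 * (B2 * d)) by lra.
    apply Bd_ext with (cadd (cmul (csub (F T U) (F T V)) (G T U)) (cmul (F T V) (csub (G T U) (G T V)))).
    + intros. unfold cadd, csub, cmul. rewrite <- sum_plus, <- minus_sum. apply sum_eq. intros; lra.
    + apply Bd_add; apply Bd_mul; auto; apply Rmult_le_pos; auto.
Qed.

Lemma Tame_weaken p q F : q <= p -> Tame p F -> Tame q F.
Proof.
  intros Hq [B [HB H]]. exists B. split; auto. intros T HT U V d Hd HU HV HUV.
  destruct (H T HT U V d Hd HU HV HUV) as [C1' [D1 E1]].
  split; auto; split; apply Bd_weaken1 with p; auto. pos.
Qed.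

Lemma Tame_J p a F : 0 < p -> 0 <= a -> Tame p F -> Tame p (fun T U => Jc T a (F T U)).
Proof.
  intros Hp Ha [B [HB H]]. exists (B / p). assert (HBp : 0 <= B / p) by (apply Rdiv_le_0_compat; auto).
  split; auto. intros T HT U V d Hd HU HV HUV.
  destruct (H T HT U V d Hd HU HV HUV) as [C1' [D1 E1]].
  destruct (H T HT V U d Hd HV HU (Near_sym _ _ _ _ HUV)) as [C2' [D2 E2]].
  splits.
  - apply Ct_J with B p; auto.
  - apply Bd_J; auto.
  - eapply Bd_ext.
    + intros n t Ht. apply Jf_minus; auto; apply okf_Bd with B p; auto.
    + replace (B / p * d) with (B * d / p) by lra.
      apply Bd_J; auto. apply Rmult_le_pos; auto. intros n t Ht. apply Rcont_minus; auto.
Qed.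

Lemma Tame_dJ p a F : dl < p -> 0 <= a -> Tame p F -> Tame (p - dl) (fun T U => cdx (Jc T a (F T U))).
Proof.
  intros Hp Ha [B [HB H]]. exists (B * (3 * R0 / dl)).
  assert (HRd : 0 <= 3 * R0 / dl) by pos.
  split; [nra|]. intros T HT U V d Hd HU HV HUV.
  destruct (H T HT U V d Hd HU HV HUV) as [C1' [D1 E1]].
  destruct (H T HT V U d Hd HV HU (Near_sym _ _ _ _ HUV)) as [C2' [D2 E2]].
  splits.
  - apply Ct_dx. apply Ct_J with B p; auto; lra.
  - apply Bd_cdx_J; auto.
  - apply Bd_ext with (cdx (Jc T a (csub (F T U) (F T V)))).
    + intros n t Ht. unfold cdx, Jc, csub. rewrite Jf_minus; auto.
      * ring.
      * apply okf_Bd with B p; auto; lra.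
      * apply okf_Bd with B p; auto; lra.
    + replace (B * (3 * R0 / dl) * d) with (B * d * (3 * R0 / dl)) by lra.
      apply Bd_cdx_J; auto. apply Rmult_le_pos; auto. intros n t Ht. apply Rcont_minus; auto.
Qed.

Fixpoint csum (f : nat -> coef) (m : nat) : coef :=
  match m with O => f O | S m' => cadd (csum f m') (f m) end.

Lemma Tame_sum p F m : (forall j, (j <= m)%nat -> Tame p (F j)) -> Tame p (fun T U => csum (fun j => F j T U) m).
Proof.
  induction m; intros H.
  - eauto.
  - apply Tame_plus.
    apply IHm; intros; apply H; lia. auto.
Qed.

(** The constants of a tame functional do not depend on [T], so an order [p] above that of the
    unknowns becomes the small factor [T^(p - mu)]. *)
Lemma Tame_Contr p th F : mu < p -> 0 < th -> Tame p F -> Contr th F.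
Proof.
  intros Hp Hth [B [HB H]].
  destruct (lim0_Rpower B (p - mu) ltac:(lra) th Hth) as [d0 [Hd0 Hl]].
  exists (Rmin 1 (d0 / 2)). mins.
  split. pos.
  intros T HT U V d Hd HU HV HUV.
  destruct (H T ltac:(lra) U V d Hd HU HV HUV) as [C1' [D1 E1]].
  specialize (Hl T ltac:(lra)). apply Rabs_def2 in Hl.
  split; auto; split.
  - apply Bd_le with (B * Rpower T (p - mu)); [nra|]. apply Bd_weaken; auto; lra.
  - apply Bd_le with (B * d * Rpower T (p - mu)).
    + nra.
    + apply Bd_weaken; try lra. apply Rmult_le_pos; auto. auto.
Qed.

Lemma Contr_plus th1 th2 F G : Contr th1 F -> Contr th2 G -> Contr (th1 + th2) (fun T U => cadd (F T U) (G T U)).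
Proof.
  intros [T1 [HT1 H1]] [T2 [HT2 H2]]. exists (Rmin T1 T2).
  mins.
  split. pos. intros T HT U V d Hd HU HV HUV.
  destruct (H1 T ltac:(lra) U V d Hd HU HV HUV) as [C1' [D1 E1]].
  destruct (H2 T ltac:(lra) U V d Hd HU HV HUV) as [C2' [D2 E2]].
  splits.
  - apply Ct_add; auto.
  - apply Bd_add; auto.
  - rewrite Rmult_plus_distr_r.
    apply Bd_ext with (cadd (csub (F T U) (F T V)) (csub (G T U) (G T V))).
    + intros; unfold cadd, csub; ring.
    + apply Bd_add; auto.
Qed.

(** A factor of order zero gains no power of [t], so shrinking [T] does not help; contraction comes
    from the smallness of [G] against [mu], the loss of the inverse being [1 / mu]. *)
Lemma Contr_mulJ G g a c th : 0 <= G -> 0 <= a -> Ct 1 g -> Bd 1 G 0 g -> G / mu <= th ->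
  Contr th (fun T U => cmul g (Jc T a (U c))).
Proof.
  intros HG Ha Hg. exists 1. split; [lra|]. intros T HT U V d Hd HU HV.
  destruct (HU c) as [C1' D1]. destruct (HV c) as [C2' D2].
  assert (HgT : Bd T G 0 g) by (apply Bd_sub_T with 1; pos).
  assert (Hin : 0 <= / mu) by pos.
  split; [|split].
  - apply Ct_mul. intros n t Ht; apply Hg; lra. apply Ct_J with 1 mu; auto; lra.
  - apply Bd_le with (G * (1 / mu)). lra.
    replace mu with (0 + mu) at 2 by lra. apply Bd_mul; auto. lra.
    apply Bd_J; auto; lra.
  - apply Bd_ext with (cmul g (Jc T a (csub (U c) (V c)))).
    + intros n t Ht. unfold csub, cmul. rewrite <- minus_sum. apply sum_eq. intros. unfold Jc.
      rewrite Jf_minus; auto. ring. eapply okf_Bd with (p := mu) (K := 1); eauto; lra.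
      eapply okf_Bd with (p := mu) (K := 1); eauto; lra.
    + apply Bd_le with (G * (d / mu)). unfold Rdiv in *. replace (G * (d * / mu)) with (G * / mu * d) by lra.
      apply Rmult_le_compat_r; auto.
      replace mu with (0 + mu) at 2 by lra. apply Bd_mul; auto. apply Rdiv_le_0_compat; auto.
      apply Bd_J; auto. intros n t Ht. apply Rcont_minus; auto.
Qed.

(** Iteration from zero, with distances halved in the weighted norm. The limit is taken coefficient
    by coefficient at each time; for fixed [n] the bounds are uniform in [t], because
    [ZZ t <= 3 R0], so continuity in [t] survives. *)
Lemma fixed_point Phi T : 0 < T <= 1 ->
  (forall c, LipB T (/ 2) (/ 2) mu (Phi c)) ->
  exists U, Ball T U /\ forall c n t, 0 < t < T -> Phi c T U n t = U c n t.
Proof.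
  intros HT HPhi.
  set (it := fix it k : unk := match k with O => fun _ _ _ => 0 | S k' => fun c => Phi c T (it k') end).
  assert (Hball : forall k, Ball T (it k)).
  { induction k; intros c.
    - split. intros n t Ht; apply Rcont_const. intros n t Ht. simpl. rewrite Rabs_R0.
      pos.
    - destruct (HPhi c (it k) (it k) 0 (Rle_refl 0) IHk IHk (Near_refl T 0 (it k) (Rle_refl 0))) as [H1 [H2 _]].
      split; auto. apply Bd_le with (/ 2); pos. }
  assert (Hnear : forall k, Near T ((/ 2) ^ k) (it (S k)) (it k)).
  { induction k; intros c.
    - apply Bd_ext with (it 1%nat c). intros; unfold csub; simpl; ring. apply Hball.
    - destruct (HPhi c (it (S k)) (it k) ((/ 2) ^ k)) as [_ [_ H]]; auto. pos. }
  assert (Hnear2 : forall j k, Near T (2 * (/ 2) ^ k) (it (k + j)%nat) (it k)).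
  { assert (Hj : forall j k, Near T ((2 - 2 * (/ 2) ^ j) * (/ 2) ^ k) (it (k + j)%nat) (it k)).
    { induction j; intros k c n t Ht.
      - rewrite Nat.add_0_r. unfold csub. rewrite Rminus_diag, Rabs_R0. lra.
      - rewrite Nat.add_succ_r.
        replace (csub (it (S (k + j)) c) (it k c) n t) with
          (csub (it (S (k + j)) c) (it (k + j)%nat c) n t + csub (it (k + j)%nat c) (it k c) n t) by (unfold csub; ring).
        eapply Rle_trans; [apply Rabs_triang|].
        assert (H1 := Hnear (k + j)%nat c n t). assert (H2 := IHj k c n t).
        rewrite pow_add in H1. simpl pow.
        lra. }
    intros j k c. eapply Bd_le; [|apply Hj]. assert (H1 := pow_lt (/ 2) j). pos. }
  assert (Hcv : forall c n t, exists l : R, 0 < t < T -> is_lim_seq (fun k => it k c n t) l).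
  { intros c n t. destruct (Rlt_le_dec 0 t) as [H0|H0]; [|exists 0; intros; lra].
    destruct (Rlt_le_dec t T) as [H1|H1]; [|exists 0; intros; lra].
    assert (Hc : ex_finite_lim_seq (fun k => it k c n t)).
    { apply ex_lim_seq_cauchy_corr. intros [e He]; simpl.
      set (W := 1 + Rpower t mu * wz n t).
      assert (HW : 1 < W). { unfold W. assert (H2 := wz_pos n t). assert (H3 := Rpower_pos t mu). nra. }
      destruct (pow_lt_1_zero (/ 2)) with (y := e / (4 * W)) as [N HN].
      { rewrite Rabs_pos_eq; lra. }
      { pos. }
      exists N.
      assert (Hk : forall k, (N <= k)%nat -> Rabs (it k c n t - it N c n t) < e / 2).
      { intros k Hk. assert (H2 := Hnear2 (k - N)%nat N c).
        replace (N + (k - N))%nat with k in H2 by lia.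
        specialize (HN N (le_n N)). rewrite Rabs_pos_eq in HN by pos.
        apply Rlt_div_r in HN; [|lra]. eapply Rle_lt_trans; eauto.
        assert (H3 := pow_lt (/ 2) N). fold (wz n t).
        apply Rle_lt_trans with (2 * (/ 2) ^ N * W); [|lra].
        unfold W. lra. }
      intros p q Hp Hq. replace (it p c n t - it q c n t) with ((it p c n t - it N c n t) - (it q c n t - it N c n t)) by lra.
      eapply Rle_lt_trans; [apply Rabs_triang|]. rewrite Rabs_Ropp.
      assert (H2 := Hk p Hp). assert (H3 := Hk q Hq). lra. }
    destruct Hc as [l Hl]. eauto. }
  set (U := fun c n t => real (Lim_seq (fun k => it k c n t))).
  assert (HU : forall c n t, 0 < t < T -> is_lim_seq (fun k => it k c n t) (U c n t)).
  { intros c n t Ht. destruct (Hcv c n t) as [l Hl]. specialize (Hl Ht). unfold U.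
    rewrite (is_lim_seq_unique _ _ Hl). auto. }
  assert (HUn : forall k, Near T (2 * (/ 2) ^ k) U (it k)).
  { intros k c n t Ht.
    apply (is_lim_seq_le (fun j => Rabs (it (j + k)%nat c n t - it k c n t)) (fun _ => 2 * (/ 2) ^ k * Rpower t mu * (wgt n * ZZ t ^ n))
      (Rabs (U c n t - it k c n t)) (2 * (/ 2) ^ k * Rpower t mu * (wgt n * ZZ t ^ n))).
    - intros. rewrite Nat.add_comm. apply Hnear2, Ht.
    - apply (is_lim_seq_abs _ (U c n t - it k c n t)). apply is_lim_seq_minus'.
      + apply (is_lim_seq_incr_n (fun k => it k c n t)). auto.
      + apply is_lim_seq_const.
    - apply is_lim_seq_const. }
  assert (HBU : Ball T U).
  { split.
    - intros n t Ht. apply continuous_eps. intros e He.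
      set (W := 1 + wgt n * (3 * R0) ^ n).
      assert (HW0 : 0 < wgt n * (3 * R0) ^ n) by pos.
      destruct (pow_lt_1_zero (/ 2)) with (y := e / (8 * W)) as [N HN].
      { rewrite Rabs_pos_eq; lra. } { apply Rdiv_lt_0_compat; unfold W; lra. }
      specialize (HN N (le_n N)). rewrite Rabs_pos_eq in HN by pos.
      apply Rlt_div_r in HN; [|unfold W; lra].
      assert (Hunif : forall s, 0 < s < T -> Rabs (U c n s - it N c n s) <= e / 4).
      { intros s Hs. assert (H := HUn N c). eapply Rle_trans; eauto.
        assert (H1 := Rpower_le1).
        assert (H3 : wgt n * ZZ s ^ n <= wgt n * (3 * R0) ^ n).
        { apply Rmult_le_compat_l. apply Rlt_le, wgt_pos. apply pow_incr. split; [pos | apply ZZ_le; lra]. }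
        assert (H4 := wz_pos).
        apply Rle_trans with (2 * (/ 2) ^ N * 1 * (wgt n * (3 * R0) ^ n)).
        - pos.
        - unfold W in HN. nra. }
      destruct (proj1 (continuous_eps _ _) (proj1 (Hball N c) n t Ht) (e / 2)) as [d [Hd H1]]; [lra|].
      set (d' := Rmin d (Rmin t (T - t))).
      assert (Hd' : 0 < d') by (repeat apply Rmin_glb_lt; lra).
      assert (Hb1 := Rmin_l d (Rmin t (T - t))). assert (Hb2 := Rmin_r d (Rmin t (T - t))).
      assert (Hb3 := Rmin_l t (T - t)). assert (Hb4 := Rmin_r t (T - t)).
      exists d'. split; auto. intros y Hy.
      assert (Hy2 := Hy). apply Rabs_def2 in Hy2. fold d' in Hb1, Hb2.
      assert (H2 := Hunif y). assert (H3 := Hunif t). specialize (H1 y).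
      replace (U c n y - U c n t) with ((U c n y - it N c n y) + (it N c n y - it N c n t) - (U c n t - it N c n t)) by lra.
      eapply Rle_lt_trans; [apply Rabs_triang|]. rewrite Rabs_Ropp.
      assert (H4 := Rabs_triang (U c n y - it N c n y) (it N c n y - it N c n t)). lra.
    - intros n t Ht.
      apply (is_lim_seq_le (fun k => Rabs (it k c n t)) (fun _ => 1 * Rpower t mu * (wgt n * ZZ t ^ n))
        (Rabs (U c n t)) (1 * Rpower t mu * (wgt n * ZZ t ^ n))).
      + intros k. apply Hball, Ht.
      + apply (is_lim_seq_abs _ (U c n t)). auto.
      + apply is_lim_seq_const. }
  exists U. split; auto. intros c n t Ht.
  assert (Hlim : is_lim_seq (fun k => it (S k) c n t) (Phi c T U n t)).
  { apply lim_seq_eps. intros e He.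
    set (W := 1 + Rpower t mu * wz n t).
    assert (HW : 1 < W). { unfold W. assert (H2 := wz_pos n t). assert (H3 := Rpower_pos t mu). nra. }
    destruct (pow_lt_1_zero (/ 2)) with (y := e / W) as [N HN].
    { rewrite Rabs_pos_eq; lra. } { pos. }
    exists N. intros k Hk. specialize (HN k Hk). rewrite Rabs_pos_eq in HN by pos.
    apply Rlt_div_r in HN; [|lra].
    assert (H5 := pow_lt (/ 2) k).
    destruct (HPhi c U (it k) (2 * (/ 2) ^ k)) as [_ [_ H]]; auto. lra.
    rewrite Rabs_minus_sym.
    eapply Rle_lt_trans; eauto. fold (wz n t).
    apply Rle_lt_trans with ((/ 2) ^ k * W); auto. unfold W; lra. }
  apply is_lim_seq_unique in Hlim.
  assert (H2 := is_lim_seq_incr_1 (fun k => it k c n t) (U c n t)).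
  assert (H3 := is_lim_seq_unique _ _ (proj1 H2 (HU c n t Ht))).
  rewrite H3 in Hlim. injection Hlim. auto.
Qed.

End Weighted.
#[export] Hint Resolve wgt_pos ZZ_pos wz_pos : pos.

(** * Termwise limits and derivatives of series *)

Lemma wgt_0 : wgt 0 = / 8.
Proof. unfold wgt. simpl. field. Qed.

Lemma wgt_le n : wgt n <= / 8.
Proof. induction n. rewrite wgt_0; lra. eapply Rle_trans; [apply wgt_S | auto]. Qed.

Lemma sum_swap f N M : sum_f_R0 (fun k => sum_f_R0 (fun j => f k j) M) N = sum_f_R0 (fun j => sum_f_R0 (fun k => f k j) N) M.
Proof.
  induction N; simpl; auto. rewrite IHN, <- sum_plus. auto.
Qed.

Lemma Rex_scal_l c a : ex_series a -> ex_series (fun n => c * a n).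
Proof. apply (ex_series_scal (V := R_NormedModule)). Qed.

Lemma Rex_scal_r c a : ex_series a -> ex_series (fun n => a n * c).
Proof.
  intros H. eapply ex_series_ext. intros; apply Rmult_comm. apply Rex_scal_l, H.
Qed.

(* Tannery's theorem, with an arbitrary modulus [w] so that it yields both continuity
   and termwise differentiation. *)
Lemma tannery a c w d0 : 0 < d0 -> (forall h, 0 <= w h) -> ex_series c ->
  (forall n h, Rabs h < d0 -> Rabs (a n h) <= c n * w h) ->
  (forall n e, 0 < e -> exists d, 0 < d /\ forall h, Rabs h < d -> Rabs (a n h) <= e * w h) ->
  forall e, 0 < e -> exists d, 0 < d /\ forall h, Rabs h < d -> Rabs (Series (fun n => a n h)) <= e * w h.
Proof.
  intros Hd0 Hw Hc Hb Hs e He.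
  assert (Hcs := Series_correct _ Hc). apply is_series_lim in Hcs.
  destruct (proj1 (lim_seq_eps _ _) Hcs (e / 2)) as [N HN]; [lra|].
  specialize (HN N (le_n N)).
  assert (Htail : Series (fun k => c (S N + k)%nat) < e / 2).
  { rewrite (Series_incr_n c (S N)) in HN by (try lia; auto). simpl pred in HN. apply Rabs_def2 in HN. lra. }
  assert (Hfin : forall M e', 0 < e' -> exists d, 0 < d /\ forall h, Rabs h < d ->
    sum_f_R0 (fun n => Rabs (a n h)) M <= e' * w h).
  { induction M; intros e' He'.
    - eauto.
    - destruct (IHM (e' / 2)) as [d1 [Hd1 H1]]; [lra|].
      destruct (Hs (S M) (e' / 2)) as [d2 [Hd2 H2]]; [lra|].
      exists (Rmin d1 d2). split. apply Rmin_glb_lt; auto. intros h Hh.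
      mins.
      specialize (H1 h). specialize (H2 h). rewrite tech5. lra. }
  destruct (Hfin N (e / 2)) as [d1 [Hd1 H1]]; [lra|].
  exists (Rmin d0 d1). split. apply Rmin_glb_lt; auto. intros h Hh.
  mins.
  assert (Hex : ex_series (fun n => Rabs (a n h))).
  { eapply (@ex_series_le R_AbsRing R_CompleteNormedModule).
    - intros. rewrite Rabs_Rabsolu. apply Hb; lra.
    - apply Rex_scal_r. auto. }
  eapply Rle_trans; [apply Series_Rabs; auto|].
  rewrite (Series_incr_n _ (S N)) by (try lia; auto). simpl pred.
  specialize (H1 h).
  assert (H2 : Series (fun k => Rabs (a (S N + k)%nat h)) <= Series (fun k => c (S N + k)%nat) * w h).
  { rewrite <- Series_scal_r. apply Series_le.
    - pos.
    - apply Rex_scal_r. apply ex_series_incr_n. auto. }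
  specialize (Hw h). nra.
Qed.

Lemma ex_series_abs_le a b : (forall n, Rabs (a n) <= b n) -> ex_series b -> ex_series a.
Proof.
  eapply (@ex_series_le R_AbsRing R_CompleteNormedModule).
Qed.

Lemma series_continuous f c t d0 : 0 < d0 -> ex_series c -> (forall n s, Rabs (s - t) < d0 -> Rabs (f n s) <= c n) ->
  (forall n, continuous (f n) t) -> continuous (fun s => Series (fun n => f n s)) t.
Proof.
  intros Hd0 Hc Hb Hf. apply continuous_eps. intros e He.
  destruct (tannery (fun n h => f n (t + h) - f n t) (fun n => 2 * c n) (fun _ => 1) d0) with (e := e / 2)
    as [d [Hd H]]; auto.
  - pos.
  - apply Rex_scal_l. auto.
  - intros n h Hh. eapply Rle_trans; [apply Rabs_triang|]. rewrite Rabs_Ropp.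
    assert (H1 := Hb n (t + h)). assert (H2 := Hb n t). replace (t + h - t) with h in H1 by lra.
    rewrite Rminus_diag, Rabs_R0 in H2. lra.
  - intros n e' He'. destruct (proj1 (continuous_eps _ _) (Hf n) e' He') as [d [Hd H]].
    exists d. split; auto. intros h Hh. rewrite Rmult_1_r. apply Rlt_le, H. replace (t + h - t) with h by lra. auto.
  - lra.
  - exists (Rmin d d0). split. apply Rmin_glb_lt; auto. intros y Hy.
    mins.
    specialize (H (y - t)). replace (t + (y - t)) with y in H by lra.
    rewrite Series_minus in H. lra.
    + apply ex_series_abs_le with c; auto. pos.
    + apply ex_series_abs_le with c; auto. intros. apply Hb. rewrite Rminus_diag, Rabs_R0. auto.
Qed.

Lemma series_derive f df c t d0 : 0 < d0 -> ex_series c ->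
  (forall n s, Rabs (s - t) < d0 -> is_derive (f n) s (df n s)) ->
  (forall n s, Rabs (s - t) < d0 -> Rabs (df n s) <= c n) ->
  (forall s, Rabs (s - t) < d0 -> ex_series (fun n => f n s)) ->
  is_derive (fun s => Series (fun n => f n s)) t (Series (fun n => df n t)).
Proof.
  intros Hd0 Hc Hf Hb Hex. apply is_derive_eps. intros e He.
  assert (H0 : Rabs (t - t) < d0) by (rewrite Rminus_diag, Rabs_R0; auto).
  destruct (tannery (fun n h => f n (t + h) - f n t - df n t * h) (fun n => 2 * c n) Rabs d0) with e
    as [d [Hd H]]; auto.
  - pos.
  - apply Rex_scal_l. auto.
  - intros n h Hh. unfold Rminus. eapply Rle_trans; [apply Rabs_triang|]. rewrite Rabs_Ropp, Rabs_mult.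
    assert (H1 : Rabs (f n (t + h) - f n t) <= c n * Rabs (t + h - t)).
    { assert (Hin : forall x, Rmin t (t + h) <= x <= Rmax t (t + h) -> Rabs (x - t) < d0).
      { intros x Hx. apply between_dist in Hx. replace (t + h - t) with h in Hx by lra. lra. }
      eapply derive_bound_lip; auto. }
    replace (t + h - t) with h in H1 by lra. assert (H2 := Hb n t).
    assert (H3 := Rabs_pos h). unfold Rminus in H1. nra.
  - intros n e' He'. exact (proj1 (is_derive_eps _ _ _) (Hf n t H0) e' He').
  - exists (Rmin d d0). split. apply Rmin_glb_lt; auto. intros h Hh.
    mins.
    specialize (H h ltac:(lra)).
    assert (He1 : ex_series (fun n => f n (t + h))) by (apply Hex; replace (t + h - t) with h by ring; lra).
    assert (He3 : ex_series (fun n => df n t)) by (eapply ex_series_abs_le; auto).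
    rewrite Series_minus in H.
    + rewrite Series_minus in H by pos. rewrite Series_scal_r in H. auto.
    + apply (@ex_series_minus R_AbsRing R_NormedModule); auto.
    + apply Rex_scal_r. auto.
Qed.

(** * Exponentials of power series *)

Fixpoint gp (g : nat -> R) (j : nat) : nat -> R :=
  match j with
  | O => fun n => match n with O => 1 | _ => 0 end
  | S j' => PS_mult g (gp g j')
  end.

(** The coefficients of [exp (L g)]. Cutting the exponential series at [j <= n] is exact when
    [g 0 = 0], since [g^j] then starts at order [j] ([gp_zero]). *)
Definition efun (L : R) (g : nat -> R) (n : nat) : R :=
  sum_f_R0 (fun j => L ^ j / INR (fact j) * gp g j n) n.

Lemma gp_zero g j n : g O = 0 -> (n < j)%nat -> gp g j n = 0.
Proof.
  intros Hg. revert n. induction j; intros n Hn; [lia|].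
  apply sum_eq_R0.
  intros k Hk. destruct k. rewrite Hg; ring. rewrite IHj by lia. ring.
Qed.

Lemma efun_ext L g n N : g O = 0 -> (n <= N)%nat ->
  efun L g n = sum_f_R0 (fun j => L ^ j / INR (fact j) * gp g j n) N.
Proof.
  intros. induction N.
  - replace n with O by lia. auto.
  - destruct (Nat.eq_dec n (S N)) as [->|]; auto.
    rewrite tech5, <- IHN by lia. rewrite gp_zero by (auto; lia). ring.
Qed.

Lemma efun_derive L g n : g O = 0 -> is_derive (fun L => efun L g n) L (PS_mult g (fun k => efun L g k) n).
Proof.
  intros Hg.
  assert (H : forall c N, is_derive (fun L => sum_f_R0 (fun j => L ^ j / INR (fact j) * c j) N) L
     (sum_f_R0 (fun j => L ^ j / INR (fact j) * c (S j)) N - L ^ N / INR (fact N) * c (S N))).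
  { induction N.
    - simpl.
      replace (1 / 1 * c 1%nat - 1 / 1 * c 1%nat) with 0 by lra.
      apply (@is_derive_const R_AbsRing R_NormedModule).
    - rewrite tech5.
      evar_last.
      + apply (@is_derive_plus R_AbsRing R_NormedModule) with (1 := IHN).
        apply (is_derive_ext (fun L => (c (S N) / INR (fact (S N))) * L ^ S N)).
        { intros; lra. }
        apply is_derive_scal. apply is_derive_pow. apply (@is_derive_id R_AbsRing).
      + change (@plus R_NormedModule) with Rplus. change (@one R_AbsRing) with 1.
        simpl Init.Nat.pred. rewrite fact_simpl, mult_INR.
        field. repeat split; first [apply INR_fact_neq_0 | apply not_0_INR; lia]. }
  evar_last; eauto. cbv beta.
  rewrite gp_zero by pos. rewrite Rmult_0_r, Rminus_0_r.
  unfold PS_mult. symmetry.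
  rewrite (sum_eq _ (fun k => sum_f_R0 (fun j => L ^ j / INR (fact j) * (g k * gp g j (n - k))) n)).
  2:{ intros k Hk. rewrite (efun_ext L g (n - k) n) by (auto; lia). rewrite scal_sum. apply sum_eq. intros; lra. }
  rewrite sum_swap. apply sum_eq. intros. simpl gp. unfold PS_mult. rewrite scal_sum. apply sum_eq. intros; lra.
Qed.

Definition Bc (R0 K : R) (c : nat -> R) : Prop := forall n, Rabs (c n) <= K * (wgt n * R0 ^ n).

Lemma Bc_mult R0 K1 K2 a b : 0 < R0 -> 0 <= K1 -> 0 <= K2 -> Bc R0 K1 a -> Bc R0 K2 b -> Bc R0 (K1 * K2) (PS_mult a b).
Proof.
  intros HR H1 H2 Ha Hb n. eapply Rle_trans; [apply sum_f_R0_triangle|].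
  apply Rle_trans with (sum_f_R0 (fun k => wgt k * wgt (n - k) * (K1 * K2 * R0 ^ n)) n).
  - apply sum_Rle. intros k Hk. rewrite Rabs_mult.
    eapply Rle_trans.
    + apply Rmult_le_compat; auto using Rabs_pos.
    + right. replace (R0 ^ n) with (R0 ^ k * R0 ^ (n - k)). ring. rewrite <- pow_add. f_equal. lia.
  - rewrite <- scal_sum. eapply Rle_trans.
    + apply Rmult_le_compat_l; [|apply wgt_conv]. pos.
    + lra.
Qed.

Lemma gp_bound R0 G g j : 0 < R0 -> 0 <= G -> Bc R0 G g -> Bc R0 (8 * G ^ j) (gp g j).
Proof.
  intros. induction j.
  - intros n. simpl. destruct n.
    + rewrite Rabs_R1, wgt_0. lra.
    + rewrite Rabs_R0. pos.
  - replace (8 * G ^ S j) with (G * (8 * G ^ j)) by (simpl; ring).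
    apply Bc_mult; auto. pos.
Qed.

Lemma efun_bound R0 G g L : 0 < R0 -> 0 <= G -> Bc R0 G g -> Bc R0 (8 * exp (Rabs L * G)) (fun n => efun L g n).
Proof.
  intros HR HG Hg n. eapply Rle_trans; [apply sum_f_R0_triangle|].
  assert (Hw : 0 < wgt n * R0 ^ n) by pos.
  apply Rle_trans with (sum_f_R0 (fun j => (Rabs L * G) ^ j / INR (fact j) * (8 * (wgt n * R0 ^ n))) n).
  - apply sum_Rle. intros j Hj. unfold Rdiv. rewrite !Rabs_mult, <- RPow_abs, Rabs_inv, (Rabs_pos_eq (INR (fact j))) by pos.
    assert (H := gp_bound R0 G g j HR HG Hg). rewrite Rpow_mult_distr.
    assert (H1 : 0 <= Rabs L ^ j * / INR (fact j)).
    { apply Rmult_le_pos; [pos | apply Rlt_le, Rinv_0_lt_compat, INR_fact_lt_0]. }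
    eapply Rle_trans; pos.
  - rewrite <- scal_sum.
    replace (8 * exp (Rabs L * G) * (wgt n * R0 ^ n)) with (8 * (wgt n * R0 ^ n) * exp (Rabs L * G)) by lra.
    apply Rmult_le_compat_l; [lra|]. apply exp_ge_taylor. pos.
Qed.

Lemma Bc_CV R0 K c x : 0 < R0 -> Bc R0 K c -> Rabs x * R0 < 1 -> Rbar_lt (Rabs x) (CV_radius c).
Proof.
  intros HR HB Hx. assert (Hi : 0 < / R0) by pos.
  apply CV_radius_gt with (K / 8) (/ R0); auto.
  - split; [pos |]. apply Rmult_lt_reg_r with R0; auto. rewrite Rinv_l; lra.
  - intros n. rewrite pow_inv. assert (Hp : 0 < R0 ^ n) by pos.
    assert (Hw := wgt_le).
    assert (HK : 0 <= K).
    { specialize (HB O). rewrite wgt_0 in HB. assert (H := Rabs_pos (c O)). lra. }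
    apply Rmult_le_reg_r with (R0 ^ n); auto. rewrite Rmult_assoc, Rinv_l, Rmult_1_r by lra.
    eapply Rle_trans; auto. rewrite <- Rmult_assoc.
    apply Rmult_le_compat_r; [lra|]. apply Rmult_le_compat_l; auto.
Qed.

Lemma ex_series_wgt : ex_series wgt.
Proof.
  assert (H : ex_finite_lim_seq (sum_f_R0 wgt)).
  { apply ex_finite_lim_seq_incr with (/ 4).
    - intros n. rewrite tech5. assert (H := wgt_pos (S n)). lra.
    - intros n. unfold wgt. rewrite (sum_eq _ (fun k => / (INR k + 1) ^ 2 * / 8)) by (intros; unfold Rdiv; ring).
      rewrite <- scal_sum. assert (H := sum_inv_sq n). assert (H1 := pos_INR n).
      assert (0 < / (INR n + 1)) by pos. lra. }
  destruct H as [l Hl]. exists l. apply is_series_lim. auto.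
Qed.

Lemma Series_wgt_le : Series wgt <= 1.
Proof.
  assert (H := Series_correct _ ex_series_wgt). apply is_series_lim in H.
  apply (is_lim_seq_le (sum_f_R0 wgt) (fun _ => 1) (Series wgt) 1); auto.
  - intros n. unfold wgt. rewrite (sum_eq _ (fun k => / (INR k + 1) ^ 2 * / 8)) by (intros; unfold Rdiv; ring).
    rewrite <- scal_sum. assert (H2 := sum_inv_sq n). assert (H1 := pos_INR n).
    assert (0 < / (INR n + 1)) by pos. lra.
  - apply is_lim_seq_const.
Qed.

(** As a function of [L] the sum of the series solves [F' = (PSeries g x) F] with [F 0 = 1], so
    [F L] times [exp (- L (PSeries g x))] is constant. No double series has to be rearranged. *)
Lemma efun_eval R0 G g L x : 0 < R0 -> 0 <= G -> Bc R0 G g -> g O = 0 -> Rabs x * R0 < 1 ->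
  PSeries (fun n => efun L g n) x = exp (L * PSeries g x).
Proof.
  intros HR HG Hg H0 Hx.
  set (F := fun L => PSeries (fun n => efun L g n) x).
  assert (HCV : forall L, Rbar_lt (Rabs x) (CV_radius (fun n => efun L g n))).
  { intros L'. apply (Bc_CV R0 (8 * exp (Rabs L' * G))); auto. apply efun_bound; auto. }
  assert (HCVg : Rbar_lt (Rabs x) (CV_radius g)) by (apply (Bc_CV R0 G); auto).
  assert (HF : forall L, is_derive F L (PSeries g x * F L)).
  { intros L'. unfold F.
    rewrite <- PSeries_mult by pos.
    apply (series_derive (fun n L => efun L g n * x ^ n) (fun n L => PS_mult g (fun k => efun L g k) n * x ^ n)
      (fun n => G * (8 * exp ((Rabs L' + 1) * G)) * wgt n) L' 1).
    - lra.
    - apply Rex_scal_l, ex_series_wgt.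
    - intros n s _. eapply is_derive_ext. intros; apply Rmult_comm.
      rewrite Rmult_comm. apply is_derive_scal. apply efun_derive; auto.
    - intros n s Hs. rewrite Rabs_mult, <- RPow_abs.
      assert (Hsl : Rabs s <= Rabs L' + 1).
      { replace s with ((s - L') + L') by lra. eapply Rle_trans; [apply Rabs_triang|]. lra. }
      assert (HB : Bc R0 (G * (8 * exp ((Rabs L' + 1) * G))) (PS_mult g (fun k => efun s g k))).
      { apply Bc_mult; auto.
        - pos.
        - intros k. eapply Rle_trans; [apply (efun_bound R0 G g s HR HG Hg)|].
          apply Rmult_le_compat_r. pos.
          apply Rmult_le_compat_l; [lra|].
          assert (Rabs s * G <= (Rabs L' + 1) * G) by pos.
          destruct (Req_dec (Rabs s * G) ((Rabs L' + 1) * G)) as [->|]; [lra|].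
          apply Rlt_le, exp_increasing; lra. }
      eapply Rle_trans.
      + pos.
      + replace (G * (8 * exp ((Rabs L' + 1) * G)) * (wgt n * R0 ^ n) * Rabs x ^ n)
          with (G * (8 * exp ((Rabs L' + 1) * G)) * wgt n * (Rabs x * R0) ^ n) by (rewrite Rpow_mult_distr; ring).
        rewrite <- (Rmult_1_r (G * (8 * exp ((Rabs L' + 1) * G)) * wgt n)) at 2.
        apply Rmult_le_compat_l.
        * pos.
        * rewrite <- (pow1 n). apply pow_incr. pos.
    - intros s _.
      destruct (CV_radius_inside _ _ (HCV s)) as [l Hl]. exists l. apply is_pseries_R in Hl. auto. }
  assert (HH : forall L, is_derive (fun L => F L * exp (- L * PSeries g x)) L 0).
  { intros L'.
    assert (He : is_derive (fun L => exp (- L * PSeries g x)) L' (- PSeries g x * exp (- L' * PSeries g x))).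
    { auto_derive; auto. ring. }
    evar_last; [apply (is_derive_Rmult _ _ _ _ _ (HF L') He)|]. lra. }
  destruct (MVT_between (fun L => F L * exp (- L * PSeries g x)) (fun _ => 0) 0 L) as [c [_ Hc]]; auto.
  assert (HF0 : F 0 = 1).
  { unfold F. rewrite (PSeries_ext _ (fun n => match n with O => 1 | _ => 0 end)).
    - apply is_pseries_unique, is_pseries_R. apply is_series_lim. apply lim_seq_eps. exists O. intros n _.
      replace (sum_f_R0 _ n) with 1. rewrite Rminus_diag, Rabs_R0; auto.
      induction n; simpl. ring. lra.
    - unfold efun. destruct n. simpl; field.
      apply sum_eq_R0.
      intros i Hi. destruct i; simpl. field. lra. }
  replace (- 0 * PSeries g x) with 0 in Hc by lra. rewrite exp_0 in Hc.
  replace (- L * PSeries g x) with (- (L * PSeries g x)) in Hc by lra. rewrite exp_Ropp in Hc.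
  assert (He := exp_pos (L * PSeries g x)). fold (F L).
  apply Rmult_eq_reg_r with (/ exp (L * PSeries g x)); [| nra].
  rewrite Rinv_r by lra. lra.
Qed.

Lemma sq_le_pow4 n : (INR n + 1) ^ 2 <= 4 ^ n.
Proof.
  induction n. simpl; lra. rewrite S_INR. assert (H := pos_INR n). simpl pow at 2. nra.
Qed.

(** The quadratic denominator of the weight is absorbed by [(n + 1)^2 <= 4^n]; hence the factor 4 in
    the threshold for [R0]. *)
Lemma Bc_of_CV c r : 0 < r -> Rbar_lt r (CV_radius c) ->
  exists K, 0 < K /\ forall R0, 4 / r <= R0 -> Bc R0 K c.
Proof.
  intros Hr H. destruct (CV_radius_coef c r Hr H) as [K [HK HB]]. exists (8 * K). split; [lra|].
  intros R0 HR n.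
  assert (Hn := pos_INR n). unfold wgt.
  assert (Hp : 0 < r ^ n) by pos.
  apply Rmult_le_reg_r with (r ^ n); auto. eapply Rle_trans; auto.
  replace (8 * K * (/ 8 / (INR n + 1) ^ 2 * R0 ^ n) * r ^ n) with (K * ((R0 * r) ^ n / (INR n + 1) ^ 2)).
  2:{ rewrite Rpow_mult_distr. lra. }
  rewrite <- Rmult_1_r at 1. apply Rmult_le_compat_l; [lra|].
  apply Rle_div_r. apply Rlt_gt, pow_lt; lra. rewrite Rmult_1_l.
  eapply Rle_trans; [apply sq_le_pow4|]. apply pow_incr.
  apply Rle_div_l in HR; lra.
Qed.

(** * Coefficient sequences evaluated as functions of t and x *)

Definition kst (c : nat -> R) : coef := fun n _ => c n.
Definition sct (f : R -> R) : coef := fun n t => match n with O => f t | _ => 0 end.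
(** The coefficients of [t^(a g(x))], for [g] without constant term. The constant part of an
    exponent is kept apart as a pure power of [t]. *)
Definition texp (a : R) (g : nat -> R) : coef := fun n t => efun (a * ln t) g n.

Section Eval.
Context (R0 dl : R) (HR0 : 0 < R0) (Hdl : 0 < dl).
Notation Bd := (Bd R0 dl).

Lemma Bd_of_Bc K p u T : 0 < T <= 1 -> 0 <= K -> (forall t, 0 < t < T -> Bc R0 (K * Rpower t p) (fun n => u n t)) -> Bd T K p u.
Proof.
  intros HT HK H n t Ht. eapply Rle_trans; [apply (H t Ht)|].
  apply Rmult_le_compat_l. apply Rmult_le_pos; auto. apply Rlt_le, Rpower_pos.
  apply Rmult_le_compat_l. apply Rlt_le, wgt_pos. apply pow_incr. split; [lra | apply ZZ_ge; auto].
Qed.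

Lemma Bd_kst K c : 0 <= K -> Bc R0 K c -> Bd 1 K 0 (kst c).
Proof.
  intros. apply Bd_of_Bc; auto; [lra|]. intros. rewrite Rpower_O by lra. rewrite Rmult_1_r. eauto.
Qed.

Lemma Ct_kst c : Ct 1 (kst c).
Proof. intros n t Ht. apply Rcont_const. Qed.

Lemma Bd_sct K p f : 0 <= K -> (forall t, 0 < t < 1 -> Rabs (f t) <= K * Rpower t p) -> Bd 1 (8 * K) p (sct f).
Proof.
  intros HK H. apply Bd_of_Bc; try lra. intros t Ht n. unfold sct. destruct n.
  - rewrite wgt_0. specialize (H t). lra.
  - rewrite Rabs_R0. pos.
Qed.

Lemma Ct_sct f : (forall t, 0 < t < 1 -> continuous f t) -> Ct 1 (sct f).
Proof. intros H n t Ht. destruct n; [auto | apply Rcont_const]. Qed.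

(** The variable part of the exponent costs the power [Rabs a * G] of [t], which a large [R0] makes
    as small as desired. *)
Lemma Bd_texp a g G : 0 <= G -> Bc R0 G g -> Bd 1 8 (- (Rabs a * G)) (texp a g).
Proof.
  intros HG Hg. apply Bd_of_Bc; try lra. intros t Ht n.
  assert (H := efun_bound R0 G g (a * ln t) HR0 HG Hg). eapply Rle_trans; eauto. right. f_equal. f_equal.
  unfold Rpower. f_equal. rewrite Rabs_mult, (Rabs_left (ln t)). ring.
  rewrite <- ln_1. apply ln_increasing; lra.
Qed.

Lemma Ct_texp a g : g O = 0 -> Ct 1 (texp a g).
Proof.
  intros Hg n t Ht. apply (continuous_comp (fun t => a * ln t) (fun L => efun L g n)).
  - apply (is_derive_cont _ _ (a * / t)). auto_derive; lra.
  - eapply is_derive_cont, efun_derive; auto.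
Qed.

Definition Ev (u : coef) (t x : R) : R := PSeries (fun n => u n t) x.

Context (T : R) (HT : 0 < T <= 1).

Definition Ok (u : coef) : Prop := Ct T u /\ exists K p, 0 <= K /\ Bd T K p u.

Lemma Bd_pt K p u t : 0 <= K -> Bd T K p u -> 0 < t < T -> Bc (3 * R0) (K * Rpower t p) (fun n => u n t).
Proof.
  intros HK H Ht n. eapply Rle_trans; auto.
  apply Rmult_le_compat_l. apply Rmult_le_pos; auto. apply Rlt_le, Rpower_pos.
  apply Rmult_le_compat_l. apply Rlt_le, wgt_pos. apply pow_incr.
  split; [pos | apply ZZ_le; auto; lra].
Qed.

Lemma Ok_CV u t x : Ok u -> 0 < t < T -> Rabs x * (3 * R0) < 1 -> Rbar_lt (Rabs x) (CV_radius (fun n => u n t)).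
Proof.
  intros [_ [K [p [HK H]]]] Ht Hx. eapply Bc_CV; [|eapply Bd_pt; eauto|]; lra.
Qed.

Lemma Ok_ex u t x : Ok u -> 0 < t < T -> Rabs x * (3 * R0) < 1 -> ex_pseries (fun n => u n t) x.
Proof. intros. apply CV_radius_inside, Ok_CV; auto. Qed.

Lemma Ok_add u v : Ok u -> Ok v -> Ok (cadd u v).
Proof.
  intros [Hc [K [p [HK H]]]] [Hc' [K' [p' [HK' H']]]]. split. apply Ct_add; auto.
  exists (K + K'), (Rmin p p'). split; [lra|].
  apply Bd_add; [apply Bd_weaken1 with p | apply Bd_weaken1 with p']; auto; [apply Rmin_l | apply Rmin_r].
Qed.

Lemma Ok_mul u v : Ok u -> Ok v -> Ok (cmul u v).
Proof.
  intros [Hc [K [p [HK H]]]] [Hc' [K' [p' [HK' H']]]]. split. apply Ct_mul; auto.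
  exists (K * K'), (p + p'). split; [pos |]. apply Bd_mul; auto.
Qed.

Lemma Ev_add u v t x : Ok u -> Ok v -> 0 < t < T -> Rabs x * (3 * R0) < 1 ->
  Ev (cadd u v) t x = Ev u t x + Ev v t x.
Proof. intros. apply PSeries_plus; apply Ok_ex; auto. Qed.

Lemma Ev_mul u v t x : Ok u -> Ok v -> 0 < t < T -> Rabs x * (3 * R0) < 1 ->
  Ev (cmul u v) t x = Ev u t x * Ev v t x.
Proof.
  intros. apply (PSeries_mult (fun n => u n t) (fun n => v n t)); apply Ok_CV; auto.
Qed.

Lemma Ev_sct f t x : Ev (sct f) t x = f t.
Proof.
  apply is_pseries_unique, is_pseries_R, is_series_lim, lim_seq_eps. exists O. intros n _.
  replace (sum_f_R0 _ n) with (f t). rewrite Rminus_diag, Rabs_R0; auto.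
  induction n; simpl. ring. lra.
Qed.

Lemma Ev_kst c t x : Ev (kst c) t x = PSeries c x.
Proof. auto. Qed.

Lemma Ev_dx u t x : Ok u -> 0 < t < T -> Rabs x * (3 * R0) < 1 ->
  is_derive (fun y => Ev u t y) x (Ev (cdx u) t x).
Proof.
  intros. apply is_derive_PSeries. apply Ok_CV; auto.
Qed.

Lemma Ev_dx2 u t x : Ok u -> 0 < t < T -> Rabs x * (3 * R0) < 1 ->
  is_derive (fun y => Ev (cdx u) t y) x (Ev (cdx (cdx u)) t x).
Proof.
  intros. apply is_derive_PSeries.
  change (fun n => cdx u n t) with (PS_derive (fun n => u n t)). rewrite CV_radius_derive. apply Ok_CV; auto.
Qed.

Lemma Ev_bound K p u t x : 0 <= K -> Bd T K p u -> 0 < t < T -> Rabs x * (3 * R0) < 1 ->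
  Rabs (Ev u t x) <= K * Rpower t p.
Proof.
  intros HK H Ht Hx. assert (HB := Bd_pt K p u t HK H Ht).
  assert (HP := Rpower_pos t p).
  assert (Hn : forall n, Rabs (u n t * x ^ n) <= K * Rpower t p * wgt n).
  { intros n. rewrite Rabs_mult, <- RPow_abs.
    eapply Rle_trans.
    - pos.
    - replace (K * Rpower t p * (wgt n * (3 * R0) ^ n) * Rabs x ^ n) with (K * Rpower t p * wgt n * (Rabs x * (3 * R0)) ^ n)
        by (rewrite Rpow_mult_distr; ring).
      rewrite <- (Rmult_1_r (K * Rpower t p * wgt n)) at 2. assert (Hw := wgt_pos n). apply Rmult_le_compat_l. nonneg.
      rewrite <- (pow1 n). apply pow_incr. pos. }
  assert (He : ex_series (fun n => K * Rpower t p * wgt n)) by (apply Rex_scal_l, ex_series_wgt).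
  eapply Rle_trans; [apply Series_Rabs|].
  { apply ex_series_abs_le with (2 := He). intros n. rewrite Rabs_Rabsolu. auto. }
  apply Rle_trans with (Series (fun n => K * Rpower t p * wgt n)).
  - apply Series_le; auto. pos.
  - rewrite Series_scal_l. rewrite <- (Rmult_1_r (K * Rpower t p)) at 2. apply Rmult_le_compat_l. nonneg. apply Series_wgt_le.
Qed.

Lemma unif_term K p u t x n : 0 <= K -> Bd T K p u -> 0 < t < T -> Rabs x * (3 * R0) < 1 ->
  Rabs (u n t * x ^ n) <= K * Rpower t p * wgt n.
Proof.
  intros HK H Ht Hx. assert (HB := Bd_pt K p u t HK H Ht). assert (HP := Rpower_pos t p).
  rewrite Rabs_mult, <- RPow_abs.
  eapply Rle_trans.
  - pos.
  - replace (K * Rpower t p * (wgt n * (3 * R0) ^ n) * Rabs x ^ n) with (K * Rpower t p * wgt n * (Rabs x * (3 * R0)) ^ n)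
      by (rewrite Rpow_mult_distr; ring).
    rewrite <- (Rmult_1_r (K * Rpower t p * wgt n)) at 2. assert (Hw := wgt_pos n). apply Rmult_le_compat_l. nonneg.
    rewrite <- (pow1 n). apply pow_incr. pos.
Qed.

Lemma Rpower_bounded p t : 0 < t < T -> exists d M, 0 < d /\ 0 <= M /\
  forall s, Rabs (s - t) < d -> 0 < s < T /\ Rpower s p <= M.
Proof.
  intros Ht. destruct (proj1 (continuous_eps _ _) (cont_Rpower_t p t ltac:(lra)) 1) as [d [Hd H]]; [lra|].
  exists (Rmin d (Rmin t (T - t))), (Rpower t p + 1). assert (HP := Rpower_pos t p).
  split; [pos |]. split; [lra|]. intros s Hs.
  mins.
  specialize (H s ltac:(lra)). apply Rabs_def2 in H. apply Rabs_def2 in Hs. lra.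
Qed.

Lemma Ev_cont_t u t x : Ok u -> 0 < t < T -> Rabs x * (3 * R0) < 1 -> continuous (fun s => Ev u s x) t.
Proof.
  intros [Hc [K [p [HK H]]]] Ht Hx.
  destruct (Rpower_bounded p t Ht) as [d [M [Hd [HM Hs]]]].
  apply (series_continuous (fun n s => u n s * x ^ n) (fun n => K * M * wgt n) t d); auto.
  - apply Rex_scal_l, ex_series_wgt.
  - intros n s Hsd. destruct (Hs s Hsd) as [Hs1 Hs2].
    eapply Rle_trans; [apply (unif_term K p); auto|]. pos.
  - intros. apply Rcont_mult; [auto | apply Rcont_const].
Qed.

Lemma Ev_J a K p u t x : 0 <= a -> 0 <= K -> 0 < p -> Ct T u -> Bd T K p u -> 0 < t < T -> Rabs x * (3 * R0) < 1 ->
  is_derive (fun s => Ev (Jc T a u) s x) t ((Ev u t x - a * Ev (Jc T a u) t x) / t).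
Proof.
  intros Ha HK Hp Hc H Ht Hx.
  assert (HJ := Bd_J R0 dl HR0 Hdl T a K p u HT Ha HK Hp Hc H).
  assert (HKp : 0 <= K / p) by (apply Rdiv_le_0_compat; auto).
  assert (HokJ : Ok (Jc T a u)).
  { split; [apply (Ct_J R0 dl HR0 Hdl T a K p); auto | eauto]. }
  set (df := fun n s => (u n s - a * Jc T a u n s) / s * x ^ n).
  replace ((Ev u t x - a * Ev (Jc T a u) t x) / t) with (Series (fun n => df n t)).
  2:{ unfold Ev, df. change (PSeries (fun n => u n t) x) with (Series (fun n => u n t * x ^ n)).
      change (PSeries (fun n => Jc T a u n t) x) with (Series (fun n => Jc T a u n t * x ^ n)).
      rewrite <- Series_scal_l, <- Series_minus.
      - unfold Rdiv. rewrite <- Series_scal_r. apply Series_ext. intros; lra.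
      - apply ex_series_abs_le with (fun n => K * Rpower t p * wgt n).
        intros; apply unif_term; auto. apply Rex_scal_l, ex_series_wgt.
      - apply Rex_scal_l.
        apply ex_series_abs_le with (fun n => K / p * Rpower t p * wgt n).
        intros; apply unif_term; auto. apply Rex_scal_l, ex_series_wgt. }
  destruct (Rpower_bounded p t Ht) as [d1 [M1 [Hd1 [HM1 Hs1]]]].
  destruct (Rpower_bounded (-1) t Ht) as [d2 [M2 [Hd2 [HM2 Hs2]]]].
  assert (H3 := Rmin_l d1 d2). assert (H4 := Rmin_r d1 d2).
  apply (series_derive (fun n s => Jc T a u n s * x ^ n) df (fun n => (K + a * (K / p)) * M1 * M2 * wgt n) t (Rmin d1 d2)).
  - pos.
  - apply Rex_scal_l, ex_series_wgt.
  - intros n s Hs. unfold df. eapply is_derive_ext. intros; apply Rmult_comm.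
    rewrite Rmult_comm. apply is_derive_scal.
    apply Jf_derive; auto. apply (okf_Bd R0 dl HR0 Hdl T K p); auto. apply Hs1; lra.
  - intros n s Hs. destruct (Hs1 s ltac:(lra)) as [Hs0 HsM]. destruct (Hs2 s ltac:(lra)) as [_ HsM2].
    unfold df. replace ((u n s - a * Jc T a u n s) / s * x ^ n) with
      ((u n s * x ^ n - a * (Jc T a u n s * x ^ n)) * / s) by lra.
    assert (Hin : 0 < / s <= M2).
    { split. apply Rinv_0_lt_compat; lra. replace (-1) with (- (1)) in HsM2 by lra. rewrite Rpower_Ropp, Rpower_1 in HsM2; lra. }
    rewrite Rabs_mult, (Rabs_pos_eq (/ s)) by lra.
    assert (E1 := unif_term K p u s x n HK H).
    assert (E2 := unif_term (K / p) p _ s x n HKp HJ).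
    assert (E3 : Rabs (u n s * x ^ n - a * (Jc T a u n s * x ^ n)) <= (K + a * (K / p)) * M1 * wgt n).
    { eapply Rle_trans; [apply Rabs_triang|]. rewrite Rabs_Ropp, (Rabs_mult a), (Rabs_pos_eq a) by lra.
      assert (F1 : K * Rpower s p * wgt n <= K * M1 * wgt n) by pos.
      assert (F2 : K / p * Rpower s p * wgt n <= K / p * M1 * wgt n) by pos.
      nra. }
    replace ((K + a * (K / p)) * M1 * M2 * wgt n) with ((K + a * (K / p)) * M1 * wgt n * M2) by lra.
    pos.
  - intros s Hs. destruct (Hs1 s ltac:(lra)) as [Hs0 HsM].
    apply ex_series_abs_le with (fun n => K / p * Rpower s p * wgt n).
    intros; apply unif_term; auto. apply Rex_scal_l, ex_series_wgt.
Qed.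

Lemma Ev_analytic u t x0 r : Ok u -> 0 < t < T -> 0 < r -> r * (3 * R0) <= 1 ->
  analytic_on (fun x => Ev u t (x - x0)) (x0 - r) (x0 + r).
Proof.
  intros [_ [K [p [HK H]]]] Ht Hr Hr2. assert (HB := Bd_pt K p u t HK H Ht).
  apply PSeries_analytic with (K * Rpower t p); auto. intros n.
  assert (Hw := wgt_le n).
  eapply Rle_trans.
  - pos.
  - replace (K * Rpower t p * (wgt n * (3 * R0) ^ n) * r ^ n) with (K * Rpower t p * (wgt n * (r * (3 * R0)) ^ n))
      by (rewrite Rpow_mult_distr; ring).
    rewrite <- (Rmult_1_r (K * Rpower t p)) at 2. apply Rmult_le_compat_l; [pos |].
    assert (Hq : (r * (3 * R0)) ^ n <= 1) by (rewrite <- (pow1 n); apply pow_incr; nra).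
    assert (Hq0 : 0 <= (r * (3 * R0)) ^ n) by pos. nra.
Qed.

End Eval.

Lemma Bc_le R0 R1 K c : 0 < R1 <= R0 -> 0 <= K -> Bc R1 K c -> Bc R0 K c.
Proof.
  intros HR HK H n. eapply Rle_trans; auto. apply Rmult_le_compat_l; auto.
  apply Rmult_le_compat_l. apply Rlt_le, wgt_pos. apply pow_incr; lra.
Qed.

Lemma Bc_le_K R0 K K' c : 0 < R0 -> K <= K' -> Bc R0 K c -> Bc R0 K' c.
Proof.
  intros HR HK H n. eapply Rle_trans; auto. pos.
Qed.

(** Without constant term every coefficient carries at least one factor [R0] of the majorant, so
    enlarging [R0] gains [R1 / R0]. Applied to [k - k(theta_0)]. *)
Lemma Bc_small0 R0 R1 K c : 0 < R1 <= R0 -> 0 <= K -> c O = 0 -> Bc R1 K c -> Bc R0 (K * (R1 / R0)) c.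
Proof.
  intros HR HK H0 H n. destruct n.
  - rewrite H0, Rabs_R0. pos.
  - eapply Rle_trans; auto. assert (Hw := wgt_pos (S n)).
    replace (K * (R1 / R0) * (wgt (S n) * R0 ^ S n)) with (K * (wgt (S n) * (R1 * R0 ^ n))) by (simpl; field; lra).
    apply Rmult_le_compat_l; auto. apply Rmult_le_compat_l; [lra|]. apply Rmult_le_compat_l; [lra|].
    apply pow_incr; lra.
Qed.

(** The factor [n + 1] of the derivative is absorbed by [n + 1 <= 2^n], which doubles the radius
    parameter. *)
Lemma Bc_derive R1 K c : 0 < R1 -> 0 <= K -> Bc R1 K c -> Bc (2 * R1) (K * R1) (PS_derive c).
Proof.
  intros HR HK H n. unfold PS_derive. rewrite Rabs_mult, Rabs_pos_eq by pos.
  assert (H2 : INR (S n) <= 2 ^ n).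
  { induction n. simpl; lra. rewrite S_INR. assert (1 <= 2 ^ n) by (apply pow_R1_Rle; lra). simpl pow. lra. }
  assert (Hw := wgt_S). assert (HI := pos_INR).
  apply Rle_trans with (2 ^ n * (K * (wgt n * R1 ^ S n))).
  - apply Rmult_le_compat; auto using Rabs_pos. eapply Rle_trans; eauto.
    pos.
  - right. rewrite Rpow_mult_distr. simpl. ring.
Qed.

Lemma Bc_plus R0 K1 K2 a b : Bc R0 K1 a -> Bc R0 K2 b -> Bc R0 (K1 + K2) (fun n => a n + b n).
Proof.
  intros Ha Hb n. eapply Rle_trans; [pos |]. lra.
Qed.

Lemma fin_ev m Q : (forall j, (j <= m)%nat -> exists c, 0 < c /\ forall c', 0 < c' <= c -> Q j c') ->
  exists c, 0 < c /\ forall c', 0 < c' <= c -> forall j, (j <= m)%nat -> Q j c'.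
Proof.
  induction m; intros H.
  - destruct (H O (le_n O)) as [c [Hc H1]]. exists c. split; auto. intros c' Hc' j Hj.
    replace j with O by lia. auto.
  - destruct IHm as [c1 [Hc1 H1]]. intros; apply H; lia.
    destruct (H (S m) (le_n _)) as [c2 [Hc2 H2]].
    assert (H3 := Rmin_l c1 c2). assert (H4 := Rmin_r c1 c2).
    exists (Rmin c1 c2). split. apply Rmin_glb_lt; auto. intros c' Hc' j Hj.
    destruct (Nat.eq_dec j (S m)) as [->|]. apply H2; lra. apply H1; [lra | lia].
Qed.

Lemma ln_bound sg t : 0 < sg -> 0 < t < 1 -> Rabs (ln t) <= / sg * Rpower t (- sg).
Proof.
  intros Hsg Ht. assert (Hl : ln t < 0) by (rewrite <- ln_1; apply ln_increasing; lra).
  rewrite Rabs_left by lra. apply Rmult_le_reg_l with sg; auto.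
  rewrite <- Rmult_assoc, Rinv_r by lra.
  unfold Rpower. assert (H := exp_ineq1_le (- sg * ln t)). lra.
Qed.

(** * The fixed-point problem and its contraction property *)

Definition tp (p : R) : coef := sct (fun t => Rpower t p).
Definition lnc : coef := sct ln.
Definition cst (c : R) : coef := sct (fun _ => c).
Definition tail0 (c : nat -> R) : nat -> R := fun n => match n with O => 0 | _ => c n end.

Lemma cmul_cst c u n t : cmul (cst c) u n t = c * u n t.
Proof.
  assert (H : forall N, sum_f_R0 (fun k => cst c k t * u (n - k)%nat t) N = c * u n t).
  { induction N; simpl. rewrite Nat.sub_0_r; reflexivity. lra. }
  eauto.
Qed.

Section System.
(* Index [j <= m] stands for the paper's [I = j + 3]; [a0], [a1], [b0], [b1] are the Taylor
   coefficients at [theta_0] of [p_I0], [p_I1], [q_I0], [q_I1]. *)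
Context (m : nat) (ep : nat -> R) (a0 a1 b0 b1 : nat -> nat -> R).

Definition kc (j n : nat) : R := sum_f_R0 (fun i => a0 i n) m + a0 j n.
Definition sc (j n : nat) : R := sum_f_R0 (fun i => a1 i n) m + a1 j n.
Definition k0 (j : nat) : R := kc j O.
Definition gk (j : nat) := tail0 (kc j).
Definition gs (j : nat) := tail0 (sc j).

(** The coefficients of [exp (-2 s)], where [s] is the sum of the [p_J1] plus [p_I1]. The constant
    term of [s] is split off because [efun] represents an exponential only for series without
    constant term; likewise [T2 s j] represents [t^(s k_I)]. *)
Definition y1 (j : nat) : coef := cmul (cst (exp (-2 * sc j O))) (kst (fun n => efun (-2) (gs j) n)).
Definition T2 (s : R) (j : nat) : coef := cmul (tp (s * k0 j)) (texp s (gk j)).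

Section Functionals.
Context (T : R) (U : unk).
Local Infix "[*]" := cmul (at level 40, left associativity).
Local Infix "[+]" := cadd (at level 50, left associativity).
Local Notation d1 c := (kst (PS_derive c)).
Local Notation d2 c := (kst (PS_derive (PS_derive c))).

(* [U (0,j)], [U (1,j)], [U (2,j)] are [(D+eps)^2 pi], [(D+2 k(theta_0)) D kappa] and [D E],
   where [exp (-2 (P + P_I)) = t^(-2k) y1 (1 + E)]. *)
Definition fA j : coef := Jc T (ep j) (U (0%nat, j)).
Definition fpi j : coef := Jc T (ep j) (fA j).
Definition fdpi j : coef := cdx (fpi j).
(** Each of the two inverses defining [fpi] pays for one [x]-derivative, so one derivative is placed
    behind each. That the result is the second derivative of [fpi] is the content of [Ev_ddJ]. *)
Definition fddpi j : coef := cdx (Jc T (ep j) (cdx (fA j))).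
Definition fB j : coef := Jc T (2 * k0 j) (U (1%nat, j)).
Definition fkap j : coef := Jc T 0 (fB j).
Definition fdkap j : coef := cdx (fkap j).
Definition fddkap j : coef := cdx (Jc T 0 (cdx (fB j))).
Definition fE j : coef := Jc T 0 (U (2%nat, j)).
Definition f1E j : coef := cst 1 [+] fE j.
(** Since [D (t^ep pi) = t^ep (D + ep) pi], this is [D] applied to the remainder of [psi]; [fThx] is
    the [x]-derivative of that remainder. *)
Definition fTh j : coef := csum (fun i => tp (ep i) [*] fA i) m [+] tp (ep j) [*] fA j.
Definition fThx j : coef := csum (fun i => tp (ep i) [*] fdpi i) m [+] tp (ep j) [*] fdpi j.
Definition fw j : coef := kst (b1 j) [+] fkap j.
Definition fwx j : coef := d1 (b1 j) [+] fdkap j.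
Definition fwxx j : coef := d2 (b1 j) [+] fddkap j.
(** [D Q = t^(2k) fV] and [t d_x Q = t q_I0' + t^(2k) fW], while [fpx] is [d_x psi]. The logarithms
    come from differentiating [t^(2k)] in [x]. *)
Definition fV j : coef := cst 2 [*] (kst (kc j) [*] fw j) [+] fB j.
Definition fW j : coef := tp 1 [*] fwx j [+] tp 1 [*] lnc [*] (cst 2 [*] d1 (kc j) [*] fw j).
Definition fpx j : coef := lnc [*] d1 (kc j) [+] d1 (sc j) [+] fThx j.
Definition fN j : coef := fV j [*] fV j [+] cst (-1) [*] fW j [*] fW j.

(** The equation of [P_I] divided by [t^ep], with the square of [t d_x Q] expanded around [t q_I0'].
    The exponents [2 k - ep] and [2 - 2 k - ep] are those controlled by the conditions on [ep]. *)
Definition PhiS j : coef :=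
  tp 2 [*] fddpi j
  [+] tp (2 - ep j) [*] lnc [*] d2 (a0 j)
  [+] tp (2 - ep j) [*] d2 (a1 j)
  [+] cst (-1/2) [*] y1 j [*] f1E j [*] (tp (- ep j) [*] T2 2 j) [*] fN j
  [+] y1 j [*] f1E j [*] tp (1 - ep j) [*] d1 (b0 j) [*] fW j
  [+] cst (1/2) [*] y1 j [*] f1E j [*] (tp (2 - ep j) [*] T2 (-2) j) [*] (d1 (b0 j) [*] d1 (b0 j)).

(** The equation of [Q_I] divided by [t^(2k)]. The term [2 k fV] of [D^2 Q] cancels against the
    leading part of [2 D psi D Q], which leaves [(D + 2 k) fB] on the left. *)
Definition PhiR j : coef :=
  tp 2 [*] fwxx j
  [+] tp 2 [*] lnc [*] (cst 4 [*] d1 (kc j) [*] fwx j)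
  [+] tp 2 [*] lnc [*] (cst 2 [*] d2 (kc j) [*] fw j)
  [+] tp 2 [*] lnc [*] lnc [*] (cst 4 [*] d1 (kc j) [*] d1 (kc j) [*] fw j)
  [+] tp 2 [*] T2 (-2) j [*] d2 (b0 j)
  [+] cst 2 [*] fTh j [*] fV j
  [+] cst (-2) [*] tp 1 [*] fpx j [*] fW j
  [+] cst (-2) [*] (tp 2 [*] T2 (-2) j) [*] fpx j [*] d1 (b0 j).

(** The price of freezing [k] at [theta_0] in [D + 2 k]. It is of the same order as the unknowns. *)
Definition PhiR0 j : coef := kst (fun n => -2 * gk j n) [*] fB j.

(** The linear equation satisfied by [exp (-2 Theta) - 1], with [Theta] the remainder of [psi]. *)
Definition PhiX j : coef := cst (-2) [*] fTh j [*] f1E j.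

Definition Phi (c : idx) : coef :=
  if Nat.leb (snd c) m then
    match fst c with
    | O => PhiS (snd c)
    | 1%nat => PhiR0 (snd c) [+] PhiR (snd c)
    | 2%nat => PhiX (snd c)
    | _ => fun _ _ => 0
    end
  else fun _ _ => 0.

End Functionals.

Context (R0 gap : R) (HR0 : 0 < R0) (Hgap : 0 < gap).
(** [sg] is the price of one [x]-derivative, of one logarithm, or of the variable part of an
    exponent; [mu] is the order of the unknowns. With these values all terms of [Phi] other than
    [PhiR0] keep an order of at least [5/8 gap], which exceeds [mu]. *)
Notation sg := (gap / 16).
Notation mu := (gap / 2).
Notation Tm := (Tame R0 sg mu).

Definition Bcx (c : nat -> R) := exists K, 0 <= K /\ Bc R0 K c.
Definition Bc2 (c : nat -> R) := Bcx c /\ Bcx (PS_derive c) /\ Bcx (PS_derive (PS_derive c)).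

Context (Hep : forall j, (j <= m)%nat -> gap <= ep j /\ ep j + gap <= 2 * k0 j /\ ep j + gap <= 2 - 2 * k0 j).
Context (Hdat : forall j, (j <= m)%nat -> Bc2 (a0 j) /\ Bc2 (a1 j) /\ Bc2 (b0 j) /\ Bc2 (b1 j) /\ Bc2 (kc j) /\ Bc2 (sc j)).
Context (Hgk : forall j, (j <= m)%nat -> Bc R0 (gap / 32) (gk j)).

Lemma Hsg : 0 < sg. Proof. lra. Qed.
Lemma Hmu : 0 < mu. Proof. lra. Qed.

Lemma Tame_kst c : Bcx c -> Tm 0 (fun _ _ => kst c).
Proof.
  intros [K [HK H]]. apply Tame_const with K; auto using Ct_kst.
  apply Bd_kst; auto.
Qed.

Lemma Tame_tp p : Tm p (fun _ _ => tp p).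
Proof.
  apply Tame_const with (8 * 1); try lra.
  - apply Ct_sct. intros t Ht. apply cont_Rpower_t; lra.
  - apply Bd_sct; try lra. intros. rewrite Rabs_pos_eq. lra. pos.
Qed.

Lemma Tame_lnc : Tm (- sg) (fun _ _ => lnc).
Proof.
  assert (H : 0 < / sg) by pos.
  apply Tame_const with (8 * / sg); try lra.
  - apply Ct_sct. intros t Ht. apply (is_derive_cont _ _ (/ t)). auto_derive; lra.
  - apply Bd_sct; try lra. intros. apply ln_bound; auto using Hsg.
Qed.

Lemma Tame_cst c : Tm 0 (fun _ _ => cst c).
Proof.
  assert (H := Rabs_pos c).
  apply Tame_const with (8 * Rabs c); try lra.
  - apply Ct_sct. intros t Ht. apply Rcont_const.
  - apply Bd_sct; try lra. intros. rewrite Rpower_O; lra.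
Qed.

Lemma gk0 j : gk j O = 0. Proof. auto. Qed.
Lemma gs0 j : gs j O = 0. Proof. auto. Qed.

Lemma Bcx_tail0 c : Bcx c -> Bcx (tail0 c).
Proof.
  intros [K [HK H]]. exists K. split; auto. intros n. destruct n; simpl; auto.
  rewrite Rabs_R0. pos.
Qed.

Lemma Tame_texp s j : (j <= m)%nat -> Rabs s <= 2 -> Tm (- sg) (fun _ _ => texp s (gk j)).
Proof.
  intros. apply Tame_weaken with (- (Rabs s * (gap / 32))); auto using Hsg; [nra|].
  apply Tame_const with 8; try lra. apply Ct_texp; auto using gk0.
  apply Bd_texp; auto using Hsg; lra.
Qed.

Lemma Tame_T2 s j : (j <= m)%nat -> Rabs s <= 2 -> Tm (s * k0 j - sg) (fun _ _ => T2 s j).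
Proof.
  intros.
  apply Tame_mult; auto.
  apply Tame_tp. apply Tame_texp; auto.
Qed.

Lemma Bcx_efun j : (j <= m)%nat -> Bcx (fun n => efun (-2) (gs j) n).
Proof.
  intros Hj. destruct (Hdat j Hj) as [_ [_ [_ [_ [_ [H _]]]]]].
  destruct (Bcx_tail0 _ H) as [K [HK H1]].
  exists (8 * exp (Rabs (-2) * K)). split. assert (H2 := exp_pos (Rabs (-2) * K)). lra.
  apply efun_bound; auto.
Qed.

Create HintDb tame discriminated.
Hint Constants Opaque : tame.

Ltac tmul := eapply Tame_mult; [apply HR0 | |].
Ltac tadd := eapply Tame_plus.
Ltac tw := eapply Tame_weaken; [apply HR0 | |].

Lemma Tame_var' c : Tm mu (fun _ U => U c).
Proof. apply Tame_var. Qed.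

Lemma Tame_y1 j : (j <= m)%nat -> Tm 0 (fun _ _ => y1 j).
Proof.
  intros. replace 0 with (0 + 0) by lra.
  apply Tame_mult; auto.
  apply Tame_cst. apply Tame_kst, Bcx_efun; auto.
Qed.

Lemma k0_pos j : (j <= m)%nat -> 0 <= 2 * k0 j.
Proof. intros Hj. specialize (Hep j Hj). lra. Qed.

Lemma ep_pos j : (j <= m)%nat -> 0 <= ep j.
Proof. intros Hj. specialize (Hep j Hj). lra. Qed.

Lemma Tame_fA j : (j <= m)%nat -> Tm mu (fun T U => fA T U j).
Proof. intros. apply Tame_J; auto using Hsg, Hmu, ep_pos, Tame_var'. Qed.

Lemma Tame_fpi j : (j <= m)%nat -> Tm mu (fun T U => fpi T U j).
Proof. intros. apply Tame_J; auto using Hsg, Hmu, ep_pos, Tame_fA. Qed.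

Lemma Tame_fdpi j : (j <= m)%nat -> Tm (mu - sg) (fun T U => fdpi T U j).
Proof. intros. apply Tame_dJ; auto using Hsg, Hmu, ep_pos, Tame_fA. lra. Qed.

Lemma Tame_fddpi j : (j <= m)%nat -> Tm (mu - sg - sg) (fun T U => fddpi T U j).
Proof.
  intros. apply Tame_dJ; auto using Hsg, Hmu, ep_pos; [lra|].
  apply Tame_dJ; auto using Hsg, Hmu, ep_pos, Tame_var'. lra.
Qed.

Lemma Tame_fB j : (j <= m)%nat -> Tm mu (fun T U => fB T U j).
Proof. intros. apply Tame_J; auto using Hsg, Hmu, k0_pos, Tame_var'. Qed.

Lemma Tame_fkap j : (j <= m)%nat -> Tm mu (fun T U => fkap T U j).
Proof. intros. apply Tame_J; auto using Hsg, Hmu, Tame_fB. lra. Qed.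

Lemma Tame_fdkap j : (j <= m)%nat -> Tm (mu - sg) (fun T U => fdkap T U j).
Proof. intros. apply Tame_dJ; auto using Hsg, Hmu, Tame_fB; lra. Qed.

Lemma Tame_fddkap j : (j <= m)%nat -> Tm (mu - sg - sg) (fun T U => fddkap T U j).
Proof.
  intros. apply Tame_dJ; try lra.
  apply Tame_dJ; auto using Hsg, Hmu, k0_pos, Tame_var'. lra.
Qed.

Lemma Tame_fE j : (j <= m)%nat -> Tm mu (fun T U => fE T U j).
Proof. intros. apply Tame_J; auto using Hsg, Hmu, Tame_var'. lra. Qed.

Lemma Tame_f1E j : (j <= m)%nat -> Tm 0 (fun T U => f1E T U j).
Proof. intros. tadd. apply Tame_cst. tw; [|apply Tame_fE; auto]. lra. Qed.

Lemma Tame_fTh j : (j <= m)%nat -> Tm (gap + mu) (fun T U => fTh T U j).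
Proof.
  intros Hj. tadd.
  - apply Tame_sum. intros i Hi.
    tw; [|tmul; [apply Tame_tp | apply Tame_fA; auto]]. specialize (Hep i Hi). lra.
  - tw; [|tmul; [apply Tame_tp | apply Tame_fA; auto]]. specialize (Hep j Hj). lra.
Qed.

Lemma Tame_fThx j : (j <= m)%nat -> Tm (gap + mu - sg) (fun T U => fThx T U j).
Proof.
  intros Hj. tadd.
  - apply Tame_sum. intros i Hi.
    tw; [|tmul; [apply Tame_tp | apply Tame_fdpi; auto]]. specialize (Hep i Hi). lra.
  - tw; [|tmul; [apply Tame_tp | apply Tame_fdpi; auto]]. specialize (Hep j Hj). lra.
Qed.

Lemma Bcx_dat j : (j <= m)%nat ->
  (Bcx (PS_derive (PS_derive (a0 j))) /\ Bcx (PS_derive (PS_derive (a1 j)))) /\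
  (Bcx (PS_derive (b0 j)) /\ Bcx (PS_derive (PS_derive (b0 j)))) /\
  (Bcx (b1 j) /\ Bcx (PS_derive (b1 j)) /\ Bcx (PS_derive (PS_derive (b1 j)))) /\
  (Bcx (kc j) /\ Bcx (PS_derive (kc j)) /\ Bcx (PS_derive (PS_derive (kc j)))) /\ Bcx (sc j) /\ Bcx (PS_derive (sc j)).
Proof. assert (H := Hdat j). unfold Bc2 in H. tauto. Qed.

Hint Extern 1 (Bcx _) => apply Bcx_dat; assumption : tame.
Hint Resolve Tame_tp Tame_lnc Tame_cst Tame_y1 Tame_T2 Tame_kst Tame_fA Tame_fpi Tame_fdpi Tame_fddpi Tame_fB Tame_fkap
  Tame_fdkap Tame_fddkap Tame_fE Tame_f1E Tame_fTh Tame_fThx : tame.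

Lemma Tame_fw j : (j <= m)%nat -> Tm 0 (fun T U => fw T U j).
Proof.
  intros. tadd; [|tw]; eauto with tame. lra.
Qed.

Lemma Tame_fwx j : (j <= m)%nat -> Tm 0 (fun T U => fwx T U j).
Proof.
  intros. tadd; [|tw]; eauto with tame. lra.
Qed.

Lemma Tame_fwxx j : (j <= m)%nat -> Tm 0 (fun T U => fwxx T U j).
Proof.
  intros. tadd; [|tw]; eauto with tame. lra.
Qed.

Lemma gap_lt1 j : (j <= m)%nat -> gap < 1.
Proof. intros Hj. specialize (Hep j Hj). lra. Qed.

Hint Resolve Tame_fw Tame_fwx Tame_fwxx : tame.
Ltac tmuls := lazymatch goal with
  | |- Tame _ _ _ _ (fun _ _ => cmul _ _) => tmul; tmuls | _ => eauto with tame end.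
Ltac tprod := tw; [|tmuls].

Lemma Tame_fV j : (j <= m)%nat -> Tm 0 (fun T U => fV T U j).
Proof. intros. tadd. tprod; try lra. tprod; try lra. Qed.

Lemma Tame_fW j : (j <= m)%nat -> Tm (1 - sg) (fun T U => fW T U j).
Proof. intros. tadd; tprod; try lra. Qed.

Lemma Tame_fpx j : (j <= m)%nat -> Tm (- sg) (fun T U => fpx T U j).
Proof. intros. tadd; [tadd|]; tprod; try lra. Qed.

Lemma Tame_fN j : (j <= m)%nat -> Tm 0 (fun T U => fN T U j).
Proof.
  intros Hj. assert (H := gap_lt1 j Hj). tadd.
  - tw; [|tmul; apply Tame_fV; auto]. lra.
  - tw; [|tmul; [tmul; [apply Tame_cst | apply Tame_fW; auto] | apply Tame_fW; auto]]. lra.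
Qed.

Lemma Rabs2 : Rabs 2 <= 2. Proof. rewrite Rabs_pos_eq; lra. Qed.
Lemma Rabsm2 : Rabs (-2) <= 2. Proof. rewrite Rabs_left; lra. Qed.

Hint Resolve Tame_fV Tame_fW Tame_fpx Tame_fN Rabs2 Rabsm2 : tame.

Lemma Tame_PhiS j : (j <= m)%nat -> Tm (5/8 * gap) (fun T U => PhiS T U j).
Proof.
  intros Hj. unfold PhiS. assert (H1 := Hep j Hj).
  repeat match goal with |- Tame _ _ _ _ (fun _ _ => cadd _ _) => tadd end; tprod; try lra.
Qed.

Lemma Tame_PhiR j : (j <= m)%nat -> Tm (5/8 * gap) (fun T U => PhiR T U j).
Proof.
  intros Hj. unfold PhiR. assert (H1 := Hep j Hj).
  repeat match goal with |- Tame _ _ _ _ (fun _ _ => cadd _ _) => tadd end; tprod; try lra.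
Qed.

Lemma Tame_PhiX j : (j <= m)%nat -> Tm (5/8 * gap) (fun T U => PhiX T U j).
Proof.
  intros. unfold PhiX. tprod; try lra.
Qed.

Lemma LipB_zero T B L p : 0 <= B -> 0 <= L -> LipB R0 sg mu T B L p (fun _ _ _ _ => 0).
Proof.
  split; [|split].
  - intros n t Ht; apply Rcont_const.
  - intros n t Ht. rewrite Rabs_R0. pos.
  - intros n. unfold csub. rewrite Rminus_diag, Rabs_R0. pos.
Qed.

Lemma Contr_Phi : exists T, 0 < T <= 1 /\ forall c, LipB R0 sg mu T (/ 2) (/ 2) mu (fun T U => Phi T U c).
Proof.
  assert (HC : forall j a, (j <= m)%nat -> Contr R0 sg mu (/ 2) (fun T U => Phi T U (a, j))).
  { intros j a Hj. unfold Phi; simpl snd; simpl fst. rewrite (proj2 (Nat.leb_le j m) Hj).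
    destruct a as [|[|[|a]]].
    - eapply Tame_Contr; auto using Hsg, Tame_PhiS; lra.
    (* The coefficient of [PhiR0] is at most [gap / 16], so after division by [mu = gap / 2] it uses
       [1/8] of its share [1/4]; [PhiR] has surplus order and fits into the other share. *)
    - replace (/ 2) with (/ 4 + / 4) by lra. apply Contr_plus.
      + apply (Contr_mulJ R0 sg HR0 Hsg mu Hmu (gap / 16)).
        * lra.
        * apply k0_pos; auto.
        * apply Ct_kst.
        * apply Bd_kst; auto using Hsg; [lra|]. intros n.
          rewrite Rabs_mult, Rabs_left by lra. specialize (Hgk j Hj n). lra.
        * apply Rle_div_l; lra.
      + eapply Tame_Contr; auto using Hsg, Tame_PhiR; lra.
    - eapply Tame_Contr; auto using Hsg, Tame_PhiX; lra.
    - exists 1. split; [lra|]. intros T HT. apply LipB_zero; lra. }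
  assert (HC2 : forall j, (j <= m)%nat -> exists c, 0 < c /\ forall c', 0 < c' <= c -> forall a,
    LipB R0 sg mu c' (/ 2) (/ 2) mu (fun T U => Phi T U (a, j))).
  { intros j Hj. destruct (HC j 0%nat Hj) as [T1 [HT1 H1]].
    destruct (HC j 1%nat Hj) as [T2' [HT2 H2]]. destruct (HC j 2%nat Hj) as [T3 [HT3 H3]].
    exists (Rmin T1 (Rmin T2' T3)).
    mins.
    split; [pos |].
    destruct a as [|[|[|a]]]; [pos | pos | pos |].
    unfold Phi; simpl. rewrite (proj2 (Nat.leb_le j m) Hj). apply LipB_zero; lra. }
  destruct (fin_ev m _ HC2) as [c [Hc H]].
  exists (Rmin c 1). mins.
  split. pos. intros [a j].
  destruct (Compare_dec.le_lt_dec j m) as [Hj|Hj].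
  - pos.
  - unfold Phi; simpl. rewrite (proj2 (Nat.leb_gt j m) Hj). apply LipB_zero; lra.
Qed.


(** * From the fixed point to functions and their derivatives *)

Section Solution.
Context (T : R) (HT : 0 < T <= 1) (U : unk) (HU : Ball R0 sg mu T U).
Context (Hfix : forall c n t, 0 < t < T -> Phi T U c n t = U c n t).
Notation Okk := (Ok R0 sg T).
Notation inr x := (Rabs x * (3 * R0) < 1).

Lemma Ok_tame p F : Tm p F -> Okk (F T U).
Proof.
  intros [B [HB H]]. destruct (H T HT U U 0 (Rle_refl 0) HU HU) as [H1 [H2 _]].
  - apply Near_refl; auto using Rle_refl.
  - split; auto. eauto.
Qed.

Lemma Bd_tame p F : Tm p F -> exists B, 0 <= B /\ Ct T (F T U) /\ Bd R0 sg T B p (F T U).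
Proof.
  intros [B [HB H]]. destruct (H T HT U U 0 (Rle_refl 0) HU HU) as [H1 [H2 _]].
  - apply Near_refl; auto using Rle_refl.
  - eauto.
Qed.

Lemma Ok_kst c : Bcx c -> Okk (kst c).
Proof. intros H. exact (Ok_tame 0 _ (Tame_kst c H)). Qed.

Ltac okt := lazymatch goal with
  | |- Ok _ _ _ (cadd _ _) => apply Ok_add; [assumption | assumption | okt | okt]
  | |- Ok _ _ _ (cmul _ _) => apply Ok_mul; [assumption | okt | okt]
  | |- Ok _ _ _ ?c => let F := eval pattern T, U in c in
      lazymatch F with ?G _ _ => eapply (Ok_tame _ G); eauto with tame end
  end.

Local Notation K j x := (PSeries (kc j) x).
Local Notation dK j x := (PSeries (PS_derive (kc j)) x).

Definition vpi j := Ev (fpi T U j).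
Definition vA j := Ev (fA T U j).
Definition vS j := Ev (U (0%nat, j)).
Definition vpix j := Ev (fdpi T U j).
Definition vpixx j := Ev (fddpi T U j).
Definition vkap j := Ev (fkap T U j).
Definition vB j := Ev (fB T U j).
Definition vR j := Ev (U (1%nat, j)).
Definition vkapx j := Ev (fdkap T U j).
Definition vkapxx j := Ev (fddkap T U j).
Definition vE j := Ev (fE T U j).
Definition vX j := Ev (U (2%nat, j)).
Definition vTh j t x := sum_f_R0 (fun i => Rpower t (ep i) * vA i t x) m + Rpower t (ep j) * vA j t x.
Definition vThx j t x := sum_f_R0 (fun i => Rpower t (ep i) * vpix i t x) m + Rpower t (ep j) * vpix j t x.
Definition vw j t x := PSeries (b1 j) x + vkap j t x.
Definition vwx j t x := PSeries (PS_derive (b1 j)) x + vkapx j t x.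
Definition vwxx j t x := PSeries (PS_derive (PS_derive (b1 j))) x + vkapxx j t x.
Definition vV j t x := 2 * (K j x * vw j t x) + vB j t x.
Definition vW j t x := t * vwx j t x + t * ln t * (2 * dK j x * vw j t x).
Definition vpx j t x := ln t * dK j x + PSeries (PS_derive (sc j)) x + vThx j t x.

Section Point.
Context (j : nat) (Hj : (j <= m)%nat) (t x : R) (Ht : 0 < t < T) (Hx : inr x).

Ltac ev := repeat first
  [ rewrite (Ev_add R0 sg HR0 Hsg T HT) by (assumption || okt)
  | rewrite (Ev_mul R0 sg HR0 Hsg T HT) by (assumption || okt) ].

Lemma Ev_tp p : Ev (tp p) t x = Rpower t p. Proof. exact (Ev_sct (fun t => Rpower t p) t x). Qed.
Lemma Ev_lnc : Ev lnc t x = ln t. Proof. apply Ev_sct. Qed.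
Lemma Ev_cst c : Ev (cst c) t x = c. Proof. apply Ev_sct. Qed.

Lemma Ev_ext u v : (forall n, u n t = v n t) -> Ev u t x = Ev v t x.
Proof. intros. apply PSeries_ext. auto. Qed.

Lemma PSeries_tail0 c : Bcx c -> PSeries c x = c O + PSeries (tail0 c) x.
Proof.
  intros. rewrite <- (Ev_kst c t), <- (Ev_kst (tail0 c) t).
  rewrite <- (Ev_cst (c O)) at 1. rewrite <- (Ev_add R0 sg HR0 Hsg T); auto.
  - apply Ev_ext. unfold cadd, kst, cst, sct, tail0. destruct n; ring.
  - okt.
  - apply Ok_kst, Bcx_tail0; auto.
Qed.

Lemma inr1 : Rabs x * R0 < 1.
Proof. lra. Qed.

Lemma Ev_T2 s : Rabs s <= 2 -> Ev (T2 s j) t x = Rpower t (s * K j x).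
Proof.
  intros Hs. unfold T2. rewrite (Ev_mul R0 sg HR0 Hsg T); auto.
  - rewrite Ev_tp. unfold Ev, texp.
    rewrite (efun_eval R0 (gap / 32)); auto using gk0, inr1; [|lra].
    rewrite (PSeries_tail0 (kc j)) by (apply Bcx_dat; auto). fold (gk j). fold (k0 j).
    unfold Rpower. rewrite <- exp_plus. f_equal. ring.
  - okt.
  - exact (Ok_tame _ _ (Tame_texp s j Hj Hs)).
Qed.

Lemma Ev_y1 : Ev (y1 j) t x = exp (-2 * PSeries (sc j) x).
Proof.
  unfold y1. rewrite (Ev_mul R0 sg HR0 Hsg T); auto.
  - rewrite Ev_cst, Ev_kst.
    assert (Hb : Bcx (gs j)) by (apply Bcx_tail0, Bcx_dat; auto). destruct Hb as [K [HK H]].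
    rewrite (efun_eval R0 K); auto using gs0, inr1.
    rewrite (PSeries_tail0 (sc j)) by (apply Bcx_dat; auto). fold (gs j).
    rewrite <- exp_plus. f_equal. ring.
  - okt.
  - apply Ok_kst, Bcx_efun; auto.
Qed.

Lemma Ok_csum f n : (forall i, (i <= n)%nat -> Okk (f i)) -> Okk (csum f n).
Proof.
  induction n; intros H. apply H; lia.
  apply Ok_add; auto.
Qed.

Lemma Ev_csum f n : (forall i, (i <= n)%nat -> Okk (f i)) ->
  Ev (csum f n) t x = sum_f_R0 (fun i => Ev (f i) t x) n.
Proof.
  induction n; intros H; simpl; auto. rewrite (Ev_add R0 sg HR0 Hsg T); auto.
  - rewrite IHn; auto.
  - apply Ok_csum; auto.
Qed.

Lemma Ev_tot F : (forall i, (i <= m)%nat -> Okk (F i)) ->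
  Ev (cadd (csum (fun i => cmul (tp (ep i)) (F i)) m) (cmul (tp (ep j)) (F j))) t x =
  sum_f_R0 (fun i => Rpower t (ep i) * Ev (F i) t x) m + Rpower t (ep j) * Ev (F j) t x.
Proof.
  intros. assert (Hok : forall i, (i <= m)%nat -> Okk (cmul (tp (ep i)) (F i))) by (intros; apply Ok_mul; auto; okt).
  assert (Hm : forall i, (i <= m)%nat -> Ev (cmul (tp (ep i)) (F i)) t x = Rpower t (ep i) * Ev (F i) t x).
  { intros. rewrite (Ev_mul R0 sg HR0 Hsg T), Ev_tp; auto. okt. }
  rewrite (Ev_add R0 sg HR0 Hsg T), Ev_csum, Hm; auto using Ok_csum. f_equal. apply sum_eq. auto.
Qed.

Lemma Ev_fTh : Ev (fTh T U j) t x = vTh j t x.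
Proof. apply Ev_tot. intros; okt. Qed.
Lemma Ev_fThx : Ev (fThx T U j) t x = vThx j t x.
Proof. apply Ev_tot. intros; okt. Qed.

Lemma Rpower_1' : Rpower t 1 = t. Proof. apply Rpower_1. lra. Qed.

Lemma Ev_f1E : Ev (f1E T U j) t x = 1 + vE j t x.
Proof. unfold f1E. ev. rewrite Ev_cst. auto. Qed.
Lemma Ev_fw : Ev (fw T U j) t x = vw j t x.
Proof. unfold fw. ev. auto. Qed.
Lemma Ev_fwx : Ev (fwx T U j) t x = vwx j t x.
Proof. unfold fwx. ev. auto. Qed.
Lemma Ev_fwxx : Ev (fwxx T U j) t x = vwxx j t x.
Proof. unfold fwxx. ev. auto. Qed.
Lemma Ev_fV : Ev (fV T U j) t x = vV j t x.
Proof. unfold fV. ev. rewrite Ev_cst, Ev_fw. auto. Qed.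
Lemma Ev_fW : Ev (fW T U j) t x = vW j t x.
Proof. unfold fW. ev. rewrite Ev_cst, Ev_tp, Ev_lnc, Ev_fw, Ev_fwx, Rpower_1'. auto. Qed.
Lemma Ev_fpx : Ev (fpx T U j) t x = vpx j t x.
Proof. unfold fpx. ev. rewrite Ev_lnc, Ev_fThx. auto. Qed.
Lemma Ev_fN : Ev (fN T U j) t x = vV j t x * vV j t x - vW j t x * vW j t x.
Proof. unfold fN. ev. rewrite Ev_cst, Ev_fV, Ev_fW. ring. Qed.

Lemma Ev_fix a : Ev (U (a, j)) t x = Ev (Phi T U (a, j)) t x.
Proof. apply Ev_ext. symmetry. auto. Qed.

Lemma vS_eq : vS j t x = Rpower t 2 * vpixx j t x
  + Rpower t (2 - ep j) * ln t * PSeries (PS_derive (PS_derive (a0 j))) x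
  + Rpower t (2 - ep j) * PSeries (PS_derive (PS_derive (a1 j))) x
  + -1/2 * exp (-2 * PSeries (sc j) x) * (1 + vE j t x) * (Rpower t (- ep j) * Rpower t (2 * K j x))
      * (vV j t x * vV j t x - vW j t x * vW j t x)
  + exp (-2 * PSeries (sc j) x) * (1 + vE j t x) * Rpower t (1 - ep j) * PSeries (PS_derive (b0 j)) x * vW j t x
  + 1/2 * exp (-2 * PSeries (sc j) x) * (1 + vE j t x) * (Rpower t (2 - ep j) * Rpower t (-2 * K j x))
      * (PSeries (PS_derive (b0 j)) x * PSeries (PS_derive (b0 j)) x).
Proof.
  unfold vS. rewrite Ev_fix. unfold Phi; simpl fst; simpl snd. rewrite (proj2 (Nat.leb_le j m) Hj).
  unfold PhiS. ev. rewrite !Ev_cst, !Ev_tp, !Ev_lnc, !Ev_y1, !Ev_f1E, !Ev_fN, !Ev_fW, (Ev_T2 2 Rabs2), (Ev_T2 (-2) Rabsm2). auto.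
Qed.

Lemma vR_eq : vR j t x = -2 * (K j x - k0 j) * vB j t x
  + (Rpower t 2 * vwxx j t x
  + Rpower t 2 * ln t * (4 * dK j x * vwx j t x)
  + Rpower t 2 * ln t * (2 * PSeries (PS_derive (PS_derive (kc j))) x * vw j t x)
  + Rpower t 2 * ln t * ln t * (4 * dK j x * dK j x * vw j t x)
  + Rpower t 2 * Rpower t (-2 * K j x) * PSeries (PS_derive (PS_derive (b0 j))) x
  + 2 * vTh j t x * vV j t x
  + -2 * t * vpx j t x * vW j t x
  + -2 * (Rpower t 2 * Rpower t (-2 * K j x)) * vpx j t x * PSeries (PS_derive (b0 j)) x).
Proof.
  unfold vR. rewrite Ev_fix. unfold Phi; simpl fst; simpl snd. rewrite (proj2 (Nat.leb_le j m) Hj).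
  assert (HokR : Okk (PhiR T U j)) by exact (Ok_tame _ _ (Tame_PhiR j Hj)).
  assert (Hg : Okk (kst (gk j))) by (apply Ok_kst, Bcx_tail0, Bcx_dat; auto).
  assert (He : forall n, PhiR0 T U j n t = cmul (cmul (cst (-2)) (kst (gk j))) (fB T U j) n t).
  { intros n. apply sum_eq. intros.
    rewrite cmul_cst. auto. }
  rewrite (Ev_ext _ (cadd (cmul (cmul (cst (-2)) (kst (gk j))) (fB T U j)) (PhiR T U j))).
  2:{ intros. unfold cadd. rewrite He. lra. }
  rewrite (Ev_add R0 sg HR0 Hsg T); auto.
  2:{ apply Ok_mul; auto. apply Ok_mul; auto. okt. okt. }
  f_equal.
  - rewrite (Ev_mul R0 sg HR0 Hsg T); auto.
    2:{ apply Ok_mul; auto. okt. }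
    2:{ okt. }
    rewrite (Ev_mul R0 sg HR0 Hsg T); auto. 2: okt.
    rewrite Ev_cst, Ev_kst, (PSeries_tail0 (kc j)) by (apply Bcx_dat; auto). fold (gk j) (k0 j).
    unfold vB. ring.
  - unfold PhiR. ev. rewrite !Ev_cst, !Ev_tp, !Ev_lnc, !Ev_fV, !Ev_fW, !Ev_fw, !Ev_fwx, !Ev_fwxx, !Ev_fpx, !Ev_fTh, (Ev_T2 (-2) Rabsm2), !Rpower_1'. auto.
Qed.

Lemma vX_eq : vX j t x = -2 * vTh j t x * (1 + vE j t x).
Proof.
  unfold vX. rewrite Ev_fix. unfold Phi; simpl fst; simpl snd. rewrite (proj2 (Nat.leb_le j m) Hj).
  unfold PhiX. ev. rewrite Ev_cst, Ev_fTh, Ev_f1E. auto.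
Qed.

Lemma BdU c : Ct T (U c) /\ Bd R0 sg T 1 mu (U c).
Proof. auto. Qed.

Lemma vpi_dt : is_derive (fun s => vpi j s x) t ((vA j t x - ep j * vpi j t x) / t).
Proof.
  destruct (Bd_tame _ _ (Tame_fA j Hj)) as [B [HB [Hc Hb]]].
  apply (Ev_J R0 sg HR0 Hsg T HT (ep j) B mu); auto using ep_pos, Hmu.
Qed.

Lemma vA_dt : is_derive (fun s => vA j s x) t ((vS j t x - ep j * vA j t x) / t).
Proof. apply (Ev_J R0 sg HR0 Hsg T HT (ep j) 1 mu); auto using ep_pos, Hmu; try apply BdU. lra. Qed.

Lemma vkap_dt : is_derive (fun s => vkap j s x) t (vB j t x / t).
Proof.
  destruct (Bd_tame _ _ (Tame_fB j Hj)) as [B [HB [Hc Hb]]].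
  replace (vB j t x / t) with ((vB j t x - 0 * vkap j t x) / t) by lra.
  apply (Ev_J R0 sg HR0 Hsg T HT 0 B mu); auto using Hmu. lra.
Qed.

Lemma vB_dt : is_derive (fun s => vB j s x) t ((vR j t x - 2 * k0 j * vB j t x) / t).
Proof. apply (Ev_J R0 sg HR0 Hsg T HT (2 * k0 j) 1 mu); auto using k0_pos, Hmu; try apply BdU. lra. Qed.

Lemma vE_dt : is_derive (fun s => vE j s x) t (vX j t x / t).
Proof.
  replace (vX j t x / t) with ((vX j t x - 0 * vE j t x) / t) by lra.
  apply (Ev_J R0 sg HR0 Hsg T HT 0 1 mu); try apply BdU; lra.
Qed.

Lemma vpi_dx : is_derive (fun y => vpi j t y) x (vpix j t x).
Proof. apply (Ev_dx R0 sg HR0 Hsg T); auto. okt. Qed.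

Lemma vkap_dx : is_derive (fun y => vkap j t y) x (vkapx j t x).
Proof. apply (Ev_dx R0 sg HR0 Hsg T); auto. okt. Qed.

(** Multiplication by the constant [n + 1] commutes with the inverse, by uniqueness of the
    primitive. Outside [(0, T)] the function [prim] is arbitrary, hence the second alternative. *)
Lemma cdx_J a u c : 0 <= a -> Ct T u -> (exists B, 0 <= B /\ Bd R0 sg T B mu u) ->
  forall n, cdx (Jc T a u) n c = Jc T a (cdx u) n c \/ ~ 0 < c < T.
Proof.
  intros Ha Hc [B [HB Hb]] n. destruct (Rlt_le_dec 0 c) as [H1|H1]; try lra.
  destruct (Rlt_le_dec c T) as [H2|H2]; try lra. left.
  unfold cdx, Jc. set (N := INR (S n)).
  assert (Hok : okf T (u (S n))) by (apply (okf_Bd R0 sg HR0 Hsg T B mu); auto using Hmu).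
  assert (Hok2 : okf T (fun s => N * u (S n) s)).
  { destruct Hok as [Ho1 [KK [pp [H3 [H4 H5]]]]]. split.
    - intros s Hs. apply Rcont_mult; [apply Rcont_const | auto].
    - exists (Rabs N * KK), pp. split; [pos |]. split; auto.
      intros s Hs. rewrite Rmult_assoc. pos. }
  unfold Jf. rewrite Rmult_comm, Rmult_assoc. f_equal. rewrite Rmult_comm.
  destruct (prim_spec T _ (okf_Rpower T a _ HT Ha Hok)) as [P1 P2].
  destruct (prim_spec T _ (okf_Rpower T a _ HT Ha Hok2)) as [P3 P4].
  apply (prim_unique T (fun s => N * prim T (fun s => Rpower s a * u (S n) s) s) _ (fun s => Rpower s a * (N * u (S n) s) / s)); auto.
  - intros s Hs. evar_last. apply is_derive_scal. apply P1, Hs. lra.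
  - intros e He. set (M := Rabs N + 1). assert (HM : 0 < M) by (unfold M; assert (H := Rabs_pos N); lra).
    destruct (P2 (e / M)) as [d [Hd Hd2]]; [pos |]. exists d. split; auto. intros s Hs.
    specialize (Hd2 s). apply Rlt_div_r in Hd2; auto. rewrite Rabs_mult.
    assert (H := Rabs_pos (prim T (fun s0 => Rpower s0 a * u (S n) s0) s)). unfold M in Hd2. nra.
Qed.

Lemma Ev_ddJ e u : 0 <= e -> Tm mu u -> Okk (Jc T e (u T U)) ->
  is_derive (fun y => Ev (cdx (Jc T e (u T U))) t y) x (Ev (cdx (Jc T e (cdx (u T U)))) t x).
Proof.
  intros He Hu Hok. rewrite (Ev_ext _ (cdx (cdx (Jc T e (u T U))))).
  - apply (Ev_dx2 R0 sg HR0 Hsg T); auto.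
  - intros n. unfold cdx at 1 3. f_equal. destruct (Bd_tame _ _ Hu) as [B [HB [Hc Hb]]].
    destruct (cdx_J e (u T U) t He Hc (ex_intro _ B (conj HB Hb)) (S n)) as [H|H]; lra.
Qed.

Lemma vpix_dx : is_derive (fun y => vpix j t y) x (vpixx j t x).
Proof. apply (Ev_ddJ (ep j) (fun T U => fA T U j)); auto using ep_pos, Tame_fA. exact (Ok_tame _ _ (Tame_fpi j Hj)). Qed.

Lemma vkapx_dx : is_derive (fun y => vkapx j t y) x (vkapxx j t x).
Proof. apply (Ev_ddJ 0 (fun T U => fB T U j)); auto using Tame_fB; [lra|]. exact (Ok_tame _ _ (Tame_fkap j Hj)). Qed.

End Point.

(* What [small_analytic] needs, uniformly in [x]. *)
Definition Gd (f : R -> R -> R) : Prop :=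
  (forall t x0 r, 0 < t < T -> 0 < r -> r * (3 * R0) <= 1 -> analytic_on (fun y => f t (y - x0)) (x0 - r) (x0 + r)) /\
  (forall t x, 0 < t < T -> inr x -> continuous (fun s => f s x) t) /\
  (exists C p, 0 < p /\ forall t x, 0 < t < T -> inr x -> Rabs (f t x) <= C * Rpower t p).

Lemma Gd_tame p F : 0 < p -> Tm p F -> Gd (Ev (F T U)).
Proof.
  intros Hp HF. destruct (Bd_tame _ _ HF) as [B [HB [Hc Hb]]].
  assert (Hok := Ok_tame _ _ HF). split; [|split].
  - intros. apply (Ev_analytic R0 sg HR0 Hsg T); auto.
  - intros. apply (Ev_cont_t R0 sg HR0 Hsg T); auto.
  - exists B, p. split; auto. intros. apply (Ev_bound R0 sg HR0 Hsg T); auto.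
Qed.

Lemma Gd_vpi j : (j <= m)%nat -> Gd (vpi j).
Proof. intros Hj. exact (Gd_tame _ _ Hmu (Tame_fpi j Hj)). Qed.
Lemma Gd_vkap j : (j <= m)%nat -> Gd (vkap j).
Proof. intros Hj. exact (Gd_tame _ _ Hmu (Tame_fkap j Hj)). Qed.
Lemma Gd_vB j : (j <= m)%nat -> Gd (vB j).
Proof. intros Hj. exact (Gd_tame _ _ Hmu (Tame_fB j Hj)). Qed.
Lemma Gd_vE j : (j <= m)%nat -> Gd (vE j).
Proof. intros Hj. exact (Gd_tame _ _ Hmu (Tame_fE j Hj)). Qed.

Lemma Gd_ext f g : (forall t x, 0 < t < T -> inr x -> f t x = g t x) -> Gd f -> Gd g.
Proof.
  intros He [H1 [H2 [C [p [Hp H3]]]]]. split; [|split].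
  - intros t x0 r Ht Hr Hr2. apply analytic_ext with (fun y => f t (y - x0)); auto.
    intros y Hy. apply He; auto. assert (Rabs (y - x0) < r) by (apply Rabs_def1; lra). nra.
  - intros t x Ht Hx. apply continuous_ext_loc with (fun s => f s x); auto.
    apply filter_imp with (2 := locally_itv 0 T t Ht). auto.
  - exists C, p. split; auto. intros. rewrite <- He; auto.
Qed.

Lemma Gd_Dpi j : (j <= m)%nat -> Gd (fun t x => vA j t x - ep j * vpi j t x).
Proof.
  intros. apply Gd_ext with (Ev (cadd (fA T U j) (cmul (cst (- ep j)) (fpi T U j)))).
  - intros. rewrite (Ev_add R0 sg HR0 Hsg T) by (assumption || okt).
    rewrite (Ev_mul R0 sg HR0 Hsg T) by (assumption || okt). rewrite Ev_cst. unfold vA, vpi. ring.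
  - apply (Gd_tame mu (fun T U => cadd (fA T U j) (cmul (cst (- ep j)) (fpi T U j)))); auto using Hmu.
    tadd. apply Tame_fA; auto. tw; [|tmul; [apply Tame_cst | apply Tame_fpi; auto]]. lra.
Qed.

Lemma Gd_tpix j : (j <= m)%nat -> Gd (fun t x => t * vpix j t x).
Proof.
  intros. apply Gd_ext with (Ev (cmul (tp 1) (fdpi T U j))).
  - intros. rewrite (Ev_mul R0 sg HR0 Hsg T) by (assumption || okt).
    rewrite Ev_tp, Rpower_1 by lra. auto.
  - apply (Gd_tame (1 + (mu - sg)) (fun T U => cmul (tp 1) (fdpi T U j))); [lra|].
    tmul; [apply Tame_tp | apply Tame_fdpi; auto].
Qed.

Lemma Gd_tkapx j : (j <= m)%nat -> Gd (fun t x => t * vkapx j t x).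
Proof.
  intros. apply Gd_ext with (Ev (cmul (tp 1) (fdkap T U j))).
  - intros. rewrite (Ev_mul R0 sg HR0 Hsg T) by (assumption || okt).
    rewrite Ev_tp, Rpower_1 by lra. auto.
  - apply (Gd_tame (1 + (mu - sg)) (fun T U => cmul (tp 1) (fdkap T U j))); [lra|].
    tmul; [apply Tame_tp | apply Tame_fdkap; auto].
Qed.

Definition vTheta j t x := sum_f_R0 (fun i => Rpower t (ep i) * vpi i t x) m + Rpower t (ep j) * vpi j t x.

Lemma is_derive_sum f df n t : (forall i, (i <= n)%nat -> is_derive (f i) t (df i t)) ->
  is_derive (fun s => sum_f_R0 (fun i => f i s) n) t (sum_f_R0 (fun i => df i t) n).
Proof.
  induction n; intros H. apply H; lia.
  apply (@is_derive_plus R_AbsRing R_NormedModule (fun s => sum_f_R0 (fun i => f i s) n) (f (S n))); auto.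
Qed.

Lemma vpi_term_dt j t x : (j <= m)%nat -> 0 < t < T -> inr x ->
  is_derive (fun s => Rpower s (ep j) * vpi j s x) t (Rpower t (ep j) * vA j t x / t).
Proof.
  intros. evar_last.
  - apply is_derive_Rmult.
    apply is_derive_Rpower_t; lra. apply vpi_dt; auto.
  - lra.
Qed.

Lemma vTheta_dt j t x : (j <= m)%nat -> 0 < t < T -> inr x ->
  is_derive (fun s => vTheta j s x) t (vTh j t x / t).
Proof.
  intros. unfold vTh. rewrite Rdiv_plus_distr.
  apply (@is_derive_plus R_AbsRing R_NormedModule (fun s => sum_f_R0 (fun i => Rpower s (ep i) * vpi i s x) m)).
  - unfold Rdiv. rewrite Rmult_comm, scal_sum.
    apply (is_derive_sum (fun i s => Rpower s (ep i) * vpi i s x) (fun i t => Rpower t (ep i) * vA i t x * / t)).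
    intros. apply vpi_term_dt; auto.
  - apply vpi_term_dt; auto.
Qed.

Lemma lim0_plus f g : lim0 f -> lim0 g -> lim0 (fun t => f t + g t).
Proof.
  intros Hf Hg e He. destruct (lim0_minus f (fun t => - g t) Hf (lim0_opp g Hg) e He) as [d [Hd H]].
  exists d. split; auto. intros t. replace (f t + g t) with (f t - - g t) by lra. auto.
Qed.

Lemma lim0_sum f n : (forall i, (i <= n)%nat -> lim0 (f i)) -> lim0 (fun t => sum_f_R0 (fun i => f i t) n).
Proof.
  induction n; intros H. apply H; lia. apply lim0_plus; auto.
Qed.

Lemma Gd_lim0 f x : Gd f -> inr x -> lim0 (fun t => f t x).
Proof.
  intros [_ [_ [C [p [Hp H]]]]] Hx. apply (lim0_le _ (fun t => C * Rpower t p) T); [lra| |apply lim0_Rpower; auto].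
  auto.
Qed.

Lemma lim0_scal_Rpower f p : 0 <= p -> lim0 f -> lim0 (fun t => Rpower t p * f t).
Proof.
  intros Hp Hf e He. destruct (Hf e He) as [d [Hd H]]. exists (Rmin d 1). split; [pos |].
  intros t. mins.
  rewrite Rabs_mult, Rabs_pos_eq by pos.
  assert (H3 := Rpower_le1 t p). specialize (H t).
  assert (H5 := Rabs_pos (f t)). nra.
Qed.

Lemma lim0_vTheta j x : (j <= m)%nat -> inr x -> lim0 (fun t => vTheta j t x).
Proof.
  intros.
  apply lim0_plus.
  - apply lim0_sum. intros.
    apply lim0_scal_Rpower; auto using ep_pos. apply Gd_lim0; auto using Gd_vpi.
  - apply lim0_scal_Rpower; auto using ep_pos. apply Gd_lim0; auto using Gd_vpi.
Qed.

(** The product of [1 + E] and [exp (2 Theta)] has zero [t]-derivative, by the equation of [E], and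
    tends to 1 at [0+] because [E] and [Theta] tend to zero. So the unknown [E], introduced
    independently, has the intended meaning. *)
Lemma vE_exp j t x : (j <= m)%nat -> 0 < t < T -> inr x -> 1 + vE j t x = exp (-2 * vTheta j t x).
Proof.
  intros Hj Ht Hx.
  set (F := fun s => (1 + vE j s x) * exp (2 * vTheta j s x)).
  assert (HF : forall s, 0 < s < T -> is_derive F s 0).
  { intros s Hs.
    assert (H1 : is_derive (fun s => vE j s x) s (vX j s x / s)) by (apply vE_dt; auto).
    rewrite vX_eq in H1 by pos.
    assert (H2 := vTheta_dt).
    assert (H3 : is_derive (fun s => 1 + vE j s x) s (-2 * vTh j s x * (1 + vE j s x) / s)).
    { evar_last. apply (@is_derive_plus R_AbsRing R_NormedModule (fun _ => 1) (fun s => vE j s x)).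
      apply (@is_derive_const R_AbsRing R_NormedModule). exact H1. apply Rplus_0_l. }
    assert (H4 : is_derive (fun s => exp (2 * vTheta j s x)) s (2 * (vTh j s x / s) * exp (2 * vTheta j s x))).
    { apply (is_derive_comp exp).
      apply is_derive_Reals, derivable_pt_lim_exp. apply is_derive_scal. auto. }
    evar_last. eapply is_derive_Rmult; eauto. lra. }
  assert (Hlim : lim0 (fun s => F s - 1)).
  { assert (Hexp : lim0 (fun s => exp (2 * vTheta j s x) - 1)).
    { intros e He.
      assert (Hc : continuous exp 0) by (apply (is_derive_cont _ _ (exp 0)), is_derive_Reals, derivable_pt_lim_exp).
      destruct (proj1 (continuous_eps _ _) Hc e He) as [d [Hd H]].
      destruct (lim0_vTheta j x Hj Hx (d / 2)) as [d2 [Hd2 H2]]; [lra|]. exists d2. split; auto.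
      intros s Hs. rewrite <- exp_0. apply H. rewrite Rminus_0_r, Rabs_mult, Rabs_pos_eq by lra. specialize (H2 s). lra. }
    intros e He. destruct (Hexp (Rmin (e / 4) 1)) as [d1 [Hd1 H1]]; [pos |].
    destruct (Gd_lim0 _ x (Gd_vE j Hj) Hx (e / 4)) as [d2 [Hd2 H2]]; [lra|].
    exists (Rmin d1 d2). split; [pos |]. intros s Hs.
    specialize (H1 s). specialize (H2 s).
    mins.
    unfold F. set (z := exp (2 * vTheta j s x)) in *.
    replace ((1 + vE j s x) * z - 1) with (vE j s x * z + (z - 1)) by lra.
    eapply Rle_lt_trans; [apply Rabs_triang|]. rewrite Rabs_mult.
    assert (Hz : Rabs z < 2). { apply Rabs_def1; apply Rabs_def2 in H1; lra. }
    assert (H6 := Rabs_pos z). nra. }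
  assert (Hconst : F t = 1).
  {
    assert (H0 : forall s, 0 < s < T -> F s - 1 = 0).
    { apply (prim_unique T (fun s => F s - 1) (fun _ => 0) (fun _ => 0)); auto.
      - intros s Hs. evar_last. apply (@is_derive_minus R_AbsRing R_NormedModule F (fun _ => 1)).
        apply HF, Hs. apply (@is_derive_const R_AbsRing R_NormedModule). unfold minus, plus, opp, zero; simpl. ring.
      - intros. apply (@is_derive_const R_AbsRing R_NormedModule).
      - exists 1. split; [lra|]. rewrite Rabs_R0; auto. }
    specialize (H0 t). lra. }
  unfold F in Hconst. replace (-2 * vTheta j t x) with (- (2 * vTheta j t x)) by lra. rewrite exp_Ropp.
  assert (Hp := exp_pos (2 * vTheta j t x)). apply Rmult_eq_reg_r with (exp (2 * vTheta j t x)); [|lra].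
  rewrite Rinv_l; lra.
Qed.

End Solution.

End System.

(** * Existence of the remainder fields near theta_0 *)

Definition wsum (m : nat) (ep : nat -> R) (f : nat -> R -> R -> R) (j : nat) (t x : R) : R :=
  sum_f_R0 (fun i => Rpower t (ep i) * f i t x) m + Rpower t (ep j) * f j t x.

Definition Wf (w wx dk t : R) : R := t * wx + t * ln t * (2 * dk * w).
Definition Vf (w b k : R) : R := 2 * (k * w) + b.

(** [PhiS] as an expression in functions, with [1 + E] replaced by [exp (-2 Theta)]; [rhsR] does the
    same for [PhiR0] and [PhiR]. These two are the interface between the fixed point and the
    differential equations. *)
Definition rhsS (m : nat) (ep : nat -> R) (f0 f1 g0 K S1 : nat -> R -> R) (pi kap B w wx pixx : nat -> R -> R -> R)
    (j : nat) (t x : R) : R :=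
  let W := Wf (w j t x) (wx j t x) (Derive (K j) x) t in
  let V := Vf (w j t x) (B j t x) (K j x) in
  let y := exp (-2 * S1 j x) * exp (-2 * wsum m ep pi j t x) in
  Rpower t 2 * pixx j t x
  + Rpower t (2 - ep j) * ln t * Derive (Derive (f0 j)) x
  + Rpower t (2 - ep j) * Derive (Derive (f1 j)) x
  + -1/2 * y * (Rpower t (- ep j) * Rpower t (2 * K j x)) * (V * V - W * W)
  + y * Rpower t (1 - ep j) * Derive (g0 j) x * W
  + 1/2 * y * (Rpower t (2 - ep j) * Rpower t (-2 * K j x)) * (Derive (g0 j) x * Derive (g0 j) x).

Definition rhsR (m : nat) (ep : nat -> R) (g0 K S1 : nat -> R -> R) (k0 : nat -> R)
    (A pix B w wx wxx : nat -> R -> R -> R) (j : nat) (t x : R) : R :=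
  let W := Wf (w j t x) (wx j t x) (Derive (K j) x) t in
  let V := Vf (w j t x) (B j t x) (K j x) in
  let psx := ln t * Derive (K j) x + Derive (S1 j) x + wsum m ep pix j t x in
  -2 * (K j x - k0 j) * B j t x
  + (Rpower t 2 * wxx j t x
  + Rpower t 2 * ln t * (4 * Derive (K j) x * wx j t x)
  + Rpower t 2 * ln t * (2 * Derive (Derive (K j)) x * w j t x)
  + Rpower t 2 * ln t * ln t * (4 * Derive (K j) x * Derive (K j) x * w j t x)
  + Rpower t 2 * Rpower t (-2 * K j x) * Derive (Derive (g0 j)) x
  + 2 * wsum m ep A j t x * V
  + -2 * t * psx * W
  + -2 * (Rpower t 2 * Rpower t (-2 * K j x)) * psx * Derive (g0 j) x).

Definition tot (m : nat) (f : nat -> R -> R) (j : nat) (x : R) : R := sum_f_R0 (fun i => f i x) m + f j x.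

Lemma PSeries_sum a m x : (forall i, (i <= m)%nat -> Rbar_lt (Rabs x) (CV_radius (a i))) ->
  PSeries (fun n => sum_f_R0 (fun i => a i n) m) x = sum_f_R0 (fun i => PSeries (a i) x) m /\
  ex_pseries (fun n => sum_f_R0 (fun i => a i n) m) x.
Proof.
  induction m; intros H.
  - split; auto. apply CV_radius_inside, H; lia.
  - destruct IHm as [H1 H2]; auto.
    assert (H3 : ex_pseries (a (S m)) x) by (apply CV_radius_inside, H; lia).
    split.
    + change (PSeries (PS_plus (fun n => sum_f_R0 (fun i => a i n) m) (a (S m))) x =
        sum_f_R0 (fun i => PSeries (a i) x) m + PSeries (a (S m)) x).
      rewrite PSeries_plus, H1; auto.
    + apply (ex_pseries_plus (fun n => sum_f_R0 (fun i => a i n) m)); auto.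
Qed.

Lemma is_derive_shift (f : R -> R) x0 y l : is_derive f (y - x0) l -> is_derive (fun y => f (y - x0)) y l.
Proof.
  intros H. evar_last. apply is_derive_comp. exact H. auto_derive; auto.
  unfold scal; simpl; unfold mult; simpl. ring.
Qed.

Lemma Derive_of_PSeries f c x0 r : (forall y, Rabs (y - x0) < r -> f y = PSeries c (y - x0)) ->
  (forall y, Rabs (y - x0) < r -> Rbar_lt (Rabs (y - x0)) (CV_radius c)) ->
  forall y, Rabs (y - x0) < r -> Derive f y = PSeries (PS_derive c) (y - x0).
Proof.
  intros Hf Hc y Hy. apply is_derive_unique.
  apply is_derive_ext_loc with (fun y => PSeries c (y - x0)).
  - apply filter_imp with (2 := locally_absball x0 r y Hy). symmetry. auto.
  - apply is_derive_shift, is_derive_PSeries. auto.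
Qed.

Lemma sum_bcx R1 a m : (forall i, (i <= m)%nat -> Bcx R1 (a i)) ->
  Bcx R1 (fun n => sum_f_R0 (fun i => a i n) m).
Proof.
  induction m; intros H. apply H; lia.
  destruct IHm as [K1 [HK1 H1]]; auto. destruct (H (S m) (le_n _)) as [K2 [HK2 H2]].
  exists (K1 + K2). split; [lra|]. apply Bc_plus; auto.
Qed.

Lemma Bc2_of R0 R1 c : 0 < R1 -> 4 * R1 <= R0 -> Bcx R1 c -> Bc2 R0 c.
Proof.
  intros HR1 HR [K [HK H]].
  assert (H1 := Bc_derive R1 K c HR1 HK H).
  assert (H2 := Bc_derive (2 * R1) (K * R1) _ ltac:(lra) ltac:(nra) H1).
  repeat split.
  - exists K. split; auto. apply Bc_le with R1; auto; lra.
  - exists (K * R1). split; [nra|]. apply Bc_le with (2 * R1); auto; nra.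
  - exists (K * R1 * (2 * R1)). split; [pos |]. apply Bc_le with (2 * (2 * R1)); pos.
Qed.

Lemma Gd_small R0 T f x0 r : 0 < R0 -> 0 < T -> 0 < r -> r * (3 * R0) <= 1 -> Gd R0 T f ->
  small_analytic (fun t y => f t (y - x0)) T (x0 - r) (x0 + r).
Proof.
  intros HR0 HT Hr Hr2 [H1 [H2 [C [p [Hp H3]]]]].
  assert (Hin : forall y, x0 - r < y < x0 + r -> Rabs (y - x0) * (3 * R0) < 1).
  { intros y Hy. assert (Rabs (y - x0) < r) by (apply Rabs_def1; lra). nra. }
  split; [|split].
  - auto.
  - auto.
  - intros e He. destruct (lim0_Rpower C p Hp e He) as [d [Hd H]]. exists d. split; auto.
    intros. eapply Rle_lt_trans; [pos |].
    eapply Rle_lt_trans; [apply Rle_abs|]. auto.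
Qed.

(** The constants depend on each other in one direction: the radius [c0] of the data, the [gap] in
    the conditions on [ep], a radius parameter [R0] adapted to both, and the time [T] of the
    contraction. *)
Lemma fields_exist m ep f0 f1 g0 g1 th0 rho : 0 < rho ->
  (forall j, (j <= m)%nat -> analytic_on (f0 j) (th0 - rho) (th0 + rho) /\ analytic_on (f1 j) (th0 - rho) (th0 + rho) /\
     analytic_on (g0 j) (th0 - rho) (th0 + rho) /\ analytic_on (g1 j) (th0 - rho) (th0 + rho)) ->
  (forall j, (j <= m)%nat -> 0 < ep j /\ ep j < 2 * tot m f0 j th0 /\ ep j < 2 * (1 - tot m f0 j th0)) ->
  exists (T r : R) (pi A Sx pix pixx kap B Rx kapx kapxx : nat -> R -> R -> R),
  0 < T <= 1 /\ 0 < r <= rho /\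
  forall j, (j <= m)%nat ->
    (small_analytic (pi j) T (th0 - r) (th0 + r) /\
     small_analytic (fun t x => A j t x - ep j * pi j t x) T (th0 - r) (th0 + r) /\
     small_analytic (fun t x => t * pix j t x) T (th0 - r) (th0 + r) /\
     small_analytic (kap j) T (th0 - r) (th0 + r) /\
     small_analytic (B j) T (th0 - r) (th0 + r) /\
     small_analytic (fun t x => t * kapx j t x) T (th0 - r) (th0 + r)) /\
    forall t x, 0 < t < T -> th0 - r < x < th0 + r ->
      (is_derive (fun s => pi j s x) t ((A j t x - ep j * pi j t x) / t) /\
       is_derive (fun s => A j s x) t ((Sx j t x - ep j * A j t x) / t) /\
       is_derive (fun y => pi j t y) x (pix j t x) /\
       is_derive (fun y => pix j t y) x (pixx j t x)) /\
      (is_derive (fun s => kap j s x) t (B j t x / t) /\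
       is_derive (fun s => B j s x) t ((Rx j t x - 2 * tot m f0 j th0 * B j t x) / t) /\
       is_derive (fun y => kap j t y) x (kapx j t x) /\
       is_derive (fun y => kapx j t y) x (kapxx j t x)) /\
      Sx j t x = rhsS m ep f0 f1 g0 (tot m f0) (tot m f1) pi kap B (fun j t x => g1 j x + kap j t x)
        (fun j t x => Derive (g1 j) x + kapx j t x) pixx j t x /\
      Rx j t x = rhsR m ep g0 (tot m f0) (tot m f1) (fun j => tot m f0 j th0) A pix B
        (fun j t x => g1 j x + kap j t x) (fun j t x => Derive (g1 j) x + kapx j t x)
        (fun j t x => Derive (Derive (g1 j)) x + kapxx j t x) j t x.
Proof.
  intros Hrho Han Hep0.
  assert (Hin0 : th0 - rho < th0 < th0 + rho) by lra.
  assert (Hex : forall j, exists q : (nat -> R) * (nat -> R) * (nat -> R) * (nat -> R), (j <= m)%nat ->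
    exists c, 0 < c /\ forall c', 0 < c' <= c ->
      (forall y, Rabs (y - th0) < c' -> f0 j y = PSeries (fst (fst (fst q))) (y - th0) /\
         f1 j y = PSeries (snd (fst (fst q))) (y - th0) /\
         g0 j y = PSeries (snd (fst q)) (y - th0) /\ g1 j y = PSeries (snd q) (y - th0)) /\
      Bcx (/ c') (fst (fst (fst q))) /\ Bcx (/ c') (snd (fst (fst q))) /\
      Bcx (/ c') (snd (fst q)) /\ Bcx (/ c') (snd q)).
  { intros j. destruct (Compare_dec.le_lt_dec j m) as [Hj|Hj].
    2:{ exists ((fun _ => 0), (fun _ => 0), (fun _ => 0), (fun _ => 0)). lia. }
    destruct (Han j Hj) as [H1 [H2 [H3 H4]]].
    destruct (analytic_local _ _ _ th0 H1 Hin0) as [r1 [c1 [Hr1 [Hc1 He1]]]].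
    destruct (analytic_local _ _ _ th0 H2 Hin0) as [r2 [c2 [Hr2 [Hc2 He2]]]].
    destruct (analytic_local _ _ _ th0 H3 Hin0) as [r3 [c3 [Hr3 [Hc3 He3]]]].
    destruct (analytic_local _ _ _ th0 H4 Hin0) as [r4 [c4 [Hr4 [Hc4 He4]]]].
    exists (c1, c2, c3, c4).
    destruct (Bc_of_CV c1 r1 Hr1 Hc1) as [K1 [HK1 HB1]]. destruct (Bc_of_CV c2 r2 Hr2 Hc2) as [K2 [HK2 HB2]].
    destruct (Bc_of_CV c3 r3 Hr3 Hc3) as [K3 [HK3 HB3]]. destruct (Bc_of_CV c4 r4 Hr4 Hc4) as [K4 [HK4 HB4]].
    set (r := Rmin (Rmin r1 r2) (Rmin r3 r4)).
    assert (Hr : 0 < r) by (repeat apply Rmin_glb_lt; lra). mins.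
    (* The quarter meets the threshold [4 / r <= R0] of [Bc_of_CV] with [R0 = / c']. *)
    exists (r / 4). split; [lra|]. intros c' Hc'.
    assert (Hi : forall ri, r <= ri -> 4 / ri <= / c').
    { intros ri Hri. replace (4 / ri) with (/ (ri / 4)) by (field; lra). apply Rinv_le_contravar; lra. }
    splits.
    - pos.
    - exists K1. pos.
    - exists K2. pos.
    - exists K3. pos.
    - exists K4. pos. }
  destruct (choice_fun _ Hex) as [q Hq].
  set (a0 := fun j => fst (fst (fst (q j)))). set (a1 := fun j => snd (fst (fst (q j)))).
  set (b0 := fun j => snd (fst (q j))). set (b1 := fun j => snd (q j)).
  destruct (fin_ev m _ Hq) as [c0 [Hc0 Hc0b]]. specialize (Hc0b c0 ltac:(lra)).
  set (R1 := / c0). assert (HR1 : 0 < R1) by (apply Rinv_0_lt_compat; auto).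
  assert (Hdat1 : forall j, (j <= m)%nat ->
    Bcx R1 (a0 j) /\ Bcx R1 (a1 j) /\
    Bcx R1 (b0 j) /\ Bcx R1 (b1 j)).
  { apply Hc0b. }
  assert (Hval : forall j y, (j <= m)%nat -> Rabs (y - th0) < c0 ->
    f0 j y = PSeries (a0 j) (y - th0) /\ f1 j y = PSeries (a1 j) (y - th0) /\
    g0 j y = PSeries (b0 j) (y - th0) /\ g1 j y = PSeries (b1 j) (y - th0)).
  { intros j y Hj Hy. apply (Hc0b j Hj), Hy. }
  assert (Hsum : forall a j, (j <= m)%nat -> (forall i, (i <= m)%nat -> Bcx R1 (a i)) ->
    Bcx R1 (fun n => sum_f_R0 (fun i => a i n) m + a j n)).
  { intros a j Hj Ha. destruct (sum_bcx R1 a m Ha) as [K [HK H]]. destruct (Ha j Hj) as [K' [HK' H']].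
    exists (K + K'). split; [lra|]. apply Bc_plus; auto. }
  assert (Hkc : forall j, (j <= m)%nat -> Bcx R1 (kc m a0 j)).
  { intros j Hj. apply Hsum; auto. apply Hdat1. }
  assert (Hsc : forall j, (j <= m)%nat -> Bcx R1 (sc m a1 j)).
  { intros j Hj. apply Hsum; auto. apply Hdat1. }
  assert (HCV : forall c y, Bcx R1 c -> Rabs (y - th0) < c0 -> Rbar_lt (Rabs (y - th0)) (CV_radius c)).
  { intros c y [K [HK H]] Hy. apply (Bc_CV R1 K); auto. apply Rlt_div_l; auto. lra. }
  assert (Htot : forall f a, (forall i y, (i <= m)%nat -> Rabs (y - th0) < c0 -> f i y = PSeries (a i) (y - th0)) ->
    (forall i, (i <= m)%nat -> Bcx R1 (a i)) ->
    forall j y, (j <= m)%nat -> Rabs (y - th0) < c0 -> tot m f j y = PSeries (fun n => sum_f_R0 (fun i => a i n) m + a j n) (y - th0)).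
  { intros f a Hfa Ha j y Hj Hy. unfold tot. destruct (PSeries_sum a m (y - th0)) as [H1 H2]; auto.
    change (fun n => sum_f_R0 (fun i => a i n) m + a j n) with (PS_plus (fun n => sum_f_R0 (fun i => a i n) m) (a j)).
    rewrite PSeries_plus, H1; auto using CV_radius_inside. f_equal; [apply sum_eq; intros i Hi|]; auto. }
  assert (Htot0 : forall j y, (j <= m)%nat -> Rabs (y - th0) < c0 -> tot m f0 j y = PSeries (kc m a0 j) (y - th0)).
  { apply Htot; [apply Hval | apply Hdat1]. }
  assert (Htot1 : forall j y, (j <= m)%nat -> Rabs (y - th0) < c0 -> tot m f1 j y = PSeries (sc m a1 j) (y - th0)).
  { apply Htot; [apply Hval | apply Hdat1]. }
  assert (Hk0 : forall j, (j <= m)%nat -> tot m f0 j th0 = k0 m a0 j).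
  { intros j Hj. rewrite Htot0; auto. rewrite Rminus_diag. apply PSeries_0. rewrite Rminus_diag, Rabs_R0; auto. }
  destruct (fin_ev m (fun j gap => gap <= ep j /\ ep j + gap <= 2 * k0 m a0 j /\ ep j + gap <= 2 - 2 * k0 m a0 j)) as [gap [Hgap Hg1]].
  { intros j Hj. destruct (Hep0 j Hj) as [E1 [E2 E3]]. rewrite Hk0 in E2, E3 by pos.
    exists (Rmin (ep j) (Rmin (2 * k0 m a0 j - ep j) (2 - 2 * k0 m a0 j - ep j))).
    split; [pos |]. intros c' Hc'.
    mins. lra. }
  specialize (Hg1 gap ltac:(lra)).
  destruct (fin_ev m (fun j c => Bc (/ c) (gap / 32) (gk m a0 j))) as [c1 [Hc1 Hg2]].
  { intros j Hj. destruct (Hkc j Hj) as [K [HK H]].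
    exists (Rmin (/ R1) (gap / 32 / (K + 1) / R1)).
    mins.
    split. { pos. }
    intros c' Hc'.
    assert (HR : R1 <= / c'). { rewrite <- (Rinv_inv R1). apply Rinv_le_contravar; lra. }
    apply Bc_le_K with (K * (R1 / (/ c'))); try lra.
    - unfold Rdiv. rewrite Rinv_inv. assert (H2 : c' <= gap / 32 / (K + 1) / R1) by lra.
      apply Rle_div_r in H2; auto. apply Rle_div_r in H2; [|lra].
      nra.
    - apply Bc_small0; auto. intros n. unfold gk, tail0. destruct n; auto.
      rewrite Rabs_R0. pos. }
  (* [c1] makes [k - k(theta_0)] of size [gap / 32]; [c0 / 4] gives [4 R1 <= R0], room for two
     derivatives of the data, each of which doubles the parameter. *)
  set (R0 := / Rmin c1 (c0 / 4)).
  assert (Hmin : 0 < Rmin c1 (c0 / 4)) by pos.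
  mins.
  assert (HR0 : 0 < R0) by (apply Rinv_0_lt_compat; auto).
  assert (HR01 : 4 * R1 <= R0).
  { unfold R1. replace (4 * / c0) with (/ (c0 / 4)) by (field; lra). apply Rinv_le_contravar; lra. }
  assert (Hdat : forall j, (j <= m)%nat -> Bc2 R0 (a0 j) /\ Bc2 R0 (a1 j) /\ Bc2 R0 (b0 j) /\ Bc2 R0 (b1 j) /\ Bc2 R0 (kc m a0 j) /\ Bc2 R0 (sc m a1 j)).
  { intros j Hj. destruct (Hdat1 j Hj) as [D1 [D2 [D3 D4]]].
    repeat (match goal with |- _ /\ _ => split end); apply Bc2_of with R1; auto. }
  assert (Hgk : forall j, (j <= m)%nat -> Bc R0 (gap / 32) (gk m a0 j)) by eauto.
  destruct (Contr_Phi m ep a0 a1 b0 b1 R0 gap HR0 Hgap Hg1 Hdat Hgk) as [T [HT HPhi]].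
  assert (Hsg : 0 < gap / 16) by lra. assert (Hmu : 0 < gap / 2) by lra.
  destruct (fixed_point R0 (gap / 16) HR0 Hsg (gap / 2) Hmu (fun c T U => Phi m ep a0 a1 b0 b1 T U c) T HT HPhi) as [U [HU Hfix]].
  (* For [t <= 1] the majorant satisfies [ZZ t <= 3 R0], so all series converge for
     [Rabs (x - th0) < / (3 R0)]. *)
  set (r := Rmin rho (/ (3 * R0))).
  assert (H3R : 0 < / (3 * R0)) by pos.
  assert (Hr : 0 < r) by (apply Rmin_glb_lt; lra).
  mins.
  assert (Hr3 : r * (3 * R0) <= 1).
  { apply Rle_trans with (/ (3 * R0) * (3 * R0)). apply Rmult_le_compat_r; lra. rewrite Rinv_l; lra. }
  assert (Hrc : r <= c0).
  { eapply Rle_trans; eauto. apply Rle_trans with (/ R1); [|unfold R1; rewrite Rinv_inv; lra].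
    apply Rinv_le_contravar; lra. }
  exists T, r, (fun j t x => vpi ep T U j t (x - th0)), (fun j t x => vA ep T U j t (x - th0)),
    (fun j t x => vS U j t (x - th0)), (fun j t x => vpix ep T U j t (x - th0)), (fun j t x => vpixx ep T U j t (x - th0)),
    (fun j t x => vkap m a0 T U j t (x - th0)), (fun j t x => vB m a0 T U j t (x - th0)),
    (fun j t x => vR U j t (x - th0)), (fun j t x => vkapx m a0 T U j t (x - th0)), (fun j t x => vkapxx m a0 T U j t (x - th0)).
  split; auto. split; auto. intros j Hj. split.
  { assert (HG := fun f => Gd_small R0 T f th0 r HR0 (proj1 HT) Hr Hr3).
    repeat (match goal with |- _ /\ _ => split end).
    - apply HG. apply (Gd_vpi m ep a0 R0 gap); auto.
    - apply (HG (fun t x => vA ep T U j t x - ep j * vpi ep T U j t x)). apply (Gd_Dpi m ep a0 R0 gap); auto.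
    - apply (HG (fun t x => t * vpix ep T U j t x)). apply (Gd_tpix m ep a0 R0 gap); auto.
    - apply HG. apply (Gd_vkap m ep a0 R0 gap); auto.
    - apply HG. apply (Gd_vB m ep a0 R0 gap); auto.
    - apply (HG (fun t x => t * vkapx m a0 T U j t x)). apply (Gd_tkapx m ep a0 R0 gap); auto. }
  intros t x Ht Hx.
  assert (Hxr : Rabs (x - th0) < r) by (apply Rabs_def1; lra).
  assert (Hxc : Rabs (x - th0) < c0) by lra.
  assert (Hxin : Rabs (x - th0) * (3 * R0) < 1) by nra.
  split; [|split].
  { splits.
    - apply (vpi_dt m ep a0 R0 gap); auto.
    - apply (vA_dt m ep a0 R0 gap); auto.
    - apply is_derive_shift. apply (vpi_dx m ep a0 R0 gap); auto.
    - apply is_derive_shift. apply (vpix_dx m ep a0 R0 gap); auto. }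
  { splits.
    - apply (vkap_dt m ep a0 R0 gap); auto.
    - rewrite Hk0 by pos. apply (vB_dt m ep a0 R0 gap); auto.
    - apply is_derive_shift. apply (vkap_dx m ep a0 R0 gap); auto.
    - apply is_derive_shift. apply (vkapx_dx m ep a0 R0 gap); auto. }
  destruct (Hdat1 j Hj) as [D1 [D2 [D3 D4]]].
  assert (HD : forall f c, Bcx R1 c -> (forall y, Rabs (y - th0) < c0 -> f y = PSeries c (y - th0)) ->
    Derive f x = PSeries (PS_derive c) (x - th0) /\ Derive (Derive f) x = PSeries (PS_derive (PS_derive c)) (x - th0)).
  { intros f c Hc Hfc. assert (P := Derive_of_PSeries f c th0 c0). split; auto.
    apply (Derive_of_PSeries _ _ th0 c0); auto. rewrite CV_radius_derive. auto. }
  destruct (HD (f0 j) _ D1) as [_ Q1]; [intros; apply Hval; auto|].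
  destruct (HD (f1 j) _ D2) as [_ Q2]; [intros; apply Hval; auto|].
  destruct (HD (g0 j) _ D3) as [P3 Q3]; [intros; apply Hval; auto|].
  destruct (HD (g1 j) _ D4) as [P4 Q4]; [intros; apply Hval; auto|].
  destruct (HD (tot m f0 j) _ (Hkc j Hj)) as [P5 Q5]; auto.
  destruct (HD (tot m f1 j) _ (Hsc j Hj)) as [P6 _]; auto.
  destruct (Hval j x Hj Hxc) as [V1 [V2 [V3 V4]]].
  split.
  - unfold rhsS, Wf, Vf.
    rewrite P3, P4, P5, Q1, Q2, V4, (Htot0 j x Hj), (Htot1 j x Hj) by lra.
    rewrite (vS_eq m ep a0 a1 b0 b1 R0 gap) with (T := T) by pos.
    rewrite (vE_exp m ep a0 a1 b0 b1 R0 gap) with (T := T) by pos.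
    unfold vV, vW, vw, vwx, vTheta, wsum. ring.
  - unfold rhsR.
    rewrite P3, P4, P5, P6, Q3, Q4, Q5, V4, (Htot0 j x Hj), (Hk0 j Hj) by lra.
    rewrite (vR_eq m ep a0 a1 b0 b1 R0 gap) with (T := T) by pos.
    auto.
Qed.

(** * Verification of the system and of the prescribed form *)

Lemma is_derive_Rplus (f g : R -> R) x df dg :
  is_derive f x df -> is_derive g x dg -> is_derive (fun y => f y + g y) x (df + dg).
Proof. apply (@is_derive_plus R_AbsRing R_NormedModule). Qed.

Lemma is_derive_cst (c x : R) : is_derive (fun _ : R => c) x 0.
Proof. apply (@is_derive_const R_AbsRing R_NormedModule). Qed.

Lemma is_derive_Rscal (f : R -> R) x c df : is_derive f x df -> is_derive (fun y => c * f y) x (c * df).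
Proof. apply is_derive_scal. Qed.

Lemma is_derive_lncst c t : 0 < t -> is_derive (fun s => c * ln s) t (c / t).
Proof. intros H. auto_derive; lra. Qed.

Lemma is_derive_Rpower_x (k : R -> R) t x dk : is_derive k x dk ->
  is_derive (fun y => Rpower t (2 * k y)) x (2 * dk * ln t * Rpower t (2 * k x)).
Proof.
  intros H. unfold Rpower. evar_last.
  - apply is_derive_comp.
    apply is_derive_Reals, derivable_pt_lim_exp.
    apply (is_derive_ext (fun y => ln t * (2 * k y))). intros; apply Rmult_comm.
    apply is_derive_Rscal, is_derive_Rscal, H.
  - unfold scal; simpl; unfold mult; simpl. ring.
Qed.

Lemma is_derive_sumx (f : nat -> R -> R) (df : nat -> R) n x : (forall i, (i <= n)%nat -> is_derive (f i) x (df i)) ->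
  is_derive (fun s => sum_f_R0 (fun i => f i s) n) x (sum_f_R0 df n).
Proof.
  induction n; intros H. apply H; lia.
  apply is_derive_Rplus; auto.
Qed.

Lemma small_analytic_ext (f g : R -> R -> R) T a b :
  (forall t x, 0 < t < T -> a < x < b -> f t x = g t x) -> small_analytic f T a b -> small_analytic g T a b.
Proof.
  intros He [H1 [H2 H3]]. split; [|split].
  - intros t Ht. eapply analytic_ext; auto.
  - intros t x Ht Hx. apply continuous_ext_loc with (fun s => f s x); auto.
    apply filter_imp with (2 := locally_itv 0 T t Ht). auto.
  - intros e He'. destruct (H3 e He') as [d [Hd H]]. exists d. split; auto. intros. rewrite <- He; auto. lra.
Qed.

Lemma Dt_of (f : R -> R -> R) t x l : is_derive (fun s => f s x) t l -> Dt f t x = t * l.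
Proof. intros H. unfold Dt. f_equal. apply is_derive_unique, H. Qed.

Lemma dth_of (f : R -> R -> R) t x l : is_derive (fun y => f t y) x l -> dth f t x = l.
Proof. intros H. apply is_derive_unique, H. Qed.

Section Assembly.
Context (D : nat) (HD : (4 <= D)%nat) (p0 p1 q0 q1 : nat -> R -> R) (eps : nat -> R).
Let m := (D - 4)%nat.
Let ep := fun j => eps (j + 3)%nat.
Let f0 := fun j => p0 (j + 3)%nat.
Let f1 := fun j => p1 (j + 3)%nat.
Let g0 := fun j => q0 (j + 3)%nat.
Let g1 := fun j => q1 (j + 3)%nat.
Let KK := tot m f0.
Let SS := tot m f1.

Context (T a b : R) (HT : 0 < T <= 1).
Context (Han : forall j, (j <= m)%nat -> analytic_on (f0 j) a b /\ analytic_on (f1 j) a b /\ analytic_on (g0 j) a b /\ analytic_on (g1 j) a b).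
Context (pi A Sx pix pixx kap B Rx kapx kapxx : nat -> R -> R -> R).
Context (Hpi : forall j t x, (j <= m)%nat -> 0 < t < T -> a < x < b ->
   is_derive (fun s => pi j s x) t ((A j t x - ep j * pi j t x) / t) /\
   is_derive (fun s => A j s x) t ((Sx j t x - ep j * A j t x) / t) /\
   is_derive (fun y => pi j t y) x (pix j t x) /\
   is_derive (fun y => pix j t y) x (pixx j t x)).
Context (k0 : nat -> R).
Context (Hkap : forall j t x, (j <= m)%nat -> 0 < t < T -> a < x < b ->
   is_derive (fun s => kap j s x) t (B j t x / t) /\
   is_derive (fun s => B j s x) t ((Rx j t x - 2 * k0 j * B j t x) / t) /\
   is_derive (fun y => kap j t y) x (kapx j t x) /\
   is_derive (fun y => kapx j t y) x (kapxx j t x)).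
Let w := fun j t x => g1 j x + kap j t x.
Let wx := fun j t x => Derive (g1 j) x + kapx j t x.
Let wxx := fun j t x => Derive (Derive (g1 j)) x + kapxx j t x.
Context (HS : forall j t x, (j <= m)%nat -> 0 < t < T -> a < x < b ->
   Sx j t x = rhsS m ep f0 f1 g0 KK SS pi kap B w wx pixx j t x).
Context (HR : forall j t x, (j <= m)%nat -> 0 < t < T -> a < x < b ->
   Rx j t x = rhsR m ep g0 KK SS k0 A pix B w wx wxx j t x).

Definition Psol (I : nat) (t x : R) := p0 I x * ln t + p1 I x + Rpower t (eps I) * pi (I - 3)%nat t x.
Definition Qsol (I : nat) (t x : R) := q0 I x + Rpower t (2 * kI D p0 I x) * q1 I x
   + Rpower t (2 * kI D p0 I x) * kap (I - 3)%nat t x.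

Lemma j33 j : (j + 3 - 3)%nat = j. Proof. lia. Qed.

Lemma anD (g : R -> R) x : analytic_on g a b -> a < x < b -> is_derive g x (Derive g x).
Proof. intros H Hx. apply Derive_correct. eapply analytic_ex_derive; eauto. Qed.

Lemma anDD (g : R -> R) x : analytic_on g a b -> a < x < b -> is_derive (Derive g) x (Derive (Derive g) x).
Proof. intros H Hx. apply anD; auto. apply analytic_Derive; auto. Qed.

Lemma tot_dx (f : nat -> R -> R) j x : (j <= m)%nat -> (forall i, (i <= m)%nat -> analytic_on (f i) a b) -> a < x < b ->
  is_derive (tot m f j) x (tot m (fun i => Derive (f i)) j x).
Proof.
  intros Hj Hf Hx. apply is_derive_Rplus.
  - apply is_derive_sumx. intros i Hi. apply anD; auto.
  - apply anD; auto.
Qed.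

Lemma KK_an i : (i <= m)%nat -> analytic_on (f0 i) a b. Proof. intros Hi. apply (Han i Hi). Qed.
Lemma SS_an i : (i <= m)%nat -> analytic_on (f1 i) a b. Proof. intros Hi. apply (Han i Hi). Qed.

Lemma KK_dx j x : (j <= m)%nat -> a < x < b -> is_derive (KK j) x (Derive (KK j) x).
Proof. intros Hj Hx. apply Derive_correct. eexists. apply (tot_dx f0 j x Hj KK_an Hx). Qed.

Lemma SS_dx j x : (j <= m)%nat -> a < x < b -> is_derive (SS j) x (Derive (SS j) x).
Proof. intros Hj Hx. apply Derive_correct. eexists. apply (tot_dx f1 j x Hj SS_an Hx). Qed.

Lemma KK_dxx j x : (j <= m)%nat -> a < x < b -> is_derive (Derive (KK j)) x (Derive (Derive (KK j)) x).
Proof.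
  intros Hj Hx. apply Derive_correct. exists (tot m (fun i => Derive (Derive (f0 i))) j x).
  eapply is_derive_ext_loc.
  - apply filter_imp with (2 := locally_itv a b x Hx). intros y Hy. symmetry. apply is_derive_unique.
    apply (tot_dx f0 j y Hj KK_an Hy).
  - apply tot_dx; auto. intros i Hi. apply analytic_Derive, KK_an, Hi.
Qed.

Lemma kI_KK j x : kI D p0 (j + 3) x = KK j x. Proof. auto. Qed.

Lemma loc_t (t : R) : 0 < t < T -> locally t (fun s => 0 < s < T).
Proof. apply locally_itv. Qed.

Section At.
Context (j : nat) (Hj : (j <= m)%nat).

Lemma P_dt t x : 0 < t < T -> a < x < b ->
  is_derive (fun s => Psol (j + 3) s x) t ((f0 j x + Rpower t (ep j) * A j t x) / t).
Proof.
  intros Ht Hx. unfold Psol. rewrite j33. destruct (Hpi j t x Hj Ht Hx) as [H1 _]. evar_last.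
  - apply is_derive_Rplus.
    + apply is_derive_Rplus. apply is_derive_lncst; lra. apply is_derive_cst.
    + apply is_derive_Rmult. apply is_derive_Rpower_t; lra. eauto.
  - unfold f0, ep. lra.
Qed.

Lemma P_dx t x : 0 < t < T -> a < x < b ->
  is_derive (fun y => Psol (j + 3) t y) x (Derive (f0 j) x * ln t + Derive (f1 j) x + Rpower t (ep j) * pix j t x).
Proof.
  intros Ht Hx. unfold Psol. rewrite j33. destruct (Hpi j t x Hj Ht Hx) as [_ [_ [H1 _]]].
  destruct (Han j Hj) as [A1 [A2 _]].
  apply is_derive_Rplus.
  - apply is_derive_Rplus; [|apply anD; auto].
    rewrite Rmult_comm. eapply is_derive_ext. intros; apply Rmult_comm.
    apply is_derive_Rscal, anD; auto.
  - apply is_derive_Rscal. auto.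
Qed.

Lemma DtP t x : 0 < t < T -> a < x < b -> Dt (Psol (j + 3)) t x = f0 j x + Rpower t (ep j) * A j t x.
Proof.
  intros Ht Hx. rewrite (Dt_of _ _ _ _ (P_dt t x Ht Hx)). field. lra.
Qed.

Lemma dthP t x : 0 < t < T -> a < x < b -> dth (Psol (j + 3)) t x = Derive (f0 j) x * ln t + Derive (f1 j) x + Rpower t (ep j) * pix j t x.
Proof. intros Ht Hx. apply dth_of, P_dx; auto. Qed.

Lemma DtP_dt t x : 0 < t < T -> a < x < b ->
  is_derive (fun s => Dt (Psol (j + 3)) s x) t (Rpower t (ep j) * Sx j t x / t).
Proof.
  intros Ht Hx. eapply is_derive_ext_loc.
  - apply filter_imp with (2 := loc_t t Ht). symmetry. apply DtP; auto.
  - destruct (Hpi j t x Hj Ht Hx) as [_ [H1 _]]. evar_last.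
    + apply is_derive_Rplus. apply is_derive_cst.
      apply is_derive_Rmult. apply is_derive_Rpower_t; lra. eauto.
    + lra.
Qed.

Lemma dthP_dx t x : 0 < t < T -> a < x < b ->
  is_derive (fun y => dth (Psol (j + 3)) t y) x
    (Derive (Derive (f0 j)) x * ln t + Derive (Derive (f1 j)) x + Rpower t (ep j) * pixx j t x).
Proof.
  intros Ht Hx. eapply is_derive_ext_loc.
  - apply filter_imp with (2 := locally_itv a b x Hx). symmetry. apply dthP; auto.
  - destruct (Hpi j t x Hj Ht Hx) as [_ [_ [_ H1]]]. destruct (Han j Hj) as [A1 [A2 _]].
    apply is_derive_Rplus.
    + apply is_derive_Rplus; [|apply anDD; auto].
      rewrite Rmult_comm. eapply is_derive_ext. intros; apply Rmult_comm.
      apply is_derive_Rscal, anDD; auto.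
    + apply is_derive_Rscal. auto.
Qed.

Lemma Qsol_w t x : Qsol (j + 3) t x = g0 j x + Rpower t (2 * KK j x) * w j t x.
Proof. unfold Qsol. rewrite j33, kI_KK. unfold g0, w, g1. ring. Qed.

Lemma w_dt t x : 0 < t < T -> a < x < b -> is_derive (fun s => w j s x) t (B j t x / t).
Proof.
  intros Ht Hx. destruct (Hkap j t x Hj Ht Hx) as [H1 _]. evar_last.
  apply is_derive_Rplus. apply is_derive_cst. exact H1. lra.
Qed.

Lemma w_dx t x : 0 < t < T -> a < x < b -> is_derive (fun y => w j t y) x (wx j t x).
Proof.
  intros Ht Hx. destruct (Hkap j t x Hj Ht Hx) as [_ [_ [H1 _]]]. apply is_derive_Rplus; auto.
  apply anD; auto. apply Han; auto.
Qed.

Lemma wx_dx t x : 0 < t < T -> a < x < b -> is_derive (fun y => wx j t y) x (wxx j t x).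
Proof.
  intros Ht Hx. destruct (Hkap j t x Hj Ht Hx) as [_ [_ [_ H1]]]. apply is_derive_Rplus; auto.
  apply anDD; auto. apply Han; auto.
Qed.

Lemma Q_dt t x : 0 < t < T -> a < x < b ->
  is_derive (fun s => Qsol (j + 3) s x) t (Rpower t (2 * KK j x) * Vf (w j t x) (B j t x) (KK j x) / t).
Proof.
  intros Ht Hx. eapply is_derive_ext.
  { symmetry. apply Qsol_w. }
  evar_last.
  - apply is_derive_Rplus. apply is_derive_cst.
    apply is_derive_Rmult. apply is_derive_Rpower_t; lra. apply w_dt; auto.
  - unfold Vf. lra.
Qed.

Lemma Q_dx t x : 0 < t < T -> a < x < b ->
  is_derive (fun y => Qsol (j + 3) t y) x
    (Derive (g0 j) x + Rpower t (2 * KK j x) * (2 * Derive (KK j) x * ln t * w j t x + wx j t x)).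
Proof.
  intros Ht Hx. apply (is_derive_ext (fun y => g0 j y + Rpower t (2 * KK j y) * w j t y)).
  { symmetry. apply Qsol_w. }
  evar_last.
  - apply is_derive_Rplus. apply anD; auto; apply (Han j Hj).
    apply is_derive_Rmult. apply is_derive_Rpower_x, KK_dx; auto. apply w_dx; auto.
  - lra.
Qed.

Lemma DtQ t x : 0 < t < T -> a < x < b ->
  Dt (Qsol (j + 3)) t x = Rpower t (2 * KK j x) * Vf (w j t x) (B j t x) (KK j x).
Proof. intros Ht Hx. rewrite (Dt_of _ _ _ _ (Q_dt t x Ht Hx)). field. lra. Qed.

Lemma dthQ t x : 0 < t < T -> a < x < b -> dth (Qsol (j + 3)) t x =
  Derive (g0 j) x + Rpower t (2 * KK j x) * (2 * Derive (KK j) x * ln t * w j t x + wx j t x).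
Proof. intros Ht Hx. apply dth_of, Q_dx; auto. Qed.

Lemma DtQ_dt t x : 0 < t < T -> a < x < b ->
  is_derive (fun s => Dt (Qsol (j + 3)) s x) t (Rpower t (2 * KK j x) *
    (2 * KK j x * Vf (w j t x) (B j t x) (KK j x) + 2 * KK j x * B j t x + Rx j t x - 2 * k0 j * B j t x) / t).
Proof.
  intros Ht Hx.
  eapply is_derive_ext_loc.
  - apply filter_imp with (2 := loc_t t Ht). symmetry. apply DtQ; auto.
  - destruct (Hkap j t x Hj Ht Hx) as [_ [H1 _]]. evar_last.
    + apply is_derive_Rmult. apply is_derive_Rpower_t; lra.
      apply is_derive_Rplus.
      apply is_derive_Rscal, is_derive_Rscal, w_dt; auto. eauto.
    + lra.
Qed.

Lemma dthQ_dx t x : 0 < t < T -> a < x < b ->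
  is_derive (fun y => dth (Qsol (j + 3)) t y) x
    (Derive (Derive (g0 j)) x + Rpower t (2 * KK j x) *
      (2 * Derive (KK j) x * ln t * (2 * Derive (KK j) x * ln t * w j t x + wx j t x)
       + 2 * ln t * (Derive (Derive (KK j)) x * w j t x + Derive (KK j) x * wx j t x) + wxx j t x)).
Proof.
  intros Ht Hx.
  apply is_derive_ext_loc with (fun y => Derive (g0 j) y + Rpower t (2 * KK j y) * (2 * ln t * (Derive (KK j) y * w j t y) + wx j t y)).
  - apply filter_imp with (2 := locally_itv a b x Hx). intros y Hy.
    apply (Rplus_eq_reg_l 0). rewrite dthQ by lra. ring.
  - evar_last.
    + apply is_derive_Rplus. apply anDD; auto; apply (Han j Hj).
      apply is_derive_Rmult. apply is_derive_Rpower_x, KK_dx; auto.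
      apply is_derive_Rplus; [|apply wx_dx; auto].
      apply is_derive_Rscal. apply is_derive_Rmult. apply KK_dxx; auto. apply w_dx; auto.
    + lra.
Qed.

Lemma psi_eq t x : Psum D Psol t x + Psol (j + 3) t x = KK j x * ln t + SS j x + wsum m ep pi j t x.
Proof.
  unfold Psum, KK, SS, tot, wsum, Psol. fold m. rewrite j33.
  rewrite (sum_eq _ (fun i => f0 i x * ln t + f1 i x + Rpower t (ep i) * pi i t x)).
  2:{ intros i Hi. rewrite j33. auto. }
  rewrite sum_plus, sum_plus, <- scal_sum. unfold f0, f1, ep. ring.
Qed.

Lemma wsum_dt (f df : nat -> R -> R -> R) t x : (forall i, (i <= m)%nat -> is_derive (fun s => Rpower s (ep i) * f i s x) t (Rpower t (ep i) * df i t x / t)) ->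
  0 < t -> is_derive (fun s => wsum m ep f j s x) t (wsum m ep df j t x / t).
Proof.
  intros H Ht. unfold wsum. rewrite Rdiv_plus_distr.
  apply is_derive_Rplus; auto.
  unfold Rdiv. rewrite Rmult_comm, scal_sum.
  apply is_derive_sumx. auto.
Qed.

Lemma psi_dt t x : 0 < t < T -> a < x < b ->
  is_derive (fun s => Psum D Psol s x + Psol (j + 3) s x) t ((KK j x + wsum m ep A j t x) / t).
Proof.
  intros Ht Hx. eapply is_derive_ext.
  { symmetry; apply psi_eq. }
  rewrite Rdiv_plus_distr. apply is_derive_Rplus.
  - evar_last. apply is_derive_Rplus. apply is_derive_lncst; lra. apply is_derive_cst. lra.
  - apply wsum_dt; [|lra]. intros i Hi. destruct (Hpi i t x Hi Ht Hx) as [H1 _]. evar_last.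
    + apply is_derive_Rmult. apply is_derive_Rpower_t; lra. eauto.
    + lra.
Qed.

Lemma psi_dx t x : 0 < t < T -> a < x < b ->
  is_derive (fun y => Psum D Psol t y + Psol (j + 3) t y) x (ln t * Derive (KK j) x + Derive (SS j) x + wsum m ep pix j t x).
Proof.
  intros Ht Hx. apply (is_derive_ext (fun y => ln t * KK j y + SS j y + wsum m ep pi j t y)).
  { intros y. apply (Rplus_eq_reg_l 0). rewrite psi_eq. ring. }
  apply is_derive_Rplus.
  - apply is_derive_Rplus. apply is_derive_Rscal, KK_dx; auto. apply SS_dx; auto.
  - apply is_derive_Rplus.
    + apply is_derive_sumx. intros i Hi. apply is_derive_Rscal. apply Hpi; auto.
    + apply is_derive_Rscal. apply Hpi; auto.
Qed.

Lemma Rpower_nz t p : Rpower t p <> 0.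
Proof. assert (H := Rpower_pos t p). lra. Qed.

Lemma Rpower_2 t : 0 < t -> Rpower t 2 = t * t.
Proof. intros H. replace 2 with (1 + 1) by lra. rewrite Rpower_plus, Rpower_1; auto. Qed.

(** Multiplying [rhsS] by [t^ep] undoes the division; the factor [t^(-2k)] of [exp (-2 psi)]
    combines with the powers of [t] in the derivatives of [Q], and only rational algebra remains. *)
Lemma P_pde t x : 0 < t < T -> a < x < b ->
  Dt (Dt (Psol (j + 3))) t x - t ^ 2 * dth (dth (Psol (j + 3))) t x
      = - (1/2) * exp (-2 * (Psum D Psol t x + Psol (j + 3) t x))
          * ((Dt (Qsol (j + 3)) t x) ^ 2 - (tdth (Qsol (j + 3)) t x) ^ 2).
Proof.
  intros Ht Hx. rewrite (Dt_of _ _ _ _ (DtP_dt t x Ht Hx)), (dth_of _ _ _ _ (dthP_dx t x Ht Hx)).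
  unfold tdth. rewrite DtQ, dthQ, psi_eq by lra.
  rewrite HS by pos. unfold rhsS, Wf.
  replace (-2 * (KK j x * ln t + SS j x + wsum m ep pi j t x)) with
    (- (2 * KK j x * ln t) + -2 * SS j x + -2 * wsum m ep pi j t x) by lra.
  rewrite !exp_plus, exp_Ropp. change (exp (2 * KK j x * ln t)) with (Rpower t (2 * KK j x)).
  assert (H2e : Rpower t (2 - ep j) = t * t / Rpower t (ep j)).
  { unfold Rminus. rewrite Rpower_plus, Rpower_Ropp, Rpower_2 by lra. auto. }
  assert (H1e : Rpower t (1 - ep j) = t / Rpower t (ep j)).
  { unfold Rminus. rewrite Rpower_plus, Rpower_Ropp, Rpower_1 by lra. auto. }
  rewrite H2e, H1e, Rpower_Ropp, Rpower_2 by lra.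
  replace (-2 * KK j x) with (- (2 * KK j x)) by lra. rewrite Rpower_Ropp.
  assert (E1 := Rpower_nz t (ep j)). assert (E2 := Rpower_nz t (2 * KK j x)).
  field. lra.
Qed.

Lemma Q_pde t x : 0 < t < T -> a < x < b ->
  Dt (Dt (Qsol (j + 3))) t x - t ^ 2 * dth (dth (Qsol (j + 3))) t x
      = 2 * (Dt (fun s y => Psum D Psol s y + Psol (j + 3) s y) t x * Dt (Qsol (j + 3)) t x
             - t ^ 2 * dth (fun s y => Psum D Psol s y + Psol (j + 3) s y) t x * dth (Qsol (j + 3)) t x).
Proof.
  intros Ht Hx. rewrite (Dt_of _ _ _ _ (DtQ_dt t x Ht Hx)), (dth_of _ _ _ _ (dthQ_dx t x Ht Hx)).
  rewrite DtQ, dthQ by lra.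
  rewrite (Dt_of (fun s y => Psum D Psol s y + Psol (j + 3) s y) _ _ _ (psi_dt t x Ht Hx)).
  rewrite (dth_of (fun s y => Psum D Psol s y + Psol (j + 3) s y) _ _ _ (psi_dx t x Ht Hx)).
  rewrite HR by pos. unfold rhsR, Wf.
  replace (-2 * KK j x) with (- (2 * KK j x)) by lra. rewrite Rpower_Ropp, Rpower_2 by lra.
  assert (E2 := Rpower_nz t (2 * KK j x)).
  field. lra.
Qed.

End At.

Lemma range_j I : in_range D I -> exists j, (j <= m)%nat /\ I = (j + 3)%nat.
Proof. intros [H1 H2]. exists (I - 3)%nat. lia. Qed.

Lemma sol_is_solution : is_solution D Psol Qsol T a b.
Proof.
  intros I HI t x Ht Hx. destruct (range_j I HI) as [j [Hj ->]].
  split; [eexists; apply P_dt; auto|]. split; [eexists; apply P_dx; auto|].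
  split; [eexists; apply DtP_dt; auto|]. split; [eexists; apply dthP_dx; auto|].
  split; [eexists; apply Q_dt; auto|]. split; [eexists; apply Q_dx; auto|].
  split; [eexists; apply DtQ_dt; auto|]. split; [eexists; apply dthQ_dx; auto|].
  split; [apply P_pde | apply Q_pde]; auto.
Qed.

Context (Hsm : forall j, (j <= m)%nat ->
  small_analytic (pi j) T a b /\ small_analytic (fun t x => A j t x - ep j * pi j t x) T a b /\
  small_analytic (fun t x => t * pix j t x) T a b /\ small_analytic (kap j) T a b /\
  small_analytic (B j) T a b /\ small_analytic (fun t x => t * kapx j t x) T a b).

Lemma sol_has_form : has_form D p0 p1 q0 q1 eps Psol Qsol T a b.
Proof.
  exists (fun I => pi (I - 3)%nat), (fun I => kap (I - 3)%nat). intros I HI.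
  destruct (range_j I HI) as [j [Hj ->]]. rewrite j33. destruct (Hsm j Hj) as [S1 [S2 [S3 [S4 [S5 S6]]]]].
  split; [|split].
  - split; [|split; [|split]]; auto.
    + intros t x Ht Hx. destruct (Hpi j t x Hj Ht Hx) as [H1 [_ [H2 _]]]. split; eexists; eauto.
    + apply small_analytic_ext with (2 := S2). intros t x Ht Hx.
      rewrite (Dt_of _ _ _ _ (proj1 (Hpi j t x Hj Ht Hx))). field. lra.
    + apply small_analytic_ext with (2 := S3). intros t x Ht Hx. unfold tdth.
      rewrite (dth_of _ _ _ _ (proj1 (proj2 (proj2 (Hpi j t x Hj Ht Hx))))). auto.
  - split; [|split; [|split]]; auto.
    + intros t x Ht Hx. destruct (Hkap j t x Hj Ht Hx) as [H1 [_ [H2 _]]]. split; eexists; eauto.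
    + apply small_analytic_ext with (2 := S5). intros t x Ht Hx.
      rewrite (Dt_of _ _ _ _ (proj1 (Hkap j t x Hj Ht Hx))). field. lra.
    + apply small_analytic_ext with (2 := S6). intros t x Ht Hx. unfold tdth.
      rewrite (dth_of _ _ _ _ (proj1 (proj2 (proj2 (Hkap j t x Hj Ht Hx))))). auto.
  - unfold Psol, Qsol. rewrite j33. auto.
Qed.

End Assembly.

Lemma solution_exists (D : nat) (HD : (4 <= D)%nat)
  (p0 p1 q0 q1 : nat -> R -> R) (eps : nat -> R) (th0 rho : R) (Hrho : 0 < rho)
  (Han : forall I, in_range D I ->
     analytic_on (p0 I) (th0 - rho) (th0 + rho) /\
     analytic_on (p1 I) (th0 - rho) (th0 + rho) /\
     analytic_on (q0 I) (th0 - rho) (th0 + rho) /\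
     analytic_on (q1 I) (th0 - rho) (th0 + rho))
  (Heps : forall I, in_range D I -> forall x, th0 - rho < x < th0 + rho ->
     0 < eps I /\ eps I < 2 * kI D p0 I x /\ eps I < 2 * (1 - kI D p0 I x)) :
  exists (T r : R) (P Q : nat -> R -> R -> R), form_solution D p0 p1 q0 q1 eps P Q T th0 r.
Proof.
  assert (Hrg : forall j, (j <= D - 4)%nat -> in_range D (j + 3)) by (intros j Hj; unfold in_range; lia).
  destruct (fields_exist (D - 4) (fun j => eps (j + 3)%nat) (fun j => p0 (j + 3)%nat) (fun j => p1 (j + 3)%nat)
    (fun j => q0 (j + 3)%nat) (fun j => q1 (j + 3)%nat) th0 rho Hrho) as
    [T [r [pi [A [Sx [pix [pixx [kap [B [Rx [kapx [kapxx [HT [Hr Hf]]]]]]]]]]]]]].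
  { auto. }
  { intros j Hj. apply Heps; auto. lra. }
  exists T, r, (Psol p0 p1 eps pi), (Qsol D p0 q0 q1 kap).
  assert (Han' : forall j, (j <= D - 4)%nat -> analytic_on (p0 (j + 3)%nat) (th0 - r) (th0 + r) /\
    analytic_on (p1 (j + 3)%nat) (th0 - r) (th0 + r) /\ analytic_on (q0 (j + 3)%nat) (th0 - r) (th0 + r) /\
    analytic_on (q1 (j + 3)%nat) (th0 - r) (th0 + r)).
  { intros j Hj. destruct (Han (j + 3)%nat (Hrg j Hj)) as [H1 [H2 [H3 H4]]].
    split; [|split; [|split]]; apply analytic_sub with (th0 - rho) (th0 + rho); auto; lra. }
  split; [lra|]. split; [lra|]. split.
  - eapply sol_is_solution; try eassumption;
      intros j t x Hj Ht Hx; destruct (Hf j Hj) as [_ H]; apply (H t x Ht Hx).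
  - eapply sol_has_form; try eassumption.
    + intros j t x Hj Ht Hx; destruct (Hf j Hj) as [_ H]; apply (H t x Ht Hx).
    + intros j t x Hj Ht Hx; destruct (Hf j Hj) as [_ H]; apply (H t x Ht Hx).
    + intros j Hj. apply Hf; auto.
Qed.

(** * Integrals depending on a parameter, under weak regularity *)

Lemma lim_inv_INR1 : is_lim_seq (fun n => / (INR n + 1)) 0.
Proof.
  apply lim_seq_eps. intros e He. destruct (nfloor_ex (/ e)) as [N HN]; [pos |].
  exists (S N). intros n Hn. apply le_INR in Hn. rewrite S_INR in Hn.
  assert (Hn0 := pos_INR N). rewrite Rminus_0_r, Rabs_pos_eq by pos.
  rewrite <- Rinv_inv. apply Rinv_lt_contravar; [|lra].
  pos.
Qed.

(** A failing limit is turned into a sequence of increments, the form in which bounded convergence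
    applies. *)
Lemma seq_of_not_lim Q : (forall d, 0 < d -> exists h, Rabs h < d /\ Q h) ->
  exists u : nat -> R, is_lim_seq u 0 /\ forall n, Q (u n) /\ Rabs (u n) < / (INR n + 1).
Proof.
  intros H.
  assert (H1 : forall n : nat, exists h, Q h /\ Rabs h < / (INR n + 1)).
  { intros n. destruct (H (/ (INR n + 1))) as [h [H2 H3]].
    { apply Rinv_0_lt_compat. assert (H2 := pos_INR n). lra. }
    eauto. }
  destruct (choice_fun _ H1) as [u Hu]. exists u. split; auto.
  apply lim_seq_eps. intros e He. destruct (proj1 (lim_seq_eps _ _) lim_inv_INR1 e He) as [N HN].
  exists N. intros n Hn. specialize (HN n Hn). destruct (Hu n) as [_ H2].
  rewrite Rminus_0_r in *. apply Rabs_def2 in HN. lra.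
Qed.

(** The derivative in the parameter is not assumed jointly continuous. The difference quotients are
    bounded by [K] and converge pointwise to a continuous function of [y], so bounded convergence
    gives the limit along any sequence of increments. *)
Lemma RInt_derive_bounded F Fs s a b K d : a <= b -> 0 < d ->
  (forall y h, a <= y <= b -> Rabs h < d -> continuous (F (s + h)) y /\ Rabs (F (s + h) y - F s y) <= K * Rabs h) ->
  (forall y, a <= y <= b -> is_derive (fun s => F s y) s (Fs y)) ->
  (forall y, a <= y <= b -> continuous Fs y) ->
  is_derive (fun s => RInt (F s) a b) s (RInt Fs a b).
Proof.
  intros Hab Hd HF Hder Hc. apply is_derive_eps. intros e He. apply NNPP. intros HN.
  set (Bad := fun h => e * Rabs h < Rabs (RInt (F (s + h)) a b - RInt (F s) a b - RInt Fs a b * h)).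
  destruct (seq_of_not_lim (fun h => Bad h /\ Rabs h < d)) as [u [Hu Hub]].
  { intros d' Hd'. apply NNPP. intros H. apply HN. exists (Rmin d d'). split; [pos |].
    intros h Hh. mins.
    apply Rnot_lt_le. intros H3. apply H. exists h. pos. }
  assert (Hun : forall n, u n <> 0).
  { intros n H. destruct (Hub n) as [[H1 _] _]. unfold Bad in H1. rewrite H in H1.
    rewrite Rplus_0_r in H1. replace (RInt (F s) a b - RInt (F s) a b - RInt Fs a b * 0) with 0 in H1 by lra.
    rewrite Rabs_R0 in H1. lra. }
  assert (Hs0 : forall y, a <= y <= b -> continuous (F s) y).
  { intros y Hy. destruct (HF y 0 Hy) as [H _]. rewrite Rabs_R0; auto. rewrite Rplus_0_r in H. auto. }
  assert (Hlim : is_lim_seq (fun n => RInt (fun y => (F (s + u n) y - F s y) * / u n) a b) (RInt Fs a b)).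
  { apply bounded_convergence with K; auto.
    - intros n y Hy. apply Rcont_mult; [|apply Rcont_const]. apply Rcont_minus; auto.
      apply HF; auto. apply Hub.
    - intros n y Hy. rewrite Rabs_mult, Rabs_inv. destruct (HF y (u n) Hy) as [_ H]; [apply Hub|].
      assert (H1 : 0 < Rabs (u n)) by (apply Rabs_pos_lt, Hun).
      apply Rmult_le_reg_r with (Rabs (u n)); auto. rewrite Rmult_assoc, Rinv_l; lra.
    - intros y Hy. apply lim_seq_eps. intros e' He'.
      destruct (proj1 (is_derive_eps _ _ _) (Hder y Hy) (e' / 2)) as [d' [Hd' H]]; [lra|].
      destruct (proj1 (lim_seq_eps _ _) Hu d' Hd') as [N HNn]. exists N. intros n Hn.
      specialize (HNn n Hn). rewrite Rminus_0_r in HNn. specialize (H (u n)).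
      replace ((F (s + u n) y - F s y) * / u n - Fs y) with ((F (s + u n) y - F s y - Fs y * u n) * / u n) by (field; apply Hun).
      rewrite Rabs_mult, Rabs_inv. assert (H1 : 0 < Rabs (u n)) by (apply Rabs_pos_lt, Hun).
      apply Rmult_lt_reg_r with (Rabs (u n)); auto. rewrite Rmult_assoc, Rinv_l; nra. }
  destruct (proj1 (lim_seq_eps _ _) Hlim e He) as [N HNn]. specialize (HNn N (le_n N)).
  destruct (Hub N) as [[H1 H2] _]. unfold Bad in H1.
  assert (Hi : RInt (fun y => (F (s + u N) y - F s y) * / u N) a b = (RInt (F (s + u N)) a b - RInt (F s) a b) * / u N).
  { assert (Hc1 : forall y, a <= y <= b -> continuous (F (s + u N)) y) by (intros y Hy; apply HF; auto).
    rewrite <- RInt_minus_cont by pos.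
    rewrite (RInt_ext _ (fun y => scal (/ u N) (F (s + u N) y - F s y))).
    2:{ intros; unfold scal; simpl; unfold mult; simpl; ring. }
    rewrite (RInt_scal (V := R_CompleteNormedModule)).
    unfold scal; simpl; unfold mult; simpl; ring.
    apply ex_RInt_cont; auto. intros; apply Rcont_minus; auto. }
  rewrite Hi in HNn.
  replace (RInt (F (s + u N)) a b - RInt (F s) a b - RInt Fs a b * u N) with
    (((RInt (F (s + u N)) a b - RInt (F s) a b) * / u N - RInt Fs a b) * u N) in H1 by (field; apply Hun).
  rewrite Rabs_mult in H1. assert (H3 : 0 < Rabs (u N)) by (apply Rabs_pos_lt, Hun). nra.
Qed.

Lemma RInt_of_derive g dg a b : a <= b ->
  (forall y, a <= y <= b -> is_derive g y (dg y)) -> (forall y, a <= y <= b -> continuous dg y) ->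
  RInt dg a b = g b - g a.
Proof.
  intros. apply is_RInt_unique. apply (is_RInt_derive (V := R_CompleteNormedModule)).
  - rewrite Rmin_left, Rmax_right by lra. auto.
  - rewrite Rmin_left, Rmax_right by lra. auto.
Qed.

Lemma RInt_cont_param F s a b K d : a <= b -> 0 < d ->
  (forall y s', a <= y <= b -> Rabs (s' - s) < d -> continuous (F s') y /\ Rabs (F s' y) <= K) ->
  (forall y, a <= y <= b -> continuous (fun s => F s y) s) ->
  continuous (fun s => RInt (F s) a b) s.
Proof.
  intros Hab Hd HF Hc. apply continuous_eps. intros e He. apply NNPP. intros HN.
  destruct (seq_of_not_lim (fun h => e <= Rabs (RInt (F (s + h)) a b - RInt (F s) a b) /\ Rabs h < d)) as [u [Hu Hub]].
  { intros d' Hd'. apply NNPP. intros H. apply HN. exists (Rmin d d'). split; [pos |].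
    intros y Hy. mins.
    apply Rnot_le_lt. intros H3. apply H. exists (y - s). replace (s + (y - s)) with y by lra.
    lra. }
  assert (Hlim : is_lim_seq (fun n => RInt (F (s + u n)) a b) (RInt (F s) a b)).
  { eapply bounded_convergence; auto.
    - intros n y Hy. apply HF; auto. replace (s + u n - s) with (u n) by lra. apply Hub.
    - intros y Hy. apply HF; auto. rewrite Rminus_diag, Rabs_R0. auto.
    - intros n y Hy. apply HF; auto. replace (s + u n - s) with (u n) by lra. apply Hub.
    - intros y Hy. apply lim_seq_eps. intros e' He'.
      destruct (proj1 (continuous_eps _ _) (Hc y Hy) e' He') as [d' [Hd' H]].
      destruct (proj1 (lim_seq_eps _ _) Hu d' Hd') as [N HNn]. exists N. intros n Hn. apply H.
      replace (s + u n - s) with (u n - 0) by lra. auto. }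
  destruct (proj1 (lim_seq_eps _ _) Hlim e He) as [N HNn]. specialize (HNn N (le_n N)).
  destruct (Hub N) as [[H1 _] _]. lra.
Qed.

Lemma is_derive_upper (g : R -> R) a b c : (forall y, a < y < b -> continuous g y) -> a < c < b ->
  forall y, a < y < b -> is_derive (fun y => RInt g c y) y (g y).
Proof.
  intros Hg Hc y Hy. apply (is_derive_RInt (V := R_NormedModule) g _ c); auto.
  destruct (locally_itv a b y Hy) as [d Hd]. exists d. intros z Hz. specialize (Hd z Hz).
  apply (RInt_correct (V := R_CompleteNormedModule)), ex_RInt_continuous.
  intros w Hw. apply Hg. unfold Rmin, Rmax in Hw. destruct Rle_dec; lra.
Qed.

Lemma RInt_diff_upper g a b c y z : (forall y, a < y < b -> continuous g y) -> a < c < b ->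
  a < y < b -> a < z < b -> RInt g y z = RInt g c z - RInt g c y.
Proof.
  intros Hg Hc Hy Hz.
  assert (He : forall p q, a < p < b -> a < q < b -> ex_RInt g p q).
  { intros. apply ex_RInt_continuous.
    intros w Hw. apply Hg. unfold Rmin, Rmax in Hw. destruct Rle_dec; lra. }
  rewrite <- (RInt_Chasles (V := R_CompleteNormedModule) g c y) by pos.
  unfold plus; simpl. lra.
Qed.

Lemma derive_0_bound G l K eta : 0 < eta -> G 0 = 0 -> is_derive G 0 l ->
  (forall k, 0 < k < eta -> Rabs (G k) <= K * k) -> Rabs l <= K.
Proof.
  intros He H0 Hd HK. apply le_epsilon. intros e Hep.
  destruct (proj1 (is_derive_eps _ _ _) Hd e Hep) as [d [Hd0 H]].
  set (k := Rmin eta d / 2). assert (B0 : 0 < Rmin eta d) by pos.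
  assert (B1 := Rmin_l eta d). assert (B2 := Rmin_r eta d).
  assert (Hk : 0 < k) by (unfold k; lra).
  specialize (HK k ltac:(unfold k in *; lra)). specialize (H k).
  rewrite Rabs_pos_eq in H by lra. specialize (H ltac:(unfold k in *; lra)).
  rewrite Rplus_0_l, H0 in H.
  assert (H1 : Rabs (l * k) <= Rabs (G k) + Rabs (G k - 0 - l * k)).
  { replace (l * k) with (G k - (G k - 0 - l * k)) at 1 by lra.
    eapply Rle_trans; [apply Rabs_triang|]. rewrite Rabs_Ropp. lra. }
  rewrite Rabs_mult, (Rabs_pos_eq k) in H1 by lra. nra.
Qed.

Lemma derive_bound_open f df a b M : a <= b -> 0 <= M ->
  (forall x, a < x < b -> is_derive f x (df x)) -> (forall x, a <= x <= b -> continuous f x) ->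
  (forall x, a < x < b -> Rabs (df x) <= M) -> Rabs (f b - f a) <= M * (b - a).
Proof.
  intros Hab HM0 Hd Hc HM.
  (* The derivative is extended by zero to the endpoints; [0 <= M] makes that default harmless. *)
  destruct (MVT_gen f a b (fun x => if Rlt_dec a x then if Rlt_dec x b then df x else 0 else 0)) as [c [_ He]].
  - rewrite Rmin_left, Rmax_right by lra. intros x Hx. destruct Rlt_dec; [|lra].
    destruct Rlt_dec; [|lra]. auto.
  - rewrite Rmin_left, Rmax_right by lra. intros. apply continuity_pt_filterlim, Hc; lra.
  - rewrite He, Rabs_mult, (Rabs_pos_eq (b - a)) by lra. apply Rmult_le_compat_r; [lra|].
    destruct Rlt_dec; [destruct Rlt_dec|]; try (rewrite Rabs_R0; lra). auto.
Qed.


(** [chain_line] with the two variables exchanged: since [c] is 1 or -1, the line is parametrised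
    equally well by [x]. *)
Lemma chain_line_x f fx ft t x c d0 : 0 < d0 -> c * c = 1 ->
  (forall s y, Rabs (s - t) < d0 -> Rabs (y - x) < d0 -> is_derive (fun y => f s y) y (fx s y)) ->
  continuity_2d_pt fx t x ->
  is_derive (fun s => f s x) t ft ->
  is_derive (fun s => f s (x + c * (s - t))) t (ft + c * fx t x).
Proof.
  intros Hd0 Hc Hfx Hcont Hft.
  assert (H : is_derive (fun y => f (t + c * (y - x)) y) x (fx t x + c * ft)).
  { apply (chain_line (fun y s => f s y) (fun y s => fx s y) ft x t c d0); auto.
    apply cont2_eps. intros e He. destruct (proj1 (cont2_eps _ _ _) Hcont e He) as [d [Hd H]].
    eauto. }
  apply is_derive_ext with (fun s => f (t + c * ((x + c * (s - t)) - x)) (x + c * (s - t))).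
  { intros s. f_equal. transitivity (t + (c * c) * (s - t)). ring. rewrite Hc. ring. }
  assert (Haff : is_derive (fun s => x + c * (s - t)) t c) by (auto_derive; auto; ring).
  evar_last.
  - apply (is_derive_comp (fun y => f (t + c * (y - x)) y)).
    + replace (x + c * (t - t)) with x by lra. eauto.
    + eauto.
  - unfold scal; simpl; unfold mult; simpl. transitivity (c * fx t x + (c * c) * ft). ring. rewrite Hc. ring.
Qed.

Lemma is_derive_comp_add (g : R -> R) y k l : is_derive g (y + k) l -> is_derive (fun y => g (y + k)) y l.
Proof.
  intros H. apply is_derive_eps. intros e He. destruct (proj1 (is_derive_eps _ _ _) H e He) as [d [Hd H1]].
  exists d. split; auto. intros h. replace (y + h + k) with (y + k + h) by lra. auto.
Qed.

Lemma is_derive_Rminus f g x df dg : is_derive f x df -> is_derive g x dg -> is_derive (fun x => f x - g x) x (df - dg).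
Proof. apply (is_derive_minus (K := R_AbsRing) (V := R_NormedModule)). Qed.

Lemma cont2_shift f t x k : continuity_2d_pt f t (x + k) -> continuity_2d_pt (fun s y => f s (y + k)) t x.
Proof.
  intros H. apply cont2_eps. intros e He. destruct (proj1 (cont2_eps _ _ _) H e He) as [d [Hd H1]].
  exists d. split; auto. intros s y Hs Hy. apply H1; auto. replace (y + k - (x + k)) with (y - x) by lra. auto.
Qed.

Lemma continuous_shift (g : R -> R) y k : continuous g (y + k) -> continuous (fun y => g (y + k)) y.
Proof.
  intros H. apply continuous_eps. intros e He. destruct (proj1 (continuous_eps _ _) H e He) as [d [Hd H1]].
  exists d. split; auto. intros h Hh. apply H1. replace (h + k - (y + k)) with (h - y) by lra. auto.
Qed.

Lemma RInt_shift (g : R -> R) k x y : x <= y -> (forall z, x <= z <= y -> continuous g (z + k)) ->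
  RInt (fun z => g (z + k)) x y = RInt g (x + k) (y + k).
Proof.
  intros Hxy Hg. assert (H := RInt_comp_lin (V := R_CompleteNormedModule) g 1 k x y). rewrite !Rmult_1_l in H.
  rewrite <- H.
  - apply RInt_ext. intros z. rewrite !Rmult_1_l. auto.
  - apply ex_RInt_cont; [lra|]. intros z. replace z with (z - k + k) by lra. pos.
Qed.

(** * Lipschitz bounds in x, from separate ones at each time to locally uniform ones *)

Section Regularity.
Context (Ix : Type) (u A B f Bx : Ix -> R -> R -> R).
Context (al be x0 rho a b M C : R).
Context (Hal : 0 < al) (Ha : a < x0 - rho) (Hb : x0 + rho < b) (HM : 0 <= M) (HC : 0 <= C).
Notation dom t x := (al < t < be /\ a < x < b).
Context (Hut : forall i t x, al < t < be -> a < x < b -> is_derive (fun s => u i s x) t (A i t x)).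
Context (Hux : forall i t x, al < t < be -> a < x < b -> is_derive (fun y => u i t y) x (B i t x)).
Context (HAt : forall i t x, al < t < be -> a < x < b -> is_derive (fun s => A i s x) t (Bx i t x + f i t x)).
Context (HBx : forall i t x, al < t < be -> a < x < b -> is_derive (fun y => B i t y) x (Bx i t x)).
Context (HBc : forall i t x, al < t < be -> a < x < b -> continuous (fun s => B i s x) t).
Context (HBxc : forall i t x, al < t < be -> a < x < b -> continuous (Bx i t) x).
Context (Hbd : forall i t x, al < t < be -> a < x < b -> Rabs (A i t x) <= M /\ Rabs (B i t x) <= M /\ Rabs (f i t x) <= M).
Context (Hl0 : forall t, al < t < be -> exists n : nat, forall i x y, a < x < b -> a < y < b ->
   Rabs (A i t x - A i t y) <= INR n * Rabs (x - y) /\ Rabs (B i t x - B i t y) <= INR n * Rabs (x - y)).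
Context (Hfl : forall i t x y d, al < t < be -> a < x < b -> a < y < b -> 0 <= d ->
   (forall j, Rabs (A j t x - A j t y) <= d /\ Rabs (B j t x - B j t y) <= d) ->
   Rabs (f i t x - f i t y) <= C * (Rabs (x - y) + d)).

(** A cone of unit slope that narrows as [t] grows: a characteristic followed backwards in time from
    one of its points stays inside ([Om_line]). *)
Definition Om (t x : R) : Prop := Rabs (x - x0) < rho - t.
Definition L (t n : R) : Prop := forall i x y, Om t x -> Om t y ->
   Rabs (A i t x - A i t y) <= n * Rabs (x - y) /\ Rabs (B i t x - B i t y) <= n * Rabs (x - y).

Lemma Om_dom t x : al < t -> Om t x -> a < x < b.
Proof. intros Ht H. apply Rabs_def2 in H. lra. Qed.

Lemma Om_open t x : Om t x -> exists d, 0 < d /\ forall s y, Rabs (s - t) < d -> Rabs (y - x) < d -> Om s y.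
Proof.
  unfold Om. exists ((rho - t - Rabs (x - x0)) / 2). split; [lra|]. intros s y Hs Hy.
  replace (y - x0) with ((y - x) + (x - x0)) by lra. eapply Rle_lt_trans; [apply Rabs_triang|].
  apply Rabs_def2 in Hs. lra.
Qed.

Lemma L_mono t n n' : n <= n' -> L t n -> L t n'.
Proof.
  intros Hn H i x y Hx Hy. destruct (H i x y Hx Hy) as [H1 H2].
  assert (H3 := Rabs_pos (x - y)). nra.
Qed.

Lemma A_cont_x i t x : al < t < be -> a < x < b -> continuous (A i t) x.
Proof.
  intros Ht Hx. destruct (Hl0 t Ht) as [n Hn]. apply continuous_eps. intros e.
  assert (Hn0 := pos_INR n).
  destruct (locally_itv a b x Hx) as [d Hd].
  exists (Rmin d (e / (INR n + 1))). split. pos.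
  intros y Hy. mins.
  destruct (Hn i y x) as [H3 _]; auto. apply Hd. change (Rabs (y - x) < d). lra.
  assert (H4 : Rabs (y - x) < e / (INR n + 1)) by lra.
  apply Rlt_div_r in H4; [|lra]. nra.
Qed.

Lemma f_cont_x i t x : al < t < be -> a < x < b -> continuous (f i t) x.
Proof.
  intros Ht Hx. destruct (Hl0 t Ht) as [n Hn]. apply continuous_eps. intros e.
  assert (Hn0 := pos_INR n). assert (HCn : 0 <= C * (1 + INR n)) by nra.
  destruct (locally_itv a b x Hx) as [d Hd].
  exists (Rmin d (e / (C * (1 + INR n) + 1))). split. pos.
  intros y Hy. mins.
  assert (Hyd : a < y < b) by (apply Hd; change (Rabs (y - x) < d); lra).
  assert (H5 := Rabs_pos (y - x)).
  eapply Rle_lt_trans; [apply Hfl; auto; nra|].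
  assert (H4 : Rabs (y - x) < e / (C * (1 + INR n) + 1)) by lra.
  apply Rlt_div_r in H4; [|lra].
  lra.
Qed.

Lemma Bx_bound i t x n : al < t < be -> Om t x -> L t n -> Rabs (Bx i t x) <= n.
Proof.
  intros Ht Hx Hn. assert (Hxd := Om_dom t x ltac:(lra) Hx).
  apply Rnot_lt_le. intros Hlt. set (e := (Rabs (Bx i t x) - n) / 2).
  destruct (proj1 (is_derive_eps _ _ _) (HBx i t x Ht Hxd) e) as [d [Hd H]]; [unfold e; lra|].
  destruct (Om_open t x Hx) as [d2 [Hd2 HO]].
  set (h := Rmin d d2 / 2). assert (Hmin : 0 < Rmin d d2) by pos.
  assert (B1 := Rmin_l d d2). assert (B2 := Rmin_r d d2).
  assert (Hh : Rabs h = h) by (apply Rabs_pos_eq; unfold h; lra).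
  specialize (H h ltac:(rewrite Hh; unfold h; lra)).
  destruct (Hn i (x + h) x) as [_ H1]; auto.
  { apply HO. rewrite Rminus_diag, Rabs_R0; auto. replace (x + h - x) with h by lra. rewrite Hh. unfold h; lra. }
  replace (x + h - x) with h in H1 by lra.
  assert (H2 : Rabs (Bx i t x * h) <= Rabs (B i t (x + h) - B i t x) + Rabs (B i t (x + h) - B i t x - Bx i t x * h)).
  { replace (Bx i t x * h) with ((B i t (x + h) - B i t x) - (B i t (x + h) - B i t x - Bx i t x * h)) at 1 by lra.
    eapply Rle_trans; [apply Rabs_triang|]. rewrite Rabs_Ropp. lra. }
  rewrite Rabs_mult in H2. unfold e in H. assert (0 < h) by (unfold h; lra). nra.
Qed.

Context (t1 t2 : R) (Ht12 : al < t1 /\ t2 < be).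
Definition Good (t : R) : Prop := exists d n, 0 < d /\ forall s, t1 <= s <= t2 -> Rabs (s - t) < d -> L s n.

(** Near a good time [Bx] is bounded by the Lipschitz constant of [B], so the difference quotients
    of [A] in time are bounded and the integral may be differentiated. Integrating [Bx] leaves only
    the endpoint values of [B]. *)
Lemma avg_dt i s x k : t1 < s < t2 -> Good s -> 0 <= k -> Om s x -> Om s (x + k) ->
  is_derive (fun s => RInt (A i s) x (x + k)) s (B i s (x + k) - B i s x + RInt (f i s) x (x + k)).
Proof.
  intros Hs [d [n [Hd HL]]] Hk Hx Hxk.
  destruct (Om_open s x Hx) as [d1 [Hd1 HO1]]. destruct (Om_open s (x + k) Hxk) as [d2 [Hd2 HO2]].
  set (dd := Rmin (Rmin d (Rmin d1 d2)) (Rmin (s - t1) (t2 - s))).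
  assert (Hdd : 0 < dd) by (repeat apply Rmin_glb_lt; lra).
  mins.
  assert (HOm : forall s' y, Rabs (s' - s) < dd -> x <= y <= x + k -> Om s' y).
  { intros s' y Hs' Hy.
    assert (G1 : Om s' x) by (apply HO1; [lra | rewrite Rminus_diag, Rabs_R0; auto]).
    assert (G2 : Om s' (x + k)) by (apply HO2; [lra | rewrite Rminus_diag, Rabs_R0; auto]).
    apply Rabs_def2 in G1. apply Rabs_def2 in G2. apply Rabs_def1; lra. }
  assert (Hs'd : forall s', Rabs (s' - s) < dd -> t1 <= s' <= t2 /\ al < s' < be).
  { intros s' Hs'. apply Rabs_def2 in Hs'. lra. }
  assert (Hs0 : Rabs (s - s) < dd) by (rewrite Rminus_diag, Rabs_R0; auto).
  replace (B i s (x + k) - B i s x + RInt (f i s) x (x + k)) with (RInt (fun y => Bx i s y + f i s y) x (x + k)).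
  - apply RInt_derive_bounded with (K := n + M) (d := dd); try lra.
    + intros y h Hy Hh. assert (Hsh : Rabs (s + h - s) < dd) by (replace (s + h - s) with h by ring; auto).
      split.
      * apply A_cont_x. apply Hs'd; auto. apply (Om_dom s); pos.
      * assert (G0 := derive_bound_lip (fun s => A i s y) (fun s => Bx i s y + f i s y) s (s + h)).
        replace (s + h - s) with h in G0 by lra. apply G0.
        -- intros s' Hs'. apply between_dist in Hs'.
           apply HAt. apply Hs'd; lra. apply (Om_dom s'); [apply Hs'd; lra | pos].
        -- intros s' Hs'. apply between_dist in Hs'.
           assert (G1 : al < s' < be) by (apply Hs'd; lra).
           assert (G2 : Om s' y) by pos.
           eapply Rle_trans; [apply Rabs_triang|]. apply Rplus_le_compat.
           apply Bx_bound; auto. apply HL; [apply Hs'd; lra | lra].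
           apply Hbd; auto. apply (Om_dom s'); auto; lra.
    + intros y Hy. apply HAt. apply Hs'd; auto. apply (Om_dom s); pos.
    + intros y Hy. assert (a < y < b) by (apply (Om_dom s); pos).
      apply Rcont_plus; [pos | apply f_cont_x]; auto; apply Hs'd; auto.
  - assert (Hyd : forall y, x <= y <= x + k -> a < y < b).
    { intros y Hy. apply (Om_dom s); pos. }
    assert (Hsd : al < s < be) by lra.
    rewrite RInt_plus_cont; try lra.
    + f_equal. apply RInt_of_derive; try lra. auto. auto.
    + auto.
    + intros. apply f_cont_x; auto.
Qed.

Lemma cont2_good g s x : t1 < s < t2 -> (exists d n, 0 < d /\ forall s' y z, t1 <= s' <= t2 -> Rabs (s' - s) < d -> Om s' y -> Om s' z ->
  Rabs (g s' y - g s' z) <= n * Rabs (y - z)) -> Om s x -> continuous (fun s => g s x) s -> continuity_2d_pt g s x.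
Proof.
  intros Hs [d [n [Hd HL]]] Hx Hc. destruct (Om_open s x Hx) as [d1 [Hd1 HO1]].
  set (dd := Rmin (Rmin d d1) (Rmin (s - t1) (t2 - s))).
  assert (Hdd : 0 < dd) by (repeat apply Rmin_glb_lt; lra).
  mins.
  apply cont2_of_lip with dd n; auto. intros s' y z Hs' Hy Hz. apply HL; try lra.
  - apply Rabs_def2 in Hs'. lra.
  - pos.
  - pos.
Qed.

Lemma A_cont2 i s x : t1 < s < t2 -> Good s -> Om s x -> continuity_2d_pt (A i) s x.
Proof.
  intros Hs [d [n [Hd HL]]] Hx. apply cont2_good; auto.
  - exists d, n. split; auto. intros. apply HL; auto.
  - eapply is_derive_cont. apply HAt. lra. apply (Om_dom s); auto; lra.
Qed.

Lemma B_cont2 i s x : t1 < s < t2 -> Good s -> Om s x -> continuity_2d_pt (B i) s x.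
Proof.
  intros Hs [d [n [Hd HL]]] Hx. apply cont2_good; auto.
  - exists d, n. split; auto. intros. apply HL; auto.
  - apply HBc. lra. apply (Om_dom s); auto; lra.
Qed.

(** The integral over [[y, y+k]] of the Riemann invariant [A + e B], the integral of [B] being a
    difference of [u]. [A] is only Lipschitz in [x] and [B] only continuous in [t], so the invariant
    itself cannot be differentiated along a characteristic; its average can. *)
Definition W i e k s y : R := RInt (A i s) y (y + k) + e * (u i s (y + k) - u i s y).

Lemma W_dy i e k s y : al < s < be -> 0 <= k -> a < y -> y + k < b ->
  is_derive (fun y => W i e k s y) y (A i s (y + k) - A i s y + e * (B i s (y + k) - B i s y)).
Proof.
  intros.
  assert (Hc : forall z, a < z < b -> continuous (A i s) z) by (intros; apply A_cont_x; auto).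
  assert (Hm : a < y < b) by lra.
  apply is_derive_ext_loc with (fun z => (RInt (A i s) y (z + k) - RInt (A i s) y z) + e * (u i s (z + k) - u i s z)).
  { destruct (locally_itv a b y Hm) as [d1 Hd1]. destruct (locally_itv a b (y + k)) as [d2 Hd2]; [lra|].
    assert (Hd : 0 < Rmin d1 d2) by pos.
    exists (mkposreal _ Hd). intros z Hz. change (Rabs (z - y) < Rmin d1 d2) in Hz.
    mins.
    assert (Hz1 : a < z < b) by (apply Hd1; change (Rabs (z - y) < d1); lra).
    assert (Hz2 : a < z + k < b).
    { apply Hd2. change (Rabs (z + k - (y + k)) < d2). replace (z + k - (y + k)) with (z - y) by lra. lra. }
    unfold W. rewrite (RInt_diff_upper (A i s) a b y z); auto. }
  assert (HP := is_derive_upper (A i s) a b y Hc).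
  apply is_derive_Rplus.
  - apply is_derive_Rminus; [apply is_derive_comp_add |]; apply HP; lra.
  - apply is_derive_Rscal, is_derive_Rminus; [apply is_derive_comp_add |]; apply Hux; lra.
Qed.

Lemma is_derive_W_k i e s y k : al < s < be -> a < y < b -> a < y + k < b ->
  is_derive (fun k => W i e k s y) k (A i s (y + k) + e * B i s (y + k)).
Proof.
  intros.
  assert (Hc : forall z, a < z < b -> continuous (A i s) z) by (intros; apply A_cont_x; auto).
  apply is_derive_Rplus.
  - apply is_derive_ext with (fun k => RInt (A i s) y (k + y)). intros; f_equal; ring.
    replace (y + k) with (k + y) by lra. apply is_derive_comp_add.
    apply is_derive_upper with a b; auto. lra.
  - apply is_derive_Rscal. rewrite <- Rminus_0_r.
    apply is_derive_Rminus; [|apply is_derive_cst].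
    apply is_derive_ext with (fun k => u i s (k + y)). intros; f_equal; ring.
    replace (y + k) with (k + y) by lra. apply is_derive_comp_add. pos.
Qed.

Lemma W_cont2 i e k s y : al < s < be -> 0 <= k -> a < y -> y + k < b -> e * e = 1 ->
  continuity_2d_pt (W i e k) s y.
Proof.
  intros Hs Hk Hy Hyk He.
  assert (He1 : Rabs e = 1) by (unfold Rabs; destruct Rcase_abs; nra).
  destruct (locally_itv al be s Hs) as [d1 Hd1]. destruct (locally_itv a b y) as [d2 Hd2]; [lra|].
  destruct (locally_itv a b (y + k)) as [d3 Hd3]; [lra|].
  set (d := Rmin d1 (Rmin d2 d3)).
  assert (Hd : 0 < d) by (repeat apply Rmin_glb_lt; apply cond_pos).
  mins.
  assert (Hin : forall z, Rabs (z - y) < d -> a < z /\ z + k < b).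
  { split. apply Hd2. change (Rabs (z - y) < d2). lra.
    apply Hd3. change (Rabs (z + k - (y + k)) < d3). replace (z + k - (y + k)) with (z - y) by lra. lra. }
  assert (Hts : forall s', Rabs (s' - s) < d -> al < s' < be).
  { intros s' Hs'. apply Hd1. change (Rabs (s' - s) < d1). lra. }
  apply cont2_of_lip with (d0 := d) (L := 4 * M); auto.
  - intros s' z w Hs' Hz Hw.
    eapply derive_bound_lip.
    + intros v Hv. assert (a < v /\ v + k < b).
      { destruct (Hin z Hz). destruct (Hin w Hw). unfold Rmin, Rmax in Hv. destruct Rle_dec; lra. }
      apply W_dy; auto; lra.
    + intros v Hv. assert (a < v /\ v + k < b).
      { destruct (Hin z Hz). destruct (Hin w Hw). unfold Rmin, Rmax in Hv. destruct Rle_dec; lra. }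
      eapply Rle_trans; [apply Rabs_triang|]. rewrite Rabs_mult, He1.
      destruct (Hbd i s' v) as [G1 [G2 _]]; auto; [lra|]. destruct (Hbd i s' (v + k)) as [G3 [G4 _]]; auto; [lra|].
      apply Rabs_le_between in G1, G2, G3, G4.
      assert (Rabs (A i s' (v + k) - A i s' v) <= 2 * M) by (apply Rabs_le; lra).
      assert (Rabs (B i s' (v + k) - B i s' v) <= 2 * M) by (apply Rabs_le; lra). lra.
  - apply Rcont_plus.
    + apply RInt_cont_param with (K := M) (d := d); try lra.
      * split. apply A_cont_x; auto; lra. apply Hbd; auto; lra.
      * intros. eapply is_derive_cont. pos.
    + apply Rcont_mult; [apply Rcont_const|]. apply Rcont_minus; eapply is_derive_cont; apply Hut; lra.
Qed.

Lemma W_line i e k s y : t1 < s < t2 -> Good s -> 0 <= k -> Om s y -> Om s (y + k) -> e * e = 1 ->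
  is_derive (fun s' => W i e k s' (y + - e * (s' - s))) s (RInt (f i s) y (y + k)).
Proof.
  intros Hs HG Hk Hy Hyk He.
  assert (Hsd : al < s < be) by lra.
  assert (Hyd : a < y < b) by (apply (Om_dom s); auto; lra).
  assert (Hykd : a < y + k < b) by (apply (Om_dom s); auto; lra).
  destruct (locally_itv al be s Hsd) as [d1 Hd1]. destruct (locally_itv a b y) as [d2 Hd2]; auto.
  destruct (locally_itv a b (y + k)) as [d3 Hd3]; auto.
  set (d := Rmin d1 (Rmin d2 d3)).
  assert (Hd : 0 < d) by (repeat apply Rmin_glb_lt; apply cond_pos).
  mins.
  evar_last.
  - apply (chain_line_x (W i e k) (fun s y => A i s (y + k) - A i s y + e * (B i s (y + k) - B i s y))
      (B i s (y + k) - B i s y + RInt (f i s) y (y + k) + e * (A i s (y + k) - A i s y)) s y (- e) d); auto.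
    + lra.
    + intros s' z Hs' Hz. apply W_dy; auto.
      * apply Hd1. change (Rabs (s' - s) < d1). lra.
      * apply Hd2. change (Rabs (z - y) < d2). lra.
      * apply Hd3. change (Rabs (z + k - (y + k)) < d3). replace (z + k - (y + k)) with (z - y) by lra. lra.
    + apply continuity_2d_pt_plus.
      * apply continuity_2d_pt_minus; [apply cont2_shift|]; apply A_cont2; auto.
      * apply continuity_2d_pt_mult; [apply continuity_2d_pt_const|].
        apply continuity_2d_pt_minus; [apply cont2_shift|]; apply B_cont2; auto.
    + apply is_derive_Rplus; [apply avg_dt; auto|].
      apply is_derive_Rscal, is_derive_Rminus; auto.
  - transitivity (RInt (f i s) y (y + k) + (1 - e * e) * (B i s (y + k) - B i s y)); [ring|]. rewrite He. ring.
Qed.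

Lemma Om_line e s s' x : e * e = 1 -> s' <= s -> Om s x -> Om s' (x + - e * (s' - s)).
Proof.
  unfold Om. intros.
  assert (He1 : Rabs e = 1) by (unfold Rabs; destruct Rcase_abs; nra).
  replace (x + - e * (s' - s) - x0) with ((x - x0) + e * (s - s')) by lra.
  eapply Rle_lt_trans; [apply Rabs_triang|]. rewrite Rabs_mult, He1, (Rabs_pos_eq (s - s')); lra.
Qed.

Lemma Om_between s x y z : Om s x -> Om s y -> x <= z <= y -> Om s z.
Proof. intros Hx Hy Hz. apply Rabs_def2 in Hx, Hy. apply Rabs_def1; lra. Qed.

Lemma W_init i e n s h k y : e * e = 1 -> 0 <= n -> 0 <= h -> 0 <= k -> al < s < be -> L s n -> Om s y -> Om s (y + h + k) ->
  Rabs (W i e k s (y + h) - W i e k s y) <= 2 * n * h * k.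
Proof.
  intros He Hn Hh Hk Hs HL Hy Hyhk.
  assert (He1 : Rabs e = 1) by (unfold Rabs; destruct Rcase_abs; nra).
  assert (HO : forall z, y <= z <= y + h + k -> Om s z) by (intros; apply Om_between with y (y + h + k); auto).
  assert (Hdm : forall z, y <= z <= y + h + k -> a < z < b) by (intros; apply (Om_dom s); pos).
  set (G := fun k => W i e k s (y + h) - W i e k s y).
  assert (G0 : G 0 = 0).
  { unfold G, W. rewrite !Rplus_0_r, !RInt_point. lra. }
  assert (Hd : forall k', 0 <= k' <= k -> is_derive G k' ((A i s (y + h + k') + e * B i s (y + h + k')) - (A i s (y + k') + e * B i s (y + k')))).
  { intros k' Hk'. apply is_derive_Rminus; apply is_derive_W_k; auto; apply Hdm; lra. }
  assert (H := derive_bound_lip G (fun k' => (A i s (y + h + k') + e * B i s (y + h + k')) - (A i s (y + k') + e * B i s (y + k'))) 0 k).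
  rewrite G0, !Rminus_0_r, (Rabs_pos_eq k) in H by lra.
  rewrite Rmin_left, Rmax_right in H by lra. apply H.
  - auto.
  - intros k' Hk'. destruct (HL i (y + h + k') (y + k')) as [G1 G2]; try (apply HO; lra).
    replace (y + h + k' - (y + k')) with h in * by lra. rewrite (Rabs_pos_eq h) in * by lra.
    replace (A i s (y + h + k') + e * B i s (y + h + k') - (A i s (y + k') + e * B i s (y + k'))) with
      ((A i s (y + h + k') - A i s (y + k')) + e * (B i s (y + h + k') - B i s (y + k'))) by lra.
    eapply Rle_trans; [apply Rabs_triang|]. rewrite Rabs_mult, He1. lra.
Qed.

Definition Dif h ta t d : Prop := forall s j x, ta <= s <= t -> Om s x -> Om s (x + h) ->
  Rabs (A j s (x + h) - A j s x) <= d /\ Rabs (B j s (x + h) - B j s x) <= d.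

(** For averages of width [k], the difference of [W] at distance [h] starts at most at [2 n h k] and
    changes along a characteristic at rate at most [k C (h + d)], by the Lipschitz bound on [f].
    Dividing by [k] and letting [k] tend to zero returns the invariant. *)
Lemma char_bound h d n ta t : t1 <= ta -> t < t2 -> 0 <= h -> 0 <= d -> 0 <= n -> L ta n ->
  (forall s, ta < s <= t -> Good s) -> Dif h ta t d ->
  forall s i e x, ta <= s <= t -> e * e = 1 -> Om s x -> Om s (x + h) ->
  Rabs ((A i s (x + h) + e * B i s (x + h)) - (A i s x + e * B i s x)) <= 2 * n * h + C * (h + d) * (s - ta).
Proof.
  intros Hta Ht Hh Hd Hn HL HG HD s i e x Hs He Hx Hxh.
  assert (Hsd : al < s < be) by lra.
  assert (Hxd : a < x < b) by (apply (Om_dom s); auto; lra).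
  assert (Hxhd : a < x + h < b) by (apply (Om_dom s); auto; lra).
  destruct (Om_open s (x + h) Hxh) as [eta [Heta HO]].
  apply derive_0_bound with (G := fun k => W i e k s (x + h) - W i e k s x) (eta := eta); auto.
  { unfold W. rewrite !Rplus_0_r, !RInt_point. lra. }
  { assert (E := is_derive_Rminus (fun k => W i e k s (x + h)) (fun k => W i e k s x) 0 _ _
      (is_derive_W_k i e s (x + h) 0 Hsd Hxhd ltac:(rewrite Rplus_0_r; lra)) (is_derive_W_k i e s x 0 Hsd Hxd ltac:(rewrite Rplus_0_r; lra))).
    rewrite !Rplus_0_r in E. auto. }
  intros k Hk.
  assert (Hxhk : Om s (x + h + k)).
  { apply HO. rewrite Rminus_diag, Rabs_R0; auto. rewrite Rabs_pos_eq; lra. }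
  set (ln := fun s' => x + - e * (s' - s)).
  assert (HOm : forall s' z, ta <= s' <= s -> x <= z <= x + h + k -> Om s' (z + - e * (s' - s))).
  { intros s' z Hs' Hz. apply Om_line; try lra. apply Om_between with x (x + h + k); auto. }
  assert (HOm' : forall s' w, ta <= s' <= s -> 0 <= w <= h + k -> Om s' (ln s' + w)).
  { intros s' w Hs' Hw. replace (ln s' + w) with (x + w + - e * (s' - s)) by (unfold ln; ring). pos. }
  assert (HOd : forall s' w, ta <= s' <= s -> 0 <= w <= h + k -> a < ln s' + w < b).
  { intros s' w Hs' Hw. apply (Om_dom s'); pos. }
  set (Psi := fun s' => W i e k s' (ln s' + h) - W i e k s' (ln s' + 0)).
  assert (Hl1 : forall s' v w, ln v + w = ln s' + w + - e * (v - s')) by (intros; unfold ln; ring).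
  assert (HP : Rabs (Psi s - Psi ta) <= k * (C * (h + d)) * (s - ta)).
  (* The starting time [ta] need not be good: [W] is only required to be continuous there. *)
  { apply derive_bound_open with (df := fun s' => RInt (f i s') (ln s' + h) (ln s' + h + k) - RInt (f i s') (ln s' + 0) (ln s' + 0 + k)); [lra | pos | | |].
    - intros s' Hs'. apply is_derive_Rminus.
      + apply is_derive_ext with (fun v => W i e k v (ln s' + h + - e * (v - s'))). intros v; rewrite <- Hl1; reflexivity.
        apply W_line; try lra. apply HG; lra. apply HOm'; lra. rewrite Rplus_assoc. pos.
      + apply is_derive_ext with (fun v => W i e k v (ln s' + 0 + - e * (v - s'))). intros v; rewrite <- Hl1; reflexivity.
        apply W_line; try lra. apply HG; lra. apply HOm'; lra. rewrite Rplus_assoc. pos.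
    - intros s' Hs'. apply Rcont_minus.
      + apply continuous_ext with (fun v => W i e k v (ln s' + h + - e * (v - s'))). intros v; rewrite <- Hl1; reflexivity.
        apply cont2_line, W_cont2; try lra. apply HOd; lra. rewrite Rplus_assoc; apply HOd; lra.
      + apply continuous_ext with (fun v => W i e k v (ln s' + 0 + - e * (v - s'))). intros v; rewrite <- Hl1; reflexivity.
        apply cont2_line, W_cont2; try lra. apply HOd; lra. rewrite Rplus_assoc; apply HOd; lra.
    - intros s' Hs'.
      assert (HcA : forall w, 0 <= w <= h + k -> continuous (f i s') (ln s' + w)).
      { intros w Hw. apply f_cont_x; pos. }
      assert (HcB : forall w y, y = ln s' + w -> 0 <= w <= h + k -> continuous (f i s') y) by (intros; subst; auto).
      rewrite Rplus_0_r.
      replace (RInt (f i s') (ln s' + h) (ln s' + h + k)) with (RInt (fun z => f i s' (z + h)) (ln s') (ln s' + k)).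
      2:{ rewrite RInt_shift; [f_equal; ring | lra|]. intros z Hz. apply (HcB (z + h - ln s')); lra. }
      rewrite <- RInt_minus_cont.
      + replace (k * (C * (h + d))) with (C * (h + d) * (ln s' + k - ln s')) by lra.
        apply RInt_abs_bound; try lra.
        * intros z Hz. apply Rcont_minus; [apply continuous_shift|].
          apply (HcB (z + h - ln s')); lra. apply (HcB (z - ln s')); lra.
        * intros z Hz.
          assert (HzO : forall w, ln s' <= w <= ln s' + h + k -> Om s' w).
          { intros w. replace w with (ln s' + (w - ln s')) by lra. pos. }
          replace h with (Rabs (z + h - z)) at 2 by (replace (z + h - z) with h by ring; apply Rabs_pos_eq; auto).
          apply Hfl; try lra; try (apply (Om_dom s'); pos).
          pos.
      + lra.
      + intros z Hz. apply continuous_shift. apply (HcB (z + h - ln s')); lra.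
      + intros z Hz. apply (HcB (z - ln s')); lra. }
  assert (HP0 : Rabs (Psi ta) <= 2 * n * h * k).
  { unfold Psi. rewrite Rplus_0_r. apply W_init; auto; try lra.
    - replace (ln ta) with (ln ta + 0) by lra. pos.
    - rewrite Rplus_assoc. pos. }
  assert (HPs : Psi s = W i e k s (x + h) - W i e k s x).
  { unfold Psi, ln. f_equal; f_equal; ring. }
  rewrite <- HPs. replace (Psi s) with ((Psi s - Psi ta) + Psi ta) by lra.
  eapply Rle_trans; [apply Rabs_triang|]. lra.
Qed.

(** A bound [d] on differences at distance [h] is improved by [char_bound] to [2 n h + (h + d) / 2],
    because [C (t - ta) <= 1/2]. Starting from the trivial bound [2 M], the iteration converges to
    its fixed point [(4 n + 1) h]. *)
Lemma propagate n ta t : t1 <= ta <= t -> t < t2 -> 0 <= n -> L ta n -> C * (t - ta) <= 1 / 2 ->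
  (forall s, ta < s <= t -> Good s) -> L t (4 * n + 1).
Proof.
  intros Hta Ht Hn HL HC2 HG.
  assert (Hh : forall h x i, 0 <= h -> Om t x -> Om t (x + h) ->
    Rabs (A i t (x + h) - A i t x) <= (4 * n + 1) * h /\ Rabs (B i t (x + h) - B i t x) <= (4 * n + 1) * h).
  { intros h x i Hh Hx.
    assert (HD : forall m : nat, Dif h ta t ((4 * n + 1) * h + 2 * M * (/ 2) ^ m)).
    { induction m.
      - intros s j y Hs Hy Hyh. destruct (Hbd j s y) as [G1 [G2 _]]; [lra | apply (Om_dom s); auto; lra|].
        destruct (Hbd j s (y + h)) as [G3 [G4 _]]; [lra | apply (Om_dom s); auto; lra|].
        apply Rabs_le_between in G1, G2, G3, G4. assert (0 <= (4 * n + 1) * h) by nra.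
        split; apply Rabs_le; lra.
      - set (d := (4 * n + 1) * h + 2 * M * (/ 2) ^ m) in *.
        assert (Hd : 0 <= d).
        { unfold d. pos. }
        assert (Hcb := char_bound h d n ta t ltac:(lra) Ht Hh Hd Hn HL HG IHm).
        assert (Hd' : (4 * n + 1) * h + 2 * M * (/ 2) ^ S m = 2 * n * h + (h + d) / 2) by (unfold d; simpl; field).
        intros s j y Hs Hy Hyh.
        assert (H1 := Hcb s j 1 y Hs ltac:(ring) Hy Hyh).
        assert (H2 := Hcb s j (-1) y Hs ltac:(ring) Hy Hyh).
        assert (H3 : C * (h + d) * (s - ta) <= (h + d) / 2).
        { assert (C * (s - ta) <= 1 / 2) by nra. nra. }
        apply Rabs_le_between in H1, H2. split; apply Rabs_le; lra. }
    assert (Hlim : forall z, (forall m : nat, z <= (4 * n + 1) * h + 2 * M * (/ 2) ^ m) -> z <= (4 * n + 1) * h).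
    { intros z Hz. apply le_epsilon. intros ep Hep.
      destruct (pow_lt_1_zero (/ 2) ltac:(rewrite Rabs_pos_eq; lra) (ep / (2 * M + 1))) as [N HN].
      { pos. }
      specialize (HN N (le_n N)). rewrite Rabs_pos_eq in HN by pos.
      apply Rlt_div_r in HN; [|lra]. specialize (Hz N). nra. }
    split; apply Hlim; intros m; apply HD; auto; lra. }
  intros i x y. destruct (Rle_dec x y) as [Hle|Hle].
  - rewrite (Rabs_minus_sym x), Rabs_minus_sym, (Rabs_minus_sym (B i t x)), (Rabs_pos_eq (y - x)) by lra.
    specialize (Hh (y - x) x). replace (x + (y - x)) with y in Hh by lra. pos.
  - rewrite (Rabs_pos_eq (x - y)) by lra.
    specialize (Hh (x - y) y). replace (y + (x - y)) with x in Hh by lra. pos.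
Qed.

Lemma L_closed t n : t1 <= t <= t2 ->
  (forall d, 0 < d -> exists s, t1 <= s <= t2 /\ Rabs (s - t) < d /\ L s n) -> L t n.
Proof.
  intros Ht H i x y Hx Hy.
  destruct (Om_open t x Hx) as [d1 [Hd1 HO1]]. destruct (Om_open t y Hy) as [d2 [Hd2 HO2]].
  assert (Hxd : a < x < b) by (apply (Om_dom t); auto; lra).
  assert (Hyd : a < y < b) by (apply (Om_dom t); auto; lra).
  assert (Hg : forall g, continuous (fun s => g s x) t -> continuous (fun s => g s y) t ->
     (forall s, t1 <= s <= t2 -> L s n -> Om s x -> Om s y -> Rabs (g s x - g s y) <= n * Rabs (x - y)) ->
     Rabs (g t x - g t y) <= n * Rabs (x - y)).
  { intros g Hgx Hgy HL. apply le_epsilon. intros e He.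
    destruct (proj1 (continuous_eps _ _) Hgx (e / 2)) as [d3 [Hd3 H3]]; [lra|].
    destruct (proj1 (continuous_eps _ _) Hgy (e / 2)) as [d4 [Hd4 H4]]; [lra|].
    destruct (H (Rmin (Rmin d1 d2) (Rmin d3 d4))) as [s [Hs [Hst HLs]]]; [pos |].
    mins.
    specialize (H3 s ltac:(lra)). specialize (H4 s ltac:(lra)).
    assert (G := HL s Hs HLs ltac:(apply HO1; [lra | rewrite Rminus_diag, Rabs_R0; auto]) ltac:(apply HO2; [lra | rewrite Rminus_diag, Rabs_R0; auto])).
    apply Rabs_def2 in H3, H4. apply Rabs_le_between in G. apply Rabs_le. lra. }
  split; apply Hg.
  - eapply is_derive_cont. pos.
  - eapply is_derive_cont. pos.
  - intros s Hs HL Hsx Hsy. apply HL; auto.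
  - pos.
  - pos.
  - intros s Hs HL. apply HL.
Qed.

Lemma bad_closed x : (forall d, 0 < d -> exists z, (t1 <= z <= t2 /\ ~ Good z) /\ Rabs (z - x) < d) -> t1 <= x <= t2 /\ ~ Good x.
Proof.
  split.
  - split; apply Rnot_lt_le; intros Hlt.
    + destruct (H (t1 - x)) as [z [[Hz _] Hzx]]; [lra|]. apply Rabs_def2 in Hzx. lra.
    + destruct (H (x - t2)) as [z [[Hz _] Hzx]]; [lra|]. apply Rabs_def2 in Hzx. lra.
  - intros [d [n [Hd HL]]]. destruct (H (d / 2)) as [z [[_ Hz] Hzx]]; [lra|]. apply Hz.
    exists (d / 2), n. split; [lra|]. intros s Hs Hsz. apply HL; auto.
    replace (s - x) with ((s - z) + (z - x)) by lra. eapply Rle_lt_trans; [apply Rabs_triang|]. lra.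
Qed.

(* On a ball around [z] in which all bad times share the constant [n], every time is reached from the last
   earlier bad time (or from the left end) by [propagate]. *)
Lemma all_good t : t1 <= t <= t2 -> Good t.
Proof.
  intros. apply NNPP. intros Hbad.
  destruct (baire_closed (fun t => t1 <= t <= t2 /\ ~ Good t) (fun n t => L t (INR n))) as [n [z [d [[Hz Hzb] [Hd HE]]]]].
  - apply bad_closed.
  - intros n x [Hx _] Hd. apply L_closed; auto. intros d Hd0. destruct (Hd d Hd0) as [z [[Hz _] [HL Hzx]]]. eauto.
  - intros z [Hz _]. destruct (Hl0 z) as [n Hn]; [lra|]. exists n. intros i x y Hx Hy. apply Hn; apply (Om_dom z); auto; lra.
  - eauto.
  (* The constant makes [C (2 d') <= 1/2], so that [propagate] covers the interval of half-length
     [d'] around [z]. *)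
  - apply Hzb. set (d' := Rmin d (/ (4 * (C + 1)))).
    assert (Hd'0 : 0 < d') by (apply Rmin_glb_lt; pos).
    mins.
    assert (HCd : C * (2 * d') <= 1 / 2).
    { apply Rle_trans with (C * (2 * / (4 * (C + 1)))). apply Rmult_le_compat_l; lra.
      apply Rmult_le_reg_r with (C + 1); [lra|]. field_simplify; lra. }
    set (s0 := Rmax t1 (z - d' / 2)). assert (B3 : t1 <= s0) by apply Rmax_l. assert (B4 : z - d' / 2 <= s0) by apply Rmax_r.
    assert (B5 : s0 <= z) by (apply Rmax_lub; lra).
    destruct (Hl0 s0) as [n0 Hn0]; [lra|].
    set (N := Rmax (INR n) (INR n0)). assert (B6 : INR n <= N) by apply Rmax_l. assert (B7 : INR n0 <= N) by apply Rmax_r.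
    assert (HN0 : 0 <= N) by (assert (Hp := pos_INR n); lra).
    assert (HLs0 : L s0 N).
    { apply L_mono with (INR n0); auto. intros i x y Hx Hy. apply Hn0; apply (Om_dom s0); auto; lra. }
    assert (Hlt : forall t, s0 <= t < z + d' -> t < t2 -> L t (4 * N + 1)).
    { intros t' Ht' Ht2. set (S := fun s => s0 <= s <= t' /\ (s = s0 \/ (t1 <= s <= t2 /\ ~ Good s))).
      destruct (completeness S) as [ta [Hub Hlub]].
      - exists t'. intros s [Hs _]. lra.
      - exists s0. split; lra.
      - assert (Hta : s0 <= ta <= t').
        { split. apply Hub. split; lra. apply Hlub. intros s [Hs _]. lra. }
        assert (Happ : forall e, 0 < e -> exists s, S s /\ Rabs (s - ta) < e).
        { intros e He. apply NNPP. intros Hno. assert (G : ta <= ta - e); [|lra].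
          apply Hlub. intros s Hs. apply Rnot_lt_le. intros Hlt. apply Hno. exists s. split; auto.
          assert (G1 := Hub s Hs). rewrite Rabs_left1; lra. }
        assert (HLta : L ta N).
        { destruct (Req_dec ta s0) as [->|Hne]; auto. apply L_mono with (INR n); auto. apply HE.
          - apply bad_closed. intros e He. destruct (Happ (Rmin e (ta - s0))) as [s [[Hs [Hs1|Hs1]] Hse]].
            + pos.
            + assert (G := Rmin_r e (ta - s0)). rewrite Rabs_left1 in Hse; lra.
            + exists s. split; auto. mins; lra.
          - apply Rabs_def1; lra. }
        apply propagate with ta; auto; try lra.
        + nra.
        + intros s Hs. apply NNPP. intros Hng. assert (G : s <= ta); [|lra]. apply Hub. split; [lra|]. pos. }
    (* [propagate] needs a time strictly before [t2]; the endpoint is reached as a limit of earlier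
       times, by [L_closed]. *)
    assert (Hle : forall t, s0 <= t < z + d' -> t <= t2 -> L t (4 * N + 1)).
    { intros t' Ht' Ht2.
      destruct (Req_dec t' s0) as [->|Hne]. apply L_mono with N; auto; lra.
      apply L_closed; [lra|]. intros e He. set (r := Rmin e (t' - s0) / 2).
      assert (Hr0 : 0 < Rmin e (t' - s0)) by pos.
      mins.
      exists (t' - r). unfold r. split; [lra|]. split; [rewrite Rabs_left1; lra|]. pos. }
    exists (d' / 2), (4 * N + 1). split; [lra|]. intros s Hs Hsz. apply Rabs_def2 in Hsz. apply Hle; try lra.
    split; [|lra]. apply Rmax_lub; lra.
Qed.

End Regularity.

(** * Growth estimates along characteristics *)

(** The continuation principle behind all contractions below: if every positive upper bound can be
    lowered, the supremum is not positive. An a priori bound [M], however poor, is enough to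
    start. *)
Lemma sup_contract (S : R -> Prop) M : (forall z, S z -> z <= M) ->
  (forall N, 0 < N -> (forall z, S z -> z <= N) -> exists N', N' < N /\ forall z, S z -> z <= N') ->
  forall z, S z -> z <= 0.
Proof.
  intros HM HC z Hz. destruct (completeness S) as [N [Hub Hlub]].
  - exists M. auto.
  - eauto.
  - apply Rnot_lt_le. intros Hlt. assert (HN : 0 < N) by (assert (H := Hub z Hz); lra).
    destruct (HC N HN Hub) as [N' [HN' H]]. assert (N <= N') by pos. lra.
Qed.

Section Characteristics.
Context (x0 rho T : R) (k : R -> R) (W Rm : R -> R -> R -> R) (Eh r : R -> R) (M : R).
Context (Hk : forall s y, 0 < s < T -> Om x0 rho s y -> 0 <= k y <= 1).
Context (HW : forall e s y, e * e = 1 -> 0 < s < T -> Om x0 rho s y ->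
  is_derive (fun s' => W e s' (y + - e * (s' - s))) s
    ((- (k y + 1 / 2) * W e s y - (k y - 1 / 2) * W (- e) s y + Rm e s y) / s)).
Context (HR : forall e s y, e * e = 1 -> 0 < s < T -> Om x0 rho s y -> Rabs (Rm e s y) <= r s).
Context (HE : forall s, 0 < s < T -> is_derive Eh s (r s / s)).
Context (Hr : forall s, 0 < s < T -> 0 <= r s).
Context (HE0 : lim0 Eh).
Context (HW0 : forall ep, 0 < ep -> exists d, 0 < d /\ forall e s y, e * e = 1 -> 0 < s < d -> s < T -> Om x0 rho s y -> Rabs (W e s y) <= ep).
Context (HM : forall e s y, e * e = 1 -> 0 < s < T -> Om x0 rho s y -> Rabs (W e s y) <= M).

Lemma Eh_mono s t : 0 < s <= t -> t < T -> Eh s <= Eh t.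
Proof.
  intros. eapply incr_of_derive; try lra; intros x Hx.
  - apply HE; lra.
  - apply Rmult_le_pos; pos.
Qed.

(* [s^2 (W - g)] decreases along characteristics as long as [|W| <= g], because [|k - 1/2| <= k + 1/2 <= 3/2]. *)
Lemma char_improve s0 ts m0 N : 0 < s0 <= ts -> ts < T -> 0 <= m0 -> 0 < N ->
  (forall e y, e * e = 1 -> Om x0 rho s0 y -> Rabs (W e s0 y) <= m0) ->
  (forall e s y, e * e = 1 -> s0 <= s <= ts -> Om x0 rho s y -> Rabs (W e s y) <= m0 + Eh s - Eh s0 + N) ->
  forall e s y, e * e = 1 -> s0 <= s <= ts -> Om x0 rho s y ->
    Rabs (W e s y) <= m0 + Eh s - Eh s0 + N * (1 - (s0 / ts) ^ 2).
Proof.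
  intros Hs0 Hts Hm0 HN H0 Hg e s1 y1 He Hs1 Hy1.
  set (g := fun s => m0 + Eh s - Eh s0 + N) in *.
  assert (Hg' : forall s, 0 < s < T -> is_derive g s (r s / s)).
  { intros s Hs. replace (r s / s) with (0 + r s / s - 0 + 0) by lra.
    apply is_derive_Rplus; [|apply is_derive_cst]. apply is_derive_Rminus; [|apply is_derive_cst].
    apply is_derive_Rplus; [apply is_derive_cst | auto]. }
  set (ln := fun s => y1 + - e * (s - s1)).
  assert (Hln : forall s, s0 <= s <= s1 -> Om x0 rho s (ln s)).
  { intros s Hs. apply Om_line; auto; lra. }
  assert (Hth : forall th, th * th = 1 -> th * W e s1 y1 - g s1 <= - (N * (s0 / ts) ^ 2)).
  { intros th Hth.
    assert (Hth1 : Rabs th = 1) by (unfold Rabs; destruct Rcase_abs; nra).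
    assert (Hab : forall w m, Rabs w <= m -> th * w <= m /\ - m <= th * w).
    { intros w m Hw. assert (Hw1 : Rabs (th * w) <= m) by (rewrite Rabs_mult, Hth1; lra). apply Rabs_le_between in Hw1. lra. }
    set (z := fun s => s ^ 2 * (g s - th * W e s (ln s))).
    set (dz := fun s => 2 * s * (g s - th * W e s (ln s)) + s ^ 2 * (r s / s - th *
       ((- (k (ln s) + 1 / 2) * W e s (ln s) - (k (ln s) - 1 / 2) * W (- e) s (ln s) + Rm e s (ln s)) / s))).
    assert (Hz : z s0 <= z s1).
    { apply incr_of_derive with dz; try lra.
      - intros s Hs. apply (is_derive_Rmult (fun s => s ^ 2) (fun s => g s - th * W e s (ln s))).
        + auto_derive; auto. lra.
        + apply is_derive_Rminus; [pos |]. apply is_derive_Rscal.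
          apply is_derive_ext with (fun s' => W e s' (ln s + - e * (s' - s))).
          { intros. unfold ln. f_equal. ring. }
          pos.
      - intros s Hs. unfold dz.
        assert (Hsd : 0 < s < T) by lra. assert (HO := Hln s Hs).
        assert (He' : (- e) * (- e) = 1) by lra.
        destruct (Hab _ _ (Hg e s (ln s) He ltac:(lra) HO)) as [G1 _].
        destruct (Hab _ _ (Hg (- e) s (ln s) He' ltac:(lra) HO)) as [G3 G4].
        destruct (Hab _ _ (HR e s (ln s) He Hsd HO)) as [G5 _].
        assert (Hkk := Hk s (ln s) Hsd HO).
        replace (2 * s * (g s - th * W e s (ln s)) + s ^ 2 * (r s / s - th *
          ((- (k (ln s) + 1 / 2) * W e s (ln s) - (k (ln s) - 1 / 2) * W (- e) s (ln s) + Rm e s (ln s)) / s)))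
        with (s * (2 * (g s - th * W e s (ln s)) + (r s - th * Rm e s (ln s)) + (k (ln s) + 1 / 2) * (th * W e s (ln s)) + (k (ln s) - 1 / 2) * (th * W (- e) s (ln s)))) by (field; lra).
        apply Rmult_le_pos; [lra|].
        fold (g s) in G1, G3, G4. nra. }
    unfold z in Hz.
    assert (Hzs : ln s1 = y1) by (unfold ln; ring). rewrite Hzs in Hz.
    destruct (Hab _ _ (H0 e (ln s0) He (Hln s0 ltac:(lra)))) as [G1 _].
    assert (G2 : s0 ^ 2 * N <= s0 ^ 2 * (g s0 - th * W e s0 (ln s0))).
    { apply Rmult_le_compat_l; [nra|]. unfold g. lra. }
    assert (G3 : N * (s0 / ts) ^ 2 * ts ^ 2 = N * s0 ^ 2) by (field; lra).
    assert (G5 : s1 ^ 2 <= ts ^ 2) by nra.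
    assert (G6 : 0 < s1 ^ 2) by nra.
    assert (G7 : s1 ^ 2 * (N * (s0 / ts) ^ 2) <= ts ^ 2 * (N * (s0 / ts) ^ 2)) by pos.
    nra. }
  assert (P1 := Hth 1). assert (P2 := Hth (-1)). unfold g in P1, P2.
  apply Rabs_le. nra.
Qed.

(** [char_improve] multiplies the excess over the expected bound by [1 - (s0 / t)^2 < 1] on all of
    [[s0, t]], and [sup_contract] removes it. The time [s0] is so small that [W] and [Eh] are below
    [ep / 2] there. *)
Lemma char_gronwall e t y : e * e = 1 -> 0 < t < T -> Om x0 rho t y -> Rabs (W e t y) <= Eh t.
Proof.
  intros He Ht Hy. apply le_epsilon. intros ep Hep.
  destruct (HW0 (ep / 2)) as [d1 [Hd1 H1]]; [lra|]. destruct (HE0 (ep / 2)) as [d2 [Hd2 H2]]; [lra|].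
  set (s0 := Rmin t (Rmin d1 d2) / 2).
  assert (Hm : 0 < Rmin t (Rmin d1 d2)) by pos.
  assert (B1 := Rmin_l t (Rmin d1 d2)). assert (B2 := Rmin_r t (Rmin d1 d2)).
  assert (B3 := Rmin_l d1 d2). assert (B4 := Rmin_r d1 d2).
  assert (Hs0 : 0 < s0 < t /\ s0 < d1 /\ s0 < d2) by (unfold s0; lra).
  specialize (H2 s0 ltac:(lra)). apply Rabs_def2 in H2.
  assert (H : Rabs (W e t y) - (ep / 2 + Eh t - Eh s0) <= 0); [|lra].
  apply sup_contract with (S := fun z => exists e s y, e * e = 1 /\ s0 <= s <= t /\ Om x0 rho s y /\ z = Rabs (W e s y) - (ep / 2 + Eh s - Eh s0)) (M := M).
  - intros z [e' [s [y' [He' [Hs [Hy' ->]]]]]]. assert (G := HM e' s y' He' ltac:(lra) Hy').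
    assert (G2 := Eh_mono s0 s). lra.
  - intros N HN Hz. exists (N * (1 - (s0 / t) ^ 2)). split.
    + assert (0 < s0 / t) by pos. assert (0 < (s0 / t) ^ 2) by nra. nra.
    + intros z [e' [s [y' [He' [Hs [Hy' ->]]]]]].
      assert (G : Rabs (W e' s y') <= ep / 2 + Eh s - Eh s0 + N * (1 - (s0 / t) ^ 2)); [|lra].
      apply char_improve; auto; try lra.
      * pos.
      * intros e2 s2 y2 He2 Hs2 Hy2. assert (G := Hz).
        assert (G2 : Rabs (W e2 s2 y2) - (ep / 2 + Eh s2 - Eh s0) <= N); [|lra]. apply G.
        exists e2, s2, y2. auto.
  - exists e, t, y. pos.
Qed.

End Characteristics.

(** * The potential of a first-order system with a source *)

Section Potential.
Context (x0 rho T : R) (HT : 0 < T).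
Notation Omg := (Om x0 rho).
Notation "'onD' t x , Z" := (forall t x : R, 0 < t < T -> Omg t x -> Z) (at level 200, t name, x name).
Notation dom t x := (0 < t < T /\ Omg t x).
Definition lb (g : R -> R -> R) : Prop := forall t, 0 < t < T -> exists d K, 0 < d /\
  forall s x, 0 < s < T -> Rabs (s - t) < d -> Omg s x -> Rabs (g s x) <= K.

Context (A B Bx f : R -> R -> R) (E lam M : R) (Hlam : 0 < lam) (HE : 0 <= E).
Context (HAt : onD t x, is_derive (fun s => A s x) t (Bx t x + f t x / t)).
Context (HBx : onD t x, is_derive (fun y => B t y) x (Bx t x)).
Context (HBxc : onD t x, continuous (Bx t) x).
Context (HBxl : lb Bx).
Context (HAc : onD t x, continuous (A t) x).
Context (HBc : onD t x, continuity_2d_pt B t x).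
Context (Hfc : onD t x, continuity_2d_pt f t x).
Context (Hf : onD t x, Rabs (f t x) <= E * Rpower t lam).
Context (HB : onD t x, Rabs (B t x) <= M).
Context (HA0 : forall e, 0 < e -> exists d, 0 < d /\ forall t x, 0 < t < T -> t < d -> Omg t x -> Rabs (A t x) <= e).
Context (HB0 : forall e, 0 < e -> exists d, 0 < d /\ forall t x, 0 < t < T -> t < d -> Omg t x -> Rabs (B t x) <= e).

Lemma Om_anti s t x : s <= t -> Omg t x -> Omg s x.
Proof. unfold Om. lra. Qed.

(** The time at which the vertical line through [x] leaves the cone or the time interval; primitives
    in [t] are taken line by line up to this time. *)
Definition Tx (x : R) : R := Rmin T (rho - Rabs (x - x0)).

Lemma Tx_in t x : 0 < t < Tx x <-> 0 < t < T /\ Omg t x.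
Proof.
  unfold Tx, Om. split.
  - mins; lra.
  - pos.
Qed.

(** For continuity in [x], the primitive up to a small time [s] is uniformly small by its own bound,
    while from [s] to [t] it is an integral with bounded continuous integrand. *)
Lemma source_primitive : exists F : R -> R -> R,
  (onD t x, is_derive (fun s => F s x) t (f t x / t)) /\
  (onD t x, Rabs (F t x) <= E / lam * Rpower t lam) /\
  (onD t x, continuous (F t) x).
Proof.
  assert (H : forall x, exists F, (forall t, 0 < t < Tx x -> is_derive F t (f t x / t)) /\ lim0 F).
  { intros x. apply prim_exists with lam E; auto.
    - intros t Ht. apply Tx_in in Ht. apply cont2_fst. apply Hfc; tauto.
    - intros t Ht. apply Tx_in in Ht. apply Hf; tauto. }
  destruct (choice_fun _ H) as [Fx HFx]. exists (fun t x => Fx x t).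
  assert (Hd : onD t x, is_derive (fun s => Fx x s) t (f t x / t)).
  { intros t x Ht Hx. apply HFx. apply Tx_in; auto. }
  assert (Hb : onD t x, Rabs (Fx x t) <= E / lam * Rpower t lam).
  { intros t x Ht Hx. apply compare0_abs with (f := fun t => f t x / t) (g := fun t => E / lam * (lam * Rpower t lam / t)) (G := fun t => E / lam * Rpower t lam) (T := Tx x).
    - apply HFx.
    - intros s Hs. apply is_derive_Rscal, is_derive_Rpower_t. lra.
    - intros s Hs. rewrite Rabs_div by lra. rewrite (Rabs_pos_eq s) by lra.
      replace (E / lam * (lam * Rpower s lam / s)) with (E * Rpower s lam / s) by (field; lra).
      apply Rmult_le_compat_r; [pos |]. apply Tx_in in Hs. apply Hf; tauto.
    - apply HFx.
    - apply lim0_Rpower; auto.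
    - apply Tx_in; auto. }
  split; [auto | split; auto].
  intros t x Ht Hx. apply continuous_eps. intros e He.
  destruct (lim0_Rpower (E / lam) lam Hlam (e / 3) ltac:(lra)) as [d0 [Hd0 Hs]].
  set (s := Rmin d0 t / 2). assert (Hm : 0 < Rmin d0 t) by pos.
  mins.
  assert (Hst : 0 < s < t) by (unfold s; lra). assert (Hsd : s < d0) by (unfold s; lra).
  specialize (Hs s ltac:(lra)).
  destruct (Om_open x0 rho t x Hx) as [d1 [Hd1 HO]].
  assert (HO' : forall y, Rabs (y - x) < d1 -> Omg t y) by (intros y Hy; apply HO; [rewrite Rminus_diag, Rabs_R0|]; auto).
  assert (Hfd : forall y, Omg t y -> Fx y t - Fx y s = RInt (fun s => f s y / s) s t).
  { symmetry. apply RInt_of_derive; try lra; intros r Hr.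
    - apply Hd; [lra | apply Om_anti with t; auto; lra].
    - apply Rcont_mult. apply cont2_fst, Hfc; [lra | apply Om_anti with t; auto; lra].
      apply continuous_Rinv. lra. }
  assert (HI : continuous (fun y => RInt (fun s => f s y / s) s t) x).
  { apply (RInt_cont_param (fun y s => f s y / s) x s t (E * Rpower T lam / s) d1); try lra.
    - intros r y Hr Hy. assert (HyO : Omg r y) by (apply Om_anti with t; pos). split.
      + apply Rcont_mult. apply cont2_fst, Hfc; pos. apply continuous_Rinv. lra.
      + rewrite Rabs_div by lra. rewrite (Rabs_pos_eq r) by lra.
        apply Rmult_le_compat.
        * pos.
        * pos.
        * eapply Rle_trans; [pos |]. apply Rmult_le_compat_l; auto. apply Rpower_le_base; lra.
        * apply Rinv_le_contravar; lra.
    - intros. apply Rcont_mult; [|apply Rcont_const]. apply cont2_snd, Hfc; [lra | apply Om_anti with t; auto; lra]. }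
  destruct (proj1 (continuous_eps _ _) HI (e / 3)) as [d2 [Hd2 H2]]; [lra|].
  exists (Rmin d1 d2). split; [pos |]. intros y Hy.
  mins.
  specialize (H2 y ltac:(lra)). assert (HyO : Omg t y) by pos.
  rewrite <- !Hfd in H2 by pos.
  assert (G1 := Hb s y ltac:(lra) ltac:(apply Om_anti with t; auto; lra)).
  assert (G2 := Hb s x ltac:(lra) ltac:(apply Om_anti with t; auto; lra)).
  apply Rabs_def2 in H2, Hs. apply Rabs_le_between in G1, G2. apply Rabs_def1; lra.
Qed.

(** [S] is defined line by line as the time integral of [B] from zero. For its [x]-derivative,
    [S t x2 - S t x1] and the integral of [A - F] over [[x1, x2]] have the same time derivative, as
    [f / t] cancels, and both vanish at [0+]. *)
Lemma potential_exists F : (onD t x, is_derive (fun s => F s x) t (f t x / t)) ->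
  (onD t x, Rabs (F t x) <= E / lam * Rpower t lam) ->
  (onD t x, continuous (F t) x) ->
  exists S : R -> R -> R,
  (onD t x, is_derive (fun s => S s x) t (B t x)) /\
  (onD t x, is_derive (fun y => S t y) x (A t x - F t x)) /\
  (onD t x, Rabs (S t x) <= M * t) /\
  (forall e, 0 < e -> exists d, 0 < d /\ forall t x, 0 < t < T -> t < d -> Omg t x -> Rabs (S t x) <= e * t).
Proof.
  intros HF HFb HFc.
  assert (H : forall x, exists S, (forall t, 0 < t < Tx x -> is_derive S t (t * B t x / t)) /\ lim0 S).
  { intros x. apply prim_exists with 1 (Rmax M 0).
    - lra.
    - apply Rmax_r.
    - intros t Ht. apply Tx_in in Ht. apply Rcont_mult; [apply continuous_id|]. apply cont2_fst. apply HBc; tauto.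
    - intros t Ht. rewrite Rpower_1 by lra. apply Tx_in in Ht. rewrite Rabs_mult, Rabs_pos_eq, Rmult_comm by lra.
      apply Rmult_le_compat_r; [lra|]. eapply Rle_trans; [apply HB; tauto | apply Rmax_l]. }
  destruct (choice_fun _ H) as [Sx HSx]. exists (fun t x => Sx x t).
  assert (Hd : onD t x, is_derive (fun s => Sx x s) t (B t x)).
  { intros t x Ht Hx. replace (B t x) with (t * B t x / t) by (field; lra). apply HSx. apply Tx_in; auto. }
  assert (Hb : forall e t1 x, 0 < t1 < T -> Omg t1 x -> (forall t, 0 < t < t1 -> Rabs (B t x) <= e) -> forall t, 0 < t < t1 -> Rabs (Sx x t) <= e * t).
  { intros e t1 x Ht1 Hx He t Ht. apply compare0_abs with (f := fun t => B t x) (g := fun _ => e * 1) (G := fun t => e * t) (T := t1); auto.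
    - intros s Hs. apply Hd; [lra | apply Om_anti with t1; auto; lra].
    - intros s Hs. apply is_derive_Rscal. apply (is_derive_id (K := R_AbsRing)).
    - rewrite Rmult_1_r. auto.
    - apply HSx.
    - intros ep Hep. destruct (lim0_Rpower e 1 ltac:(lra) ep Hep) as [d [Hd0 H0]]. exists d. split; auto.
      intros s Hs. specialize (H0 s). rewrite Rpower_1 in H0 by lra. auto. }
  assert (Hb' : forall e t1 x, 0 < t1 < T -> Omg t1 x -> (forall t, 0 < t <= t1 -> Rabs (B t x) <= e) -> Rabs (Sx x t1) <= e * t1).
  { intros e t1 x Ht1 Hx He.
    apply le_epsilon. intros ep Hep.
    assert (Hc : continuous (fun s => Sx x s) t1) by (eapply is_derive_cont; apply Hd; auto).
    destruct (proj1 (continuous_eps _ _) Hc ep) as [d2 [Hd2 H2]]; auto.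
    set (s := Rmax (t1 / 2) (t1 - d2 / 2)).
    assert (B1 := Rmax_l (t1 / 2) (t1 - d2 / 2)). assert (B2 := Rmax_r (t1 / 2) (t1 - d2 / 2)).
    assert (Hs : s < t1) by (apply Rmax_lub_lt; lra). fold s in B1, B2.
    assert (G := Hb e t1 x Ht1 Hx ltac:(intros; apply He; lra) s ltac:(lra)).
    specialize (H2 s ltac:(rewrite Rabs_left1; lra)). apply Rabs_def2 in H2. apply Rabs_le_between in G. apply Rabs_le. nra. }
  assert (Hgam : forall t x1 x2, 0 < t < T -> x1 <= x2 -> Omg t x1 -> Omg t x2 ->
     Sx x2 t - Sx x1 t = RInt (fun y => A t y - F t y) x1 x2).
  { intros t x1 x2 Ht Hx Hx1 Hx2.
    destruct (Om_open x0 rho t x1 Hx1) as [d1 [Hd1 HO1]]. destruct (Om_open x0 rho t x2 Hx2) as [d2 [Hd2 HO2]].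
    set (t' := Rmin T (t + Rmin d1 d2)).
    assert (Hm : 0 < Rmin d1 d2) by pos. assert (B1 := Rmin_l d1 d2). assert (B2 := Rmin_r d1 d2).
    assert (Ht' : t < t') by (apply Rmin_glb_lt; lra).
    assert (B3 : t' <= T) by apply Rmin_l. assert (B4 : t' <= t + Rmin d1 d2) by apply Rmin_r.
    assert (HO : forall s y, 0 < s < t' -> x1 <= y <= x2 -> Omg s y).
    { intros s y Hs Hy. apply Om_between with x1 x2; auto.
      - destruct (Rle_dec s t). apply Om_anti with t; auto. apply HO1; [apply Rabs_def1; lra | rewrite Rminus_diag, Rabs_R0; auto].
      - destruct (Rle_dec s t). apply Om_anti with t; auto. apply HO2; [apply Rabs_def1; lra | rewrite Rminus_diag, Rabs_R0; auto]. }
    assert (HGc : forall s y, 0 < s < t' -> x1 <= y <= x2 -> continuous (fun y => A s y - F s y) y).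
    { intros s y Hs Hy. apply Rcont_minus; pos. }
    assert (HGd : forall s y, 0 < s < t' -> x1 <= y <= x2 -> is_derive (fun s => A s y - F s y) s (Bx s y)).
    { intros s y Hs Hy. replace (Bx s y) with (Bx s y + f s y / s - f s y / s) by lra.
      apply is_derive_Rminus; pos. }
    apply (prim_unique t' (fun s => Sx x2 s - Sx x1 s) (fun s => RInt (fun y => A s y - F s y) x1 x2) (fun s => B s x2 - B s x1)).
    - intros s Hs. apply is_derive_Rminus; apply Hd; try lra; apply HO; lra.
    - intros s Hs. rewrite <- (RInt_of_derive (B s) (Bx s)); auto.
      2: intros y Hy; pos.
      2: intros y Hy; pos.
      destruct (HBxl s) as [d [K [Hd0 HK]]]; [lra|].
      set (d' := Rmin d (Rmin s (t' - s))).
      mins.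
      apply RInt_derive_bounded with (F := fun s y => A s y - F s y) (K := K) (d := d'); auto.
      + repeat apply Rmin_glb_lt; lra.
      + intros y h Hy Hh. apply Rabs_def2 in Hh. split. apply HGc; lra.
        assert (G := derive_bound_lip (fun s => A s y - F s y) (fun s => Bx s y) s (s + h)).
        replace (s + h - s) with h in G by lra. apply G; intros r Hr; apply between_dist in Hr; assert (Hr' : Rabs (r - s) < d') by (eapply Rle_lt_trans; [eauto | apply Rabs_def1; lra]);
          assert (Hr'' := Hr'); apply Rabs_def2 in Hr''; pos.
      + pos.
    - apply lim0_minus; apply HSx.
    - intros ep Hep. set (w := x2 - x1 + 1).
      destruct (HA0 (ep / (2 * w))) as [d3 [Hd3 H3]]; [apply Rdiv_lt_0_compat; unfold w; lra|].
      destruct (lim0_Rpower (E / lam) lam Hlam (ep / (2 * w))) as [d4 [Hd4 H4]]; [apply Rdiv_lt_0_compat; unfold w; lra|].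
      exists (Rmin t' (Rmin d3 d4)). split; [pos |]. intros s Hs.
      mins.
      assert (G : Rabs (RInt (fun y => A s y - F s y) x1 x2) <= (ep / w) * (x2 - x1)).
      { apply RInt_abs_bound; auto. intros y Hy. apply HGc; lra. intros y Hy.
        assert (G1 := H3 s y ltac:(lra) ltac:(lra) ltac:(apply HO; lra)).
        assert (G2 := HFb s y ltac:(lra) ltac:(apply HO; lra)).
        specialize (H4 s ltac:(lra)). apply Rabs_def2 in H4. apply Rabs_le_between in G1, G2.
        replace (ep / w) with (ep / (2 * w) + ep / (2 * w)) by (field; unfold w; lra). apply Rabs_le. lra. }
      eapply Rle_lt_trans; eauto. apply Rlt_le_trans with ((ep / w) * w).
      apply Rmult_lt_compat_l; [apply Rdiv_lt_0_compat; unfold w; lra | unfold w; lra].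
      right. field. unfold w; lra.
    - lra. }
  split; auto. splits.
  - intros t x Ht Hx. destruct (Om_open x0 rho t x Hx) as [d [Hd0 HO]].
    assert (HO' : forall y, x - d < y < x + d -> Omg t y).
    { intros y Hy. apply HO; [rewrite Rminus_diag, Rabs_R0; auto | apply Rabs_def1; lra]. }
    assert (HGc : forall y, x - d < y < x + d -> continuous (fun y => A t y - F t y) y).
    { intros y Hy. apply Rcont_minus; auto. }
    apply is_derive_ext_loc with (fun y => RInt (fun y => A t y - F t y) x y + Sx x t).
    + assert (Hx' : x - d < x < x + d) by lra.
      destruct (locally_itv _ _ _ Hx') as [d' Hd']. exists d'. intros y Hy. specialize (Hd' y Hy).
      destruct (Rle_dec x y) as [Hle|Hle].
      * rewrite <- Hgam; auto. lra.
      * assert (Hsw : opp (RInt (fun y => A t y - F t y) y x) = RInt (fun y => A t y - F t y) x y).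
        { apply opp_RInt_swap, ex_RInt_cont; [lra|]. pos. }
        rewrite <- Hsw, <- Hgam; auto; [|lra]. unfold opp; simpl. lra.
    + replace (A t x - F t x) with (A t x - F t x + 0) by lra. apply is_derive_Rplus; [|apply is_derive_cst].
      apply (is_derive_upper (fun y => A t y - F t y) (x - d) (x + d)); auto; lra.
  - intros t x Ht Hx. apply Hb'; auto. intros s Hs. apply HB; [lra | apply Om_anti with t; auto; lra].
  - intros e He. destruct (HB0 e He) as [d [Hd0 H0]]. exists d. split; auto. intros t x Ht Htd Hx.
    apply Hb'; auto. intros. apply H0; [lra | lra | apply Om_anti with t; auto; lra].
Qed.

End Potential.

(** * The weighted estimate for the difference of two solutions *)

(** The sources [a], [b] and [F / y] contribute [2 + c0 / lam], integration of [t^lam] against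
    [dt / t] gives [1 / lam], the leading 2 absorbs the terms proportional to the unknown, and
    [2^lam] comes from working up to time [2 t]. *)
Definition wave_cst (c0 lam : R) : R := 2 * ((2 + c0 / lam) / lam) * Rpower 2 lam.

Section Estimate.
Context (x0 rho T : R) (HT : 0 < T <= 1).
Notation Omg := (Om x0 rho).
Notation "'onD' t x , Z" := (forall t x : R, 0 < t < T -> Omg t x -> Z) (at level 200, t name, x name).
Context (v vt vx y yt yx A B Bx f a b : R -> R -> R) (k : R -> R) (c0 c g0 lam E M : R).
Context (Hlam : 0 < lam) (Hg0 : 0 < g0) (HE : 0 <= E) (Hc : 0 <= c) (Hc0 : 0 < c0).
Context (HcT : 3 * c / g0 * Rpower T g0 <= 1 / 2).
Context (Hvt : onD t x, is_derive (fun s => v s x) t (vt t x)).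
Context (Hvx : onD t x, is_derive (fun z => v t z) x (vx t x)).
Context (Hvxc : onD t x, continuity_2d_pt vx t x).
Context (Hyt : onD t x, is_derive (fun s => y s x) t (yt t x)).
Context (Hyx : onD t x, is_derive (fun z => y t z) x (yx t x)).
Context (Hyxc : onD t x, continuity_2d_pt yx t x).
Context (Hy : onD t x, 0 < y t x /\ y t x <= c0 /\ / y t x <= c0).
Context (Hyb : onD t x, Rabs (t * yt t x / y t x) <= c * Rpower t g0 /\ Rabs (t * yx t x / y t x) <= c * Rpower t g0).
Context (Hk : onD t x, 0 <= k x <= 1).
Context (HA : onD t x, A t x = y t x * (t * vt t x + 2 * k x * v t x + a t x)).
Context (HB : onD t x, B t x = y t x * (t * vx t x + b t x)).
Context (HAt : onD t x, is_derive (fun s => A s x) t (Bx t x + f t x / t)).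
Context (HBx : onD t x, is_derive (fun z => B t z) x (Bx t x)).
Context (HBxc : onD t x, continuous (Bx t) x).
Context (HBxl : lb x0 rho T Bx).
Context (HAc : onD t x, continuous (A t) x).
Context (HBc : onD t x, continuity_2d_pt B t x).
Context (Hfc : onD t x, continuity_2d_pt f t x).
Context (Ha : onD t x, Rabs (a t x) <= E * Rpower t lam).
Context (Hb : onD t x, Rabs (b t x) <= E * Rpower t lam + c * Rpower t g0 * Rabs (v t x)).
Context (Hf : onD t x, Rabs (f t x) <= E * Rpower t lam).
Context (HM : onD t x, Rabs (v t x) <= M /\ Rabs (t * vx t x) <= M).
Context (Hv0 : forall e, 0 < e -> exists d, 0 < d /\ forall t x, 0 < t < T -> t < d -> Omg t x ->
  Rabs (v t x) <= e /\ Rabs (t * vt t x) <= e /\ Rabs (t * vx t x) <= e).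

Lemma B_bounded t x : 0 < t < T -> Omg t x -> Rabs (B t x) <= c0 * (M + E + c * M).
Proof.
  intros Ht Hx. rewrite HB by pos. destruct (Hy t x Ht Hx) as [H1 [H2 H3]]. destruct (HM t x Ht Hx) as [H4 H5].
  assert (H6 := Hb t x Ht Hx). assert (H7 := Rpower_le1 t lam). assert (H8 := Rpower_le1 t g0).
  rewrite Rabs_mult, Rabs_pos_eq by lra. apply Rmult_le_compat; [lra | pos | auto|].
  eapply Rle_trans; [apply Rabs_triang|].
  assert (H11 := Rabs_pos (v t x)). assert (c * Rpower t g0 * Rabs (v t x) <= c * M).
  { rewrite Rmult_assoc. apply Rmult_le_compat_l; auto. nra. }
  nra.
Qed.

Lemma AB_small e : 0 < e -> exists d, 0 < d /\ forall t x, 0 < t < T -> t < d -> Omg t x -> Rabs (A t x) <= e /\ Rabs (B t x) <= e.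
Proof.
  intros. set (e1 := e / (c0 * (4 + c))).
  assert (Hp : 0 < c0 * (4 + c)) by nra.
  assert (He1 : 0 < e1) by (apply Rdiv_lt_0_compat; auto).
  destruct (Hv0 e1 He1) as [d1 [Hd1 H1]]. destruct (lim0_Rpower E lam Hlam e1 He1) as [d2 [Hd2 H2]].
  exists (Rmin d1 d2). split; [pos |]. intros t x Ht Htd Hx.
  mins.
  destruct (H1 t x Ht ltac:(lra) Hx) as [V1 [V2 V3]]. specialize (H2 t ltac:(lra)). apply Rabs_def2 in H2.
  destruct (Hy t x Ht Hx) as [Y1 [Y2 Y3]].
  assert (H8 := Rpower_le1 t g0). assert (H10 := Rpower_pos t g0).
  assert (Hk1 := Hk t x Ht Hx). assert (Ha1 := Ha t x Ht Hx). assert (Hb1 := Hb t x Ht Hx).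
  assert (Hcv : c * Rpower t g0 * Rabs (v t x) <= c * e1).
  { rewrite Rmult_assoc. apply Rmult_le_compat_l; auto. nra. }
  assert (Hfin : c0 * ((4 + c) * e1) = e) by (unfold e1; field; lra).
  assert (Hce : 0 <= c * e1) by nra.
  assert (G : forall w, Rabs w <= (4 + c) * e1 -> Rabs (y t x * w) <= e).
  { intros. rewrite Rabs_mult, Rabs_pos_eq, <- Hfin by lra. pos. }
  split.
  - rewrite HA by pos. apply G.
    assert (V4 : Rabs (2 * k x * v t x) <= 2 * e1).
    { rewrite !Rabs_mult, Rabs_pos_eq, Rabs_pos_eq by lra. pos. }
    apply Rabs_le_between in V2, V4, Ha1. apply Rabs_le. lra.
  - rewrite HB by pos. apply G. apply Rabs_le_between in V3, Hb1. apply Rabs_le. lra.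
Qed.

(** The errors proportional to the unknown, namely the logarithmic derivatives of [y] and the part
    of [b] containing [v], all carry [c t^g0]; [HcT] makes their accumulated effect at most half of
    the unknown, so they do not enter the final bound. *)
Lemma wave_bound t x : 0 < t < T -> Omg t x -> Rabs (v t x) <= wave_cst c0 lam * E * Rpower t lam.
Proof.
  intros Ht Hx.
  set (M1 := c0 * (M + E + c * M)).
  destruct (source_primitive x0 rho T f E lam Hlam HE Hfc Hf) as [F [HF [HFb HFc]]].
  destruct (potential_exists x0 rho T A B Bx f E lam M1 Hlam HAt HBx HBxc HBxl HAc HBc B_bounded) with F as [S [HSt [HSx [HSb HS0]]]]; auto.
  { intros e He. destruct (AB_small e He) as [d [Hd H]]. exists d. split; auto. apply H. }
  { intros e He. destruct (AB_small e He) as [d [Hd H]]. exists d. split; auto. apply H. }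
  set (sig := fun s z => S s z / (s * y s z)).
  assert (Hsig : forall s z m, 0 < s < T -> Omg s z -> Rabs (S s z) <= m * s -> Rabs (sig s z) <= m * c0).
  { intros s z m Hs Hz Hm. destruct (Hy s z Hs Hz) as [Y1 [Y2 Y3]]. unfold sig.
    rewrite Rabs_div by nra. rewrite (Rabs_pos_eq (s * y s z)) by nra.
    replace (Rabs (S s z) / (s * y s z)) with (Rabs (S s z) / s * / y s z) by (field; lra).
    apply Rmult_le_compat; auto.
    - apply Rmult_le_pos; pos.
    - pos.
    - apply Rle_div_l; lra. }
  set (W := fun e s z => v s z + e * sig s z).
  set (Rm := fun e s z => e * b s z - a s z + F s z / y s z - e * sig s z * (s * yt s z / y s z) + sig s z * (s * yx s z / y s z)).
  (* Restricting to times below [ts <= 2 t] yields the power [t^lam] at time [t] instead of a power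
     of [T]. *)
  set (ts := Rmin T (2 * t)).
  assert (Hts : 0 < ts /\ t < ts /\ ts <= T /\ ts <= 2 * t).
  { mins.
    assert (t < ts) by (apply Rmin_glb_lt; lra). pos. }
  (* The terms in [A] and [B] cancel between [v] and the potential. What remains, [-2 k v - e sig],
     is a combination of [W e] and [W (- e)] with coefficients [-(k + 1/2)] and [-(k - 1/2)]. *)
  assert (HWd : forall e s z, e * e = 1 -> 0 < s < T -> Omg s z ->
    is_derive (fun s' => W e s' (z + - e * (s' - s))) s
    ((- (k z + 1 / 2) * W e s z - (k z - 1 / 2) * W (- e) s z + Rm e s z) / s)).
  { intros e s z He Hs Hz. assert (He' : - e * - e = 1) by lra.
    destruct (Om_open x0 rho s z Hz) as [d [Hd HO]]. destruct (locally_itv 0 T s Hs) as [d2 Hd2].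
    set (dd := Rmin d d2). assert (Hdd : 0 < dd) by (apply Rmin_glb_lt; pos).
    mins.
    assert (HO1 : forall s' z', Rabs (s' - s) < dd -> Rabs (z' - z) < dd -> 0 < s' < T /\ Omg s' z').
    { split. apply Hd2. change (Rabs (s' - s) < d2). lra. pos. }
    assert (HO2 : forall s' z', Rabs (s' - s) < dd -> Rabs (z' - z) < dd -> 0 < s' < T) by (intros s' z' G1 G2; apply (HO1 s' z' G1 G2)).
    assert (HO3 : forall s' z', Rabs (s' - s) < dd -> Rabs (z' - z) < dd -> Omg s' z') by pos.
    assert (Lv := chain_line_x v vx (vt s z) s z (- e) dd Hdd He' (fun s' z' G1 G2 => Hvx s' z' (HO2 s' z' G1 G2) (HO3 s' z' G1 G2))).
    assert (Ly := chain_line_x y yx (yt s z) s z (- e) dd Hdd He' (fun s' z' G1 G2 => Hyx s' z' (HO2 s' z' G1 G2) (HO3 s' z' G1 G2)) (Hyxc s z Hs Hz) (Hyt s z Hs Hz)).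
    assert (LS := chain_line S B (A s z - F s z) s z (- e) dd Hdd (fun s' z' G1 G2 => HSt s' z' (HO2 s' z' G1 G2) (HO3 s' z' G1 G2)) (HBc s z Hs Hz) (HSx s z Hs Hz)).
    assert (Lid := is_derive_id (K := R_AbsRing) s).
    assert (Lsy := is_derive_Rmult (fun s => s) _ s _ _ Lid Ly).
    destruct (Hy s z Hs Hz) as [Y1 _].
    assert (Hz0 : z + - e * (s - s) = z) by lra.
    assert (Hne : s * y s (z + - e * (s - s)) <> 0) by (rewrite Hz0; nra).
    assert (Lsig := is_derive_div _ _ s _ _ LS Lsy Hne). cbv beta in Lsig. rewrite Hz0 in Lsig.
    evar_last.
    - apply is_derive_Rplus; [auto | apply is_derive_Rscal; exact Lsig].
    - unfold W, Rm, sig.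
      assert (HA1 := HA s z Hs Hz). assert (HB1 := HB s z Hs Hz).
      replace (vt s z) with ((A s z / y s z - 2 * k z * v s z - a s z) / s) by (rewrite HA1; field; lra).
      replace (vx s z) with ((B s z / y s z - b s z) / s) by (rewrite HB1; field; lra).
      unfold one; simpl.
      set (X := S s z). set (YY := y s z) in *.
      match goal with |- ?l = ?r => assert (G : l - r = (1 - e * e) * ((A s z - F s z) / (s * YY) - X * yx s z / (s * YY ^ 2))); [|rewrite He in G; lra] end.
      field. lra. }
  assert (Hmain : forall e s z, e * e = 1 -> 0 < s < ts -> Omg s z -> Rabs (W e s z) <= 2 * ((2 + c0 / lam) / lam * E * Rpower ts lam)).
  { intros e s z He Hs Hz. set (K := (2 + c0 / lam) / lam * E * Rpower ts lam).
    assert (HK0 : 0 <= K).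
    { assert (0 < c0 / lam) by pos.
      apply Rmult_le_pos; pos. }
    assert (HWM : forall e s z, e * e = 1 -> 0 < s < T -> Omg s z -> Rabs (W e s z) <= M + M1 * c0).
    { intros e' s' z' He' Hs' Hz'. eapply Rle_trans; [apply Rabs_triang|].
      assert (G1 := Hsig s' z' M1 Hs' Hz' (HSb s' z' Hs' Hz')). destruct (HM s' z' Hs' Hz') as [G2 _].
      rewrite Rabs_mult. replace (Rabs e') with 1. lra. unfold Rabs; destruct Rcase_abs; nra. }
    assert (HW0 : forall ep, 0 < ep -> exists d, 0 < d /\ forall e s z, e * e = 1 -> 0 < s < d -> s < ts -> Omg s z -> Rabs (W e s z) <= ep).
    { intros ep Hep. destruct (Hv0 (ep / 2)) as [d1 [Hd1 H1]]; [lra|].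
      destruct (HS0 (ep / (2 * c0))) as [d2 [Hd2 H2]]; [pos |].
      exists (Rmin d1 d2). split; [pos |]. intros e' s' z' He' Hs' Hst Hz'.
      assert (B1 := Rmin_l d1 d2). assert (B2 := Rmin_r d1 d2).
      assert (G1 := Hsig s' z' _ ltac:(lra) Hz' (H2 s' z' ltac:(lra) ltac:(lra) Hz')).
      destruct (H1 s' z' ltac:(lra) ltac:(lra) Hz') as [G2 _].
      eapply Rle_trans; [apply Rabs_triang|]. rewrite Rabs_mult. replace (Rabs e') with 1.
      replace (ep / (2 * c0) * c0) with (ep / 2) in G1 by (field; lra). lra. unfold Rabs; destruct Rcase_abs; nra. }
    assert (G : Rabs (W e s z) - 2 * K <= 0); [|lra].
    apply sup_contract with (S := fun w => exists e s z, e * e = 1 /\ 0 < s < ts /\ Omg s z /\ w = Rabs (W e s z) - 2 * K) (M := M + M1 * c0).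
    - intros w [e' [s' [z' [He' [Hs' [Hz' ->]]]]]]. assert (G := HWM e' s' z' He' ltac:(lra) Hz'). lra.
    - intros N HN Hw. exists (N / 2). split; [lra|]. intros w [e' [s' [z' [He' [Hs' [Hz' ->]]]]]].
      (* [Hh] is the provisional bound on [W]. The sources give [K] and the proportional errors at
         most [Hh / 2], hence [2 K + N / 2]: the excess [N] is halved. *)
      set (Hh := 2 * K + N).
      assert (HH : forall e s z, e * e = 1 -> 0 < s < ts -> Omg s z -> Rabs (W e s z) <= Hh).
      { intros e2 s2 z2 He2 Hs2 Hz2. assert (G : Rabs (W e2 s2 z2) - 2 * K <= N); [|unfold Hh; lra].
        apply Hw. exists e2, s2, z2. auto. }
      set (r := fun s => (2 + c0 / lam) * E * Rpower s lam + 3 * c * Hh * Rpower s g0).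
      set (Eh := fun s => (2 + c0 / lam) / lam * E * Rpower s lam + 3 * c / g0 * Hh * Rpower s g0).
      assert (HHh : 0 <= Hh) by (unfold Hh; lra).
      assert (Hq : 0 < c0 / lam) by pos.
      assert (Q : Rabs (W e' s' z') <= Eh s').
      { apply (char_gronwall x0 rho ts k W Rm Eh r Hh); auto.
        - intros s2 y2 Hs2 Hy2. apply (Hk s2); auto; lra.
        - pos.
        - intros e2 s2 y2 He2 Hs2 Hy2. assert (Hs2' : 0 < s2 < T) by lra. unfold Rm, r.
          assert (P1 := Ha s2 y2 Hs2' Hy2). assert (P2 := Hb s2 y2 Hs2' Hy2).
          destruct (Hyb s2 y2 Hs2' Hy2) as [P4 P5]. destruct (Hy s2 y2 Hs2' Hy2) as [Y1 [Y2 Y3]].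
          assert (W1 := HH 1 s2 y2 ltac:(ring) Hs2 Hy2). assert (W2 := HH (-1) s2 y2 ltac:(ring) Hs2 Hy2). unfold W in W1, W2.
          assert (Wv : Rabs (v s2 y2) <= Hh) by (apply Rabs_le_between in W1, W2; apply Rabs_le; lra).
          assert (Ws : Rabs (sig s2 y2) <= Hh) by (apply Rabs_le_between in W1, W2; apply Rabs_le; lra).
          assert (He1 : Rabs e2 = 1) by (unfold Rabs; destruct Rcase_abs; nra).
          assert (Q1 : Rabs (e2 * b s2 y2) <= E * Rpower s2 lam + c * Rpower s2 g0 * Hh).
          { rewrite Rabs_mult, He1, Rmult_1_l. eapply Rle_trans; auto. pos. }
          assert (Q2 : Rabs (F s2 y2 / y s2 y2) <= E / lam * Rpower s2 lam * c0).
          { unfold Rdiv at 1. rewrite Rabs_mult, Rabs_inv, (Rabs_pos_eq (y s2 y2)) by lra.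
            pos. }
          assert (Q3 : Rabs (e2 * sig s2 y2 * (s2 * yt s2 y2 / y s2 y2)) <= Hh * (c * Rpower s2 g0)).
          { rewrite Rabs_mult, Rabs_mult, He1. pos. }
          assert (Q4 : Rabs (sig s2 y2 * (s2 * yx s2 y2 / y s2 y2)) <= Hh * (c * Rpower s2 g0)) by pos.
          apply Rabs_le_between in P1, Q1, Q2, Q3, Q4. apply Rabs_le. lra.
        - intros s2 Hs2. unfold r.
          replace (((2 + c0 / lam) * E * Rpower s2 lam + 3 * c * Hh * Rpower s2 g0) / s2) with
           ((2 + c0 / lam) / lam * E * (lam * Rpower s2 lam / s2) + 3 * c / g0 * Hh * (g0 * Rpower s2 g0 / s2)) by (field; lra).
          apply is_derive_Rplus; apply is_derive_Rscal, is_derive_Rpower_t; lra.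
        - unfold r. pos.
        - apply lim0_plus; apply lim0_Rpower; auto. }
      assert (Q2 : Eh s' <= K + Hh / 2).
      { apply Rplus_le_compat.
        - apply Rmult_le_compat_l. apply Rmult_le_pos; auto. apply Rlt_le, Rdiv_lt_0_compat; lra. apply Rpower_le_base; lra.
        - apply Rle_trans with (3 * c / g0 * Rpower T g0 * Hh).
          + assert (G := Rpower_le_base s' T g0).
            assert (0 <= 3 * c / g0 * Hh) by (apply Rmult_le_pos; auto; apply Rmult_le_pos; pos). nra.
          + nra. }
      unfold Hh in Q2. lra.
    - exists e, s, z. auto. }
  assert (P1 := Hmain 1 t x ltac:(ring) ltac:(lra) Hx). assert (P2 := Hmain (-1) t x ltac:(ring) ltac:(lra) Hx). unfold W in P1, P2.
  assert (G : Rabs (v t x) <= 2 * ((2 + c0 / lam) / lam * E * Rpower ts lam)).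
  { apply Rabs_le_between in P1, P2. apply Rabs_le. lra. }
  unfold wave_cst.
  assert (G2 : Rpower ts lam <= Rpower 2 lam * Rpower t lam).
  { rewrite Rpower_mult_distr by lra. apply Rpower_le_base; lra. }
  assert (Hq : 0 < c0 / lam) by pos.
  assert (Hq2 : 0 <= (2 + c0 / lam) / lam * E) by pos.
  nra.
Qed.

End Estimate.

(** * Competing solutions as collections of fields *)

Definition onr (m : nat) (T a b : R) (Phi : nat -> R -> R -> Prop) : Prop :=
  forall j t x, (j <= m)%nat -> 0 < t < T -> a < x < b -> Phi j t x.

Definition totf (m : nat) (P : nat -> R -> R -> R) (j : nat) (t x : R) : R := tot m (fun i => P i t) j x.

Definition fP (m : nat) (P Pt Qt Qx : nat -> R -> R -> R) (j : nat) (t x : R) : R :=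
  - Pt j t x / t - 1 / 2 * exp (-2 * totf m P j t x) * (Qt j t x ^ 2 - Qx j t x ^ 2).
Definition fQ (m : nat) (Pt Px Qt Qx : nat -> R -> R -> R) (j : nat) (t x : R) : R :=
  - Qt j t x / t + 2 * (totf m Pt j t x * Qt j t x - totf m Px j t x * Qx j t x).

Definition lipb (f : R -> R) (a b K : R) : Prop := forall x y, a < x < b -> a < y < b -> Rabs (f x - f y) <= K * Rabs (x - y).

Section Wsol.
Context {m : nat} {p0 p1 q0 q1 : nat -> R -> R} {ep : nat -> R} {T a b : R}
  {P Pt Px Pxx Q Qt Qx Qxx pi Api pix kap Bk kapx : nat -> R -> R -> R}.

(** All that is retained of a competing solution. [Api] stands for [(D + ep) pi] and [Bk] for
    [D kap]. The Lipschitz constant of [ws_lip] may depend on [t] in an uncontrolled way, and the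
    second [x]-derivatives are continuous in [x] only. *)
Record wsol : Prop := {
  ws_Pt : onr m T a b (fun j t x => is_derive (fun s => P j s x) t (Pt j t x));
  ws_Px : onr m T a b (fun j t x => is_derive (fun y => P j t y) x (Px j t x));
  ws_Ptt : onr m T a b (fun j t x => is_derive (fun s => Pt j s x) t (Pxx j t x + fP m P Pt Qt Qx j t x));
  ws_Pxx : onr m T a b (fun j t x => is_derive (fun y => Px j t y) x (Pxx j t x));
  ws_Pxc : onr m T a b (fun j t x => continuous (fun s => Px j s x) t);
  ws_Pxxc : onr m T a b (fun j t x => continuous (Pxx j t) x);
  ws_Qt : onr m T a b (fun j t x => is_derive (fun s => Q j s x) t (Qt j t x));
  ws_Qx : onr m T a b (fun j t x => is_derive (fun y => Q j t y) x (Qx j t x));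
  ws_Qtt : onr m T a b (fun j t x => is_derive (fun s => Qt j s x) t (Qxx j t x + fQ m Pt Px Qt Qx j t x));
  ws_Qxx : onr m T a b (fun j t x => is_derive (fun y => Qx j t y) x (Qxx j t x));
  ws_Qxc : onr m T a b (fun j t x => continuous (fun s => Qx j s x) t);
  ws_Qxxc : onr m T a b (fun j t x => continuous (Qxx j t) x);
  ws_lip : forall t, 0 < t < T -> exists n, forall j, (j <= m)%nat ->
    lipb (Pt j t) a b n /\ lipb (Px j t) a b n /\ lipb (Qt j t) a b n /\ lipb (Qx j t) a b n;
  ws_kt : onr m T a b (fun j t x => is_derive (fun s => kap j s x) t (Bk j t x / t));
  ws_kx : onr m T a b (fun j t x => is_derive (fun y => kap j t y) x (kapx j t x));
  ws_kxc : onr m T a b (fun j t x => continuous (fun s => kapx j s x) t);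
  ws_P : onr m T a b (fun j t x => P j t x = p0 j x * ln t + p1 j x + Rpower t (ep j) * pi j t x);
  ws_DP : onr m T a b (fun j t x => t * Pt j t x = p0 j x + Rpower t (ep j) * Api j t x);
  ws_xP : onr m T a b (fun j t x => Px j t x = Derive (p0 j) x * ln t + Derive (p1 j) x + Rpower t (ep j) * pix j t x);
  ws_Q : onr m T a b (fun j t x => Q j t x = q0 j x + Rpower t (2 * tot m p0 j x) * (q1 j x + kap j t x));
  ws_DQ : onr m T a b (fun j t x => t * Qt j t x = Rpower t (2 * tot m p0 j x) * (2 * tot m p0 j x * (q1 j x + kap j t x) + Bk j t x));
  ws_xQ : onr m T a b (fun j t x => Qx j t x = Derive (q0 j) x + Rpower t (2 * tot m p0 j x) *
     (Derive (q1 j) x + 2 * Derive (tot m p0 j) x * ln t * (q1 j x + kap j t x) + kapx j t x));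
  ws_bd : onr m T a b (fun j t x => Rabs (pi j t x) <= 1 /\ Rabs (Api j t x) <= 1 /\ Rabs (t * pix j t x) <= 1 /\
     Rabs (kap j t x) <= 1 /\ Rabs (Bk j t x) <= 1 /\ Rabs (t * kapx j t x) <= 1);
  ws_sm : forall e, 0 < e -> exists d, 0 < d /\ onr m T a b (fun j t x => t < d -> Rabs (pi j t x) <= e /\ Rabs (Api j t x) <= e /\ Rabs (t * pix j t x) <= e /\
     Rabs (kap j t x) <= e /\ Rabs (Bk j t x) <= e /\ Rabs (t * kapx j t x) <= e)
}.

End Wsol.
Arguments wsol : clear implicits.

Lemma C1_lip f a b a' b' : C1 f a' b' -> a' < a -> b < b' -> exists K, 0 <= K /\ lipb f a b K.
Proof.
  intros Hf Ha Hb. destruct (Rle_dec a b) as [Hab|Hab].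
  - destruct (continuity_ab_maj (fun x => Rabs (Derive f x)) a b Hab) as [xm [HM _]].
    { intros. apply continuity_pt_filterlim, Rcont_abs, Hf. lra. }
    exists (Rabs (Derive f xm)). split; [pos |]. intros x y Hx Hy.
    eapply derive_bound_lip; intros z Hz; assert (a <= z <= b) by (unfold Rmin, Rmax in Hz; destruct Rle_dec; lra).
    + apply (C1_is_derive f a' b'); auto. lra.
    + auto.
  - exists 0. split; [lra|]. intros x y. lra.
Qed.

Lemma C1_bound f a b a' b' : C1 f a' b' -> a' < a -> b < b' -> exists K, 0 <= K /\ forall x, a < x < b -> Rabs (f x) <= K.
Proof.
  intros. destruct (Rle_dec a b) as [Hab|Hab].
  - destruct (continuity_ab_maj (fun x => Rabs (f x)) a b Hab) as [xm [HM _]].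
    { intros. apply continuity_pt_filterlim, Rcont_abs, (C1_cont f a' b'); auto. lra. }
    exists (Rabs (f xm)). pos.
  - exists 0. pos.
Qed.

Lemma fin_max Phi m : (forall j n n', n <= n' -> Phi j n -> Phi j n') ->
  (forall j, (j <= m)%nat -> exists n, Phi j n) -> exists n, forall j, (j <= m)%nat -> Phi j n.
Proof.
  intros Hmon H. induction m.
  - destruct (H O (le_n O)) as [n Hn]. exists n. intros j Hj. replace j with O by lia. auto.
  - destruct IHm as [n1 H1]; auto. destruct (H (S m) (le_n _)) as [n2 H2].
    exists (Rmax n1 n2). intros j Hj. destruct (Nat.eq_dec j (S m)) as [->|].
    + apply Hmon with n2; auto. apply Rmax_r.
    + eapply Hmon; [apply Rmax_l | apply H1; lia].
Qed.

Lemma fin_min Phi m : (forall j d d', 0 < d' <= d -> Phi j d -> Phi j d') ->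
  (forall j, (j <= m)%nat -> exists d, 0 < d /\ Phi j d) -> exists d, 0 < d /\ forall j, (j <= m)%nat -> Phi j d.
Proof.
  intros Hmon H. induction m.
  - destruct (H O (le_n O)) as [n [Hn0 Hn]]. exists n. split; auto. intros j Hj. replace j with O by lia. auto.
  - destruct IHm as [n1 [H0 H1]]; auto. destruct (H (S m) (le_n _)) as [n2 [H2 H3]].
    assert (Hm : 0 < Rmin n1 n2) by pos.
    exists (Rmin n1 n2). split; auto. intros j Hj. destruct (Nat.eq_dec j (S m)) as [->|].
    + apply Hmon with n2; auto. mins; lra.
    + eapply Hmon; [split; auto; apply Rmin_l | apply H1; lia].
Qed.

Lemma lipb_mono f a b n n' : n <= n' -> lipb f a b n -> lipb f a b n'.
Proof. intros Hn H x y. assert (G := H x y). assert (G2 := Rabs_pos (x - y)). nra. Qed.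

Lemma is_derive_tot m f df j x : (j <= m)%nat ->
  (forall i, (i <= m)%nat -> is_derive (f i) x (df i)) ->
  is_derive (fun y => sum_f_R0 (fun i => f i y) m + f j y) x (sum_f_R0 df m + df j).
Proof. intros. apply is_derive_Rplus; auto. apply is_derive_sumx; auto. Qed.

Section Extract.
Context (D : nat) (HD : (4 <= D)%nat) (p0 p1 q0 q1 : nat -> R -> R) (eps : nat -> R) (T a b : R) (HT : 0 < T).
Context (Hp : forall I, in_range D I -> analytic_on (p0 I) a b /\ analytic_on (p1 I) a b /\ analytic_on (q0 I) a b /\ analytic_on (q1 I) a b).
Context (P Q pi kappa : nat -> R -> R -> R).
Context (Hsol : is_solution D P Q T a b).
Context (Hform : forall I, in_range D I ->
      remainder_class (pi I) T a b /\ remainder_class (kappa I) T a b /\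
      forall t x, 0 < t < T -> a < x < b ->
        P I t x = p0 I x * ln t + p1 I x + Rpower t (eps I) * pi I t x /\
        Q I t x = q0 I x + Rpower t (2 * kI D p0 I x) * q1 I x
                  + Rpower t (2 * kI D p0 I x) * kappa I t x).
Let m := (D - 4)%nat.
Let sh (f : nat -> R -> R -> R) : nat -> R -> R -> R := fun j => f (j + 3)%nat.
Let f0 := fun j => p0 (j + 3).
Let k := fun j => tot m f0 j.

Lemma rg j : (j <= m)%nat -> in_range D (j + 3).
Proof. unfold in_range. lia. Qed.

Section One.
Context (j : nat) (Hj : (j <= m)%nat).
Let J := (j + 3)%nat.
Let HJ : in_range D J. Proof. apply rg, Hj. Qed.
Context (t : R) (Ht : 0 < t < T).

Lemma ct_ext (f g : R -> R) s : 0 < s < T -> (forall r, 0 < r < T -> f r = g r) -> continuous f s -> continuous g s.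
Proof.
  intros Hs He. apply continuous_ext_loc. apply filter_imp with (2 := locally_itv 0 T s Hs). auto.
Qed.

Lemma dt_ext (f g : R -> R) s l : 0 < s < T -> (forall r, 0 < r < T -> f r = g r) -> is_derive f s l -> is_derive g s l.
Proof.
  intros Hs He. apply is_derive_ext_loc. apply filter_imp with (2 := locally_itv 0 T s Hs). auto.
Qed.

Lemma dx_ext (f g : R -> R) x l : a < x < b -> (forall y, a < y < b -> f y = g y) -> is_derive f x l -> is_derive g x l.
Proof.
  intros Hs He. apply is_derive_ext_loc. apply filter_imp with (2 := locally_itv a b x Hs). auto.
Qed.

(** [D^2 f = t^2 f_tt + t f_t]; the second time derivative is obtained by differentiating [D f / t],
    since only [D f] is known to be differentiable. *)
Lemma Dt_div f x rhs xx : a < x < b -> ex_derive (fun s => Dt f s x) t -> Dt (Dt f) t x - t ^ 2 * xx = t ^ 2 * rhs ->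
  is_derive (fun s => dt f s x) t (xx + (- dt f t x / t + rhs)).
Proof.
  intros Hx He Heq. apply dt_ext with (fun s => Dt f s x * / s); auto.
  { intros. unfold Dt. field. lra. }
  assert (Hd : Derive (fun s => Dt f s x) t = t * xx + t * rhs).
  { apply Rmult_eq_reg_l with t; [|lra]. unfold Dt at 1, dt at 1 in Heq. lra. }
  assert (He2 : is_derive (fun s => Dt f s x) t (t * xx + t * rhs)) by (rewrite <- Hd; apply Derive_correct, He).
  assert (Hi : is_derive (fun s => / s) t (- 1 / t ^ 2)).
  { auto_derive; [lra|]. field. lra. }
  assert (H := is_derive_Rmult (fun s => Dt f s x) (fun s => / s) t _ _ He2 Hi). evar_last; eauto.
  unfold Dt. field. lra.
Qed.

Lemma kan : analytic_on (p0 J) a b /\ analytic_on (p1 J) a b /\ analytic_on (q0 J) a b /\ analytic_on (q1 J) a b.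
Proof. auto. Qed.

Lemma k_C1 : C1 (k j) a b.
Proof.
  apply C1_plus; [|apply analytic_C1, kan].
  assert (H : forall n, (n <= m)%nat -> C1 (fun x => sum_f_R0 (fun i => f0 i x) n) a b).
  { induction n; intros Hn.
    - apply analytic_C1, (Hp 3); unfold in_range; lia.
    - apply C1_plus; [apply IHn; lia | apply analytic_C1, (Hp (S n + 3)), rg, Hn]. }
  auto.
Qed.

Lemma kpow_C1 : C1 (fun x => Rpower t (2 * k j x)) a b.
Proof.
  apply C1_exp. apply C1_mult; [|apply C1_const]. apply C1_mult; [apply C1_const | apply k_C1].
Qed.

Lemma Hrem : remainder_class (pi J) T a b /\ remainder_class (kappa J) T a b.
Proof. destruct (Hform J HJ) as [H1 [H2 _]]. auto. Qed.

Lemma rem_C1 f : remainder_class f T a b -> C1 (f t) a b /\ C1 (Dt f t) a b /\ C1 (dth f t) a b.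
Proof.
  intros [_ [[H1 _] [[H2 _] [H3 _]]]]. splits.
  - apply analytic_C1; auto.
  - apply analytic_C1; auto.
  - apply C1_ext with (fun x => / t * tdth f t x). intros; unfold tdth; field; lra.
    apply C1_mult; [apply C1_const | apply analytic_C1; auto].
Qed.

Lemma rem_dt f x : remainder_class f T a b -> a < x < b ->
  is_derive (fun s => f s x) t (Dt f t x / t) /\ is_derive (fun y => f t y) x (dth f t x).
Proof.
  intros [H _] Hx. destruct (H t x Ht Hx) as [H1 H2]. split.
  - replace (Dt f t x / t) with (dt f t x) by (unfold Dt; field; lra). apply Derive_correct; auto.
  - apply Derive_correct; auto.
Qed.

Lemma rem_xc f x : remainder_class f T a b -> a < x < b -> continuous (fun s => dth f s x) t.
Proof.
  intros [_ [_ [_ [_ [H _]]]]] Hx. apply ct_ext with (fun s => tdth f s x * / s); auto.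
  intros. unfold tdth. field. lra. apply Rcont_mult; auto. apply continuous_Rinv. lra.
Qed.

Lemma E_P x : a < x < b -> P J t x = p0 J x * ln t + p1 J x + Rpower t (eps J) * pi J t x.
Proof. apply Hform; auto. Qed.
Lemma E_Q x : a < x < b -> Q J t x = q0 J x + Rpower t (2 * k j x) * (q1 J x + kappa J t x).
Proof. intros Hx. destruct (Hform J HJ) as [_ [_ H]]. rewrite (proj2 (H t x Ht Hx)). change (kI D p0 J x) with (k j x). ring. Qed.
End One.

Lemma E_Pt j t x : (j <= m)%nat -> 0 < t < T -> a < x < b ->
  t * dt (P (j + 3)) t x = p0 (j + 3) x + Rpower t (eps (j + 3)) * (eps (j + 3) * pi (j + 3) t x + Dt (pi (j + 3)) t x).
Proof.
  intros Hj Ht Hx. destruct (Hrem j Hj) as [Hr _]. destruct (rem_dt t Ht _ x Hr Hx) as [H1 _].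
  assert (H : is_derive (fun s => P (j + 3) s x) t (p0 (j + 3) x / t + 0 +
    (eps (j + 3) * Rpower t (eps (j + 3)) / t * pi (j + 3) t x + Rpower t (eps (j + 3)) * (Dt (pi (j + 3)) t x / t)))).
  { eapply dt_ext; auto.
    { symmetry. apply E_P; auto. }
    apply is_derive_Rplus. apply is_derive_Rplus. apply is_derive_lncst; lra. apply is_derive_cst.
    apply (is_derive_Rmult (fun s => Rpower s (eps (j + 3))) (fun s => pi (j + 3) s x)). apply is_derive_Rpower_t; lra. auto. }
  assert (Hd := is_derive_unique _ _ _ H : dt (P (j + 3)) t x = _). rewrite Hd. field. lra.
Qed.

Lemma E_Px j t x : (j <= m)%nat -> 0 < t < T -> a < x < b ->
  dth (P (j + 3)) t x = Derive (p0 (j + 3)) x * ln t + Derive (p1 (j + 3)) x + Rpower t (eps (j + 3)) * dth (pi (j + 3)) t x.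
Proof.
  intros Hj Ht Hx. destruct (Hrem j Hj) as [Hr _]. destruct (rem_dt t Ht _ x Hr Hx) as [_ H1].
  destruct (kan j Hj) as [A0 [A1 _]]. apply analytic_C1 in A0, A1.
  apply is_derive_unique. apply dx_ext with (fun x => ln t * p0 (j + 3) x + p1 (j + 3) x + Rpower t (eps (j + 3)) * pi (j + 3) t x); auto.
  { intros. rewrite E_P; auto. ring. }
  rewrite Rmult_comm. apply is_derive_Rplus. apply is_derive_Rplus.
  - apply is_derive_Rscal. eapply C1_is_derive; eauto.
  - eapply C1_is_derive; eauto.
  - apply is_derive_Rscal. auto.
Qed.

Lemma E_Qt j t x : (j <= m)%nat -> 0 < t < T -> a < x < b ->
  t * dt (Q (j + 3)) t x = Rpower t (2 * k j x) * (2 * k j x * (q1 (j + 3) x + kappa (j + 3) t x) + Dt (kappa (j + 3)) t x).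
Proof.
  intros Hj Ht Hx. destruct (Hrem j Hj) as [_ Hr]. destruct (rem_dt t Ht _ x Hr Hx) as [H1 _].
  assert (H : is_derive (fun s => Q (j + 3) s x) t (0 +
    (2 * k j x * Rpower t (2 * k j x) / t * (q1 (j + 3) x + kappa (j + 3) t x) + Rpower t (2 * k j x) * (0 + Dt (kappa (j + 3)) t x / t)))).
  { eapply dt_ext; auto.
    { symmetry. apply E_Q; auto. }
    apply is_derive_Rplus. apply is_derive_cst.
    apply (is_derive_Rmult (fun s => Rpower s (2 * k j x)) (fun s => q1 (j + 3) x + kappa (j + 3) s x)). apply is_derive_Rpower_t; lra.
    apply is_derive_Rplus; [apply is_derive_cst | auto]. }
  assert (Hd := is_derive_unique _ _ _ H : dt (Q (j + 3)) t x = _). rewrite Hd. field. lra.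
Qed.

Lemma E_Qx j t x : (j <= m)%nat -> 0 < t < T -> a < x < b ->
  dth (Q (j + 3)) t x = Derive (q0 (j + 3)) x + Rpower t (2 * k j x) *
   (Derive (q1 (j + 3)) x + 2 * Derive (k j) x * ln t * (q1 (j + 3) x + kappa (j + 3) t x) + dth (kappa (j + 3)) t x).
Proof.
  intros Hj Ht Hx. destruct (Hrem j Hj) as [_ Hr]. destruct (rem_dt t Ht _ x Hr Hx) as [_ H1].
  destruct (kan j Hj) as [_ [_ [A0 A1]]]. apply analytic_C1 in A0, A1.
  apply is_derive_unique. apply dx_ext with (fun x => q0 (j + 3) x + Rpower t (2 * k j x) * (q1 (j + 3) x + kappa (j + 3) t x)); auto.
  { symmetry. apply E_Q; auto. }
  evar_last.
  - apply is_derive_Rplus; [eapply C1_is_derive; eauto|].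
    apply is_derive_Rmult.
    + apply is_derive_Rpower_x. apply (C1_is_derive (k j) a b); auto. apply k_C1; auto.
    + apply is_derive_Rplus; [eapply C1_is_derive; eauto | eauto].
  - lra.
Qed.

Lemma C1_Px j t : (j <= m)%nat -> 0 < t < T -> C1 (dth (P (j + 3)) t) a b.
Proof.
  intros Hj Ht. destruct (Hrem j Hj) as [Hr _]. destruct (rem_C1 t Ht _ Hr) as [_ [_ H]].
  destruct (kan j Hj) as [A0 [A1 _]].
  eapply C1_ext. symmetry. apply E_Px; auto.
  apply C1_plus; [apply C1_plus|].
  - apply C1_mult; [apply analytic_C1, analytic_Derive; auto | apply C1_const].
  - apply analytic_C1, analytic_Derive; auto.
  - apply C1_mult; [apply C1_const | auto].
Qed.

Lemma C1_Pt j t : (j <= m)%nat -> 0 < t < T -> C1 (dt (P (j + 3)) t) a b.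
Proof.
  intros Hj Ht. destruct (Hrem j Hj) as [Hr _]. destruct (rem_C1 t Ht _ Hr) as [H1 [H2 _]].
  destruct (kan j Hj) as [A0 [A1 _]].
  apply C1_ext with (fun x => / t * (p0 (j + 3) x + Rpower t (eps (j + 3)) * (eps (j + 3) * pi (j + 3) t x + Dt (pi (j + 3)) t x))).
  { intros. rewrite <- E_Pt by pos. field. lra. }
  apply C1_mult; [apply C1_const|]. apply C1_plus; [apply analytic_C1; auto|].
  apply C1_mult; [apply C1_const|]. apply C1_plus; auto. apply C1_mult; [apply C1_const | auto].
Qed.

Lemma Dk_C1 j : (j <= m)%nat -> C1 (Derive (k j)) a b.
Proof.
  intros Hj. eapply C1_ext.
  { symmetry. apply is_derive_unique. apply is_derive_tot; auto.
    intros i Hi. apply (C1_is_derive (f0 i) a b); auto. apply analytic_C1, (kan i Hi). }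
  apply C1_plus; [|apply analytic_C1, analytic_Derive, (kan j Hj)].
  assert (H : forall n, (n <= m)%nat -> C1 (fun x => sum_f_R0 (fun i => Derive (f0 i) x) n) a b).
  { induction n; intros Hn.
    - apply analytic_C1, analytic_Derive, (kan 0 Hn).
    - apply C1_plus; [apply IHn; lia | apply analytic_C1, analytic_Derive, (kan (S n) Hn)]. }
  auto.
Qed.

Lemma C1_Qx j t : (j <= m)%nat -> 0 < t < T -> C1 (dth (Q (j + 3)) t) a b.
Proof.
  intros Hj Ht. destruct (Hrem j Hj) as [_ Hr]. destruct (rem_C1 t Ht _ Hr) as [H1 [_ H2]].
  destruct (kan j Hj) as [_ [_ [A0 A1]]].
  eapply C1_ext. symmetry. apply E_Qx; auto.
  apply C1_plus; [apply analytic_C1, analytic_Derive; auto|].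
  apply C1_mult; [apply kpow_C1; auto|]. apply C1_plus; [apply C1_plus|]; auto.
  - apply analytic_C1, analytic_Derive; auto.
  - apply C1_mult; [apply C1_mult; [apply C1_mult; [apply C1_const | apply Dk_C1; auto] | apply C1_const]|].
    apply C1_plus; auto. apply analytic_C1; auto.
Qed.

Lemma C1_Qt j t : (j <= m)%nat -> 0 < t < T -> C1 (dt (Q (j + 3)) t) a b.
Proof.
  intros Hj Ht. destruct (Hrem j Hj) as [_ Hr]. destruct (rem_C1 t Ht _ Hr) as [H1 [H2 _]].
  destruct (kan j Hj) as [_ [_ [A0 A1]]].
  apply C1_ext with (fun x => / t * (Rpower t (2 * k j x) * (2 * k j x * (q1 (j + 3) x + kappa (j + 3) t x) + Dt (kappa (j + 3)) t x))).
  { intros. rewrite <- E_Qt by pos. field. lra. }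
  apply C1_mult; [apply C1_const|]. apply C1_mult; [apply kpow_C1; auto|]. apply C1_plus; auto.
  apply C1_mult; [apply C1_mult; [apply C1_const | apply k_C1; auto]|]. apply C1_plus; auto. apply analytic_C1; auto.
Qed.

Lemma PsumE t x : Psum D P t x = sum_f_R0 (fun i => P (i + 3) t x) m.
Proof. auto. Qed.

Context (a' b' T' : R) (Ha' : a < a') (Hb' : b' < b) (HT' : 0 < T' <= T).
Context (Hbd : onr m T' a' b' (fun j t x => Rabs (pi (j + 3) t x) <= 1 /\
     Rabs (eps (j + 3) * pi (j + 3) t x + Dt (pi (j + 3)) t x) <= 1 /\ Rabs (tdth (pi (j + 3)) t x) <= 1 /\
     Rabs (kappa (j + 3) t x) <= 1 /\ Rabs (Dt (kappa (j + 3)) t x) <= 1 /\ Rabs (tdth (kappa (j + 3)) t x) <= 1)).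
Context (Hsm : forall e, 0 < e -> exists d, 0 < d /\ onr m T' a' b' (fun j t x => t < d -> Rabs (pi (j + 3) t x) <= e /\
     Rabs (eps (j + 3) * pi (j + 3) t x + Dt (pi (j + 3)) t x) <= e /\ Rabs (tdth (pi (j + 3)) t x) <= e /\
     Rabs (kappa (j + 3) t x) <= e /\ Rabs (Dt (kappa (j + 3)) t x) <= e /\ Rabs (tdth (kappa (j + 3)) t x) <= e)).

(** Analyticity in [x] at each fixed time makes the first derivatives continuously differentiable on
    [(a, b)]; the margin between [(a', b')] and [(a, b)] turns this into a Lipschitz constant at
    that time, by compactness. *)
Lemma extract_wsol : wsol m f0 (fun j => p1 (j + 3)) (fun j => q0 (j + 3)) (fun j => q1 (j + 3)) (fun j => eps (j + 3)) T' a' b'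
  (sh P) (fun j => dt (P (j + 3))) (fun j => dth (P (j + 3))) (fun j => dth (dth (P (j + 3))))
  (sh Q) (fun j => dt (Q (j + 3))) (fun j => dth (Q (j + 3))) (fun j => dth (dth (Q (j + 3))))
  (sh pi) (fun j t x => eps (j + 3) * pi (j + 3) t x + Dt (pi (j + 3)) t x) (fun j => dth (pi (j + 3)))
  (sh kappa) (fun j => Dt (kappa (j + 3))) (fun j => dth (kappa (j + 3))).
Proof.
  assert (Hx' : forall x, a' < x < b' -> a < x < b) by pos.
  assert (Ht' : forall t, 0 < t < T' -> 0 < t < T) by pos.
  constructor.
  - intros j t x Hj Ht Hx. apply Derive_correct. apply (Hsol (j + 3)%nat (rg j Hj) t x); auto.
  - intros j t x Hj Ht Hx. apply Derive_correct. apply (Hsol (j + 3)%nat (rg j Hj) t); auto.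
  - intros j t x Hj Ht Hx. destruct (Hsol (j + 3)%nat (rg j Hj) t x (Ht' t Ht) (Hx' x Hx)) as [_ [_ [H3 [_ [_ [_ [_ [_ [H9 _]]]]]]]]].
    assert (H := Dt_div t (Ht' t Ht) (P (j + 3)) x (- (1 / 2) * exp (-2 * (Psum D P t x + P (j + 3) t x)) * (dt (Q (j + 3)) t x ^ 2 - dth (Q (j + 3)) t x ^ 2))
      (dth (dth (P (j + 3))) t x) (Hx' x Hx) H3). evar_last.
    + apply H. rewrite H9. unfold Dt, tdth. ring.
    + unfold fP, totf, tot. rewrite PsumE. unfold sh. lra.
  - intros j t x Hj Ht Hx. apply Derive_correct. apply (Hsol (j + 3)%nat (rg j Hj) t); auto.
  - intros j t x Hj Ht Hx. destruct (Hrem j Hj) as [Hr _].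
    eapply ct_ext; auto.
    { symmetry. apply E_Px; auto. }
    apply Rcont_plus. apply Rcont_plus; [|apply Rcont_const].
    + eapply is_derive_cont, is_derive_lncst; lra.
    + apply Rcont_mult; [eapply is_derive_cont, is_derive_Rpower_t; lra | apply rem_xc; auto].
  - intros j t x Hj Ht Hx. apply C1_Px; auto.
  - intros j t x Hj Ht Hx. apply Derive_correct. apply (Hsol (j + 3)%nat (rg j Hj) t x); auto.
  - intros j t x Hj Ht Hx. apply Derive_correct. apply (Hsol (j + 3)%nat (rg j Hj) t); auto.
  - intros j t x Hj Ht Hx. destruct (Hsol (j + 3)%nat (rg j Hj) t x (Ht' t Ht) (Hx' x Hx)) as [_ [_ [_ [_ [_ [_ [H7 [_ [_ H10]]]]]]]]].
    assert (Hst : Dt (fun s y => Psum D P s y + P (j + 3) s y) t x = t * totf m (fun j => dt (P (j + 3))) j t x).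
    { apply Dt_of. apply (is_derive_tot m (fun i s => P (i + 3) s x) (fun i => dt (P (i + 3)) t x) j t Hj).
      intros i Hi. apply Derive_correct. apply (Hsol (i + 3)%nat (rg i Hi) t x); auto. }
    assert (Hsx : dth (fun s y => Psum D P s y + P (j + 3) s y) t x = totf m (fun j => dth (P (j + 3))) j t x).
    { apply dth_of. apply (is_derive_tot m (fun i y => P (i + 3) t y) (fun i => dth (P (i + 3)) t x) j x Hj).
      intros i Hi. apply Derive_correct. apply (Hsol (i + 3)%nat (rg i Hi) t); auto. }
    assert (H := Dt_div t (Ht' t Ht) (Q (j + 3)) x (2 * (totf m (fun j => dt (P (j + 3))) j t x * dt (Q (j + 3)) t x - totf m (fun j => dth (P (j + 3))) j t x * dth (Q (j + 3)) t x))
      (dth (dth (Q (j + 3))) t x) (Hx' x Hx) H7). apply H.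
    rewrite H10, Hst, Hsx. unfold Dt. ring.
  - intros j t x Hj Ht Hx. apply Derive_correct. apply (Hsol (j + 3)%nat (rg j Hj)); auto.
  - intros j t x Hj Ht Hx. destruct (Hrem j Hj) as [_ Hr].
    eapply ct_ext; auto.
    { symmetry. apply E_Qx; auto. }
    destruct (rem_dt t (Ht' t Ht) _ x Hr (Hx' x Hx)) as [H1 _].
    apply Rcont_plus; [apply Rcont_const|]. apply Rcont_mult; [eapply is_derive_cont, is_derive_Rpower_t; lra|].
    apply Rcont_plus; [|apply rem_xc; auto]. apply Rcont_plus; [apply Rcont_const|].
    apply Rcont_mult. eapply is_derive_cont, is_derive_lncst; lra. apply Rcont_plus; [apply Rcont_const | eapply is_derive_cont; exact H1].
  - intros j t x Hj Ht Hx. apply C1_Qx; auto.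
  - intros t Ht. apply fin_max.
    { intros j n n' Hn [L1 [L2 [L3 L4]]]. repeat split; eapply lipb_mono; eauto. }
    intros j Hj.
    destruct (C1_lip _ a' b' a b (C1_Pt j t Hj (Ht' t Ht)) Ha' Hb') as [n1 [N1 H1]].
    destruct (C1_lip _ a' b' a b (C1_Px j t Hj (Ht' t Ht)) Ha' Hb') as [n2 [N2 H2]].
    destruct (C1_lip _ a' b' a b (C1_Qt j t Hj (Ht' t Ht)) Ha' Hb') as [n3 [N3 H3]].
    destruct (C1_lip _ a' b' a b (C1_Qx j t Hj (Ht' t Ht)) Ha' Hb') as [n4 [N4 H4]].
    exists (n1 + n2 + n3 + n4). splits; eapply lipb_mono; try eassumption; lra.
  - intros j t x Hj Ht Hx. apply rem_dt; auto. apply Hrem; auto.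
  - intros j t x Hj Ht Hx. apply rem_dt; auto. apply Hrem; auto.
  - intros j t x Hj Ht Hx. apply rem_xc; auto. apply Hrem; auto.
  - intros j t x Hj Ht Hx. apply E_P; auto.
  - intros j t x Hj Ht Hx. apply E_Pt; auto.
  - intros j t x Hj Ht Hx. apply E_Px; auto.
  - intros j t x Hj Ht Hx. apply E_Q; auto.
  - intros j t x Hj Ht Hx. apply E_Qt; auto.
  - intros j t x Hj Ht Hx. apply E_Qx; auto.
  - auto.
  - auto.
Qed.

End Extract.

(** * Regularity of a competing solution *)

Section Dlc.
Context (Ad : R -> R -> R -> R -> Prop) (HAd : forall t x y d, Ad t x y d -> 0 <= d).
(** Boundedness together with a Lipschitz bound in terms of [Rabs (x - y)] and a common bound [d] on
    the differences of the first derivatives. The class is closed under the operations that build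
    the source terms, and its bound is the hypothesis on [f] in the regularity argument. *)
Definition dlc (g : R -> R -> R) : Prop := exists K, 0 <= K /\ forall t x y d, Ad t x y d ->
  Rabs (g t x) <= K /\ Rabs (g t y) <= K /\ Rabs (g t x - g t y) <= K * (Rabs (x - y) + d).

Lemma dlc_ext f g : (forall t x, f t x = g t x) -> dlc f -> dlc g.
Proof. intros He [K [HK H]]. exists K. split; auto. intros. rewrite <- !He. auto. Qed.

Lemma dlc_plus f g : dlc f -> dlc g -> dlc (fun t x => f t x + g t x).
Proof.
  intros [K [HK H]] [L [HL G]]. exists (K + L). split; [lra|]. intros t x y d Hd.
  destruct (H t x y d Hd) as [H1 [H2 H3]]. destruct (G t x y d Hd) as [G1 [G2 G3]].
  apply Rabs_le_between in H1, H2, H3, G1, G2, G3.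
  splits; apply Rabs_le; lra.
Qed.

Lemma dlc_mult f g : dlc f -> dlc g -> dlc (fun t x => f t x * g t x).
Proof.
  intros [K [HK H]] [L [HL G]]. exists (2 * K * L). split; [nra|]. intros t x y d Hd.
  destruct (H t x y d Hd) as [H1 [H2 H3]]. destruct (G t x y d Hd) as [G1 [G2 G3]].
  assert (P : forall u w, Rabs u <= K -> Rabs w <= L -> Rabs (u * w) <= 2 * K * L) by pos.
  split; [auto | split; auto].
  replace (f t x * g t x - f t y * g t y) with (f t x * (g t x - g t y) + (f t x - f t y) * g t y) by lra.
  eapply Rle_trans; [apply Rabs_triang|]. rewrite !Rabs_mult.
  assert (Q1 : Rabs (f t x) * Rabs (g t x - g t y) <= K * (L * (Rabs (x - y) + d))) by pos.
  assert (Q2 : Rabs (f t x - f t y) * Rabs (g t y) <= K * (Rabs (x - y) + d) * L) by pos.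
  lra.
Qed.

Lemma dlc_t h K : (forall t x y d, Ad t x y d -> Rabs (h t) <= K) -> dlc (fun t _ => h t).
Proof.
  exists (Rmax K 0). split; [apply Rmax_r|]. intros t x y d Hd. assert (H1 := H t x y d Hd).
  assert (H2 := Rmax_l K 0). assert (H3 := Rmax_r). split; [lra | split; [lra|]].
  rewrite Rminus_diag, Rabs_R0. assert (H4 := HAd t x y). pos.
Qed.

Lemma dlc_cst c : dlc (fun _ _ => c).
Proof. apply (dlc_t (fun _ => c) (Rabs c)). pos. Qed.

Lemma exp_lip u w K : Rabs u <= K -> Rabs w <= K -> Rabs (exp u - exp w) <= exp K * Rabs (u - w).
Proof.
  intros Hu Hw. eapply derive_bound_lip.
  - intros x _. apply is_derive_Reals, derivable_pt_lim_exp.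
  - intros x Hx. rewrite Rabs_pos_eq by pos.
    apply Rabs_le_between in Hu, Hw. assert (x <= K) by (unfold Rmin, Rmax in Hx; destruct Rle_dec; lra).
    destruct (Req_dec x K) as [->|]; [lra|]. apply Rlt_le, exp_increasing; lra.
Qed.

Lemma exp_le u K : u <= K -> exp u <= exp K.
Proof. intros. destruct (Req_dec u K) as [->|]; [lra|]. apply Rlt_le, exp_increasing; lra. Qed.

Lemma dlc_exp f : dlc f -> dlc (fun t x => exp (f t x)).
Proof.
  intros [K [HK H]]. assert (HeK := exp_pos K). exists (exp K * (1 + K)). split; [nra|]. intros t x y d Hd.
  destruct (H t x y d Hd) as [H1 [H2 H3]].
  assert (Q : forall u, Rabs u <= K -> Rabs (exp u) <= exp K * (1 + K)).
  { intros u Hu. rewrite Rabs_pos_eq by pos. apply Rabs_le_between in Hu.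
    assert (G := exp_le u K). nra. }
  split; [auto | split; auto].
  eapply Rle_trans; [apply exp_lip; eauto|]. rewrite Rmult_assoc.
  assert (H4 := HAd t x y d Hd). assert (H5 := Rabs_pos (x - y)). nra.
Qed.

Lemma dlc_sum f n : (forall i, (i <= n)%nat -> dlc (f i)) -> dlc (fun t x => sum_f_R0 (fun i => f i t x) n).
Proof.
  induction n; intros H. apply H; lia. apply dlc_plus; auto.
Qed.

Lemma dlc_tot m f j : (j <= m)%nat -> (forall i, (i <= m)%nat -> dlc (f i)) -> dlc (totf m f j).
Proof. intros. apply dlc_plus; auto. apply dlc_sum; auto. Qed.
End Dlc.

Lemma ln_abs_le t : 0 < t <= 1 -> Rabs (ln t) <= / t.
Proof.
  intros Ht. assert (H : ln t <= 0) by (rewrite <- ln_1; destruct (Req_dec t 1) as [->|]; [lra | apply Rlt_le, ln_increasing; lra]).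
  rewrite Rabs_left1 by lra. rewrite <- ln_Rinv by lra.
  assert (H2 := exp_ineq1_le (ln (/ t))). rewrite exp_ln in H2. lra. pos.
Qed.

Definition base_bd (m : nat) (p0 p1 q0 q1 : nat -> R -> R) (ep : nat -> R) (a b C0 : R) : Prop :=
  forall j x, (j <= m)%nat -> a < x < b ->
   (Rabs (p0 j x) <= C0 /\ Rabs (p1 j x) <= C0 /\ Rabs (q1 j x) <= C0) /\
   (Rabs (Derive (p0 j) x) <= C0 /\ Rabs (Derive (p1 j) x) <= C0 /\ Rabs (Derive (q0 j) x) <= C0 /\ Rabs (Derive (q1 j) x) <= C0 /\
    Rabs (Derive (tot m p0 j) x) <= C0) /\ 0 < ep j /\ 0 < tot m p0 j x < 1.

Section Reg.
Context {m : nat} {p0 p1 q0 q1 : nat -> R -> R} {ep : nat -> R} {T a b : R}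
  {P Pt Px Pxx Q Qt Qx Qxx pi Api pix kap Bk kapx : nat -> R -> R -> R}.
Context (W : wsol m p0 p1 q0 q1 ep T a b P Pt Px Pxx Q Qt Qx Qxx pi Api pix kap Bk kapx).
Context {C0 : R} (HC0 : 0 <= C0) (Hbase : base_bd m p0 p1 q0 q1 ep a b C0) (HT : 0 < T <= 1).

(** A bound for times above [al] that degenerates as [al] tends to zero; regularity is a local
    question in [t], so this suffices. *)
Definition crude (al : R) : R := (C0 + 2) * (C0 + 2) * (4 * / al + 2).

Lemma fields_bounded al j t x : (j <= m)%nat -> 0 < al -> al < t < T -> a < x < b ->
  Rabs (P j t x) <= crude al /\ Rabs (Pt j t x) <= crude al /\ Rabs (Px j t x) <= crude al /\ Rabs (Qt j t x) <= crude al /\ Rabs (Qx j t x) <= crude al.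
Proof.
  intros Hj Hal Ht Hx. assert (Ht' : 0 < t < T) by lra.
  destruct (Hbase j x Hj Hx) as [[B1 [B2 B3]] [[B4 [B5 [B6 [B7 B8]]]] [He Hk]]].
  destruct (ws_bd W j t x Hj Ht' Hx) as [D1 [D2 [D3 [D4 [D5 D6]]]]].
  assert (Hti : 0 < / t) by pos.
  assert (Hia : / t <= / al) by (apply Rinv_le_contravar; lra).
  assert (Hln := ln_abs_le t).
  assert (R1 : Rabs (Rpower t (ep j)) <= 1).
  { rewrite Rabs_pos_eq by pos. apply Rpower_le1; lra. }
  assert (R2 : Rabs (Rpower t (2 * tot m p0 j x)) <= 1).
  { rewrite Rabs_pos_eq by pos. apply Rpower_le1; lra. }
  assert (Hdiv : forall u c, Rabs (t * u) <= c -> Rabs u <= c * / al).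
  { intros u c Hu.
    replace u with (t * u * / t) by (field; lra). rewrite Rabs_mult, (Rabs_pos_eq (/ t)) by lra.
    pos. }
  assert (D3' := Hdiv _ _ D3). assert (D6' := Hdiv _ _ D6).
  assert (Hpr : forall u w c d, Rabs u <= c -> Rabs w <= d -> Rabs (u * w) <= c * d) by pos.
  assert (Hpl : forall u w c d, Rabs u <= c -> Rabs w <= d -> Rabs (u + w) <= c + d) by pos.
  assert (Hln' : Rabs (ln t) <= / al) by lra. clear Hln.
  assert (Hal' : 0 < / al) by lra. set (L := / al) in *.
  unfold crude. fold L.
  assert (Hqk : Rabs (q1 j x + kap j t x) <= C0 + 1) by pos.
  splits.
  - rewrite (ws_P W j t x Hj Ht' Hx).
    eapply Rle_trans; eauto. nra.
  - eapply Rle_trans; [apply Hdiv|].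
    rewrite (ws_DP W j t x Hj Ht' Hx).
    eauto. nra.
  - rewrite (ws_xP W j t x Hj Ht' Hx).
    eapply Rle_trans; eauto. nra.
  - eapply Rle_trans; [apply Hdiv|].
    rewrite (ws_DQ W j t x Hj Ht' Hx).
    apply Hpr; eauto. apply Hpl; eauto. apply (Hpr _ _ 2 (C0 + 1)); auto.
    rewrite Rabs_pos_eq; lra. nra.
  - rewrite (ws_xQ W j t x Hj Ht' Hx).
    eapply Rle_trans.
    { apply Hpl; eauto. apply Hpr; eauto. apply Hpl; eauto. apply Hpl; eauto.
      apply (Hpr _ _ (2 * C0 * L) (C0 + 1)); auto. apply Hpr; auto. apply Hpr; auto. rewrite Rabs_pos_eq; lra. }
    nra.
Qed.

Context (x0 rho : R) (Hra : a < x0 - rho) (Hrb : x0 + rho < b).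

Definition Adm (al t x y d : R) : Prop := al < t < T /\ a < x < b /\ a < y < b /\ 0 <= d /\ forall j, (j <= m)%nat ->
  Rabs (Pt j t x - Pt j t y) <= d /\ Rabs (Px j t x - Px j t y) <= d /\ Rabs (Qt j t x - Qt j t y) <= d /\ Rabs (Qx j t x - Qx j t y) <= d.

Lemma Adm_pos al t x y d : Adm al t x y d -> 0 <= d.
Proof. intros H. apply H. Qed.

Lemma crude_pos al : 0 < al -> 0 <= crude al.
Proof. intros. assert (0 < / al) by pos. apply Rmult_le_pos; nra. Qed.

Lemma dlc_fields al j : (j <= m)%nat -> 0 < al -> dlc (Adm al) (P j) /\ dlc (Adm al) (Pt j) /\ dlc (Adm al) (Px j) /\ dlc (Adm al) (Qt j) /\ dlc (Adm al) (Qx j).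
Proof.
  intros Hj Hal. assert (Hc := crude_pos al).
  assert (Hmain : forall g : R -> R -> R, (forall t x, al < t < T -> a < x < b -> Rabs (g t x) <= crude al) ->
    (forall t x y d, Adm al t x y d -> Rabs (g t x - g t y) <= d) -> dlc (Adm al) g).
  { intros g H1 H2. exists (crude al + 1). split; [lra|]. intros t x y d Hd. assert (Hd' := Hd). destruct Hd' as [G1 [G2 [G3 [G4 _]]]].
    assert (N1 := H1 t x). assert (N2 := H1 t y). assert (N3 := H2 t x y d Hd).
    assert (N4 := Rabs_pos (x - y)). nra. }
  splits.
  2-5: apply Hmain; [intros t x Ht Hx; apply (fields_bounded al j t x Hj Hal Ht Hx) | intros t x y d Hd; apply Hd; auto].
  exists (crude al). split; auto. intros t x y d Hd. destruct Hd as [G1 [G2 [G3 [G4 _]]]].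
  split; [apply (fields_bounded al j t x Hj Hal G1 G2) | split; [apply (fields_bounded al j t y Hj Hal G1 G3)|]].
  apply Rle_trans with (crude al * Rabs (x - y)); [| pos].
  eapply derive_bound_lip; intros z Hz; assert (Hz' : a < z < b) by (unfold Rmin, Rmax in Hz; destruct Rle_dec; lra).
  - apply (ws_Px W); auto; lra.
  - apply fields_bounded; auto.
Qed.

Lemma dlc_inv_t al : 0 < al -> dlc (Adm al) (fun t _ => / t).
Proof.
  intros. apply (dlc_t (Adm al) (Adm_pos al) (fun t => / t) (/ al)). intros t x y d [Ht _].
  rewrite Rabs_pos_eq by pos. apply Rinv_le_contravar; lra.
Qed.

Lemma dlc_sources al j : (j <= m)%nat -> 0 < al -> dlc (Adm al) (fP m P Pt Qt Qx j) /\ dlc (Adm al) (fQ m Pt Px Qt Qx j).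
Proof.
  intros Hj Hal. assert (Hp := Adm_pos al).
  assert (HF := fun i Hi => dlc_fields al i Hi Hal). destruct (HF j Hj) as [F1 [F2 [F3 [F4 F5]]]].
  split.
  - apply dlc_ext with (fun t x => -1 * (Pt j t x * / t) + (- 1 / 2 * exp (-2 * totf m P j t x)) * (Qt j t x * Qt j t x + -1 * (Qx j t x * Qx j t x))).
    { intros t x. unfold fP, Rdiv. ring. }
    apply dlc_plus.
    + apply dlc_mult. apply dlc_cst; auto. apply dlc_mult; auto. apply dlc_inv_t; auto.
    + apply dlc_mult.
      * apply dlc_mult. apply dlc_cst; auto. apply dlc_exp; auto.
        apply dlc_mult. apply dlc_cst; auto. apply dlc_tot; auto. apply HF.
      * apply dlc_plus; apply dlc_mult; auto. apply dlc_cst; auto. apply dlc_mult; auto.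
  - apply dlc_ext with (fun t x => -1 * (Qt j t x * / t) + 2 * (totf m Pt j t x * Qt j t x + -1 * (totf m Px j t x * Qx j t x))).
    { intros. unfold fQ, Rdiv. ring. }
    apply dlc_plus.
    + apply dlc_mult. apply dlc_cst; auto. apply dlc_mult; auto. apply dlc_inv_t; auto.
    + apply dlc_mult. apply dlc_cst; auto. apply dlc_plus.
      * apply dlc_mult; auto. apply dlc_tot; auto. apply HF.
      * apply dlc_mult. apply dlc_cst; auto. apply dlc_mult; auto. apply dlc_tot; auto. apply HF.
Qed.

Lemma sources_uniform al : 0 < al -> exists K, 0 <= K /\ forall j t x y d, (j <= m)%nat -> Adm al t x y d ->
  (Rabs (fP m P Pt Qt Qx j t x) <= K /\ Rabs (fQ m Pt Px Qt Qx j t x) <= K) /\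
  Rabs (fP m P Pt Qt Qx j t x - fP m P Pt Qt Qx j t y) <= K * (Rabs (x - y) + d) /\
  Rabs (fQ m Pt Px Qt Qx j t x - fQ m Pt Px Qt Qx j t y) <= K * (Rabs (x - y) + d).
Proof.
  intros Hal.
  destruct (fin_max (fun j K => 0 <= K /\ forall t x y d, Adm al t x y d ->
  (Rabs (fP m P Pt Qt Qx j t x) <= K /\ Rabs (fQ m Pt Px Qt Qx j t x) <= K) /\
  Rabs (fP m P Pt Qt Qx j t x - fP m P Pt Qt Qx j t y) <= K * (Rabs (x - y) + d) /\
  Rabs (fQ m Pt Px Qt Qx j t x - fQ m Pt Px Qt Qx j t y) <= K * (Rabs (x - y) + d)) m) as [K HK].
  - intros j n n' Hn [H0 H]. split; [lra|]. intros t x y d Hd. destruct (H t x y d Hd) as [[H1 H2] [H3 H4]].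
    assert (Hd0 := Adm_pos _ _ _ _ _ Hd). assert (Hx := Rabs_pos (x - y)).
    nra.
  - intros j Hj. destruct (dlc_sources al j Hj Hal) as [[K1 [HK1 H1]] [K2 [HK2 H2]]]. exists (K1 + K2). split; [lra|].
    intros t x y d Hd. destruct (H1 t x y d Hd) as [G1 [G2 G3]]. destruct (H2 t x y d Hd) as [G4 [G5 G6]].
    assert (Hd0 := Adm_pos _ _ _ _ _ Hd). assert (Hx := Rabs_pos (x - y)).
    nra.
  - exists K. split; [apply (HK O); lia|]. intros. apply HK; auto.
Qed.

(** Packs the [P] and [Q] families into one family, since the regularity argument treats the coupled
    unknowns together. [Nat.min] makes every index of the type admissible. *)
Definition pk (F G : nat -> R -> R -> R) (i : bool * nat) : R -> R -> R :=
  if fst i then F (Nat.min (snd i) m) else G (Nat.min (snd i) m).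

(** On [[t / 2, (t + T) / 2]] all times are good. A locally uniform Lipschitz constant gives joint
    continuity of the first derivatives and local bounds on the second ones in [x], as needed for
    integration along characteristics. *)
Lemma wsol_regular t : 0 < t < T ->
  (forall j x, (j <= m)%nat -> Om x0 rho t x -> continuity_2d_pt (Pt j) t x /\ continuity_2d_pt (Px j) t x /\
    continuity_2d_pt (Qt j) t x /\ continuity_2d_pt (Qx j) t x) /\
  exists d K, 0 < d /\ forall j s x, (j <= m)%nat -> 0 < s < T -> Rabs (s - t) < d -> Om x0 rho s x -> Rabs (Pxx j s x) <= K /\ Rabs (Qxx j s x) <= K.
Proof.
  intros Ht. set (al := t / 4). assert (Hal : 0 < al) by (unfold al; lra).
  destruct (sources_uniform al Hal) as [C [HC Hsrc]].
  set (M := crude al + C). assert (Hcr := crude_pos al).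
  assert (HM : 0 <= M) by (unfold M; lra).
  set (u := pk P Q). set (A := pk Pt Qt). set (B := pk Px Qx). set (f := pk (fP m P Pt Qt Qx) (fQ m Pt Px Qt Qx)). set (Bx := pk Pxx Qxx).
  set (t1 := t / 2). set (t2 := (t + T) / 2). assert (Ht12 : al < t1 /\ t2 < T) by (unfold al, t1, t2; lra).
  assert (Hmin : forall j, (Nat.min j m <= m)%nat) by lia.
  assert (Hminj : forall j, (j <= m)%nat -> Nat.min j m = j) by lia.
  assert (HAt : forall i s x, al < s < T -> a < x < b -> is_derive (fun s => A i s x) s (Bx i s x + f i s x)).
  { intros [[|] j] s x Hs Hx.
    apply (ws_Ptt W); auto; lra.
    apply (ws_Qtt W); auto; lra. }
  assert (HBx : forall i s x, al < s < T -> a < x < b -> is_derive (fun y => B i s y) x (Bx i s x)).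
  { intros [[|] j] s x Hs Hx.
    apply (ws_Pxx W); auto; lra.
    apply (ws_Qxx W); auto; lra. }
  assert (HBc : forall i s x, al < s < T -> a < x < b -> continuous (fun s => B i s x) s).
  { intros [[|] j] s x Hs Hx.
    apply (ws_Pxc W); auto; lra.
    apply (ws_Qxc W); auto; lra. }
  assert (HBxc : forall i s x, al < s < T -> a < x < b -> continuous (Bx i s) x).
  { intros [[|] j] s x Hs Hx.
    apply (ws_Pxxc W); auto; lra.
    apply (ws_Qxxc W); auto; lra. }
  assert (Hut : forall i s x, al < s < T -> a < x < b -> is_derive (fun s => u i s x) s (A i s x)).
  { intros [[|] j] s x Hs Hx.
    apply (ws_Pt W); auto; lra.
    apply (ws_Qt W); auto; lra. }
  assert (Hux : forall i s x, al < s < T -> a < x < b -> is_derive (fun y => u i s y) x (B i s x)).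
  { intros [[|] j] s x Hs Hx.
    apply (ws_Px W); auto; lra.
    apply (ws_Qx W); auto; lra. }
  assert (Hl0 : forall s, al < s < T -> exists n : nat, forall i x y, a < x < b -> a < y < b ->
     Rabs (A i s x - A i s y) <= INR n * Rabs (x - y) /\ Rabs (B i s x - B i s y) <= INR n * Rabs (x - y)).
  { intros s Hs. destruct (ws_lip W s) as [n Hn]; [lra|].
    destruct (nfloor_ex (Rmax n 0) (Rmax_r _ _)) as [N HN]. exists (S N).
    assert (HnN : n <= INR (S N)). { rewrite S_INR. assert (H := Rmax_l n 0). lra. }
    intros [bb j] x y Hx Hy. destruct (Hn _ (Hmin j)) as [L1 [L2 [L3 L4]]].
    apply lipb_mono with (n' := INR (S N)) in L1, L2, L3, L4; auto.
    unfold A, B, pk. destruct bb; auto. }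
  assert (HAdm : forall s x y d, al < s < T -> a < x < b -> a < y < b -> 0 <= d ->
     (forall i, Rabs (A i s x - A i s y) <= d /\ Rabs (B i s x - B i s y) <= d) -> Adm al s x y d).
  { intros s x y d Hs Hx Hy Hd H. repeat split; try lra.
    - destruct (H (true, j)) as [G _]. unfold A, pk in G. rewrite Hminj in G; auto.
    - destruct (H (true, j)) as [_ G]. unfold B, pk in G. rewrite Hminj in G; auto.
    - destruct (H (false, j)) as [G _]. unfold A, pk in G. rewrite Hminj in G; auto.
    - destruct (H (false, j)) as [_ G]. unfold B, pk in G. rewrite Hminj in G; auto. }
  assert (Hbd : forall i s x, al < s < T -> a < x < b -> Rabs (A i s x) <= M /\ Rabs (B i s x) <= M /\ Rabs (f i s x) <= M).
  { intros i s x Hs Hx. assert (HA := HAdm s x x 0 Hs Hx Hx (Rle_refl 0) ltac:(intros; rewrite !Rminus_diag, Rabs_R0; lra)).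
    destruct i as [bb j]. destruct (Hsrc _ s x x 0 (Hmin j) HA) as [[G1 G2] _].
    destruct (fields_bounded al _ s x (Hmin j) Hal Hs Hx) as [_ [N1 [N2 [N3 N4]]]].
    unfold A, B, f, pk, M. destruct bb; cbv [fst snd]; lra. }
  assert (Hfl : forall i s x y d, al < s < T -> a < x < b -> a < y < b -> 0 <= d ->
   (forall j, Rabs (A j s x - A j s y) <= d /\ Rabs (B j s x - B j s y) <= d) ->
   Rabs (f i s x - f i s y) <= C * (Rabs (x - y) + d)).
  { intros [bb j] s x y d Hs Hx Hy Hd H. destruct (Hsrc _ s x y d (Hmin j) (HAdm s x y d Hs Hx Hy Hd H)) as [_ [G1 G2]].
    destruct bb; auto. }
  assert (HG : forall s, t1 <= s <= t2 -> Good _ A B x0 rho t1 t2 s).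
  { eapply all_good with (M := M) (C := C); eassumption. }
  assert (HcA : forall i x, Om x0 rho t x -> continuity_2d_pt (A i) t x /\ continuity_2d_pt (B i) t x).
  { intros i x Hx. assert (Hin : t1 < t < t2) by (unfold t1, t2; lra). assert (HGt := HG t ltac:(lra)). split; [exact (A_cont2 _ A B f Bx al T x0 rho a b Hal Hra Hrb HAt t1 t2 Ht12 i t x Hin HGt Hx) | exact (B_cont2 _ A B al T x0 rho a b Hal Hra Hrb HBc t1 t2 Ht12 i t x Hin HGt Hx)]. }
  split.
  - intros j x Hj Hx. destruct (HcA (true, j) x Hx) as [G1 G2]. destruct (HcA (false, j) x Hx) as [G3 G4].
    unfold A, B, pk in *. rewrite Hminj in *; auto.
  - destruct (HG t ltac:(unfold t1, t2; lra)) as [d [n [Hd HL]]].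
    set (d' := Rmin d (Rmin (t / 4) ((T - t) / 4))).
    mins.
    exists d', n. split; [repeat apply Rmin_glb_lt; lra|]. intros j s x Hj Hs Hst Hx.
    assert (Hst' := Hst). apply Rabs_def2 in Hst'.
    assert (HLs : L _ A B x0 rho s n) by (apply HL; [unfold t1, t2 in *; lra | lra]).
    assert (Hsa : al < s < T) by (unfold al; lra).
    assert (HBb : forall i, Rabs (Bx i s x) <= n).
    { intros i. exact (Bx_bound _ A B Bx al T x0 rho a b Hal Hra Hrb HBx i s x n Hsa Hx HLs). }
    assert (G1 := HBb (true, j)). assert (G2 := HBb (false, j)). unfold Bx, pk in *. rewrite Hminj in *; auto.
Qed.

End Reg.
Arguments crude : clear implicits.

(** * Size of the fields near t = 0 *)

Lemma sum_abs_le f n c : (forall i, (i <= n)%nat -> Rabs (f i) <= c) -> Rabs (sum_f_R0 f n) <= (INR n + 1) * c.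
Proof.
  induction n; intros H.
  - simpl. assert (G := H O (le_n O)). lra.
  - rewrite S_INR. replace ((INR n + 1 + 1) * c) with ((INR n + 1) * c + c) by lra.
    apply Rabs_plus_le; auto.
Qed.

Lemma tot_abs_le m f j x c : (j <= m)%nat -> (forall i, (i <= m)%nat -> Rabs (f i x) <= c) -> Rabs (tot m f j x) <= (INR m + 2) * c.
Proof.
  intros. replace ((INR m + 2) * c) with ((INR m + 1) * c + c) by lra.
  apply Rabs_plus_le; auto. apply sum_abs_le; auto.
Qed.

Lemma tot_lin m f g h j x c d : (j <= m)%nat -> (forall i, (i <= m)%nat -> h i x = c * f i x + d * g i x) ->
  tot m h j x = c * tot m f j x + d * tot m g j x.
Proof.
  intros Hj H. unfold tot. rewrite H by pos.
  assert (G : forall n, (n <= m)%nat -> sum_f_R0 (fun i => h i x) n = c * sum_f_R0 (fun i => f i x) n + d * sum_f_R0 (fun i => g i x) n).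
  { induction n; intros Hn; simpl. auto. rewrite IHn, H by lia. ring. }
  rewrite G by pos. ring.
Qed.

Lemma t_ln_le t : 0 < t <= 1 -> Rabs (t * ln t) <= 1 /\ Rabs (t * ln t) <= 2 * Rpower t (1 / 2).
Proof.
  assert (H := ln_abs_le t).
  split.
  - rewrite Rabs_mult, Rabs_pos_eq by lra. apply Rle_trans with (t * / t). apply Rmult_le_compat_l; lra. right; field; lra.
  - set (s := Rpower t (1 / 2)). assert (Hs := Rpower_pos t (1 / 2)). fold s in Hs.
    assert (Hs1 : s <= 1) by (apply Rpower_le1; lra).
    assert (Hss : s * s = t). { unfold s. rewrite <- Rpower_plus. replace (1 / 2 + 1 / 2) with 1 by lra. apply Rpower_1; lra. }
    assert (G := ln_abs_le s).
    assert (Hl : ln t = 2 * ln s). { rewrite <- Hss, ln_mult by lra. ring. }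
    rewrite Hl, Rabs_mult, Rabs_pos_eq, Rabs_mult, Rabs_pos_eq by lra.
    apply Rle_trans with (t * (2 * / s)). apply Rmult_le_compat_l; lra. right. rewrite <- Hss. field. lra.
Qed.

Section Basic.
Context {m : nat} {p0 p1 q0 q1 : nat -> R -> R} {ep : nat -> R} {T a b : R}
  {P Pt Px Pxx Q Qt Qx Qxx pi Api pix kap Bk kapx : nat -> R -> R -> R}.
Context (W : wsol m p0 p1 q0 q1 ep T a b P Pt Px Pxx Q Qt Qx Qxx pi Api pix kap Bk kapx).
Context {C0 ga : R} (HC0 : 0 <= C0) (Hbase : base_bd m p0 p1 q0 q1 ep a b C0) (HT : 0 < T <= 1).
Context (Hga : 0 < ga <= 1 / 2) (Hgae : forall j, (j <= m)%nat -> ga <= ep j).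
Context (Hkd : forall j x, (j <= m)%nat -> a < x < b -> is_derive (tot m p0 j) x (tot m (fun i => Derive (p0 i)) j x)).

Definition cK1 : R := exp (2 * (INR m + 2) * (C0 + 1)).
(** One constant dominating all bounds of this section: its summands come from [yf] and its inverse,
    from the first derivatives of [Q], and from those of [psi]. *)
Definition cK : R := cK1 + 4 * (C0 + 2) * (C0 + 2) + 2 * (INR m + 2) * (C0 + 2).
Definition qf (j : nat) (t x : R) : R := Rpower t (2 * tot m p0 j x).
(** The exponent of [exp (-2 psi) t^(2k)]. The logarithm cancels, so [yf] is bounded above and away
    from zero. *)
Definition yexp (j : nat) (t x : R) : R := -2 * totf m P j t x + 2 * tot m p0 j x * ln t.
Definition yf (j : nat) (t x : R) : R := exp (yexp j t x).

Lemma cK_ge : 1 <= cK1 /\ cK1 <= cK /\ 4 * (C0 + 2) * (C0 + 2) <= cK /\ 2 * (INR m + 2) * (C0 + 2) <= cK /\ 1 <= cK.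
Proof.
  assert (Hm := pos_INR m).
  assert (H : 1 <= cK1).
  { rewrite <- exp_0 at 1. apply exp_le. pos. }
  assert (H1 : 0 <= 4 * C0 * C0) by nra.
  assert (H2 : 0 <= 2 * (INR m + 2) * C0) by pos.
  unfold cK. lra.
Qed.

Section At.
Context (j : nat) (t x : R) (Hj : (j <= m)%nat) (Ht : 0 < t < T) (Hx : a < x < b).

Lemma pow_ga_le i : (i <= m)%nat -> 0 < Rpower t (ep i) <= Rpower t ga.
Proof. split; [pos | apply Rpower_anti; pos]. Qed.

Lemma t_le_ga : t <= Rpower t ga <= 1.
Proof.
  split; [|apply Rpower_le1; lra]. rewrite <- Rpower_1 at 1 by lra. apply Rpower_anti; lra.
Qed.

Lemma psi_form : yexp j t x = -2 * (tot m (fun i => p1 i) j x + tot m (fun i x => Rpower t (ep i) * pi i t x) j x).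
Proof.
  unfold yexp, totf. assert (H : tot m (fun i => P i t) j x = ln t * tot m p0 j x + 1 * tot m (fun i x => 1 * p1 i x + 1 * (Rpower t (ep i) * pi i t x)) j x).
  { apply tot_lin; auto. intros i Hi. rewrite (ws_P W i t x Hi Ht Hx). ring. }
  assert (H2 : tot m (fun i x => 1 * p1 i x + 1 * (Rpower t (ep i) * pi i t x)) j x = 1 * tot m (fun i => p1 i) j x + 1 * tot m (fun i x => Rpower t (ep i) * pi i t x) j x).
  { apply tot_lin; auto. }
  lra.
Qed.

Lemma pow_bd i u c : (i <= m)%nat -> Rabs u <= c -> Rabs (Rpower t (ep i) * u) <= Rpower t ga * c.
Proof.
  intros Hi Hu. destruct (pow_ga_le i Hi) as [H1 H2]. rewrite Rabs_mult, Rabs_pos_eq by lra.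
  pos.
Qed.

Lemma yexp_bd : Rabs (yexp j t x) <= 2 * (INR m + 2) * (C0 + 1).
Proof.
  rewrite psi_form. destruct t_le_ga as [_ Hg].
  assert (H1 : Rabs (tot m (fun i => p1 i) j x) <= (INR m + 2) * C0).
  { apply tot_abs_le; auto. intros i Hi. apply Hbase; auto. }
  assert (H2 : Rabs (tot m (fun i x => Rpower t (ep i) * pi i t x) j x) <= (INR m + 2) * 1).
  { apply tot_abs_le; auto. intros i Hi. eapply Rle_trans; [apply pow_bd; [auto | apply (ws_bd W i t x Hi Ht Hx)]|]. lra. }
  apply Rabs_le_between in H1, H2. apply Rabs_le. lra.
Qed.

Lemma yf_bd : 0 < yf j t x /\ yf j t x <= cK /\ / yf j t x <= cK.
Proof.
  assert (H := yexp_bd). apply Rabs_le_between in H. destruct cK_ge as [_ [G _]].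
  unfold yf. rewrite <- exp_Ropp. split; [pos |].
  split; eapply Rle_trans; try exact G; apply exp_le; lra.
Qed.

Lemma yf_q : exp (-2 * totf m P j t x) * qf j t x = yf j t x.
Proof. unfold qf, Rpower. rewrite <- exp_plus. auto. Qed.

Lemma DQ_bd : Rabs (t * Qt j t x) <= cK * qf j t x.
Proof.
  rewrite (ws_DQ W j t x Hj Ht Hx). fold (qf j t x). assert (Hq : 0 < qf j t x) by apply Rpower_pos.
  destruct (Hbase j x Hj Hx) as [[B1 [B2 B3]] [_ [_ Hk]]]. destruct (ws_bd W j t x Hj Ht Hx) as [_ [_ [_ [D4 [D5 _]]]]].
  rewrite (Rmult_comm cK). apply Rabs_mult_le; [rewrite Rabs_pos_eq; lra|].
  eapply Rle_trans.
  { apply Rabs_plus_le; eauto. apply Rabs_mult_le; [|apply Rabs_plus_le; eassumption].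
    rewrite Rabs_pos_eq by lra. apply Rle_trans with 2; [lra | apply Rle_refl]. }
  destruct cK_ge as [_ [_ [G _]]]. nra.
Qed.

Lemma xQ_bd : Rabs (t * Qx j t x) <= cK * (qf j t x + t).
Proof.
  rewrite (ws_xQ W j t x Hj Ht Hx). fold (qf j t x). assert (Hq : 0 < qf j t x) by apply Rpower_pos.
  destruct (Hbase j x Hj Hx) as [[B1 [B2 B3]] [[B4 [B5 [B6 [B7 B8]]]] [_ Hk]]]. destruct (ws_bd W j t x Hj Ht Hx) as [_ [_ [_ [D4 [_ D6]]]]].
  destruct (t_ln_le t ltac:(lra)) as [Hl _].
  replace (t * (Derive (q0 j) x + qf j t x * (Derive (q1 j) x + 2 * Derive (tot m p0 j) x * ln t * (q1 j x + kap j t x) + kapx j t x)))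
   with (t * Derive (q0 j) x + qf j t x * (t * Derive (q1 j) x + 2 * Derive (tot m p0 j) x * (t * ln t) * (q1 j x + kap j t x) + t * kapx j t x)) by lra.
  assert (T1 : Rabs (t * Derive (q0 j) x) <= t * C0) by (apply Rabs_mult_le; auto; rewrite Rabs_pos_eq; lra).
  assert (T2 : Rabs (t * Derive (q1 j) x + 2 * Derive (tot m p0 j) x * (t * ln t) * (q1 j x + kap j t x) + t * kapx j t x) <= 1 * C0 + 2 * C0 * 1 * (C0 + 1) + 1).
  { apply Rabs_plus_le; auto. apply Rabs_plus_le.
    - apply Rabs_mult_le; auto. rewrite Rabs_pos_eq; lra.
    - apply Rabs_mult_le; [| pos]. apply Rabs_mult_le; auto. apply Rabs_mult_le; auto. rewrite Rabs_pos_eq; lra. }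
  eapply Rle_trans; [apply Rabs_plus_le; [eauto | apply Rabs_mult_le; eauto; rewrite Rabs_pos_eq; [apply Rle_refl | lra]]|].
  destruct cK_ge as [_ [_ [G _]]]. nra.
Qed.

Lemma Dpsi_form : t * totf m Pt j t x = tot m p0 j x + tot m (fun i x => Rpower t (ep i) * Api i t x) j x.
Proof.
  assert (H : tot m (fun i x => t * Pt i t x + 0 * 0) j x = t * totf m Pt j t x + 0 * tot m (fun _ _ => 0) j x).
  { apply tot_lin; auto. }
  assert (H2 : tot m (fun i x => t * Pt i t x + 0 * 0) j x = 1 * tot m p0 j x + 1 * tot m (fun i x => Rpower t (ep i) * Api i t x) j x).
  { apply tot_lin; auto. intros i Hi. rewrite (ws_DP W i t x Hi Ht Hx). ring. }
  lra.
Qed.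

Lemma xpsi_form : totf m Px j t x = Derive (tot m p0 j) x * ln t + (tot m (fun i => Derive (p1 i)) j x + tot m (fun i x => Rpower t (ep i) * pix i t x) j x).
Proof.
  rewrite (is_derive_unique _ _ _ (Hkd j x Hj Hx)).
  assert (H : totf m Px j t x = ln t * tot m (fun i => Derive (p0 i)) j x + 1 * tot m (fun i x => 1 * Derive (p1 i) x + 1 * (Rpower t (ep i) * pix i t x)) j x).
  { apply tot_lin; auto. intros i Hi. rewrite (ws_xP W i t x Hi Ht Hx). ring. }
  assert (H2 : tot m (fun i x => 1 * Derive (p1 i) x + 1 * (Rpower t (ep i) * pix i t x)) j x = 1 * tot m (fun i => Derive (p1 i)) j x + 1 * tot m (fun i x => Rpower t (ep i) * pix i t x) j x).
  { apply tot_lin; auto. }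
  lra.
Qed.

(** This is [t d_t] of the logarithm of [yf]: the leading part [k] of [D psi] cancels, which leaves
    a power of [t]. In [y_dx_bd] the terms with [t ln t] cancel in the same way. *)
Lemma y_dt_bd : Rabs (-2 * (t * totf m Pt j t x) + 2 * tot m p0 j x) <= cK * Rpower t ga.
Proof.
  rewrite Dpsi_form. replace (-2 * (tot m p0 j x + tot m (fun i x => Rpower t (ep i) * Api i t x) j x) + 2 * tot m p0 j x)
    with (-2 * tot m (fun i x => Rpower t (ep i) * Api i t x) j x) by lra.
  rewrite Rabs_mult, Rabs_left1 by lra.
  assert (H2 : Rabs (tot m (fun i x => Rpower t (ep i) * Api i t x) j x) <= (INR m + 2) * (Rpower t ga * 1)).
  { apply tot_abs_le; auto. intros i Hi. apply pow_bd; [auto | apply (ws_bd W i t x Hi Ht Hx)]. }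
  assert (Hm := pos_INR m). assert (Hp := Rpower_pos t ga). destruct cK_ge as [_ [_ [_ [G _]]]]. assert (G2 : 2 * (INR m + 2) <= cK) by nra. nra.
Qed.

Lemma tpix_tot_bd : Rabs (t * tot m (fun i x => Rpower t (ep i) * pix i t x) j x) <= (INR m + 2) * (Rpower t ga * 1).
Proof.
  assert (H : tot m (fun i x => Rpower t (ep i) * (t * pix i t x)) j x = t * tot m (fun i x => Rpower t (ep i) * pix i t x) j x + 0 * tot m (fun _ _ => 0) j x).
  { apply tot_lin; auto. intros; lra. }
  replace (t * tot m (fun i x => Rpower t (ep i) * pix i t x) j x) with (tot m (fun i x => Rpower t (ep i) * (t * pix i t x)) j x) by lra.
  apply tot_abs_le; auto. intros i Hi. apply pow_bd; [auto | apply (ws_bd W i t x Hi Ht Hx)].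
Qed.

Lemma y_dx_bd : Rabs (-2 * (t * totf m Px j t x) + 2 * Derive (tot m p0 j) x * (t * ln t)) <= cK * Rpower t ga.
Proof.
  rewrite xpsi_form. set (S1 := tot m (fun i => Derive (p1 i)) j x). set (S2 := tot m (fun i x => Rpower t (ep i) * pix i t x) j x).
  replace (-2 * (t * (Derive (tot m p0 j) x * ln t + (S1 + S2))) + 2 * Derive (tot m p0 j) x * (t * ln t)) with (-2 * (t * S1 + t * S2)) by lra.
  rewrite Rabs_mult, Rabs_left1 by lra.
  assert (H2 := tpix_tot_bd). fold S2 in H2.
  assert (H1 : Rabs (t * S1) <= Rpower t ga * ((INR m + 2) * C0)).
  { apply Rabs_mult_le. rewrite Rabs_pos_eq; [apply t_le_ga | lra]. apply tot_abs_le; auto. intros. apply Hbase; auto. }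
  assert (H3 := Rabs_plus_le _ _ _ _ H1 H2).
  assert (Hm := pos_INR m). assert (Hp := Rpower_pos t ga). destruct cK_ge as [_ [_ [_ [G _]]]].
  nra.
Qed.

Lemma Dpsi_bd : Rabs (t * totf m Pt j t x) <= cK.
Proof.
  assert (H := y_dt_bd). destruct t_le_ga as [_ Hg]. destruct cK_ge as [_ [_ [G [_ G1]]]].
  destruct (Hbase j x Hj Hx) as [_ [_ Hk]].
  apply Rabs_le_between in H. apply Rabs_le. nra.
Qed.

Lemma xpsi_bd : Rabs (t * totf m Px j t x) <= cK.
Proof.
  assert (H := y_dx_bd). destruct t_le_ga as [_ Hg]. destruct cK_ge as [_ [_ [G [_ G1]]]].
  destruct (Hbase j x Hj Hx) as [_ [[_ [_ [_ [_ B8]]]] _]].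
  destruct (t_ln_le t ltac:(lra)) as [Hl _].
  assert (H2 : Rabs (2 * Derive (tot m p0 j) x * (t * ln t)) <= 2 * C0 * 1).
  { apply Rabs_mult_le; auto. apply Rabs_mult_le; auto. rewrite Rabs_pos_eq; lra. }
  apply Rabs_le_between in H, H2. apply Rabs_le. nra.
Qed.
End At.
End Basic.
Arguments cK1 : clear implicits.
Arguments cK : clear implicits.
Arguments qf : clear implicits.
Arguments yexp : clear implicits.
Arguments yf : clear implicits.

(** * Continuity and local boundedness on the cone *)

Section Classes.
Context (x0 rho T : R).
Notation Omg := (Om x0 rho).
Notation "'onD' t x , Z" := (forall t x : R, 0 < t < T -> Omg t x -> Z) (at level 200, t name, x name).
Definition c2 (g : R -> R -> R) : Prop := onD t x, continuity_2d_pt g t x.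

Lemma c2_plus f g : c2 f -> c2 g -> c2 (fun t x => f t x + g t x).
Proof. intros Hf Hg t x Ht Hx. apply continuity_2d_pt_plus; auto. Qed.
Lemma c2_minus f g : c2 f -> c2 g -> c2 (fun t x => f t x - g t x).
Proof. intros Hf Hg t x Ht Hx. apply continuity_2d_pt_minus; auto. Qed.
Lemma c2_mult f g : c2 f -> c2 g -> c2 (fun t x => f t x * g t x).
Proof. intros Hf Hg t x Ht Hx. apply continuity_2d_pt_mult; auto. Qed.
Lemma c2_cst c : c2 (fun _ _ => c).
Proof. intros t x Ht Hx. apply continuity_2d_pt_const. Qed.
Lemma c2_comp h f : (forall u, continuous h u) -> c2 f -> c2 (fun t x => h (f t x)).
Proof.
  intros Hh Hf t x Ht Hx. apply continuity_1d_2d_pt_comp; auto. apply continuity_pt_filterlim, Hh.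
Qed.
Lemma c2_exp f : c2 f -> c2 (fun t x => exp (f t x)).
Proof.
  apply c2_comp. intros u. apply (is_derive_cont _ _ (exp u)), is_derive_Reals, derivable_pt_lim_exp.
Qed.
Lemma c2_t h : (forall t, 0 < t < T -> continuous h t) -> c2 (fun t _ => h t).
Proof.
  intros Hh t x Ht Hx. apply cont2_eps. intros e He. destruct (proj1 (continuous_eps _ _) (Hh t Ht) e He) as [d [Hd H]].
  eauto.
Qed.
Lemma c2_x h : (onD t x, continuous h x) -> c2 (fun _ x => h x).
Proof.
  intros Hh t x Ht Hx. apply cont2_eps. intros e He. destruct (proj1 (continuous_eps _ _) (Hh t x Ht Hx) e He) as [d [Hd H]].
  eauto.
Qed.
Lemma c2_sum f n : (forall i, (i <= n)%nat -> c2 (f i)) -> c2 (fun t x => sum_f_R0 (fun i => f i t x) n).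
Proof. induction n; intros H. apply H; lia. apply c2_plus; auto. Qed.
Lemma c2_tot m f j : (j <= m)%nat -> (forall i, (i <= m)%nat -> c2 (f i)) -> c2 (totf m f j).
Proof. intros. apply c2_plus; auto. apply c2_sum; auto. Qed.

Lemma lb_plus f g : lb x0 rho T f -> lb x0 rho T g -> lb x0 rho T (fun t x => f t x + g t x).
Proof.
  intros Hf Hg t Ht. destruct (Hf t Ht) as [d [K [Hd H]]]. destruct (Hg t Ht) as [d' [K' [Hd' H']]].
  exists (Rmin d d'), (K + K'). split; [pos |].
  mins. pos.
Qed.
Lemma lb_mult f g : lb x0 rho T f -> lb x0 rho T g -> lb x0 rho T (fun t x => f t x * g t x).
Proof.
  intros Hf Hg t Ht. destruct (Hf t Ht) as [d [K [Hd H]]]. destruct (Hg t Ht) as [d' [K' [Hd' H']]].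
  exists (Rmin d d'), (K * K'). split; [pos |].
  mins. pos.
Qed.
Lemma lb_bd f K : (onD t x, Rabs (f t x) <= K) -> lb x0 rho T f.
Proof. exists 1, K. pos. Qed.
Lemma lb_cst c : lb x0 rho T (fun _ _ => c).
Proof. apply lb_bd with (Rabs c). pos. Qed.
Lemma lb_opp f : lb x0 rho T f -> lb x0 rho T (fun t x => - f t x).
Proof.
  intros Hf t Ht. destruct (Hf t Ht) as [d [K [Hd H]]]. exists d, K. split; auto. intros. rewrite Rabs_Ropp. auto.
Qed.
Lemma lb_minus f g : lb x0 rho T f -> lb x0 rho T g -> lb x0 rho T (fun t x => f t x - g t x).
Proof. intros. apply lb_plus; auto. apply lb_opp; auto. Qed.
Lemma lb_exp f : lb x0 rho T f -> lb x0 rho T (fun t x => exp (f t x)).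
Proof.
  intros Hf t Ht. destruct (Hf t Ht) as [d [K [Hd H]]]. exists d, (exp K). split; auto. intros s x Hs Hst Hx.
  rewrite Rabs_pos_eq by pos. apply exp_le. assert (G := H s x Hs Hst Hx). apply Rabs_le_between in G. lra.
Qed.
Lemma lb_sum f n : (forall i, (i <= n)%nat -> lb x0 rho T (f i)) -> lb x0 rho T (fun t x => sum_f_R0 (fun i => f i t x) n).
Proof. induction n; intros H. apply H; lia. apply lb_plus; auto. Qed.
Lemma lb_tot m f j : (j <= m)%nat -> (forall i, (i <= m)%nat -> lb x0 rho T (f i)) -> lb x0 rho T (totf m f j).
Proof. intros. apply lb_plus; auto. apply lb_sum; auto. Qed.
Lemma c2_xc f t x : c2 f -> 0 < t < T -> Omg t x -> continuous (f t) x.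
Proof. intros H Ht Hx. apply cont2_snd, H; auto. Qed.

Definition xc (f : R -> R -> R) : Prop := onD t x, continuous (f t) x.
Lemma xc_c2 f : c2 f -> xc f.
Proof. intros H t x. apply c2_xc; auto. Qed.
Lemma xc_plus f g : xc f -> xc g -> xc (fun t x => f t x + g t x).
Proof. intros Hf Hg t x Ht Hx. apply Rcont_plus; auto. Qed.
Lemma xc_minus f g : xc f -> xc g -> xc (fun t x => f t x - g t x).
Proof. intros Hf Hg t x Ht Hx. apply Rcont_minus; auto. Qed.
Lemma xc_mult f g : xc f -> xc g -> xc (fun t x => f t x * g t x).
Proof. intros Hf Hg t x Ht Hx. apply Rcont_mult; auto. Qed.

Section FieldReg.
Context {m : nat} {p0 p1 q0 q1 : nat -> R -> R} {ep : nat -> R} {a b : R}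
  {P Pt Px Pxx Q Qt Qx Qxx pi Api pix kap Bk kapx : nat -> R -> R -> R}.
Context (W : wsol m p0 p1 q0 q1 ep T a b P Pt Px Pxx Q Qt Qx Qxx pi Api pix kap Bk kapx).
Context {C0 : R} (HC0 : 0 <= C0) (Hbase : base_bd m p0 p1 q0 q1 ep a b C0) (HT : 0 < T <= 1).
Context (Hra : a < x0 - rho) (Hrb : x0 + rho < b).

Lemma Om_ab t x : 0 < t -> Omg t x -> a < x < b.
Proof. intros Ht H. apply Rabs_def2 in H. lra. Qed.

Lemma c2_of_crude g gx j : (j <= m)%nat -> (forall t x, 0 < t < T -> a < x < b -> is_derive (fun y => g t y) x (gx t x)) ->
  (forall al t x, 0 < al -> al < t < T -> a < x < b -> Rabs (gx t x) <= crude C0 al) ->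
  (forall t x, 0 < t < T -> a < x < b -> continuous (fun s => g s x) t) -> c2 g.
Proof.
  intros Hj Hd Hb Hc t x Ht Hx. assert (Hxab := Om_ab t x (proj1 Ht) Hx).
  destruct (locally_itv a b x Hxab) as [d1 Hd1]. destruct (locally_itv (t / 2) T t) as [d2 Hd2]; [lra|].
  set (d := Rmin d1 d2). assert (Hd0 : 0 < d) by (apply Rmin_glb_lt; apply cond_pos).
  mins.
  apply cont2_of_lip with d (crude C0 (t / 2)); auto.
  intros s y z Hs Hy Hz.
  assert (Hs' : t / 2 < s < T) by (apply Hd2; change (Rabs (s - t) < d2); lra).
  assert (Hy' : a < y < b) by (apply Hd1; change (Rabs (y - x) < d1); lra).
  assert (Hz' : a < z < b) by (apply Hd1; change (Rabs (z - x) < d1); lra).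
  eapply derive_bound_lip; intros w Hw; assert (Hw' : a < w < b) by (unfold Rmin, Rmax in Hw; destruct Rle_dec; lra); pos.
Qed.

Lemma fields_c2 j : (j <= m)%nat -> c2 (P j) /\ c2 (Pt j) /\ c2 (Px j) /\ c2 (Q j) /\ c2 (Qt j) /\ c2 (Qx j).
Proof.
  split; [|split; [|split; [|split; [|split]]]].
  - eapply c2_of_crude; auto.
    + intros; apply (ws_Px W); auto.
    + intros al t x Hal Ht Hx. apply (fields_bounded W); auto.
    + intros t x Ht Hx. eapply is_derive_cont. eapply ws_Pt; eauto.
  - intros t x Ht Hx. eapply (wsol_regular W); eauto.
  - intros t x Ht Hx. eapply (wsol_regular W); eauto.
  - eapply c2_of_crude; auto.
    + intros; apply (ws_Qx W); auto.
    + intros al t x Hal Ht Hx. apply (fields_bounded W); auto.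
    + intros t x Ht Hx. eapply is_derive_cont. eapply ws_Qt; eauto.
  - intros t x Ht Hx. eapply (wsol_regular W); eauto.
  - intros t x Ht. eapply wsol_regular; eauto.
Qed.

Lemma fields_lb j : (j <= m)%nat -> lb x0 rho T (P j) /\ lb x0 rho T (Px j) /\ lb x0 rho T (Qx j) /\ lb x0 rho T (Pxx j) /\ lb x0 rho T (Qxx j).
Proof.
  intros Hj.
  assert (G : forall g : R -> R -> R, (forall al t x, 0 < al -> al < t < T -> a < x < b -> Rabs (g t x) <= crude C0 al) -> lb x0 rho T g).
  { intros g H t Ht. exists (t / 2), (crude C0 (t / 2)). split; [lra|]. intros s x Hs Hst Hx. apply Rabs_def2 in Hst.
    apply H; try lra. apply (Om_ab s); auto; lra. }
  assert (Gr := fun t Ht => proj2 (wsol_regular W HC0 Hbase HT x0 rho Hra Hrb t Ht)).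
  splits.
  1-3: apply G; intros al t x Hal Ht Hx; apply (fields_bounded W HC0 Hbase HT al j t x Hj Hal Ht Hx).
  - intros t Ht. destruct (Gr t Ht) as [d [K [Hd H]]]. exists d, K. split; auto. intros s x Hs Hst Hx. apply H; auto.
  - intros t Ht. destruct (Gr t Ht) as [d [K [Hd H]]]. exists d, K. split; auto. intros. apply H; auto.
Qed.

Lemma tot_dt j t x : (j <= m)%nat -> 0 < t < T -> a < x < b -> is_derive (fun s => totf m P j s x) t (totf m Pt j t x).
Proof.
  intros Hj Ht Hx. apply (is_derive_tot m (fun i s => P i s x) (fun i => Pt i t x) j t Hj). intros. eapply ws_Pt; eauto.
Qed.
Lemma tot_dx' j t x : (j <= m)%nat -> 0 < t < T -> a < x < b -> is_derive (fun y => totf m P j t y) x (totf m Px j t x).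
Proof.
  intros. apply is_derive_tot; auto. intros. eapply ws_Px; eauto.
Qed.

Definition Yf (j : nat) (t x : R) : R := exp (-2 * totf m P j t x).

Lemma is_derive_Rexp f x df : is_derive f x df -> is_derive (fun y => exp (f y)) x (df * exp (f x)).
Proof.
  apply (is_derive_comp exp). apply is_derive_Reals, derivable_pt_lim_exp.
Qed.

Lemma Y_dt j t x : (j <= m)%nat -> 0 < t < T -> a < x < b -> is_derive (fun s => Yf j s x) t (-2 * totf m Pt j t x * Yf j t x).
Proof. intros. apply is_derive_Rexp, is_derive_Rscal, tot_dt; auto. Qed.
Lemma Y_dx j t x : (j <= m)%nat -> 0 < t < T -> a < x < b -> is_derive (fun y => Yf j t y) x (-2 * totf m Px j t x * Yf j t x).
Proof. intros. apply is_derive_Rexp, is_derive_Rscal, tot_dx'; auto. Qed.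
Lemma Y_c2 j : (j <= m)%nat -> c2 (Yf j).
Proof.
  intros. apply c2_exp, c2_mult; [apply c2_cst|]. apply c2_tot; auto. apply fields_c2.
Qed.
Lemma Y_lb j : (j <= m)%nat -> lb x0 rho T (Yf j).
Proof.
  intros. apply lb_exp, lb_mult; [apply lb_cst|]. apply lb_tot; auto. apply fields_lb.
Qed.
End FieldReg.
End Classes.
Arguments Yf : clear implicits.

(** * The difference of two solutions in divergence form *)

Section Divergence.
Context {m : nat} {p0 p1 q0 q1 : nat -> R -> R} {ep : nat -> R} {T a b : R}
  {P Pt Px Pxx Q Qt Qx Qxx pi Api pix kap Bk kapx : nat -> R -> R -> R}
  {P' Pt' Px' Pxx' Q' Qt' Qx' Qxx' pi' Api' pix' kap' Bk' kapx' : nat -> R -> R -> R}.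
Context (W : wsol m p0 p1 q0 q1 ep T a b P Pt Px Pxx Q Qt Qx Qxx pi Api pix kap Bk kapx).
Context (W' : wsol m p0 p1 q0 q1 ep T a b P' Pt' Px' Pxx' Q' Qt' Qx' Qxx' pi' Api' pix' kap' Bk' kapx').
Context (j : nat) (Hj : (j <= m)%nat).

Let Y := Yf m P j.
Let Y' := Yf m P' j.
Let dQ t x := Q j t x - Q' j t x.
Let dpsi t x := totf m P j t x - totf m P' j t x.
Let dpsit t x := totf m Pt j t x - totf m Pt' j t x.
Let dpsix t x := totf m Px j t x - totf m Px' j t x.

(* The difference of two solutions in divergence form, [t d_t A = t d_x B + f]: multiplying by [Y = exp (-2 psi)]
   absorbs the products of first derivatives, so that [f] has no derivative of [dQ]. *)
Definition AP (t x : R) : R := t * (Pt j t x - Pt' j t x) + 1 / 2 * (Y t x * dQ t x) * (t * (Qt j t x + Qt' j t x)).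
Definition BP (t x : R) : R := t * (Px j t x - Px' j t x) + 1 / 2 * (Y t x * dQ t x) * (t * (Qx j t x + Qx' j t x)).
Definition BPx (t x : R) : R := t * (Pxx j t x - Pxx' j t x) + 1 / 2 * t *
  ((-2 * totf m Px j t x * Y t x * dQ t x + Y t x * (Qx j t x - Qx' j t x)) * (Qx j t x + Qx' j t x) + Y t x * dQ t x * (Qxx j t x + Qxx' j t x)).
Definition fPd (t x : R) : R := - 1 / 2 * (Y t x - Y' t x) * (t * Qt' j t x * (t * Qt' j t x) - t * Qx' j t x * (t * Qx' j t x))
  - Y t x * dQ t x * (t * dpsit t x * (t * Qt' j t x) - t * dpsix t x * (t * Qx' j t x)).

Definition AQ (t x : R) : R := Y t x * (t * (Qt j t x - Qt' j t x)) - 2 * (Y t x * dpsi t x) * (t * Qt' j t x).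
Definition BQ (t x : R) : R := Y t x * (t * (Qx j t x - Qx' j t x)) - 2 * (Y t x * dpsi t x) * (t * Qx' j t x).
Definition BQx (t x : R) : R := t * (-2 * totf m Px j t x * Y t x * (Qx j t x - Qx' j t x) + Y t x * (Qxx j t x - Qxx' j t x))
  - 2 * t * ((-2 * totf m Px j t x * Y t x * dpsi t x + Y t x * dpsix t x) * Qx' j t x + Y t x * dpsi t x * Qxx' j t x).
Definition fQd (t x : R) : R := 4 * (Y t x * dpsi t x) * (t * dpsit t x * (t * Qt' j t x) - t * dpsix t x * (t * Qx' j t x)).

Section AtPoint.
Context (t x : R) (Ht : 0 < t < T) (Hx : a < x < b).

Lemma id_d : is_derive (fun s : R => s) t 1.
Proof. apply (is_derive_id (K := R_AbsRing)). Qed.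

Lemma AP_dt : is_derive (fun s => AP s x) t (BPx t x + fPd t x / t).
Proof.
  assert (D1 := ws_Ptt W j t x Hj Ht Hx). assert (D2 := ws_Ptt W' j t x Hj Ht Hx).
  assert (D3 := ws_Qtt W j t x Hj Ht Hx). assert (D4 := ws_Qtt W' j t x Hj Ht Hx).
  assert (D5 := ws_Qt W j t x Hj Ht Hx). assert (D6 := ws_Qt W' j t x Hj Ht Hx).
  assert (D7 := Y_dt T W j t x Hj Ht Hx).
  assert (DY := is_derive_Rmult _ _ t _ _ D7 (is_derive_Rminus _ _ t _ _ D5 D6)).
  assert (DS := is_derive_Rmult _ _ t _ _ id_d (is_derive_Rplus _ _ t _ _ D3 D4)).
  assert (DP := is_derive_Rmult _ _ t _ _ id_d (is_derive_Rminus _ _ t _ _ D1 D2)).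
  assert (DD := is_derive_Rplus _ _ t _ _ DP (is_derive_Rmult _ _ t _ _ (is_derive_Rscal _ t (1 / 2) _ DY) DS)).
  evar_last; eauto. unfold BPx, fPd, fP, fQ, dQ, dpsit, dpsix, Y, Y'. fold (Yf m P j t x). fold (Yf m P' j t x).
  field. lra.
Qed.

Lemma BP_dx : is_derive (fun y => BP t y) x (BPx t x).
Proof.
  assert (D1 := ws_Pxx W j t x Hj Ht Hx). assert (D2 := ws_Pxx W' j t x Hj Ht Hx).
  assert (D3 := ws_Qxx W j t x Hj Ht Hx). assert (D4 := ws_Qxx W' j t x Hj Ht Hx).
  assert (D5 := ws_Qx W j t x Hj Ht Hx). assert (D6 := ws_Qx W' j t x Hj Ht Hx).
  assert (D7 := Y_dx T W j t x Hj Ht Hx).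
  assert (DY := is_derive_Rmult _ _ x _ _ D7 (is_derive_Rminus _ _ x _ _ D5 D6)).
  assert (DS := is_derive_Rscal _ x t _ (is_derive_Rplus _ _ x _ _ D3 D4)).
  assert (DP := is_derive_Rscal _ x t _ (is_derive_Rminus _ _ x _ _ D1 D2)).
  assert (DD := is_derive_Rplus _ _ x _ _ DP (is_derive_Rmult _ _ x _ _ (is_derive_Rscal _ x (1 / 2) _ DY) DS)).
  evar_last; eauto. unfold BPx, dQ, Y. lra.
Qed.

Lemma AQ_dt : is_derive (fun s => AQ s x) t (BQx t x + fQd t x / t).
Proof.
  assert (D3 := ws_Qtt W j t x Hj Ht Hx). assert (D4 := ws_Qtt W' j t x Hj Ht Hx).
  assert (D7 := Y_dt T W j t x Hj Ht Hx).
  assert (D8 := tot_dt T W j t x Hj Ht Hx).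
  assert (D9 := tot_dt T W' j t x Hj Ht Hx).
  assert (DY := is_derive_Rmult _ _ t _ _ D7 (is_derive_Rminus _ _ t _ _ D8 D9)).
  assert (DS := is_derive_Rmult _ _ t _ _ id_d D4).
  assert (DP := is_derive_Rmult _ _ t _ _ D7 (is_derive_Rmult _ _ t _ _ id_d (is_derive_Rminus _ _ t _ _ D3 D4))).
  assert (DD := is_derive_Rminus _ _ t _ _ DP (is_derive_Rmult _ _ t _ _ (is_derive_Rscal _ t 2 _ DY) DS)).
  evar_last; eauto. unfold BQx, fQd, fQ, dpsi, dpsit, dpsix, Y.
  field. lra.
Qed.

Lemma BQ_dx : is_derive (fun y => BQ t y) x (BQx t x).
Proof.
  assert (D3 := ws_Qxx W j t x Hj Ht Hx). assert (D4 := ws_Qxx W' j t x Hj Ht Hx).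
  assert (D7 := Y_dx T W j t x Hj Ht Hx).
  assert (D8 := tot_dx' T W j t x Hj Ht Hx).
  assert (D9 := tot_dx' T W' j t x Hj Ht Hx).
  assert (DY := is_derive_Rmult _ _ x _ _ D7 (is_derive_Rminus _ _ x _ _ D8 D9)).
  assert (DS := is_derive_Rscal _ x t _ D4).
  assert (DP := is_derive_Rmult _ _ x _ _ D7 (is_derive_Rscal _ x t _ (is_derive_Rminus _ _ x _ _ D3 D4))).
  assert (DD := is_derive_Rminus _ _ x _ _ DP (is_derive_Rmult _ _ x _ _ (is_derive_Rscal _ x 2 _ DY) DS)).
  evar_last; eauto. unfold BQx, dpsi, dpsix, Y. lra.
Qed.
End AtPoint.
End Divergence.
Arguments AP : clear implicits.
Arguments BP : clear implicits.
Arguments BPx : clear implicits.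
Arguments fPd : clear implicits.
Arguments AQ : clear implicits.
Arguments BQ : clear implicits.
Arguments BQx : clear implicits.
Arguments fQd : clear implicits.

Lemma c2_ext x0 rho T f g : (forall t x, 0 < t < T -> Om x0 rho t x -> f t x = g t x) -> c2 x0 rho T f -> c2 x0 rho T g.
Proof.
  intros He Hf t x Ht Hx. apply cont2_eps. intros e Hep.
  destruct (proj1 (cont2_eps _ _ _) (Hf t x Ht Hx) e Hep) as [d [Hd H]].
  destruct (Om_open x0 rho t x Hx) as [d1 [Hd1 HO]]. destruct (locally_itv 0 T t Ht) as [d2 Hd2].
  set (d' := Rmin d (Rmin d1 d2)). assert (Hd' : 0 < d') by (repeat apply Rmin_glb_lt; auto; apply cond_pos).
  mins.
  exists d'. split; auto. intros s y Hs Hy. rewrite <- !He; auto.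
  - pos.
  - apply Hd2. change (Rabs (s - t) < d2). lra.
  - pos.
Qed.

Lemma lb_sub x0 rho T T1 f : 0 < T1 <= T -> lb x0 rho T f -> lb x0 rho T1 f.
Proof. intros HT H t Ht. destruct (H t ltac:(lra)) as [d [K [Hd G]]]. exists d, K. pos. Qed.

(** * Estimates of P by Q and of Q by P *)

Section Final.
Context {m : nat} {p0 p1 q0 q1 : nat -> R -> R} {ep : nat -> R} {T a b : R}
  {P Pt Px Pxx Q Qt Qx Qxx pi Api pix kap Bk kapx : nat -> R -> R -> R}
  {P' Pt' Px' Pxx' Q' Qt' Qx' Qxx' pi' Api' pix' kap' Bk' kapx' : nat -> R -> R -> R}.
Context (W : wsol m p0 p1 q0 q1 ep T a b P Pt Px Pxx Q Qt Qx Qxx pi Api pix kap Bk kapx).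
Context (W' : wsol m p0 p1 q0 q1 ep T a b P' Pt' Px' Pxx' Q' Qt' Qx' Qxx' pi' Api' pix' kap' Bk' kapx').
Context {C0 ga : R} (HC0 : 0 <= C0) (Hbase : base_bd m p0 p1 q0 q1 ep a b C0) (HT : 0 < T <= 1).
Context (Hga : 0 < ga <= 1 / 2) (Hgae : forall j, (j <= m)%nat -> ga <= ep j).
Context (Hkd : forall j x, (j <= m)%nat -> a < x < b -> is_derive (tot m p0 j) x (tot m (fun i => Derive (p0 i)) j x)).
Context (Hkc : forall j x, (j <= m)%nat -> a < x < b -> continuous (Derive (tot m p0 j)) x).
Context (x0 rho : R) (Hra : a < x0 - rho) (Hrb : x0 + rho < b).
Notation Omg := (Om x0 rho).
Notation "'onD' t x , Z" := (forall t x : R, 0 < t < T -> Omg t x -> Z) (at level 200, t name, x name).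
Notation K := (cK m C0).
Notation q := (qf m p0).
Notation tP j := (totf m P j).
Notation tP' j := (totf m P' j).

(** The two solutions share [q_I0] and [q_I1], so [Q - Q'] is exactly [t^(2k) vv]. *)
Definition vv (j : nat) (t x : R) : R := kap j t x - kap' j t x.
Definition dps (j : nat) (t x : R) : R := tP j t x - tP' j t x.

Let cls := fields_c2 x0 rho T W HC0 Hbase HT Hra Hrb.
Let cls' := fields_c2 x0 rho T W' HC0 Hbase HT Hra Hrb.
Let lbs := fields_lb x0 rho T W HC0 Hbase HT Hra Hrb.
Let lbs' := fields_lb x0 rho T W' HC0 Hbase HT Hra Hrb.

Lemma Om_in t x : 0 < t -> Omg t x -> a < x < b.
Proof. intros Ht H. apply Rabs_def2 in H. lra. Qed.

Lemma qpos j t x : 0 < q j t x.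
Proof. apply Rpower_pos. Qed.

Section J.
Context (j : nat) (Hj : (j <= m)%nat).

Lemma dQ_v t x : 0 < t < T -> a < x < b -> Q j t x - Q' j t x = q j t x * vv j t x.
Proof. intros Ht Hx. rewrite (ws_Q W j t x Hj Ht Hx), (ws_Q W' j t x Hj Ht Hx). unfold qf, vv. ring. Qed.

Lemma YdQ_v t x : 0 < t < T -> a < x < b -> Yf m P j t x * (Q j t x - Q' j t x) = yf m p0 P j t x * vv j t x.
Proof. intros. rewrite dQ_v by lra. rewrite <- yf_q. unfold Yf. ring. Qed.

Lemma v_le t x : 0 < t < T -> a < x < b -> Rabs (vv j t x) <= 2.
Proof.
  intros Ht Hx. destruct (ws_bd W j t x Hj Ht Hx) as [_ [_ [_ [H1 _]]]]. destruct (ws_bd W' j t x Hj Ht Hx) as [_ [_ [_ [H2 _]]]].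
  unfold vv. apply Rabs_le_between in H1, H2. apply Rabs_le. lra.
Qed.

Let Kge := cK_ge (m := m) HC0.
Let Yb t x Ht Hx := yf_bd W HC0 Hbase HT Hga Hgae j t x Hj Ht Hx.

(** After multiplication by [t^(2k)] both exponentials have bounded exponents, which differ by
    [-2 dps] since the logarithmic term is common. *)
Lemma dY_le t x : 0 < t < T -> a < x < b -> Rabs (Yf m P j t x - Yf m P' j t x) * q j t x <= 2 * K * Rabs (dps j t x).
Proof.
  intros. assert (Hq := qpos j t x).
  rewrite <- (Rabs_pos_eq (q j t x)), <- Rabs_mult by lra.
  replace ((Yf m P j t x - Yf m P' j t x) * q j t x) with (yf m p0 P j t x - yf m p0 P' j t x) by (rewrite <- !yf_q; unfold Yf; ring).
  assert (H1 : Rabs (yexp m p0 P j t x) <= 2 * (INR m + 2) * (C0 + 1)) by (eapply yexp_bd; eauto).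
  assert (H2 : Rabs (yexp m p0 P' j t x) <= 2 * (INR m + 2) * (C0 + 1)) by (eapply yexp_bd; eauto).
  eapply Rle_trans; [apply (exp_lip _ _ _ H1 H2)|].
  replace (yexp m p0 P j t x - yexp m p0 P' j t x) with (-2 * dps j t x) by (unfold yexp, dps; ring).
  rewrite Rabs_mult, Rabs_left1 by lra. fold (cK1 m C0). assert (G3 := Rabs_pos (dps j t x)). nra.
Qed.

Lemma field_bds t x : 0 < t < T -> a < x < b ->
  Rabs (t * Qt j t x) <= K * q j t x /\ Rabs (t * Qt' j t x) <= K * q j t x /\
  Rabs (t * Qx j t x) <= K * (q j t x + t) /\ Rabs (t * Qx' j t x) <= K * (q j t x + t) /\
  Rabs (t * (totf m Pt j t x - totf m Pt' j t x)) <= 2 * K /\ Rabs (t * (totf m Px j t x - totf m Px' j t x)) <= 2 * K.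
Proof.
  intros.
  assert (D1 : Rabs (t * totf m Pt j t x) <= K) by (eapply Dpsi_bd; eauto).
  assert (D2 : Rabs (t * totf m Pt' j t x) <= K) by (eapply Dpsi_bd; eauto).
  assert (D3 : Rabs (t * totf m Px j t x) <= K) by (eapply xpsi_bd; eauto).
  assert (D4 : Rabs (t * totf m Px' j t x) <= K) by (eapply xpsi_bd; eauto).
  splits.
  - eapply DQ_bd; eauto.
  - eapply DQ_bd; eauto.
  - eapply xQ_bd; eauto.
  - eapply xQ_bd; eauto.
  - apply Rabs_le_between in D1, D2. apply Rabs_le. lra.
  - apply Rabs_le_between in D3, D4. apply Rabs_le. lra.
Qed.

Lemma cross_le t x : 0 < t < T -> a < x < b ->
  Rabs (t * (totf m Pt j t x - totf m Pt' j t x) * (t * Qt' j t x) - t * (totf m Px j t x - totf m Px' j t x) * (t * Qx' j t x)) <= 4 * K * K * (q j t x + t).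
Proof.
  intros Ht Hx. destruct (field_bds t x Ht Hx) as [_ [B2 [_ [B4 [B5 B6]]]]].
  assert (H1 := Rabs_mult_le _ _ _ _ B5 B2). assert (H2 := Rabs_mult_le _ _ _ _ B6 B4).
  apply Rabs_le_between in H1, H2. apply Rabs_le.
  assert (2 * K * (K * q j t x) <= 2 * K * (K * (q j t x + t))) by pos. lra.
Qed.

Lemma dQ_c2 : c2 x0 rho T (fun t x => Q j t x - Q' j t x).
Proof. apply c2_minus; [apply cls | apply cls']; auto. Qed.

Lemma dps_c2 : c2 x0 rho T (dps j).
Proof. apply c2_minus; apply c2_tot; auto; [apply cls | apply cls']. Qed.

Lemma dps_lb : lb x0 rho T (dps j).
Proof. apply lb_minus; apply lb_tot; auto; [apply lbs | apply lbs']. Qed.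

Lemma dQ_lb : lb x0 rho T (fun t x => Q j t x - Q' j t x).
Proof.
  eapply lb_bd. intros t x Ht Hx. assert (Hxa := Om_in t x (proj1 Ht) Hx). rewrite dQ_v by lra.
  apply Rabs_mult_le; [|apply v_le; auto].
  rewrite Rabs_pos_eq by (apply Rlt_le, qpos). apply Rpower_le1; [lra|]. destruct (Hbase j x Hj Hxa) as [_ [_ H]]. lra.
Qed.

Lemma tid_c2 : c2 x0 rho T (fun t _ => t).
Proof. apply c2_t. intros; apply continuous_id. Qed.
Lemma tid_lb : lb x0 rho T (fun t _ => t).
Proof. apply lb_bd with 1. intros. rewrite Rabs_pos_eq; lra. Qed.
Lemma tot_c2 f : (forall i, (i <= m)%nat -> c2 x0 rho T (f i)) -> c2 x0 rho T (totf m f j).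
Proof. apply c2_tot; auto. Qed.
Let Yc := Y_c2 x0 rho T W HC0 Hbase HT Hra Hrb j Hj.
Let Yl := Y_lb x0 rho T W HC0 Hbase HT Hra Hrb j Hj.
Let Yc' := Y_c2 x0 rho T W' HC0 Hbase HT Hra Hrb j Hj.

Ltac c2tac := repeat first
  [ apply tid_c2 | apply c2_cst | exact Yc | exact Yc' | exact dQ_c2 | exact dps_c2
  | apply c2_minus | apply c2_plus | apply c2_mult
  | apply c2_sum; intros i Hi; first [apply cls; exact Hi | apply cls'; exact Hi] | apply cls; exact Hj | apply cls'; exact Hj ].

Lemma AP_c2 : c2 x0 rho T (AP m P Pt Q Qt Pt' Q' Qt' j).
Proof. c2tac. Qed.
Lemma BP_c2 : c2 x0 rho T (BP m P Px Q Qx Px' Q' Qx' j).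
Proof. c2tac. Qed.
Lemma fPd_c2 : c2 x0 rho T (fPd m P Pt Px Q P' Pt' Px' Q' Qt' Qx' j).
Proof. c2tac. Qed.
Lemma AQ_c2 : c2 x0 rho T (AQ m P Qt P' Qt' j).
Proof. c2tac. Qed.
Lemma BQ_c2 : c2 x0 rho T (BQ m P Qx P' Qx' j).
Proof. c2tac. Qed.
Lemma fQd_c2 : c2 x0 rho T (fQd m P Pt Px P' Pt' Px' Qt' Qx' j).
Proof. c2tac. Qed.

Ltac lbtac := repeat first
  [ apply tid_lb | apply lb_cst | exact Yl | exact dQ_lb | exact dps_lb
  | apply lb_minus | apply lb_plus | apply lb_mult
  | apply lb_sum; intros i Hi; first [apply lbs; exact Hi | apply lbs'; exact Hi] | apply lbs; exact Hj | apply lbs'; exact Hj ].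

Lemma BPx_lb : lb x0 rho T (BPx m P Px Pxx Q Qx Qxx Pxx' Q' Qx' Qxx' j).
Proof. lbtac. Qed.
Lemma BQx_lb : lb x0 rho T (BQx m P Px Qx Qxx P' Px' Qx' Qxx' j).
Proof. lbtac. Qed.

Lemma xx_xc : xc x0 rho T (Pxx j) /\ xc x0 rho T (Pxx' j) /\ xc x0 rho T (Qxx j) /\ xc x0 rho T (Qxx' j).
Proof.
  splits; intros t x Ht Hx; assert (Hxa := Om_in t x (proj1 Ht)).
  - apply (ws_Pxxc W); auto. - apply (ws_Pxxc W'); auto.
  - apply (ws_Qxxc W); auto. - apply (ws_Qxxc W'); auto.
Qed.

Ltac xctac := lazymatch goal with
  | |- xc _ _ _ (fun t x => @?f t x + @?g t x) => apply (xc_plus x0 rho T f g); xctac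
  | |- xc _ _ _ (fun t x => @?f t x - @?g t x) => apply (xc_minus x0 rho T f g); xctac
  | |- xc _ _ _ (fun t x => @?f t x * @?g t x) => apply (xc_mult x0 rho T f g); xctac
  | |- xc _ _ _ (fun t x => Yf _ _ _ _ _) => exact (xc_c2 _ _ _ _ Yc)
  | |- xc _ _ _ (fun t x => totf _ ?g _ _ _) => apply (xc_c2 _ _ _ (totf m g j)), tot_c2; intros i Hi; first [apply cls; exact Hi | apply cls'; exact Hi]
  | |- xc _ _ _ (fun t x => t) => apply xc_c2, tid_c2
  | |- _ => first [apply xc_c2, c2_cst | apply xx_xc | apply xc_c2, cls; exact Hj | apply xc_c2, cls'; exact Hj]
  end.

Lemma BPx_xc : xc x0 rho T (BPx m P Px Pxx Q Qx Qxx Pxx' Q' Qx' Qxx' j).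
Proof. unfold BPx. xctac. Qed.
Lemma BQx_xc : xc x0 rho T (BQx m P Px Qx Qxx P' Px' Qx' Qxx' j).
Proof. unfold BQx. xctac. Qed.

Lemma dP_form t x : 0 < t < T -> a < x < b ->
  P j t x - P' j t x = Rpower t (ep j) * (pi j t x - pi' j t x) /\
  t * (Pt j t x - Pt' j t x) = Rpower t (ep j) * (Api j t x - Api' j t x) /\
  t * (Px j t x - Px' j t x) = Rpower t (ep j) * (t * pix j t x - t * pix' j t x).
Proof.
  intros Ht Hx. splits.
  - rewrite (ws_P W j t x Hj Ht Hx), (ws_P W' j t x Hj Ht Hx). ring.
  - rewrite Rmult_minus_distr_l, (ws_DP W j t x Hj Ht Hx), (ws_DP W' j t x Hj Ht Hx). ring.
  - rewrite (ws_xP W j t x Hj Ht Hx), (ws_xP W' j t x Hj Ht Hx). ring.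
Qed.

Lemma dP_small t x e : 0 < t < T -> a < x < b ->
  Rabs (pi j t x) <= e /\ Rabs (Api j t x) <= e /\ Rabs (t * pix j t x) <= e ->
  Rabs (pi' j t x) <= e /\ Rabs (Api' j t x) <= e /\ Rabs (t * pix' j t x) <= e ->
  Rabs (P j t x - P' j t x) <= Rpower t ga * (2 * e) /\ Rabs (t * (Pt j t x - Pt' j t x)) <= Rpower t ga * (2 * e) /\
  Rabs (t * (Px j t x - Px' j t x)) <= Rpower t ga * (2 * e).
Proof.
  intros Ht Hx [A1 [A2 A3]] [B1 [B2 B3]]. destruct (dP_form t x Ht Hx) as [-> [-> ->]].
  assert (G : Rabs (Rpower t (ep j)) <= Rpower t ga).
  { rewrite Rabs_pos_eq by pos. apply Rpower_anti; pos. }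
  apply Rabs_le_between in A1, A2, A3, B1, B2, B3.
  splits; apply Rabs_mult_le; auto; apply Rabs_le; lra.
Qed.

Lemma ga_pow_le1 t : 0 < t < T -> 0 < Rpower t ga <= 1.
Proof. split; [pos | apply Rpower_le1; lra]. Qed.

(** The wave estimate with [y = 1] and [k = 0]. The first derivatives of [Q] are of size [q + t],
    which is the weight on [vv]. The difference of the exponentials is of size [dps / q] and meets
    two such factors; [(q + t)^2 / q] is the weight on [dps]. *)
Lemma P_step T1 lam E : 0 < T1 <= T -> 0 < lam -> 0 <= E ->
  (forall t x, 0 < t < T1 -> Omg t x -> Rabs (vv j t x) * (q j t x + t) <= E * Rpower t lam) ->
  (forall t x, 0 < t < T1 -> Omg t x -> Rabs (dps j t x) * (q j t x + 2 * t + t * t / q j t x) <= E * Rpower t lam) ->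
  forall t x, 0 < t < T1 -> Omg t x -> Rabs (P j t x - P' j t x) <= wave_cst 1 lam * (6 * (K * K * K) * E) * Rpower t lam.
Proof.
  intros HT1 Hlam HE Hv Hd. destruct Kge as [_ [_ [_ [_ HK]]]].
  assert (HK2 : 1 <= K * K) by nra. assert (HK3 : K * K <= K * K * K) by nra.
  assert (Hc : forall f, c2 x0 rho T f -> forall t x, 0 < t < T1 -> Omg t x -> continuity_2d_pt f t x) by pos.
  assert (HTT : forall t, 0 < t < T1 -> 0 < t < T) by pos.
  assert (Hab : forall t x, 0 < t < T1 -> Omg t x -> a < x < b) by (intros t x Ht Hx; apply (Om_in t); auto; lra).
  assert (Hyv : forall t x, 0 < t < T1 -> Omg t x -> Rabs (Yf m P j t x * (Q j t x - Q' j t x)) <= K * Rabs (vv j t x)).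
  { intros t x Ht Hx. rewrite YdQ_v by eauto. destruct (Yb t x (HTT t Ht) (Hab t x Ht Hx)) as [Y1 [Y2 _]].
    rewrite Rabs_mult, Rabs_pos_eq by lra. pos. }
  assert (Hsrc : forall t x F, 0 < t < T1 -> Omg t x -> Rabs F <= 2 * K * (q j t x + t) ->
    Rabs (1 / 2 * (Yf m P j t x * (Q j t x - Q' j t x)) * F) <= 6 * (K * K * K) * E * Rpower t lam).
  { intros t x F Ht Hx HF. assert (H2 := Hv t x Ht Hx).
    eapply Rle_trans.
    - apply Rabs_mult_le; eauto. apply Rabs_mult_le; auto. rewrite Rabs_pos_eq; [apply Rle_refl | lra].
    - replace (1 / 2 * (K * Rabs (vv j t x)) * (2 * K * (q j t x + t))) with (K * K * (Rabs (vv j t x) * (q j t x + t))) by lra.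
      apply Rle_trans with (K * K * (E * Rpower t lam)). apply Rmult_le_compat_l; lra.
      assert (0 <= E * Rpower t lam) by pos. nra. }
  apply wave_bound with
    (vt := fun t x => Pt j t x - Pt' j t x) (vx := fun t x => Px j t x - Px' j t x) (v := fun t x => P j t x - P' j t x)
    (y := fun _ _ => 1) (yt := fun _ _ => 0) (yx := fun _ _ => 0)
    (A := AP m P Pt Q Qt Pt' Q' Qt' j) (B := BP m P Px Q Qx Px' Q' Qx' j) (Bx := BPx m P Px Pxx Q Qx Qxx Pxx' Q' Qx' Qxx' j)
    (f := fPd m P Pt Px Q P' Pt' Px' Q' Qt' Qx' j)
    (a := fun t x => 1 / 2 * (Yf m P j t x * (Q j t x - Q' j t x)) * (t * (Qt j t x + Qt' j t x)))
    (b := fun t x => 1 / 2 * (Yf m P j t x * (Q j t x - Q' j t x)) * (t * (Qx j t x + Qx' j t x)))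
    (k := fun _ => 0) (c := 0) (g0 := 1) (M := 2); try lra.
  - pos.
  - intros t x Ht Hx. apply is_derive_Rminus; [apply (ws_Pt W) | apply (ws_Pt W')]; eauto.
  - intros t x Ht Hx. apply is_derive_Rminus; [apply (ws_Px W) | apply (ws_Px W')]; eauto.
  - apply Hc. apply c2_minus; [apply cls | apply cls']; auto.
  - intros. apply is_derive_cst.
  - intros. apply is_derive_cst.
  - intros. apply continuity_2d_pt_const.
  - pos.
  - intros t x Ht Hx. rewrite !Rmult_0_r. unfold Rdiv. rewrite Rmult_0_l, Rabs_R0. lra.
  - pos.
  - intros t x Ht Hx. unfold AP. ring.
  - intros t x Ht Hx. unfold BP. ring.
  - intros t x Ht Hx. eapply AP_dt; eauto.
  - intros t x Ht Hx. eapply BP_dx; eauto.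
  - intros t x Ht Hx. apply BPx_xc; auto.
  - apply lb_sub with T; auto. apply BPx_lb.
  - intros t x Ht Hx. apply cont2_snd. apply (Hc _ AP_c2); auto.
  - apply Hc, BP_c2.
  - apply Hc, fPd_c2.
  - intros t x Ht Hx. apply Hsrc; auto. destruct (field_bds t x) as [B1 [B2 _]]; eauto.
    apply Rabs_le_between in B1, B2. apply Rabs_le. nra.
  - intros t x Ht Hx. rewrite !Rmult_0_l, Rplus_0_r. apply Hsrc; auto. destruct (field_bds t x) as [_ [_ [B1 [B2 _]]]]; eauto.
    apply Rabs_le_between in B1, B2. apply Rabs_le. lra.
  - intros t x Ht Hx. assert (Ht' := HTT t Ht). assert (Hxa := Hab t x Ht Hx).
    destruct (field_bds t x Ht' Hxa) as [_ [B2 [_ [B4 _]]]]. assert (Hcr := cross_le t x).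
    assert (HdY := dY_le t x). assert (Hq := qpos j t x). assert (H3 := Hd t x).
    set (w := q j t x + t) in *. set (z := Rabs (dps j t x)) in *.
    assert (N1 : Rabs (t * Qt' j t x * (t * Qt' j t x) - t * Qx' j t x * (t * Qx' j t x)) <= 2 * (K * w * (K * w))).
    { assert (B2' : Rabs (t * Qt' j t x) <= K * w) by (unfold w; nra).
      assert (M1 := Rabs_mult_le _ _ _ _ B2' B2'). assert (M2 := Rabs_mult_le _ _ _ _ B4 B4).
      apply Rabs_le_between in M1, M2. apply Rabs_le. lra. }
    assert (Hw2 : w * w = q j t x * (q j t x + 2 * t + t * t / q j t x)) by (unfold w; field; lra).
    assert (S1 : Rabs (- 1 / 2 * (Yf m P j t x - Yf m P' j t x) * (t * Qt' j t x * (t * Qt' j t x) - t * Qx' j t x * (t * Qx' j t x))) <= 2 * (K * K * K) * (E * Rpower t lam)).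
    { eapply Rle_trans.
      - apply Rabs_mult_le; eauto. apply Rabs_mult_le; [|apply Rle_refl]. replace (- 1 / 2) with (- (1 / 2)) by lra. rewrite Rabs_Ropp, Rabs_pos_eq; [apply Rle_refl | lra].
      - set (dY := Rabs (Yf m P j t x - Yf m P' j t x)) in *.
        replace (1 / 2 * dY * (2 * (K * w * (K * w)))) with (K * K * (dY * (w * w))) by lra. rewrite Hw2.
        set (u := q j t x + 2 * t + t * t / q j t x) in *.
        assert (Hu : 0 <= u). { nra. }
        replace (dY * (q j t x * u)) with (dY * q j t x * u) by lra.
        eapply Rle_trans.
        + pos.
        + replace (K * K * (2 * K * z * u)) with (2 * (K * K * K) * (z * u)) by lra. pos. }
    assert (S2 : Rabs (Yf m P j t x * (Q j t x - Q' j t x) * (t * (totf m Pt j t x - totf m Pt' j t x) * (t * Qt' j t x) - t * (totf m Px j t x - totf m Px' j t x) * (t * Qx' j t x))) <= 4 * (K * K * K) * (E * Rpower t lam)).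
    { eapply Rle_trans; [pos |].
      replace (K * Rabs (vv j t x) * (4 * K * K * w)) with (4 * (K * K * K) * (Rabs (vv j t x) * w)) by lra. pos. }
    eapply Rle_trans; [apply Rabs_triang|]. rewrite Rabs_Ropp.
    lra.
  - intros t x Ht Hx. assert (Ht' := HTT t Ht). assert (Hxa := Hab t x Ht Hx).
    destruct (ws_bd W j t x Hj Ht' Hxa) as [D1 [D2 [D3 _]]]. destruct (ws_bd W' j t x Hj Ht' Hxa) as [F1 [F2 [F3 _]]].
    destruct (dP_small t x 1) as [G1 [_ G2]]; auto. assert (G3 := ga_pow_le1 t). lra.
  - intros e He. destruct (ws_sm W (e / 2)) as [d1 [Hd1 H1]]; [lra|]. destruct (ws_sm W' (e / 2)) as [d2 [Hd2 H2]]; [lra|].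
    exists (Rmin d1 d2). split; [pos |]. intros t x Ht Htd Hx. assert (Ht' := HTT t Ht). assert (Hxa := Hab t x Ht Hx).
    mins.
    destruct (H1 j t x Hj Ht' Hxa ltac:(lra)) as [D1 [D2 [D3 _]]]. destruct (H2 j t x Hj Ht' Hxa ltac:(lra)) as [F1 [F2 [F3 _]]].
    destruct (dP_small t x (e / 2)) as [G1 [G4 G2]]; auto. assert (G3 := ga_pow_le1 t). split; nra.
Qed.

Lemma qinv_c2 : c2 x0 rho T (fun t x => / q j t x).
Proof.
  apply c2_ext with (fun t x => exp (-2 * tot m p0 j x * ln t)).
  { intros t x Ht Hx. unfold qf, Rpower. rewrite <- exp_Ropp. f_equal. ring. }
  apply c2_exp. apply c2_mult.
  - apply c2_x. intros t x Ht Hx. apply Rcont_mult; [apply Rcont_const|].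
    eapply is_derive_cont. apply Hkd; auto. apply (Om_in t); auto; lra.
  - apply c2_t. intros. eapply is_derive_cont. apply is_derive_Reals, derivable_pt_lim_ln. lra.
Qed.

Lemma ln_c2 : c2 x0 rho T (fun t _ => ln t).
Proof. apply c2_t. intros. eapply is_derive_cont. apply is_derive_Reals, derivable_pt_lim_ln. lra. Qed.

Lemma Dk_c2 : c2 x0 rho T (fun _ x => Derive (tot m p0 j) x).
Proof. apply c2_x. intros t x Ht Hx. apply Hkc; auto. apply (Om_in t); auto; lra. Qed.

Lemma k_c2 : c2 x0 rho T (fun _ x => tot m p0 j x).
Proof. apply c2_x. intros t x Ht Hx. eapply is_derive_cont. apply Hkd; auto. apply (Om_in t); auto; lra. Qed.

Lemma dQt_v t x : 0 < t < T -> a < x < b -> t * (Qt j t x - Qt' j t x) = q j t x * (2 * tot m p0 j x * vv j t x + (Bk j t x - Bk' j t x)).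
Proof. intros Ht Hx. rewrite Rmult_minus_distr_l, (ws_DQ W j t x Hj Ht Hx), (ws_DQ W' j t x Hj Ht Hx). unfold qf, vv. ring. Qed.

Lemma dQx_v t x : 0 < t < T -> a < x < b -> Qx j t x - Qx' j t x = q j t x * (2 * Derive (tot m p0 j) x * ln t * vv j t x + (kapx j t x - kapx' j t x)).
Proof. intros Ht Hx. rewrite (ws_xQ W j t x Hj Ht Hx), (ws_xQ W' j t x Hj Ht Hx). unfold qf, vv. ring. Qed.

(** Joint continuity is known for [Q] and [Q_x], not directly for [kapx]; dividing the difference of
    [Q_x] by [t^(2k)] and removing the logarithmic term recovers it. *)
Lemma vx_c2 : c2 x0 rho T (fun t x => kapx j t x - kapx' j t x).
Proof.
  apply c2_ext with (fun t x => (Qx j t x - Qx' j t x) * / q j t x - 2 * Derive (tot m p0 j) x * ln t * ((Q j t x - Q' j t x) * / q j t x)).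
  { intros t x Ht Hx. assert (Hxa := Om_in t). assert (Hq := qpos j t x). rewrite dQx_v, dQ_v by pos. field. lra. }
  apply c2_minus; apply c2_mult.
  - apply c2_minus; [apply cls | apply cls']; auto.
  - apply qinv_c2.
  - apply c2_mult; [|apply ln_c2]. apply c2_mult; [apply c2_cst | apply Dk_c2].
  - apply c2_mult; [apply dQ_c2 | apply qinv_c2].
Qed.

Lemma yf_c2 : c2 x0 rho T (yf m p0 P j).
Proof.
  apply c2_exp. apply c2_plus.
  - apply c2_mult; [apply c2_cst|]. apply tot_c2. apply cls.
  - apply c2_mult; [|apply ln_c2]. apply c2_mult; [apply c2_cst | apply k_c2].
Qed.

Definition yft (t x : R) : R := (-2 * totf m Pt j t x + 2 * tot m p0 j x / t) * yf m p0 P j t x.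
Definition yfx (t x : R) : R := (-2 * totf m Px j t x + 2 * Derive (tot m p0 j) x * ln t) * yf m p0 P j t x.

Lemma yf_dt t x : 0 < t < T -> a < x < b -> is_derive (fun s => yf m p0 P j s x) t (yft t x).
Proof.
  intros. apply is_derive_Rexp. apply is_derive_Rplus.
  - apply is_derive_Rscal. eapply tot_dt; eauto.
  - apply is_derive_lncst. lra.
Qed.

Lemma yf_dx t x : 0 < t < T -> a < x < b -> is_derive (fun y => yf m p0 P j t y) x (yfx t x).
Proof.
  intros Ht Hx. apply is_derive_Rexp. apply is_derive_Rplus.
  - apply is_derive_Rscal. eapply tot_dx'; eauto.
  - apply is_derive_ext with (fun y => 2 * ln t * tot m p0 j y). intros y; apply (Rplus_eq_reg_l 0); ring.
    replace (2 * Derive (tot m p0 j) x * ln t) with (2 * ln t * Derive (tot m p0 j) x) by lra.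
    apply is_derive_Rscal. rewrite (is_derive_unique _ _ _ (Hkd j x Hj Hx)). auto.
Qed.

(** The wave estimate with [y = yf] and the true [k]. In the sources [dps / q] multiplies
    derivatives of [Q'] of size [q + t], whence the weight [1 + t / q]; the constant 16 comes from
    [fQd], as [4 K] times [4 K^2]. *)
Lemma Q_step T1 lam E : 0 < T1 <= T -> 3 * K / ga * Rpower T ga <= 1 / 2 -> 0 < lam -> 0 <= E ->
  (forall t x, 0 < t < T1 -> Omg t x -> Rabs (dps j t x) * (1 + t / q j t x) <= E * Rpower t lam) ->
  forall t x, 0 < t < T1 -> Omg t x -> Rabs (vv j t x) <= wave_cst K lam * (16 * (K * K * K) * E) * Rpower t lam.
Proof.
  intros HT1 HKT Hlam HE Hd.
  assert (HK2 : 1 <= K * K) by nra. assert (HK3 : K * K <= K * K * K) by nra.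
  assert (Hc : forall f, c2 x0 rho T f -> forall t x, 0 < t < T1 -> Omg t x -> continuity_2d_pt f t x) by pos.
  assert (HTT : forall t, 0 < t < T1 -> 0 < t < T) by pos.
  assert (Hab : forall t x, 0 < t < T1 -> Omg t x -> a < x < b) by (intros t x Ht Hx; apply (Om_in t); auto; lra).
  assert (HEl : forall t, 0 <= E * Rpower t lam) by pos.
  assert (Hbnd : forall t x F, 0 < t < T1 -> Omg t x -> Rabs F <= K * (q j t x + t) ->
    Rabs (-2 * (dps j t x / q j t x) * F) <= 16 * (K * K * K) * E * Rpower t lam).
  { intros t x F Ht Hx HF. assert (Hq := qpos j t x).
    replace (-2 * (dps j t x / q j t x) * F) with (-2 * dps j t x * (F / q j t x)) by lra.
    assert (HF2 : Rabs (F / q j t x) <= K * (1 + t / q j t x)).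
    { unfold Rdiv at 1. rewrite Rabs_mult, Rabs_inv, (Rabs_pos_eq (q j t x)) by lra.
      apply Rle_trans with (K * (q j t x + t) * / q j t x). pos.
      right. field. lra. }
    eapply Rle_trans; [apply (Rabs_mult_le _ _ (2 * Rabs (dps j t x))); eauto|].
    { rewrite Rabs_mult, Rabs_left1; lra. }
    replace (2 * Rabs (dps j t x) * (K * (1 + t / q j t x))) with (2 * K * (Rabs (dps j t x) * (1 + t / q j t x))) by lra.
    assert (H2 := HEl t). eapply Rle_trans; [pos |].
    rewrite (Rmult_assoc _ E). apply Rmult_le_compat_r; nra. }
  apply wave_bound with
    (v := vv j) (vt := fun t x => (Bk j t x - Bk' j t x) / t) (vx := fun t x => kapx j t x - kapx' j t x)
    (y := yf m p0 P j) (yt := yft) (yx := yfx)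
    (A := AQ m P Qt P' Qt' j) (B := BQ m P Qx P' Qx' j) (Bx := BQx m P Px Qx Qxx P' Px' Qx' Qxx' j)
    (f := fQd m P Pt Px P' Pt' Px' Qt' Qx' j)
    (a := fun t x => -2 * (dps j t x / q j t x) * (t * Qt' j t x))
    (b := fun t x => 2 * Derive (tot m p0 j) x * (t * ln t) * vv j t x + -2 * (dps j t x / q j t x) * (t * Qx' j t x))
    (k := tot m p0 j) (c := K) (g0 := ga) (M := 2); try lra.
  - pos.
  - apply Rle_trans with (3 * K / ga * Rpower T ga); auto. apply Rmult_le_compat_l.
    pos. apply Rpower_le_base; lra.
  - intros t x Ht Hx. replace ((Bk j t x - Bk' j t x) / t) with (Bk j t x / t - Bk' j t x / t) by lra.
    apply is_derive_Rminus; [apply (ws_kt W) | apply (ws_kt W')]; eauto.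
  - intros t x Ht Hx. apply is_derive_Rminus; [apply (ws_kx W) | apply (ws_kx W')]; eauto.
  - apply Hc, vx_c2.
  - intros t x Ht Hx. apply yf_dt; eauto.
  - intros t x Ht Hx. apply yf_dx; eauto.
  - apply Hc. apply c2_mult; [|apply yf_c2]. apply c2_plus.
    + apply c2_mult; [apply c2_cst|]. apply tot_c2. apply cls.
    + apply c2_mult; [|apply ln_c2]. apply c2_mult; [apply c2_cst | apply Dk_c2].
  - eauto.
  - intros t x Ht Hx. assert (Ht' := HTT t Ht). assert (Hxa := Hab t x Ht Hx). destruct (Yb t x Ht' Hxa) as [Y1 _]. split.
    + unfold yft. replace (t * ((-2 * totf m Pt j t x + 2 * tot m p0 j x / t) * yf m p0 P j t x) / yf m p0 P j t x) with (-2 * (t * totf m Pt j t x) + 2 * tot m p0 j x) by (field; lra).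
      eapply y_dt_bd; eauto.
    + unfold yfx. replace (t * ((-2 * totf m Px j t x + 2 * Derive (tot m p0 j) x * ln t) * yf m p0 P j t x) / yf m p0 P j t x) with (-2 * (t * totf m Px j t x) + 2 * Derive (tot m p0 j) x * (t * ln t)) by (field; lra).
      eapply y_dx_bd; eauto.
  - intros t x Ht Hx. destruct (Hbase j x Hj (Hab t x Ht Hx)) as [_ [_ H]]. lra.
  - intros t x Ht Hx. unfold AQ. rewrite dQt_v by eauto. rewrite <- yf_q. fold (Yf m P j t x). fold (dps j t x).
    assert (Hq := qpos j t x). field. lra.
  - intros t x Ht Hx. unfold BQ. rewrite dQx_v by eauto. rewrite <- yf_q. fold (Yf m P j t x). fold (dps j t x).
    assert (Hq := qpos j t x). field. lra.
  - intros t x Ht Hx. eapply AQ_dt; eauto.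
  - intros t x Ht Hx. eapply BQ_dx; eauto.
  - intros t x Ht Hx. apply BQx_xc; auto.
  - apply lb_sub with T; auto. apply BQx_lb.
  - intros t x Ht Hx. apply cont2_snd. apply (Hc _ AQ_c2); auto.
  - apply Hc, BQ_c2.
  - apply Hc, fQd_c2.
  - intros t x Ht Hx. apply Hbnd; auto. destruct (field_bds t x) as [_ [B2 _]]; eauto. nra.
  - intros t x Ht Hx. rewrite Rplus_comm. apply Rabs_plus_le.
    + apply Hbnd; auto. apply field_bds; eauto.
    + rewrite Rabs_mult. apply Rmult_le_compat_r; [pos |].
      destruct (t_ln_le t ltac:(lra)) as [_ Hl]. destruct (Hbase j x Hj (Hab t x Ht Hx)) as [_ [[_ [_ [_ [_ B8]]]] _]].
      (* The term proportional to [vv] comes from the [x]-derivative of [t^(2k)]. Its factor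
         [t ln t] is at most [2 t^(1/2)], and [ga <= 1/2] turns this into the admissible power
         [t^ga]. *)
      assert (G : Rpower t (1 / 2) <= Rpower t ga) by (apply Rpower_anti; lra).
      eapply Rle_trans; [apply (Rabs_mult_le _ _ (2 * C0) (2 * Rpower t ga)); [|lra]; apply Rabs_mult_le; auto; rewrite Rabs_pos_eq; lra|].
      replace (2 * C0 * (2 * Rpower t ga)) with (4 * C0 * Rpower t ga) by lra. apply Rmult_le_compat_r; [pos | nra].
  - intros t x Ht Hx. assert (Ht' := HTT t Ht). assert (Hxa := Hab t x Ht Hx).
    assert (Hcr := cross_le t x). assert (Hq := qpos j t x). assert (H1 := Hd t x Ht Hx). destruct (Yb t x Ht' Hxa) as [Y1 [Y2 _]].
    unfold fQd. fold (dps j t x).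
    set (X := t * (totf m Pt j t x - totf m Pt' j t x) * (t * Qt' j t x) - t * (totf m Px j t x - totf m Px' j t x) * (t * Qx' j t x)) in *.
    assert (HY : Yf m P j t x = yf m p0 P j t x / q j t x) by (rewrite <- yf_q; unfold Yf; field; lra). rewrite HY.
    replace (4 * (yf m p0 P j t x / q j t x * dps j t x) * X) with (4 * yf m p0 P j t x * dps j t x * (X / q j t x)) by lra.
    assert (HF2 : Rabs (X / q j t x) <= 4 * K * K * (1 + t / q j t x)).
    { unfold Rdiv at 1. rewrite Rabs_mult, Rabs_inv, (Rabs_pos_eq (q j t x)) by lra.
      eapply Rle_trans. pos.
      right. field. lra. }
    eapply Rle_trans; [apply Rabs_mult_le; [apply Rabs_mult_le; [|apply Rle_refl] | eauto]|].
    { rewrite Rabs_pos_eq by lra. apply Rmult_le_compat_l; [lra | eauto]. }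
    nra.
  - intros t x Ht Hx. assert (Ht' := HTT t Ht). assert (Hxa := Hab t x Ht Hx).
    destruct (ws_bd W j t x Hj Ht' Hxa) as [_ [_ [_ [D1 [D2 D3]]]]]. destruct (ws_bd W' j t x Hj Ht' Hxa) as [_ [_ [_ [F1 [F2 F3]]]]].
    unfold vv. apply Rabs_le_between in D1, D3, F1, F3. split; apply Rabs_le; lra.
  - intros e He. destruct (ws_sm W (e / 2)) as [d1 [Hd1 H1]]; [lra|]. destruct (ws_sm W' (e / 2)) as [d2 [Hd2 H2]]; [lra|].
    exists (Rmin d1 d2). split; [pos |]. intros t x Ht Htd Hx. assert (Ht' := HTT t Ht). assert (Hxa := Hab t x Ht Hx).
    mins.
    destruct (H1 j t x Hj Ht' Hxa ltac:(lra)) as [_ [_ [_ [D1 [D2 D3]]]]]. destruct (H2 j t x Hj Ht' Hxa ltac:(lra)) as [_ [_ [_ [F1 [F2 F3]]]]].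
    unfold vv. replace (t * ((Bk j t x - Bk' j t x) / t)) with (Bk j t x - Bk' j t x) by (field; lra).
    apply Rabs_le_between in D1, D2, D3, F1, F2, F3. splits; apply Rabs_le; lra.
Qed.

End J.

(** * The bootstrap on the rate of decay *)

Context (klo khi : nat -> R).
Context (Hkk : forall j x, (j <= m)%nat -> a < x < b -> klo j <= 2 * tot m p0 j x <= khi j).
Context (Hkap : forall j, (j <= m)%nat -> ga <= klo j /\ khi j <= 2 - ga /\ khi j <= klo j + 1 / 2).
Context (HKT : 3 * K / ga * Rpower T ga <= 1 / 2).
Notation N := (INR m + 2).

Lemma q_bds j t x : (j <= m)%nat -> 0 < t < T -> a < x < b ->
  q j t x <= Rpower t (klo j) /\ t / q j t x <= Rpower t (1 - khi j) /\ t * t / q j t x <= Rpower t (2 - khi j).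
Proof.
  intros Hj Ht Hx. destruct (Hkk j x Hj Hx) as [H1 H2]. unfold qf.
  assert (Hd : t / Rpower t (2 * tot m p0 j x) = Rpower t (1 - 2 * tot m p0 j x)).
  { unfold Rdiv. rewrite <- Rpower_Ropp. rewrite <- (Rpower_1 t) at 1 by lra. rewrite <- Rpower_plus. auto. }
  split; [apply Rpower_anti; lra|]. rewrite Hd. split; [apply Rpower_anti; lra|].
  replace (t * t / Rpower t (2 * tot m p0 j x)) with (t * Rpower t (1 - 2 * tot m p0 j x)) by nra.
  rewrite <- (Rpower_1 t) at 1 by lra. rewrite <- Rpower_plus. apply Rpower_anti; lra.
Qed.

Lemma t_pow t : 0 < t < T -> t = Rpower t 1.
Proof. intros. rewrite Rpower_1; lra. Qed.

Lemma pow_prod_le t u w l : 0 < t < T -> l <= u + w -> Rpower t u * Rpower t w <= Rpower t l.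
Proof. intros. rewrite <- Rpower_plus. apply Rpower_anti; lra. Qed.

Lemma N_pos : 2 <= N.
Proof. assert (H := pos_INR m). lra. Qed.

Lemma dps_bd j t x c : (j <= m)%nat -> (forall i, (i <= m)%nat -> Rabs (P i t x - P' i t x) <= c) -> Rabs (dps j t x) <= N * c.
Proof.
  intros Hj H. replace (dps j t x) with (tot m (fun i x => P i t x - P' i t x) j x).
  - apply tot_abs_le; auto.
  - unfold dps, totf. rewrite (tot_lin m (fun i => P i t) (fun i => P' i t) (fun i x => P i t x - P' i t x) j x 1 (-1) Hj); [ring|].
    intros; lra.
Qed.

Lemma dps_weight j t x lam Kc : (j <= m)%nat -> 0 < t < T -> Omg t x -> 0 <= Kc -> Rabs (dps j t x) <= N * (Kc * Rpower t lam) ->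
  Rabs (dps j t x) * (q j t x + 2 * t + t * t / q j t x) <= 4 * N * Kc * Rpower t (lam + ga).
Proof.
  intros Hj Ht Hx HKc Hd. assert (Hxa := Om_in t x (proj1 Ht) Hx). destruct (q_bds j t x Hj Ht Hxa) as [Q1 [_ Q3]]. destruct (Hkap j Hj) as [G1 [G2 _]].
  assert (R1 : Rpower t (klo j) <= Rpower t ga) by (apply Rpower_anti; lra).
  assert (R2 : Rpower t (2 - khi j) <= Rpower t ga) by (apply Rpower_anti; lra).
  assert (R3 : t <= Rpower t ga) by (rewrite (t_pow t Ht) at 1; apply Rpower_anti; lra).
  rewrite Rpower_plus. replace (4 * N * Kc * (Rpower t lam * Rpower t ga)) with (N * (Kc * Rpower t lam) * (4 * Rpower t ga)) by lra.
  assert (Hq := qpos). pos.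
Qed.

Lemma wave_cst_pos c l : 0 <= c -> 0 < l -> 0 <= wave_cst c l.
Proof.
  intros. apply Rmult_le_pos; [| pos].
  assert (0 <= c / l) by (apply Rmult_le_pos; pos).
  pos.
Qed.

(** The rate obtained for [vv] from the rate [lam] for [P - P']: the factor [t / q] costs [khi - 1]
    when this is positive. *)
Definition mu (j : nat) (lam : R) : R := Rmin lam (lam + 1 - khi j).
Definition cQ (j : nat) (lam : R) : R := wave_cst K (mu j lam) * (16 * (K * K * K) * (2 * N)).
Definition cP (j : nat) (lam : R) : R := wave_cst 1 (lam + ga) * (6 * (K * K * K) * (2 * cQ j lam + 4 * N)).

Lemma K_pos : 1 <= K /\ 0 <= K * K * K.
Proof. destruct (cK_ge (m := m) HC0) as [_ [_ [_ [_ H]]]]. pos. Qed.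

Lemma cQ_pos j lam : 0 < mu j lam -> 0 <= cQ j lam.
Proof.
  intros. destruct K_pos as [K1 K3]. assert (HN := N_pos). apply Rmult_le_pos; [apply wave_cst_pos; lra | nra].
Qed.

Lemma boot_v T1 lam Kc j : 0 < T1 <= T -> 0 < lam -> 0 <= Kc -> (j <= m)%nat -> khi j < 1 + lam ->
  (forall i t x, (i <= m)%nat -> 0 < t < T1 -> Omg t x -> Rabs (P i t x - P' i t x) <= Kc * Rpower t lam) ->
  forall t x, 0 < t < T1 -> Omg t x -> Rabs (vv j t x) <= cQ j lam * Kc * Rpower t (mu j lam).
Proof.
  intros HT1 Hlam HKc Hj Hkh HP t x Ht. assert (HN := N_pos).
  assert (Hmu : 0 < mu j lam) by (apply Rmin_glb_lt; lra).
  assert (Hmu1 : mu j lam <= lam) by apply Rmin_l. assert (Hmu2 : mu j lam <= lam + 1 - khi j) by apply Rmin_r.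
  replace (cQ j lam * Kc * Rpower t (mu j lam)) with (wave_cst K (mu j lam) * (16 * (K * K * K) * (2 * N * Kc)) * Rpower t (mu j lam)) by (unfold cQ; ring).
  apply Q_step with T1; auto; [nra|].
  intros s y Hs Hy. assert (Hs' : 0 < s < T) by lra. assert (Hya := Om_in s y (proj1 Hs) Hy).
  assert (Hd := dps_bd j s y _ Hj (fun i Hi => HP i s y Hi Hs Hy)).
  destruct (q_bds j s y Hj Hs' Hya) as [_ [Q2 _]].
  assert (G1 : Rpower s lam <= Rpower s (mu j lam)) by (apply Rpower_anti; lra).
  assert (G2 : Rpower s lam * Rpower s (1 - khi j) <= Rpower s (mu j lam)) by (apply pow_prod_le; lra).
  assert (Hq := qpos).
  apply Rle_trans with (N * (Kc * Rpower s lam) * (1 + Rpower s (1 - khi j))).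
  - pos.
  - replace (N * (Kc * Rpower s lam) * (1 + Rpower s (1 - khi j))) with (N * Kc * (Rpower s lam + Rpower s lam * Rpower s (1 - khi j))) by lra.
    replace (2 * N * Kc * Rpower s (mu j lam)) with (N * Kc * (2 * Rpower s (mu j lam))) by lra.
    pos.
Qed.

(** The loss in the rate of [vv] is repaid by the weight [q + t]. If [khi >= 1], then
    [mu + klo >= lam + 1/2] because [khi - klo <= 1/2], and [mu + 1 >= lam + ga] because
    [khi <= 2 - ga]. The bound is linear in [Kc], as the closing contraction requires. *)
Lemma boot_lin T1 lam Kc j : 0 < T1 <= T -> 0 < lam -> 0 <= Kc -> (j <= m)%nat -> khi j < 1 + lam ->
  (forall i t x, (i <= m)%nat -> 0 < t < T1 -> Omg t x -> Rabs (P i t x - P' i t x) <= Kc * Rpower t lam) ->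
  forall t x, 0 < t < T1 -> Omg t x -> Rabs (P j t x - P' j t x) <= cP j lam * Kc * Rpower t (lam + ga).
Proof.
  intros HT1 Hlam HKc Hj Hkh HP t x Ht. assert (HN := N_pos).
  assert (Hmu : 0 < mu j lam) by (apply Rmin_glb_lt; lra). assert (HcQ := cQ_pos j lam).
  destruct (Hkap j Hj) as [G1 [G2 G3]].
  replace (cP j lam * Kc * Rpower t (lam + ga)) with (wave_cst 1 (lam + ga) * (6 * (K * K * K) * ((2 * cQ j lam + 4 * N) * Kc)) * Rpower t (lam + ga)) by (unfold cP; ring).
  apply P_step with T1; auto; [lra | nra | |]; intros s y Hs Hy; assert (Hs' : 0 < s < T) by lra; assert (Hya := Om_in s y (proj1 Hs) Hy).
  - assert (Hv := boot_v T1). destruct (q_bds j s y Hj Hs' Hya) as [Q1 _]. assert (Hq := qpos).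
    assert (Hmc : mu j lam = lam /\ khi j <= 1 \/ mu j lam = lam + 1 - khi j /\ 1 <= khi j).
    { unfold mu, Rmin. destruct Rle_dec; lra. }
    assert (E1 : Rpower s (mu j lam) * Rpower s (klo j) <= Rpower s (lam + ga)) by (apply pow_prod_le; lra).
    assert (E2 : Rpower s (mu j lam) * Rpower s 1 <= Rpower s (lam + ga)) by (apply pow_prod_le; lra).
    rewrite <- (t_pow s Hs') in E2.
    apply Rle_trans with (cQ j lam * Kc * Rpower s (mu j lam) * (Rpower s (klo j) + s)).
    + pos.
    + replace (cQ j lam * Kc * Rpower s (mu j lam) * (Rpower s (klo j) + s)) with (cQ j lam * Kc * (Rpower s (mu j lam) * Rpower s (klo j) + Rpower s (mu j lam) * s)) by lra.
      apply Rle_trans with (cQ j lam * Kc * (2 * Rpower s (lam + ga))). pos.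
      assert (0 <= 4 * N * Kc * Rpower s (lam + ga)) by pos. lra.
  - assert (Hd := dps_bd j s y _ Hj (fun i Hi => HP i s y Hi Hs Hy)).
    eapply Rle_trans; [apply (dps_weight j s y lam Kc); auto|].
    pos.
Qed.

(** Here [vv] has no usable rate and only [Rabs vv <= 2] is used. The weights suffice:
    [klo >= khi - 1/2 >= lam + 1/2], and [1 >= lam + ga] since [1 + lam <= khi <= 2 - ga]. *)
Lemma boot_high lam Kc j : 0 < lam -> 0 <= Kc -> (j <= m)%nat -> 1 + lam <= khi j ->
  (forall i t x, (i <= m)%nat -> 0 < t < T -> Omg t x -> Rabs (P i t x - P' i t x) <= Kc * Rpower t lam) ->
  onD t x, Rabs (P j t x - P' j t x) <= wave_cst 1 (lam + ga) * (6 * (K * K * K) * (4 + 4 * N * Kc)) * Rpower t (lam + ga).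
Proof.
  intros Hlam HKc Hj Hkh HP. assert (HN := N_pos). destruct (Hkap j Hj) as [G1 [G2 G3]].
  assert (HNK : 0 <= 4 * N * Kc) by pos.
  apply P_step; auto; try lra; intros s y Hs Hy; assert (Hya := Om_in s y (proj1 Hs) Hy);
    assert (Hp := Rpower_pos s (lam + ga)).
  - destruct (q_bds j s y Hj Hs Hya) as [Q1 _]. assert (Hq := qpos). assert (Hv := v_le).
    assert (E1 : Rpower s (klo j) <= Rpower s (lam + ga)) by (apply Rpower_anti; lra).
    assert (E2 : s <= Rpower s (lam + ga)) by (rewrite (t_pow s Hs) at 1; apply Rpower_anti; lra).
    eapply Rle_trans. pos.
    nra.
  - assert (Hd := dps_bd j s y _ Hj (fun i Hi => HP i s y Hi Hs Hy)).
    eapply Rle_trans; [apply (dps_weight j s y lam Kc); auto|]. lra.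
Qed.

Lemma boot_step lam Kc : 0 < lam -> 0 <= Kc ->
  (forall i t x, (i <= m)%nat -> 0 < t < T -> Omg t x -> Rabs (P i t x - P' i t x) <= Kc * Rpower t lam) ->
  exists Kc', 0 <= Kc' /\ forall i t x, (i <= m)%nat -> 0 < t < T -> Omg t x -> Rabs (P i t x - P' i t x) <= Kc' * Rpower t (lam + ga).
Proof.
  intros Hlam HKc HP.
  destruct (fin_max (fun i Kc' => onD t x, Rabs (P i t x - P' i t x) <= Kc' * Rpower t (lam + ga)) m) as [Kc' H].
  - intros i n n' Hn H t x Ht Hx. assert (G := H t x Ht Hx). assert (Hp := Rpower_pos t (lam + ga)). nra.
  - intros i Hi. destruct (Rlt_le_dec (khi i) (1 + lam)) as [Hl|Hl].
    + exists (cP i lam * Kc). apply boot_lin; auto. lra.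
    + eexists. apply (boot_high lam Kc); auto.
  - exists (Rmax Kc' 0). split; [apply Rmax_r|]. intros. eapply Rle_trans; [apply H; auto|].
    apply Rmult_le_compat_r; [pos | apply Rmax_l].
Qed.

Lemma boot_iter n : exists Kc, 0 <= Kc /\ forall i t x, (i <= m)%nat -> 0 < t < T -> Omg t x -> Rabs (P i t x - P' i t x) <= Kc * Rpower t (ga * (INR n + 1)).
Proof.
  induction n.
  - exists 2. split; [lra|]. intros i t x Hi Ht Hx. assert (Hxa := Om_in t x (proj1 Ht) Hx).
    destruct (ws_bd W i t x Hi Ht Hxa) as [D1 [D2 [D3 _]]]. destruct (ws_bd W' i t x Hi Ht Hxa) as [F1 [F2 [F3 _]]].
    destruct (dP_small i Hi t x 1) as [G1 _]; auto. simpl. replace (ga * (0 + 1)) with ga by lra. lra.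
  - destruct IHn as [Kc [HKc H]]. rewrite S_INR. assert (Hn := pos_INR n).
    replace (ga * (INR n + 1 + 1)) with (ga * (INR n + 1) + ga) by lra. apply boot_step with Kc; auto. nra.
Qed.

Lemma wsol_unique : exists T1, 0 < T1 <= T /\ forall j t x, (j <= m)%nat -> 0 < t < T1 -> Omg t x -> P j t x = P' j t x /\ Q j t x = Q' j t x.
Proof.
  destruct (nfloor_ex (/ ga)) as [n Hn]; [pos |].
  destruct (boot_iter n) as [Kc [HKc HP]]. set (lam := ga * (INR n + 1)) in *.
  assert (Hlam : 1 <= lam).
  { apply Rle_trans with (ga * / ga); [right; field; lra|]. apply Rmult_le_compat_l; lra. }
  (* From [lam >= 1] on, the threshold holds for every [j], so the linear bound [boot_lin] applies
     to all components at once and [T1] can be chosen so that it halves any bound. *)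
  assert (Hkh : forall j, (j <= m)%nat -> khi j < 1 + lam) by (intros j Hj; destruct (Hkap j Hj) as [_ [G _]]; lra).
  destruct (fin_max (fun j C => cP j lam <= C) m) as [C HC].
  { pos. } { intros j Hj. exists (cP j lam). lra. }
  destruct (lim0_Rpower (Rmax C 0) ga (proj1 Hga) (1 / 2) ltac:(lra)) as [d [Hd0 Hd]].
  set (T1 := Rmin T (d / 2)). assert (HT1 : 0 < T1) by (apply Rmin_glb_lt; lra).
  mins.
  assert (HP0 : forall j t x, (j <= m)%nat -> 0 < t < T1 -> Omg t x -> P j t x = P' j t x).
  { intros j t x Hj Ht Hx. assert (Hpw := Rpower_pos t lam).
    assert (G : Rabs (P j t x - P' j t x) / Rpower t lam <= 0).
    { apply sup_contract with (S := fun z => exists j t x, (j <= m)%nat /\ 0 < t < T1 /\ Omg t x /\ z = Rabs (P j t x - P' j t x) / Rpower t lam) (M := Kc).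
      - intros z [j' [t' [x' [Hj' [Ht' [Hx' ->]]]]]]. apply Rle_div_l; [apply Rpower_pos|]. pos.
      - intros N0 HN0 Hz. exists (N0 / 2). split; [lra|]. intros z [j' [t' [x' [Hj' [Ht' [Hx' ->]]]]]].
        assert (Hb : forall i t x, (i <= m)%nat -> 0 < t < T1 -> Omg t x -> Rabs (P i t x - P' i t x) <= N0 * Rpower t lam).
        { intros i s y Hi Hs Hy. apply Rle_div_l; [apply Rpower_pos|]. apply Hz. exists i, s, y. auto. }
        assert (G := boot_lin T1 lam N0 j' ltac:(lra) ltac:(lra) ltac:(lra) Hj' (Hkh j' Hj') Hb t' x' Ht' Hx').
        apply Rle_div_l; [apply Rpower_pos|]. eapply Rle_trans; eauto. rewrite Rpower_plus.
        assert (Hg := Rpower_pos t' ga). specialize (Hd t' ltac:(lra)).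
        assert (HC1 := HC j' Hj'). assert (HC2 := Rmax_l C 0). assert (HC3 := Rmax_r C 0).
        rewrite Rabs_pos_eq in Hd by nra. assert (G2 : cP j' lam * Rpower t' ga <= 1 / 2) by nra.
        replace (cP j' lam * N0 * (Rpower t' lam * Rpower t' ga)) with (N0 * Rpower t' lam * (cP j' lam * Rpower t' ga)) by lra.
        replace (N0 / 2 * Rpower t' lam) with (N0 * Rpower t' lam * (1 / 2)) by lra. pos.
      - exists j, t, x. auto. }
    apply Rle_div_l in G; auto.
    apply Rminus_diag_uniq. destruct (Req_dec (P j t x - P' j t x) 0) as [E0|E0]; auto. apply Rabs_pos_lt in E0. lra. }
  exists T1. split; auto. intros j t x Hj Ht. split; auto.
  (* With [P = P'] the sources in the equation of [vv] vanish, so the estimate holds with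
     [E = 0]. *)
  assert (Hv : Rabs (vv j t x) <= wave_cst K 1 * (16 * (K * K * K) * 0) * Rpower t 1).
  { apply (Q_step j Hj T1); auto; try lra. intros s y Hs Hy.
    assert (Hd' := dps_bd j s y 0 Hj). rewrite Rmult_0_r in Hd'.
    assert (G : Rabs (dps j s y) <= 0). { apply Hd'. intros. rewrite HP0, Rminus_diag, Rabs_R0; auto; lra. }
    assert (G2 := Rabs_pos (dps j s y)). replace (Rabs (dps j s y)) with 0 by lra. lra. }
  assert (Hxa := Om_in t).
  apply Rminus_diag_uniq. rewrite dQ_v by pos.
  replace (vv j t x) with 0; [ring|]. destruct (Req_dec (vv j t x) 0) as [E0|E0]; auto. apply Rabs_pos_lt in E0. lra.
Qed.

End Final.

(** * Reduction of uniqueness to the bootstrap *)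

Lemma small_analytic_sub f T a b a' b' : a <= a' -> b' <= b -> small_analytic f T a b -> small_analytic f T a' b'.
Proof.
  intros Ha Hb [H1 [H2 H3]]. split; [|split].
  - intros. eapply analytic_sub; auto.
  - pos.
  - intros e He. destruct (H3 e He) as [d [Hd H]]. exists d. pos.
Qed.

Lemma remainder_class_sub f T a b a' b' : a <= a' -> b' <= b -> remainder_class f T a b -> remainder_class f T a' b'.
Proof.
  intros Ha Hb [H1 [H2 [H3 H4]]]. split; [|split; [|split]]; try (apply small_analytic_sub with a b; auto).
  pos.
Qed.

Lemma remainder_small m ep pi kap T a b : (forall j, (j <= m)%nat -> 0 < ep j /\ remainder_class (pi j) T a b /\ remainder_class (kap j) T a b) ->
  forall e, 0 < e -> exists d, 0 < d /\ forall j, (j <= m)%nat -> forall t x, 0 < t < d -> t < T -> a < x < b ->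
    Rabs (pi j t x) <= e /\ Rabs (ep j * pi j t x + Dt (pi j) t x) <= e /\ Rabs (tdth (pi j) t x) <= e /\
    Rabs (kap j t x) <= e /\ Rabs (Dt (kap j) t x) <= e /\ Rabs (tdth (kap j) t x) <= e.
Proof.
  intros H e He.
  apply fin_min.
  { pos. }
  intros j Hj. destruct (H j Hj) as [Hep [[_ [[_ [_ S1]] [[_ [_ S2]] [_ [_ S3]]]]] [_ [[_ [_ S4]] [[_ [_ S5]] [_ [_ S6]]]]]]].
  set (e1 := e / (ep j + 1)). assert (He1 : 0 < e1) by (apply Rdiv_lt_0_compat; lra).
  assert (Hee : ep j * e1 + e1 = e) by (unfold e1; field; lra).
  destruct (S1 e1 He1) as [d1 [Hd1 G1]]. destruct (S2 e1 He1) as [d2 [Hd2 G2]]. destruct (S3 e He) as [d3 [Hd3 G3]].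
  destruct (S4 e He) as [d4 [Hd4 G4]]. destruct (S5 e He) as [d5 [Hd5 G5]]. destruct (S6 e He) as [d6 [Hd6 G6]].
  set (d := Rmin (Rmin (Rmin d1 d2) (Rmin d3 d4)) (Rmin d5 d6)).
  assert (Hd : 0 < d) by (repeat apply Rmin_glb_lt; auto).
  assert (L : d <= d1 /\ d <= d2 /\ d <= d3 /\ d <= d4 /\ d <= d5 /\ d <= d6).
  { mins; lra. }
  exists d. split; auto. intros t x Ht HtT Hx.
  specialize (G1 t x). specialize (G2 t x). specialize (G3 t x).
  specialize (G4 t x). specialize (G5 t x ltac:(lra) HtT Hx). specialize (G6 t x ltac:(lra) HtT).
  assert (He1e : e1 <= e) by nra.
  split; [lra | split; try lra].
  rewrite <- Hee. apply Rabs_plus_le; [|lra]. rewrite Rabs_mult, Rabs_pos_eq by lra. pos.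
Qed.

Section Unique.
Context (D : nat) (HD : (4 <= D)%nat)
  (p0 p1 q0 q1 : nat -> R -> R) (eps : nat -> R) (th0 rho : R) (Hrho : 0 < rho)
  (Han : forall I, in_range D I ->
     analytic_on (p0 I) (th0 - rho) (th0 + rho) /\
     analytic_on (p1 I) (th0 - rho) (th0 + rho) /\
     analytic_on (q0 I) (th0 - rho) (th0 + rho) /\
     analytic_on (q1 I) (th0 - rho) (th0 + rho))
  (Hk : forall I, in_range D I -> forall x, th0 - rho < x < th0 + rho ->
     0 < kI D p0 I x < 1)
  (Heps : forall I, in_range D I -> forall x, th0 - rho < x < th0 + rho ->
     0 < eps I /\ eps I < 2 * kI D p0 I x /\ eps I < 2 * (1 - kI D p0 I x)).
Notation m := (D - 4)%nat.
Notation f0 := (fun j => p0 (j + 3)%nat).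
Notation f1 := (fun j => p1 (j + 3)%nat).
Notation g0 := (fun j => q0 (j + 3)%nat).
Notation g1 := (fun j => q1 (j + 3)%nat).
Notation ep := (fun j => eps (j + 3)%nat).

Definition wsol_of (T a b : R) (P Q pi kappa : nat -> R -> R -> R) : Prop :=
  wsol m f0 f1 g0 g1 ep T a b
  (fun j => P (j + 3)%nat) (fun j => dt (P (j + 3)%nat)) (fun j => dth (P (j + 3)%nat)) (fun j => dth (dth (P (j + 3)%nat)))
  (fun j => Q (j + 3)%nat) (fun j => dt (Q (j + 3)%nat)) (fun j => dth (Q (j + 3)%nat)) (fun j => dth (dth (Q (j + 3)%nat)))
  (fun j => pi (j + 3)%nat) (fun j t x => eps (j + 3)%nat * pi (j + 3)%nat t x + Dt (pi (j + 3)%nat) t x) (fun j => dth (pi (j + 3)%nat))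
  (fun j => kappa (j + 3)%nat) (fun j => Dt (kappa (j + 3)%nat)) (fun j => dth (kappa (j + 3)%nat)).

Lemma rgj j : (j <= m)%nat -> in_range D (j + 3).
Proof. unfold in_range. lia. Qed.

(** Every smaller time is allowed, so that two solutions can be brought to a common interval on
    which all remainders are at most 1. *)
Lemma form_wsol T r P Q r2 : form_solution D p0 p1 q0 q1 eps P Q T th0 r -> 0 < r2 -> r2 < r -> r2 < rho ->
  exists pi kappa T0, 0 < T0 /\ forall T', 0 < T' <= T0 -> wsol_of T' (th0 - r2) (th0 + r2) P Q pi kappa.
Proof.
  intros [HT [Hr [Hs [pi [kappa Hf]]]]] Hr2 Hr2r Hr2rho.
  set (r0 := Rmin r rho). assert (B1 : r0 <= r) by apply Rmin_l. assert (B2 : r0 <= rho) by apply Rmin_r.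
  assert (B3 : r2 < r0) by (apply Rmin_glb_lt; auto).
  assert (Hp' : forall I, in_range D I -> analytic_on (p0 I) (th0 - r0) (th0 + r0) /\ analytic_on (p1 I) (th0 - r0) (th0 + r0) /\
    analytic_on (q0 I) (th0 - r0) (th0 + r0) /\ analytic_on (q1 I) (th0 - r0) (th0 + r0)).
  { intros I HI. destruct (Han I HI) as [A1 [A2 [A3 A4]]]. splits; apply analytic_sub with (th0 - rho) (th0 + rho); auto; lra. }
  assert (Hs' : is_solution D P Q T (th0 - r0) (th0 + r0)).
  { intros I HI t x Ht Hx. pos. }
  assert (Hf' : forall I, in_range D I ->
      remainder_class (pi I) T (th0 - r0) (th0 + r0) /\ remainder_class (kappa I) T (th0 - r0) (th0 + r0) /\
      forall t x, 0 < t < T -> th0 - r0 < x < th0 + r0 ->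
        P I t x = p0 I x * ln t + p1 I x + Rpower t (eps I) * pi I t x /\
        Q I t x = q0 I x + Rpower t (2 * kI D p0 I x) * q1 I x + Rpower t (2 * kI D p0 I x) * kappa I t x).
  { intros I HI. destruct (Hf I HI) as [H1 [H2 H3]].
    splits; try (apply remainder_class_sub with (th0 - r) (th0 + r); auto; lra). pos. }
  assert (Hsm := remainder_small m ep (fun j => pi (j + 3)%nat) (fun j => kappa (j + 3)%nat) T (th0 - r0) (th0 + r0)).
  assert (Hsm' : forall j, (j <= m)%nat -> 0 < eps (j + 3) /\ remainder_class (pi (j + 3)%nat) T (th0 - r0) (th0 + r0) /\ remainder_class (kappa (j + 3)%nat) T (th0 - r0) (th0 + r0)).
  { intros j Hj. splits; try apply (Hf' _ (rgj j Hj)). apply (Heps _ (rgj j Hj) th0). lra. }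
  specialize (Hsm Hsm'). destruct (Hsm 1 Rlt_0_1) as [d1 [Hd1 H1]].
  exists pi, kappa, (Rmin T d1). split; [pos |]. intros.
  assert (B4 := Rmin_l T d1). assert (B5 := Rmin_r T d1).
  apply (extract_wsol D HD p0 p1 q0 q1 eps T (th0 - r0) (th0 + r0)); auto; try lra.
  - intros j t x Hj Ht Hx. pos.
  - intros e He. destruct (Hsm e He) as [d [Hd H2]]. exists d. split; auto. intros j. pos.
Qed.

Let K j := tot m f0 j.

Lemma K_C1 j r : (j <= m)%nat -> r <= rho -> C1 (K j) (th0 - r) (th0 + r) /\ C1 (Derive (K j)) (th0 - r) (th0 + r).
Proof.
  intros.
  assert (Hp' : forall I, in_range D I -> analytic_on (p0 I) (th0 - r) (th0 + r) /\ analytic_on (p1 I) (th0 - r) (th0 + r) /\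
    analytic_on (q0 I) (th0 - r) (th0 + r) /\ analytic_on (q1 I) (th0 - r) (th0 + r)).
  { intros I HI. destruct (Han I HI) as [A1 [A2 [A3 A4]]]. splits; apply analytic_sub with (th0 - rho) (th0 + rho); auto; lra. }
  split; [eapply k_C1 | eapply Dk_C1]; eauto.
Qed.

Lemma K_derive j x : (j <= m)%nat -> th0 - rho < x < th0 + rho -> is_derive (K j) x (tot m (fun i => Derive (f0 i)) j x).
Proof.
  intros. apply is_derive_tot; auto. intros i Hi.
  apply (C1_is_derive (f0 i) (th0 - rho) (th0 + rho)); auto. apply analytic_C1, (Han _ (rgj i Hi)).
Qed.

Lemma solution_unique T r T' r' P Q P' Q' : form_solution D p0 p1 q0 q1 eps P Q T th0 r ->
  form_solution D p0 p1 q0 q1 eps P' Q' T' th0 r' ->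
  exists T'' r'', 0 < T'' /\ 0 < r'' /\
    forall I, in_range D I -> forall t x, 0 < t < T'' -> th0 - r'' < x < th0 + r'' ->
      P I t x = P' I t x /\ Q I t x = Q' I t x.
Proof.
  intros HF HF'. assert (Hth : th0 - rho < th0 < th0 + rho) by lra.
  destruct (fin_min (fun j d => d <= eps (j + 3) /\ d <= K j th0 /\ d <= 1 - K j th0) m) as [g [Hg Hgj]].
  { pos. }
  { intros j Hj. destruct (Heps _ (rgj j Hj) th0 Hth) as [E1 [E2 E3]]. change (kI D p0 (j + 3) th0) with (K j th0) in E2, E3.
    exists (Rmin (eps (j + 3)) (Rmin (K j th0) (1 - K j th0))). split; [pos |].
    mins; lra. }
  set (ga := Rmin g (1 / 2)). assert (Hga : 0 < ga) by (apply Rmin_glb_lt; lra).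
  assert (Hga2 : ga <= 1 / 2) by apply Rmin_r.
  (* On this neighbourhood [2 k] varies by at most [ga / 2] around its value at [th0]; the bounds
     [klo] and [khi] taken at that distance differ by [ga <= 1/2], the oscillation permitted by the
     bootstrap. *)
  destruct (fin_min (fun j d => forall x, Rabs (x - th0) < d -> Rabs (K j x - K j th0) <= ga / 4) m) as [r1 [Hr1 HK]].
  { pos. }
  { intros j Hj. destruct (K_C1 j rho Hj (Rle_refl _)) as [HC _].
    destruct (proj1 (continuous_eps _ _) (C1_cont _ _ _ th0 HC Hth) (ga / 4)) as [d [Hd H]]; [lra|].
    exists d. pos. }
  assert (Hr : 0 < r) by apply HF. assert (Hr' : 0 < r') by apply HF'.
  set (r2 := Rmin (Rmin r r') (Rmin rho r1) / 2).
  assert (Hm : 0 < Rmin (Rmin r r') (Rmin rho r1)) by pos.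
  assert (L : 0 < r2 /\ r2 < r /\ r2 < r' /\ r2 < rho /\ r2 < r1).
  { mins.
    unfold r2. lra. }
  destruct L as [L0 [L1 [L2 [L3 L4]]]].
  set (a := th0 - r2). set (b := th0 + r2).
  destruct (form_wsol T r P Q r2 HF L0 L1 L3) as [pi [kappa [Ta [HTa WA]]]].
  destruct (form_wsol T' r' P' Q' r2 HF' L0 L2 L3) as [pi' [kappa' [Tb [HTb WB]]]].
  assert (HC : exists C0, forall j, (j <= m)%nat -> 0 <= C0 /\ forall x, a < x < b ->
    (Rabs (f0 j x) <= C0 /\ Rabs (f1 j x) <= C0 /\ Rabs (g1 j x) <= C0) /\
    Rabs (Derive (f0 j) x) <= C0 /\ Rabs (Derive (f1 j) x) <= C0 /\ Rabs (Derive (g0 j) x) <= C0 /\ Rabs (Derive (g1 j) x) <= C0 /\ Rabs (Derive (K j) x) <= C0).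
  { apply fin_max.
    - intros j n n' Hn [H0 H]. split; [lra|]. intros x Hx. destruct (H x Hx) as [[H1 [H2 H3]] [H4 [H5 [H6 [H7 H8]]]]]. lra.
    - intros j Hj. destruct (Han _ (rgj j Hj)) as [A1 [A2 [A3 A4]]]. destruct (K_C1 j rho Hj (Rle_refl _)) as [_ HDK].
      assert (Hb : forall f, C1 f (th0 - rho) (th0 + rho) -> exists c, 0 <= c /\ forall x, a < x < b -> Rabs (f x) <= c).
      { intros. apply C1_bound with (th0 - rho) (th0 + rho); auto; unfold a, b; lra. }
      destruct (Hb _ (analytic_C1 _ _ _ A1)) as [c1 [N1 C1']]. destruct (Hb _ (analytic_C1 _ _ _ A2)) as [c2 [N2 C2']].
      destruct (Hb _ (analytic_C1 _ _ _ A4)) as [c3 [N3 C3']].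
      destruct (Hb _ (analytic_C1 _ _ _ (analytic_Derive _ _ _ A1))) as [c4 [N4 C4']]. destruct (Hb _ (analytic_C1 _ _ _ (analytic_Derive _ _ _ A2))) as [c5 [N5 C5']].
      destruct (Hb _ (analytic_C1 _ _ _ (analytic_Derive _ _ _ A3))) as [c6 [N6 C6']]. destruct (Hb _ (analytic_C1 _ _ _ (analytic_Derive _ _ _ A4))) as [c7 [N7 C7']].
      destruct (Hb _ HDK) as [c8 [N8 C8']].
      exists (c1 + c2 + c3 + c4 + c5 + c6 + c7 + c8). split; [lra|]. intros x Hx.
      specialize (C1' x). specialize (C2' x). specialize (C3' x). specialize (C4' x).
      specialize (C5' x). specialize (C6' x). specialize (C7' x). specialize (C8' x). pos. }
  destruct HC as [C0 HC]. assert (HC0 : 0 <= C0) by (apply (HC O); lia).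
  assert (Hbase : base_bd m f0 f1 g0 g1 ep a b C0).
  { intros j x Hj Hx. destruct (HC j Hj) as [_ H]. destruct (H x Hx) as [H1 H2]. split; auto. split; auto.
    assert (Hxr : th0 - rho < x < th0 + rho) by (unfold a, b in Hx; lra).
    split; [apply (Heps _ (rgj j Hj) x Hxr) | apply (Hk _ (rgj j Hj) x Hxr)]. }
  destruct (lim0_Rpower (3 * cK m C0 / ga) ga Hga (1 / 2) ltac:(lra)) as [tk [Htk0 Htk]].
  set (T0 := Rmin (Rmin Ta Tb) (Rmin 1 (tk / 2))).
  assert (HT0 : 0 < T0) by (repeat apply Rmin_glb_lt; lra).
  mins.
  assert (W := WA T0 ltac:(lra)). assert (W' := WB T0 ltac:(lra)).
  destruct (wsol_unique W W' HC0 Hbase ltac:(lra) (conj Hga Hga2)) with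
    (x0 := th0) (rho := r2 / 2) (klo := fun j => 2 * K j th0 - ga / 2) (khi := fun j => 2 * K j th0 + ga / 2) as [T1 [HT1 HU]]; try lra.
  - intros j Hj. destruct (Hgj j Hj) as [G _]. lra.
  - intros j x Hj Hx. apply K_derive; auto. lra.
  - intros j x Hj Hx. destruct (K_C1 j rho Hj (Rle_refl _)) as [_ HDK]. eapply C1_cont; eauto. lra.
  - intros j x Hj Hx. assert (G := HK j Hj x ltac:(unfold a, b in Hx; apply Rabs_def1; lra)). apply Rabs_le_between in G. unfold K in *. lra.
  - intros j Hj. destruct (Hgj j Hj) as [_ [G1 G2]]. lra.
  - specialize (Htk T0 ltac:(lra)). apply Rabs_def2 in Htk. lra.
  (* A time below [r2 / 4] and a distance below [r2 / 4] from [th0] place the point in the cone of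
     size [r2 / 2]. *)
  - exists (Rmin T1 (r2 / 4)), (r2 / 4). split; [pos |]. split; [lra|].
    intros I HI t x Ht Hx. mins.
    destruct (range_j D HD I HI) as [j [Hj ->]]. apply HU; auto; [lra|].
    unfold Om. assert (Rabs (x - th0) < r2 / 4) by (apply Rabs_def1; lra). lra.
Qed.
End Unique.

Theorem theorem3 (D : nat) (HD : (4 <= D)%nat)
  (p0 p1 q0 q1 : nat -> R -> R) (eps : nat -> R) (th0 rho : R) (Hrho : 0 < rho)
  (Han : forall I, in_range D I ->
     analytic_on (p0 I) (th0 - rho) (th0 + rho) /\
     analytic_on (p1 I) (th0 - rho) (th0 + rho) /\
     analytic_on (q0 I) (th0 - rho) (th0 + rho) /\
     analytic_on (q1 I) (th0 - rho) (th0 + rho))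
  (Hk : forall I, in_range D I -> forall x, th0 - rho < x < th0 + rho ->
     0 < kI D p0 I x < 1)
  (Heps : forall I, in_range D I -> forall x, th0 - rho < x < th0 + rho ->
     0 < eps I /\ eps I < 2 * kI D p0 I x /\ eps I < 2 * (1 - kI D p0 I x)) :
  (exists (T r : R) (P Q : nat -> R -> R -> R),
     form_solution D p0 p1 q0 q1 eps P Q T th0 r) /\
  (forall (T r T' r' : R) (P Q P' Q' : nat -> R -> R -> R),
     form_solution D p0 p1 q0 q1 eps P Q T th0 r ->
     form_solution D p0 p1 q0 q1 eps P' Q' T' th0 r' ->
     exists T'' r'', 0 < T'' /\ 0 < r'' /\
       forall I, in_range D I -> forall t x, 0 < t < T'' -> th0 - r'' < x < th0 + r'' ->
         P I t x = P' I t x /\ Q I t x = Q' I t x).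
Proof.
  split.
  - apply (solution_exists D HD p0 p1 q0 q1 eps th0 rho Hrho Han Heps).
  - intros T r T' r' P Q P' Q'. apply (solution_unique D HD p0 p1 q0 q1 eps th0 rho Hrho Han Hk Heps).
Qed.
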